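(* Let $M>0$, $\lambda>0$, $p>1$. Suppose that $\psi_t$, $t\in\mathbb{R}$, solves $$i\partial_t\psi=D_{r_*}^2\psi+V(r_* )\psi+\lambda r^{-p+1}|\psi|^{p-1}\psi\quad\text{on }\mathbb{R}$$ with $\psi_0\in\tilde{\mathcal H}$ at $t=0$, and let $\beta>3/2$, $0\le R<\infty$. Then $$\int_{-\infty}^\infty\|(1+r_*^2)^{-\beta/2}\psi_t\|_{L^2(\mathbb{R};dr_* )}^2\,dt\le C_\beta\,\|\psi_0\|_{L^2(\mathbb{R};dr_* )}\|\psi_0\|_{\tilde{\mathcal H}},$$ $$\int_{-\infty}^\infty dt\int_{-R}^R r^{-p-1}|\psi_t|^{p+1}\,dr_*\le C_R\,\|\psi_0\|_{L^2(\mathbb{R};dr_* )}\|\psi_0\|_{\tilde{\mathcal H}},$$ with constants $C_\beta$, $C_R$ independent of the solution.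
   Context: The variable $r\in(2M,\infty)$ is regarded as a function of $r_*\in\mathbb{R}$ through the increasing bijection $r_*=r+2M\log(r-2M)$. $D_{r_*}=-i\,\partial/\partial r_*$, and $V(r_* )=\frac{2M}{r^3}\left(1-\frac{2M}{r}\right)$. The energy space is $\tilde{\mathcal H}=\{\psi\in L^2(\mathbb{R};dr_* ):\ \|\psi\|_{\tilde{\mathcal H}}<\infty\}$, where $$\|\psi\|_{\tilde{\mathcal H}}^2=\int_{-\infty}^\infty\left(|\partial_{r_*}\psi|^2+V|\psi|^2+\lambda r^{-p+1}|\psi|^{p+1}\right)dr_*$$ (as a set it equals $H^1(\mathbb{R})$). A solution is a function $\psi\in C(\mathbb{R};H^1(\mathbb{R}))$, $\psi_t=\psi(\cdot,t)$, satisfying the equation in the sense of distributions (equivalently, in Duhamel form). The constants may also depend on $M,\lambda,p$. *)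

(* Defs.v *)
From HB Require Import structures.
From mathcomp Require Import all_boot all_order all_algebra.
From mathcomp Require Import all_classical all_reals all_analysis.
From mathcomp Require Import complex lra.

Set Implicit Arguments.
Unset Strict Implicit.
Unset Printing Implicit Defensive.

Import Order.TTheory GRing.Theory Num.Theory.
Import numFieldTopology.Exports numFieldNormedType.Exports.
Import ComplexField.Normc.

Local Open Scope classical_set_scope.
Local Open Scope ring_scope.
Local Open Scope complex_scope.

(* The areal radius r as a function of the tortoise coordinate x = r_*, unique
   since r + 2 M ln (r - 2 M) is strictly increasing on ]2 M, +oo[; the
   default value 0 of xget is never taken when 0 < M (lemma areal_radiusP). *)
Definition areal_radius (R : realType) (M x : R) : R :=
  xget 0 [set r | 2 * M < r /\ r + 2 * M * ln (r - 2 * M) = x].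

Lemma areal_radiusP (R : realType) (M x : R) : 0 < M ->
  2 * M < areal_radius M x /\
  areal_radius M x + 2 * M * ln (areal_radius M x - 2 * M) = x.
Proof.
move=> M0.
pose A := [set r | 2 * M < r /\ r + 2 * M * ln (r - 2 * M) = x].
suff [r Ar] : exists r, A r by exact: (@xgetI _ 0 A r Ar).
have M20 : 0 < 2 * M by rewrite mulr_gt0.
pose g (s : R) := 2 * M + expR s + 2 * M * s.
have gc : continuous g.
  move=> s; apply: cvgD; last exact: cvgMl_tmp.
  by apply: cvgD; [exact: cvg_cst | exact: continuous_expR].
pose b := `|x| / (2 * M); pose a := - ((`|x| + 2 * M + 1) / (2 * M)).
have x0 : 0 <= `|x| by [].
have ab : a <= b.
  have h1 : 0 <= b by rewrite divr_ge0//; lra.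
  have h2 : a <= 0 by rewrite oppr_le0 divr_ge0//; lra.
  exact: le_trans h1.
have ga : g a <= x.
  have ea : expR a <= 1.
    by rewrite -expR0 ler_expR oppr_le0 divr_ge0//; lra.
  have -> : g a = expR a - 1 - `|x|.
    by rewrite /g /a mulrN [2 * M * (_ / _)]mulrC divfK ?gt_eqF//; lra.
  have := lerNnormlW (lexx `|x|); lra.
have gb : x <= g b.
  have eb := expR_gt0 b.
  have -> : g b = 2 * M + expR b + `|x|.
    by rewrite /g /b [2 * M * (_ / _)]mulrC divfK ?gt_eqF.
  have := ler_norm x; lra.
have [|s _ gs] := @IVT R g a b x ab (continuous_subspaceT gc).
  by rewrite ge_min le_max ga gb orbT.
exists (2 * M + expR s); split; first by rewrite ltrDl expR_gt0.
by rewrite [2 * M + expR s]addrC addrK expRK addrC -gs /g; lra.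
Qed.

Definition potential (R : realType) (M x : R) : R :=
  2 * M / areal_radius M x ^+ 3 * (1 - 2 * M / areal_radius M x).

Definition cintegral (R : realType) (f : R -> R[i]) : R[i] :=
  (\int[lebesgue_measure]_x complex.Re (f x)) +i*
  (\int[lebesgue_measure]_x complex.Im (f x)).

Definition cmeasurable (R : realType) (f : R -> R[i]) : Prop :=
  measurable_fun setT (fun x => complex.Re (f x)) /\
  measurable_fun setT (fun x => complex.Im (f x)).

Definition clocally_integrable (R : realType) (f : R -> R[i]) : Prop :=
  locally_integrable setT (fun x => complex.Re (f x)) /\
  locally_integrable setT (fun x => complex.Im (f x)).

Definition L2norm (R : realType) (f : R -> R[i]) : \bar R :=
  ('N[lebesgue_measure]_2%:E [(fun x => (normc (f x))%:E)])%E.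

Definition L2 (R : realType) (f : R -> R[i]) : Prop :=
  cmeasurable f /\ (L2norm f < +oo)%E.

(* All iterated directional derivatives exist and are (Frechet) differentiable,
   i.e. phi is of class C^oo. *)
Definition smooth (R : realType) (V : normedModType R) (phi : V -> R) : Prop :=
  forall (s : seq V) (z : V),
    differentiable (foldr (fun v g => 'D_v g : V -> R) phi s) z.

(* Real-valued test functions suffice: a complex test function is a complex
   linear combination of two real ones. *)
Definition test_function (R : realType) (V : normedModType R) (phi : V -> R) :
    Prop :=
  smooth phi /\ compact (closure [set z | phi z != 0]).

Definition weak_derivative (R : realType) (f g : R -> R[i]) : Prop :=
  [/\ clocally_integrable f, clocally_integrable g &
      forall phi : R -> R, test_function phi ->
        cintegral (fun x => f x * (derive1 phi x)%:C) =
        - cintegral (fun x => g x * (phi x)%:C)].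

(* The weak derivative, unique up to a null set, hence the choice made by xget
   affects none of the norms below. *)
Definition wderiv (R : realType) (f : R -> R[i]) : R -> R[i] :=
  xget (cst 0) [set g | weak_derivative f g].

Definition H1 (R : realType) (f : R -> R[i]) : Prop :=
  L2 f /\ exists2 g, weak_derivative f g & L2 g.

Definition H1norm (R : realType) (f : R -> R[i]) : \bar R :=
  ((L2norm f ^+ 2 + L2norm (wderiv f) ^+ 2) `^ 2^-1)%E.

Definition energy_norm (R : realType) (M lambda p : R) (f : R -> R[i]) :
    \bar R :=
  ((\int[lebesgue_measure]_x
      (normc (wderiv f x) ^+ 2 + potential M x * normc (f x) ^+ 2
       + lambda * areal_radius M x `^ (- p + 1) * normc (f x) `^ (p + 1))%:E)
   `^ 2^-1)%E.

Definition energy_space (R : realType) (M lambda p : R) (f : R -> R[i]) :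
    Prop :=
  [/\ L2 f, exists g, weak_derivative f g & (energy_norm M lambda p f < +oo)%E].

Definition continuous_H1 (R : realType) (psi : R -> R -> R[i]) : Prop :=
  (forall t, H1 (psi t)) /\
  (forall t, H1norm (psi s \- psi t) @[s --> t] --> 0%E).

(* A spacetime test function takes the pair (t, x). *)
Definition partial_t (R : realType) (phi : R * R -> R) : R * R -> R :=
  'D_(1, 0) phi.

Definition partial_x (R : realType) (phi : R * R -> R) : R * R -> R :=
  'D_(0, 1) phi.

(* The equation i psi_t = - psi_xx + V psi + lambda r^(1-p) |psi|^(p-1) psi
   tested against phi, all derivatives being moved onto phi.  The integrals are
   iterated because psi t is only an almost-everywhere class of functions for
   each t, so that (t, x) |-> psi t x need not be jointly measurable. *)
Definition solves_NLS (R : realType) (M lambda p : R) (psi : R -> R -> R[i]) :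
    Prop :=
  forall phi : R * R -> R, test_function phi ->
    cintegral (fun t => cintegral (fun x =>
      - (0 +i* 1) * psi t x * (partial_t phi (t, x))%:C)) =
    cintegral (fun t => cintegral (fun x =>
      - psi t x * (partial_x (partial_x phi) (t, x))%:C
      + ((potential M x)%:C * psi t x
         + (lambda * areal_radius M x `^ (- p + 1) * normc (psi t x) `^ (p - 1))%:C
           * psi t x) * (phi (t, x))%:C)).

Definition solution (R : realType) (M lambda p : R) (psi : R -> R -> R[i]) :
    Prop :=
  continuous_H1 psi /\ solves_NLS M lambda p psi.

(* Main.v *)
From HB Require Import structures.
Require Import Defs.
From mathcomp Require Import all_boot all_order all_algebra.
From mathcomp Require Import all_classical all_reals all_analysis.
From mathcomp Require Import measurable_realfun complex ring lra.

(* Idea. Write psi = u + i v, W = V + lambda r^(1-p) |psi|^(p-1), and multiply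
   the equation by g psi_x for an increasing bounded function g changing sign at
   the peak r = 8 M / 3 of V.  The time derivative of the Morawetz functional
   M(t) = <u, g v_x> - <v, g u_x> is

     int 2 g' |psi_x|^2 + g'' (u u_x + v v_x) + 2 g W (u u_x + v v_x) + g' W |psi|^2 .

   Adding the zero integrals of (kap |psi|^2)' and of a multiple of
   (g lambda r^(1-p) |psi|^(p+1))' turns the integrand into a quadratic form in
   (psi, psi_x) plus a multiple of |psi|^(p+1).  With z = 1 + eps |x - x_peak|,
   g' = z^(-2 sigma), 1/2 < sigma <= 1, and a suitable kap, the quadratic form is
   bounded below by sigma eps^2 z^(-2 sigma - 2) |psi|^2 for small eps, and the
   coefficient of |psi|^(p+1) by a multiple of g' r^(1-p).  Since |M(t)| is at
   most 2 sup |g| times ||psi||_2 ||psi_x||_2, conservation of mass and energy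
   bounds the time integral of the lower bound.

   Since psi is only continuous in time with values in H^1, the computation is
   justified with psi_x replaced by difference quotients in x, letting the step
   tend to zero after integration in time.  Du Bois-Reymond's lemma, in x and in
   t, replaces distributional derivatives by integrals throughout. *)

Set Implicit Arguments.
Unset Strict Implicit.
Unset Printing Implicit Defensive.

Import Order.TTheory GRing.Theory Num.Theory.
Import numFieldTopology.Exports numFieldNormedType.Exports.
Import ComplexField.Normc.

Local Open Scope classical_set_scope.
Local Open Scope ring_scope.

(** * Integrals on the real line *)

Section integration.
Context {R : realType}.
Notation mu := (@lebesgue_measure R).
Implicit Types (f g : R -> R) (a b h : R).

(** Integrating the g'' term by parts would give -g'''/2 |psi|^2: a favourable Dirac mass at the
    peak, where g'' jumps, but a negative density elsewhere. The function kap spreads this mass out.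
    Writing c = kap + g V, the cross term has coefficient g'' + 2 c and |psi|^2 has, from V, the
    coefficient c' - g V'. The choice c = g''/2 makes c' positive off the peak, but with a negative
    Dirac mass at it. Adding a multiple of sgn(x - x_peak) (1 - (1 - V / V_max)^2) cancels the jump;
    the derivative of this term carries the factor 1 - V / V_max, small near the peak, and is
    dominated by -g V'. The condition beta > 3/2 is the boundedness of g: the weight obtained is
    z^(-2 sigma - 2), and 2 sigma > 1 makes g' integrable. The bound sigma <= 1 matches the cubic
    decay of V at infinity: z^(-3) <= z^(-2 sigma - 1). For |psi|^(p+1) the difficulty lies below
    the peak, where g < 0 while r^(1-p) decreases, so that its derivative contributes with the wrong
    sign; there r tends to 2 M exponentially in x, and half of g' absorbs the loss. *)

Definition int1 f := mu.-integrable setT (EFin \o f).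
Definition I1 f : R := \int[mu]_x f x.

Lemma ae_imply (P Q : R -> Prop) : (forall x, P x -> Q x) ->
  {ae mu, forall x, P x} -> {ae mu, forall x, Q x}.
Proof. by move=> PQ; apply: filterS; first exact: (ae_filter_ringOfSetsType mu). Qed.

Lemma ae_and (P Q : R -> Prop) : {ae mu, forall x, P x} -> {ae mu, forall x, Q x} ->
  {ae mu, forall x, P x /\ Q x}.
Proof. by move=> p q; apply: filterI => //; exact: (ae_filter_ringOfSetsType mu). Qed.

Lemma int1_measurable f : int1 f -> measurable_fun setT f.
Proof. by move=> /integrableP[/measurable_EFinP]. Qed.

Lemma int1D f g : int1 f -> int1 g -> int1 (fun x => f x + g x).
Proof. exact: integrableD. Qed.

Lemma int1B f g : int1 f -> int1 g -> int1 (fun x => f x - g x).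
Proof. exact: integrableB. Qed.

Lemma int1Z k f : int1 f -> int1 (fun x => k * f x).
Proof. exact: integrableZl. Qed.

Lemma int10 : int1 (fun=> 0).
Proof. exact: integrable0. Qed.

Lemma le_int1 f g : measurable_fun setT f -> (forall x, `|f x| <= g x) ->
  int1 g -> int1 f.
Proof.
move=> mf fg ig; apply: (le_integrable _ _ _ ig) => //; first exact/measurable_EFinP.
by move=> x _ /=; rewrite lee_fin (le_trans (fg x))// ler_norm.
Qed.

Lemma I1D f g : int1 f -> int1 g -> I1 (fun x => f x + g x) = I1 f + I1 g.
Proof. by move=> ? ?; rewrite /I1 RintegralD. Qed.

Lemma I1B f g : int1 f -> int1 g -> I1 (fun x => f x - g x) = I1 f - I1 g.
Proof. by move=> ? ?; rewrite /I1 RintegralB. Qed.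

Lemma I1Z k f : int1 f -> I1 (fun x => k * f x) = k * I1 f.
Proof. by move=> ?; rewrite /I1 RintegralZl. Qed.

Lemma I1N f : int1 f -> I1 (fun x => - f x) = - I1 f.
Proof.
move=> fi; rewrite -mulN1r -I1Z//; congr I1; apply/funext => x; lra.
Qed.

Lemma le_I1 f g : int1 f -> int1 g -> (forall x, f x <= g x) -> I1 f <= I1 g.
Proof. by move=> ? ? fg; apply: le_Rintegral => // x _; exact: fg. Qed.

Lemma I1_ge0 f : (forall x, 0 <= f x) -> 0 <= I1 f.
Proof. by move=> f0; apply: Rintegral_ge0 => x _; exact: f0. Qed.

Lemma norm_I1 f : int1 f -> `|I1 f| <= I1 (fun x => `|f x|).
Proof. by move=> fi; apply: le_normr_Rintegral. Qed.

Lemma int1_norm f : int1 f -> int1 (fun x => `|f x|).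
Proof. exact: integrable_norm. Qed.

Lemma EFin_I1 f : int1 f -> (I1 f)%:E = (\int[mu]_x (f x)%:E)%E.
Proof. by move=> fi; rewrite /I1 /Rintegral fineK//; exact: integrable_fin_num. Qed.

Lemma I1_ae f g : measurable_fun setT f -> measurable_fun setT g ->
  {ae mu, forall x, f x = g x} -> I1 f = I1 g.
Proof.
move=> mf mg fg; rewrite /I1 /Rintegral; congr fine.
apply: ae_eq_integral => //; [exact/measurable_EFinP|exact/measurable_EFinP|].
by apply: ae_imply fg => x /= -> _.
Qed.

Lemma int1_ae f g : measurable_fun setT f -> measurable_fun setT g ->
  {ae mu, forall x, f x = g x} -> int1 f -> int1 g.
Proof.
move=> mf mg fg /integrableP[_ fi]; apply/integrableP; split.
  exact/measurable_EFinP.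
rewrite (_ : integral _ _ _ = \int[mu]_x `|(EFin \o f) x|)%E//.
apply: ae_eq_integral => //.
- by apply/measurable_EFinP; apply: measurableT_comp.
- by apply/measurable_EFinP; apply: measurableT_comp.
- by apply: ae_imply fg => x /= -> _.
Qed.

Lemma dominated_cvg (f_ : nat -> R -> R) f g : (forall n, measurable_fun setT (f_ n)) ->
  measurable_fun setT f -> {ae mu, forall x, f_ ^~ x @ \oo --> f x} ->
  int1 g -> (forall n x, `|f_ n x| <= g x) ->
  int1 f /\ I1 (f_ n) @[n --> \oo] --> I1 f.
Proof.
move=> mf_ mf ff ig fg.
have [||||| fi _ H] := @dominated_convergence _ _ _ mu setT measurableT
  (fun n => EFin \o f_ n) (EFin \o f) (EFin \o g) => //.
- by move=> n; apply/(@measurable_EFinP _ (measurableTypeR R)); exact: mf_.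
- by apply/(@measurable_EFinP _ (measurableTypeR R)); exact: mf.
- by apply: ae_imply ff => x /= h _; apply/fine_cvgP; split => //; exact: nearW.
- by apply: aeW => x n _ /=; rewrite lee_fin.
- split => //; apply: fine_cvg => /=; rewrite EFin_I1//; exact: H.
Qed.

Definition shiftf h : measurableTypeR R -> measurableTypeR R := fun x => x + h.

Lemma measurable_shift h : measurable_fun setT (shiftf h).
Proof. exact: measurable_funD. Qed.

HB.instance Definition _ h := isMeasurableFun.Build _ _ _ _
  (shiftf h) (measurable_shift h).

(** Lebesgue measure is the only measure that gives each interval ]a, b] its length, and translation
    preserves these lengths. *)
Lemma shift_measure h A : measurable A ->
  mu A = pushforward mu (shiftf h) A.
Proof.
move=> mA; apply: lebesgue_measure_unique => // X [[a b] _ <-] /=; rewrite /pushforward/=.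
have -> : shiftf h @^-1` `]a, b] = `]a - h, b - h]%classic.
  by apply/seteqP; split => x /=; rewrite /shiftf !in_itv/= => /andP[? ?]; apply/andP; split; lra.
rewrite /= !lebesgue_measure_itv/= !lte_fin ltrD2r; case: ifPn => // _.
by rewrite -!EFinD; congr EFin; lra.
Qed.

Lemma ge0_I1_shift h f : measurable_fun setT f -> (forall x, 0 <= f x) ->
  (\int[mu]_x (f (x + h))%:E = \int[mu]_x (f x)%:E)%E.
Proof.
move=> mf f0.
have /= <- := @ge0_integral_pushforward _ _ _ _ _ _ (measurable_shift h) mu setT (EFin \o f) measurableT.
- by apply: eq_measure_integral => A mA _; exact/esym/shift_measure.
- by apply/(@measurable_EFinP _ (measurableTypeR R)); exact: mf.
- by move=> x _ /=; rewrite lee_fin.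
Qed.

Lemma int1_shift h f : int1 f -> int1 (fun x => f (x + h)).
Proof.
move=> fi; have mf := int1_measurable fi; move/integrableP: (fi) => [_ foo].
apply/integrableP; split; first by apply/measurable_EFinP/measurableT_comp => //; exact: measurable_shift.
by rewrite (@ge0_I1_shift h (fun x => `|f x|))//; exact: measurableT_comp.
Qed.

Lemma I1_shift h f : int1 f -> I1 (fun x => f (x + h)) = I1 f.
Proof.
move=> fi; have mf := int1_measurable fi.
rewrite /I1 /Rintegral; congr fine.
have /= <- := @integral_pushforward _ _ _ _ _ _ (measurable_shift h) mu setT (EFin \o f) _ _ measurableT.
- by apply: eq_measure_integral => A mA _; exact/esym/shift_measure.
- by apply/(@measurable_EFinP _ (measurableTypeR R)); exact: mf.
- exact: (int1_shift h fi).
Qed.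

End integration.

(** * Square-integrable functions and their pairing *)

Section square_integrable.
Context {R : realType}.
Notation mu := (@lebesgue_measure R).
Implicit Types (f g k m : R -> R) (c C h : R).

(** Elements of L2 are functions rather than classes: [nr] is a seminorm, and changes on null sets
    go through [sq_ae] and [ip_ae]. *)
Definition sq f := measurable_fun setT f /\ int1 (fun x => f x ^+ 2).
Definition ip f g : R := I1 (fun x => f x * g x).
Definition nr f : R := Num.sqrt (ip f f).

Lemma sq_int f g : sq f -> sq g -> int1 (fun x => f x * g x).
Proof.
move=> [mf fi] [mg gi]; apply: (@le_int1 _ _ (fun x => f x ^+ 2 + g x ^+ 2)).
- exact: measurable_funM.
- move=> x; rewrite ler_norml; apply/andP; split; nra.
- exact: int1D.
Qed.

Lemma sq_le f g : measurable_fun setT f -> (forall x, `|f x| <= `|g x|) -> sq g -> sq f.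
Proof.
move=> mf fg [mg gi]; split => //; apply: le_int1 gi.
  exact: measurable_funX.
move=> x; rewrite ger0_norm ?sqr_ge0//.
by rewrite -(real_normK (num_real (f x))) -(real_normK (num_real (g x))) lerXn2r ?nnegrE.
Qed.

Lemma sqZ c f : sq f -> sq (fun x => c * f x).
Proof.
move=> [mf fi]; split; first exact: measurable_funM.
rewrite (_ : (fun x => _) = fun x => c ^+ 2 * f x ^+ 2).
  exact: int1Z.
by apply/funext => x; rewrite exprMn.
Qed.

Lemma sqD f g : sq f -> sq g -> sq (fun x => f x + g x).
Proof.
move=> sf sg; have [mf fi] := sf; have [mg gi] := sg.
split; first exact: measurable_funD.
rewrite (_ : (fun x => _) = fun x => (f x ^+ 2 + g x ^+ 2) + 2 * (f x * g x)).
  by apply: int1D; [exact: int1D|exact/int1Z/sq_int].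
by apply/funext => x; ring.
Qed.

Lemma sqN f : sq f -> sq (fun x => - f x).
Proof.
move=> /(sqZ (-1)); congr sq; apply/funext => x; ring.
Qed.

Lemma sqB f g : sq f -> sq g -> sq (fun x => f x - g x).
Proof. by move=> sf sg; exact/sqD/sqN. Qed.

Lemma sq0 : sq (fun=> 0).
Proof. by split => //; under eq_fun do rewrite expr0n/=; exact: int10. Qed.

Lemma sq_bd C m f : measurable_fun setT m -> (forall x, `|m x| <= C) -> sq f ->
  sq (fun x => m x * f x).
Proof.
move=> mm mC sf; apply: (@sq_le _ (fun x => C * f x)); last exact: sqZ.
  by apply: measurable_funM => //; case: sf.
move=> x; rewrite !normrM ler_wpM2r// (le_trans (mC x))// ler_norm//.
Qed.

Lemma sq_shift h f : sq f -> sq (fun x => f (x + h)).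
Proof.
move=> [mf fi]; split.
  by apply: measurableT_comp => //; exact: (measurable_shift h).
exact: (int1_shift h fi).
Qed.

Lemma sq_ae f g : measurable_fun setT g -> {ae mu, forall x, f x = g x} ->
  sq f -> sq g.
Proof.
move=> mg fg [mf fi]; split => //; apply: int1_ae fi.
- exact: measurable_funX.
- exact: measurable_funX.
- by apply: ae_imply fg => x /= ->.
Qed.

Lemma ipC f g : ip f g = ip g f.
Proof. by congr I1; apply/funext => x; rewrite mulrC. Qed.

Lemma ipDl f g k : sq f -> sq g -> sq k -> ip (fun x => f x + g x) k = ip f k + ip g k.
Proof.
move=> sf sg sk; rewrite /ip -I1D//; last 2 first. exact: sq_int. exact: sq_int.
by congr I1; apply/funext => x; rewrite mulrDl.
Qed.

Lemma ipBl f g k : sq f -> sq g -> sq k -> ip (fun x => f x - g x) k = ip f k - ip g k.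
Proof.
move=> sf sg sk; rewrite /ip -I1B//; last 2 first. exact: sq_int. exact: sq_int.
by congr I1; apply/funext => x; rewrite mulrBl.
Qed.

Lemma ipZl c f g : sq f -> sq g -> ip (fun x => c * f x) g = c * ip f g.
Proof.
move=> sf sg; rewrite /ip -I1Z//; last exact: sq_int.
by congr I1; apply/funext => x; rewrite mulrA.
Qed.

Lemma ipNl f g : sq f -> sq g -> ip (fun x => - f x) g = - ip f g.
Proof.
move=> sf sg; rewrite -mulN1r -ipZl//.
by congr ip; apply/funext => x; rewrite mulN1r.
Qed.

Lemma ipDr f g k : sq f -> sq g -> sq k -> ip k (fun x => f x + g x) = ip k f + ip k g.
Proof. by move=> *; rewrite ipC ipDl// !(ipC k). Qed.

Lemma ipBr f g k : sq f -> sq g -> sq k -> ip k (fun x => f x - g x) = ip k f - ip k g.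
Proof. by move=> *; rewrite ipC ipBl// !(ipC k). Qed.

Lemma ipZr c f g : sq f -> sq g -> ip g (fun x => c * f x) = c * ip g f.
Proof. by move=> *; rewrite ipC ipZl// (ipC g). Qed.

Lemma ipNr f g : sq f -> sq g -> ip g (fun x => - f x) = - ip g f.
Proof. by move=> *; rewrite ipC ipNl// (ipC g). Qed.

Lemma ip_ge0 f : 0 <= ip f f.
Proof. by apply: I1_ge0 => x; rewrite -expr2 sqr_ge0. Qed.

Lemma nr_ge0 f : 0 <= nr f. Proof. exact: sqrtr_ge0. Qed.

Lemma nrE f : nr f ^+ 2 = ip f f.
Proof. by rewrite sqr_sqrtr// ip_ge0. Qed.

Lemma ip_shift h f g : sq f -> sq g ->
  ip (fun x => f (x + h)) (fun x => g (x + h)) = ip f g.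
Proof. by move=> sf sg; exact: (I1_shift h (sq_int sf sg)). Qed.

Lemma nr_shift h f : sq f -> nr (fun x => f (x + h)) = nr f.
Proof. by move=> sf; rewrite /nr ip_shift. Qed.

Lemma ipCS f g : sq f -> sq g -> `|ip f g| <= nr f * nr g.
Proof.
move=> sf sg.
have H t : 0 <= ip f f - 2 * t * ip f g + t ^+ 2 * ip g g.
  have := ip_ge0 (fun x => f x - t * g x).
  have sgt := sqZ t sg.
  rewrite ipBl ?ipBr ?ipZl ?ipZr//; last exact: sqB.
  by rewrite (ipC g f); congr (_ <= _); ring.
have : ip f g ^+ 2 <= ip f f * ip g g.
  have [g0|g0] := eqVneq (ip g g) 0.
    have H0 : ip f g = 0.
      apply: contrapT => /eqP fg0.
      (* If <g, g> = 0 the polynomial in [H] is affine in t; this t gives it the value -1. *)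
      have := H ((ip f f + 1) / (2 * ip f g)); rewrite g0 mulr0 addr0.
      have -> : ip f f - 2 * ((ip f f + 1) / (2 * ip f g)) * ip f g = -1 by field.
      lra.
    by rewrite H0 g0 expr0n mulr0.
  have gp : 0 < ip g g by rewrite lt_def g0 ip_ge0.
  have := H (ip f g / ip g g).
  have -> : ip f f - 2 * (ip f g / ip g g) * ip f g + (ip f g / ip g g) ^+ 2 * ip g g =
    (ip f f * ip g g - ip f g ^+ 2) / ip g g by field.
  by rewrite pmulr_lge0 ?invr_gt0// subr_ge0.
rewrite -(nrE f) -(nrE g) -exprMn -(real_normK (num_real (ip f g))).
by rewrite ler_sqr// nnegrE mulr_ge0 ?nr_ge0.
Qed.

Lemma nrD f g : sq f -> sq g -> nr (fun x => f x + g x) <= nr f + nr g.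
Proof.
move=> sf sg; rewrite -ler_sqr ?nnegrE ?addr_ge0 ?nr_ge0// nrE.
have sfg := sqD sf sg.
rewrite ipDl// !ipDr// (ipC g f) sqrrD !nrE.
have := le_trans (ler_norm _) (ipCS sf sg); lra.
Qed.

Lemma nrZ c f : sq f -> nr (fun x => c * f x) = `|c| * nr f.
Proof.
move=> sf; rewrite /nr ipZl ?ipZr//; last exact: sqZ.
by rewrite mulrA -expr2 sqrtrM ?sqr_ge0// sqrtr_sqr.
Qed.

Lemma nrN f : sq f -> nr (fun x => - f x) = nr f.
Proof. by move=> sf; rewrite /nr ipNl ?ipNr ?opprK//; exact: sqN. Qed.

Lemma nrB f g : sq f -> sq g -> nr (fun x => f x - g x) <= nr f + nr g.
Proof. by move=> sf sg; rewrite -(nrN sg); apply: nrD => //; exact: sqN. Qed.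

Lemma nrBC f g : nr (fun x => f x - g x) = nr (fun x => g x - f x).
Proof.
rewrite /nr; congr (Num.sqrt _); congr I1; apply/funext => x; ring.
Qed.

Lemma nr_le f g : sq f -> sq g -> (forall x, `|f x| <= `|g x|) -> nr f <= nr g.
Proof.
move=> sf sg fg; rewrite ler_sqrt ?ip_ge0//; apply: le_I1; [exact: sq_int..|].
move=> x; rewrite -!expr2 -(real_normK (num_real (f x))) -(real_normK (num_real (g x))).
by rewrite lerXn2r ?nnegrE.
Qed.

Lemma nr_bd C m f : measurable_fun setT m -> (forall x, `|m x| <= C) -> sq f ->
  nr (fun x => m x * f x) <= C * nr f.
Proof.
move=> mm mC sf; have C0 : 0 <= C by rewrite (le_trans _ (mC 0)).
rewrite -[X in X * _]ger0_norm// -nrZ//; apply: nr_le.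
- exact: sq_bd mC sf.
- exact: sqZ.
- by move=> x; rewrite !normrM ler_wpM2r// (ger0_norm C0).
Qed.

Lemma ip_ae f f' g g' : sq f -> sq f' -> sq g -> sq g' ->
  {ae mu, forall x, f x = f' x} -> {ae mu, forall x, g x = g' x} ->
  ip f g = ip f' g'.
Proof.
move=> [mf _] [mf' _] [mg _] [mg' _] ff gg; apply: I1_ae.
- exact: measurable_funM.
- exact: measurable_funM.
- by apply: ae_imply (ae_and ff gg) => x /= [-> ->].
Qed.

End square_integrable.

Lemma le_of_eq d (T : porderType d) (x y : T) : x = y -> (x <= y)%O.
Proof. by move->. Qed.

(** * Integrals over intervals, local integrability and truncation *)

Section intervals.
Context {R : realType}.
Notation mu := (@lebesgue_measure R).
Implicit Types (f g : R -> R) (a b c h : R).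

Lemma fatou_bound (f_ : nat -> R -> R) f C : (forall n, int1 (f_ n)) ->
  (forall n x, 0 <= f_ n x) -> (forall n, I1 (f_ n) <= C) ->
  measurable_fun setT f -> (forall x, 0 <= f x) ->
  {ae mu, forall x, f_ ^~ x @ \oo --> f x} -> int1 f /\ I1 f <= C.
Proof.
move=> fi f0 fC mf ff0 [N [mN N0 sub]].
(* The indicator [w] switches everything off on the exceptional null set, so that the convergence
   holds at every point and the limit can be written as the liminf in Fatou's lemma. *)
pose w : R -> R := \1_(~` N).
have mw : measurable_fun setT w by apply: measurable_indic; exact: measurableC.
have w01 x : 0 <= w x <= 1.
  by rewrite /w indicE; case: (_ \in _); rewrite /= ?lexx ?ler01.
pose h n x := w x * f_ n x.
have hi n : int1 (h n).
  apply: le_int1 (fi n).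
    by apply: measurable_funM => //; exact: int1_measurable.
  move=> x; have /andP[w0 w1] := w01 x.
  by rewrite ger0_norm ?mulr_ge0// -[leRHS]mul1r ler_wpM2r.
have hC n : I1 (h n) <= C.
  apply: le_trans (fC n); apply: le_I1 => // x.
  by have /andP[w0 w1] := w01 x; rewrite -[leRHS]mul1r ler_wpM2r.
have hcv x : h ^~ x @ \oo --> w x * f x.
  rewrite /h /w indicE; have [xN|xN] := boolP (x \in N).
    rewrite memNset/=; last by rewrite inE in xN => /(_ xN).
    by under eq_fun do rewrite mul0r; rewrite mul0r; exact: cvg_cst.
  rewrite mem_set//=; last by move=> xN'; rewrite mem_set in xN.
  under eq_fun do rewrite mul1r; rewrite mul1r.
  by apply: contrapT => xc; move: xN; rewrite mem_set//; exact: sub.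
have wff : {ae mu, forall x, w x * f x = f x}.
  exists N; split => // x /= xf; apply: contrapT => xN; apply: xf.
  by rewrite /w indicE mem_set// mul1r.
have mwf : measurable_fun setT (fun x => w x * f x) by apply: measurable_funM.
have le1 : (\int[mu]_x (w x * f x)%:E <= C%:E)%E.
  rewrite (_ : integral _ _ _ = \int[mu]_x limn_einf (fun n => (h n x)%:E))%E; last first.
    apply: eq_integral => x _; apply/esym.
    have hx : (h n x)%:E @[n --> \oo] --> (w x * f x)%:E.
      by apply/fine_cvgP; split; [exact: nearW|exact: hcv].
    by rewrite (cvg_limn_einf_sup hx).
  apply: le_trans.
    apply: fatou => //.
    - by move=> n; apply/(@measurable_EFinP _ (measurableTypeR R)); exact: int1_measurable.
    - by move=> n x _; rewrite lee_fin mulr_ge0//; case/andP: (w01 x).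
  rewrite limn_einf_lim; apply: lime_le; first exact: is_cvg_einfs.
  apply: nearW => n; apply: ereal_inf_le => /=.
  exists (\int[mu]_x (h n x)%:E)%E; last by rewrite -EFin_I1// lee_fin.
  by exists n => /=.
have wfi : int1 (fun x => w x * f x).
  apply/integrableP; split; first exact/measurable_EFinP.
  apply: le_lt_trans (ltry C); apply: le_trans le1; apply: le_of_eq.
  apply: eq_integral => x _ /=; rewrite ger0_norm// mulr_ge0//; by case/andP: (w01 x).
split; first exact: int1_ae wff wfi.
by rewrite -(I1_ae mwf mf wff) -lee_fin EFin_I1.
Qed.

Definition ind a b : R -> R := \1_(`[a, b]%classic).
(** An integral over the line of a truncated function, so that facts about [I1] transfer directly.
    It carries no orientation: it is 0 when b < a, which is why [prim] distinguishes the sign of its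
    argument. *)
Definition II a b f : R := I1 (fun x => ind a b x * f x).
Definition loc f := measurable_fun setT f /\ forall a b, int1 (fun x => ind a b x * f x).

Lemma indE a b x : ind a b x = ((a <= x <= b)%R : bool)%:R.
Proof.
rewrite /ind indicE; congr (nat_of_bool _)%:R.
by apply/idP/idP => [/[!inE]/=|xab]; rewrite ?in_itv//= inE/= in_itv/=.
Qed.

Lemma ind01 a b x : 0 <= ind a b x <= 1.
Proof. by rewrite indE ler0n lern1 leq_b1. Qed.

Lemma norm_ind a b x : `|ind a b x| <= 1.
Proof. by case/andP: (ind01 a b x) => ? ?; rewrite ger0_norm. Qed.

Lemma ind_id a b x : ind a b x * ind a b x = ind a b x.
Proof. by rewrite indE; case: (_ && _); rewrite ?mul1r ?mul0r. Qed.

Lemma ind_shift h a b x : ind (a + h) (b + h) (x + h) = ind a b x.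
Proof. by rewrite !indE !lerD2r. Qed.

Lemma measurable_ind a b : measurable_fun setT (ind a b).
Proof. exact: measurable_indic. Qed.

Lemma int1_ind a b : int1 (ind a b).
Proof. exact: integrable_indic_itv. Qed.

Lemma I1_ind a b : a <= b -> I1 (ind a b) = b - a.
Proof.
move=> ab; rewrite /I1 /Rintegral integral_indic// setIT.
rewrite -[X in fine X]/(mu `[a, b]%classic) lebesgue_measure_itv/= lte_fin.
by case: ltP => // ba; apply/esym/eqP; rewrite subr_eq0 eq_le ab ba.
Qed.

Lemma sq_ind a b : sq (ind a b).
Proof.
split; first exact: measurable_ind.
by under eq_fun do rewrite expr2 ind_id; exact: int1_ind.
Qed.

Lemma int1_bd C (m f : R -> R) : measurable_fun setT m -> (forall x, `|m x| <= C) -> int1 f ->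
  int1 (fun x => m x * f x).
Proof.
move=> mm mC fi; apply: (@le_int1 _ _ (fun x => C * `|f x|)).
- by apply: measurable_funM => //; exact: int1_measurable.
- by move=> x; rewrite normrM ler_wpM2r.
- exact/int1Z/int1_norm.
Qed.

Lemma loc_int1 f : int1 f -> loc f.
Proof.
move=> fi; split; first exact: int1_measurable.
move=> a b; apply: int1_bd fi; [exact: measurable_ind|exact: norm_ind].
Qed.

Lemma loc_sq f : sq f -> loc f.
Proof.
move=> sf; split; first by case: sf.
by move=> a b; apply: sq_int => //; exact: sq_ind.
Qed.

Lemma loc_bdM C (m f : R -> R) : measurable_fun setT m -> (forall x, `|m x| <= C) -> loc f ->
  loc (fun x => m x * f x).
Proof.
move=> mm mC [mf fi]; split; first exact: measurable_funM.
move=> a b; rewrite (_ : (fun _ => _) = fun x => m x * (ind a b x * f x)).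
  exact: int1_bd mC (fi _ _).
by apply/funext => x; ring.
Qed.

Lemma locD f g : loc f -> loc g -> loc (fun x => f x + g x).
Proof.
move=> [mf fi] [mg gi]; split; first exact: measurable_funD.
by move=> a b; under eq_fun do rewrite mulrDr; exact: int1D.
Qed.

Lemma locZ c f : loc f -> loc (fun x => c * f x).
Proof.
move=> [mf fi]; split; first exact: measurable_funM.
by move=> a b; under eq_fun do rewrite mulrCA; exact: int1Z.
Qed.

Lemma locN f : loc f -> loc (fun x => - f x).
Proof. by move=> /(locZ (-1)); congr loc; apply/funext => x; ring. Qed.

Lemma locB f g : loc f -> loc g -> loc (fun x => f x - g x).
Proof. by move=> ? ?; exact/locD/locN. Qed.

Lemma loc_shift h f : loc f -> loc (fun x => f (x + h)).
Proof.
move=> [mf fi]; split.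
  by apply: measurableT_comp => //; exact: (measurable_shift h).
move=> a b; have := int1_shift h (fi (a + h) (b + h)).
by under eq_fun do rewrite ind_shift.
Qed.

Lemma II_shift h a b f : loc f -> II a b (fun x => f (x + h)) = II (a + h) (b + h) f.
Proof.
move=> [_ fi]; rewrite /II -(I1_shift h (fi (a + h) (b + h))).
by congr I1; apply/funext => x; rewrite ind_shift.
Qed.

Lemma IID a b f g : loc f -> loc g -> II a b (fun x => f x + g x) = II a b f + II a b g.
Proof. by move=> [_ fi] [_ gi]; rewrite /II -I1D//; congr I1; apply/funext => x; rewrite mulrDr. Qed.

Lemma IIZ c a b f : loc f -> II a b (fun x => c * f x) = c * II a b f.
Proof. by move=> [_ fi]; rewrite /II -I1Z//; congr I1; apply/funext => x; rewrite mulrCA. Qed.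

Lemma IIN a b f : loc f -> II a b (fun x => - f x) = - II a b f.
Proof. by move=> [_ fi]; rewrite /II -I1N//; congr I1; apply/funext => x; rewrite mulrN. Qed.

Lemma IIB a b f g : loc f -> loc g -> II a b (fun x => f x - g x) = II a b f - II a b g.
Proof. by move=> ? ?; rewrite IID ?IIN//; exact: locN. Qed.

Lemma le_II a b f g : loc f -> loc g -> (forall x, a <= x <= b -> f x <= g x) ->
  II a b f <= II a b g.
Proof.
move=> [_ fi] [_ gi] fg; apply: le_I1 => // x; rewrite indE.
by move: (fg x); case: (_ && _) => [/(_ isT)|_]; rewrite ?mul1r ?mul0r.
Qed.

Lemma eq_II a b f g : (forall x, a <= x <= b -> f x = g x) -> II a b f = II a b g.
Proof.
move=> fg; congr I1; apply/funext => x; rewrite indE.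
by move: (fg x); case: (_ && _) => [/(_ isT) ->|_] //; rewrite !mul0r.
Qed.

Lemma II_cst c a b : a <= b -> II a b (fun=> c) = c * (b - a).
Proof.
move=> ab; rewrite /II; under eq_fun do rewrite mulrC.
by rewrite I1Z ?I1_ind//; exact: int1_ind.
Qed.

Lemma II_ge0 a b f : (forall x, a <= x <= b -> 0 <= f x) -> 0 <= II a b f.
Proof.
move=> f0; apply: I1_ge0 => x; rewrite indE.
by move: (f0 x); case: (_ && _) => [/(_ isT)|_]; rewrite ?mul1r ?mul0r.
Qed.

Lemma loc_norm f : loc f -> loc (fun x => `|f x|).
Proof.
move=> [mf fi]; split; first exact: measurableT_comp.
move=> a b; have := int1_norm (fi a b).
by under eq_fun do rewrite normrM (ger0_norm (proj1 (andP (ind01 _ _ _)))).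
Qed.

Lemma norm_II a b f : loc f -> `|II a b f| <= II a b (fun x => `|f x|).
Proof.
move=> [mf fi]; apply: le_trans (norm_I1 (fi a b)) _; apply: le_of_eq.
congr I1; apply/funext => x.
by rewrite normrM (ger0_norm (proj1 (andP (ind01 _ _ _)))).
Qed.

Lemma II_le_I1 a b f : int1 f -> (forall x, 0 <= f x) -> II a b f <= I1 f.
Proof.
move=> fi f0; apply: le_I1 => //; first by case: (loc_int1 fi).
move=> x; have /andP[w0 w1] := ind01 a b x.
by rewrite -[leRHS]mul1r ler_wpM2r.
Qed.

Lemma ae_neq c : {ae mu, forall x, x != c}.
Proof.
exists [set c]; split => //; first by rewrite lebesgue_measure_set1.
by move=> x /= /negP; rewrite negbK => /eqP.
Qed.

Lemma II_split a b c f : loc f -> a <= b <= c -> II a c f = II a b f + II b c f.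
Proof.
move=> [mf fi] /andP[ab bc]; rewrite /II -I1D//; apply: I1_ae.
- exact: int1_measurable.
- by apply: measurable_funD; exact: int1_measurable.
- apply: ae_imply (ae_neq b) => x xb; rewrite -mulrDl !indE; congr (_ * _).
  have [xb1|bx|xbE] := ltgtP x b; last by rewrite xbE eqxx in xb.
    by rewrite (le_trans (ltW xb1) bc) ?andbT ?andbF ?addr0.
  by rewrite (le_trans ab (ltW bx)) ?andbT ?andbF ?add0r.
Qed.

Lemma II_ae a b f g : loc f -> loc g -> {ae mu, forall x, f x = g x} -> II a b f = II a b g.
Proof.
move=> [_ fi] [_ gi] fg; apply: I1_ae; [exact: int1_measurable..|].
by apply: ae_imply fg => x /= ->.
Qed.

Lemma II_refl a f : loc f -> II a a f = 0.
Proof.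
move=> [mf fi]; rewrite /II (@I1_ae _ _ (fun=> 0)) ?/I1 ?Rintegral_cst ?mul0r//.
  exact: int1_measurable.
apply: ae_imply (ae_neq a) => x xa; rewrite indE -eq_le eq_sym.
by rewrite (negbTE xa) mul0r.
Qed.

Lemma II_Rintegral a b f : II a b f = \int[mu]_(x in `[a, b]) f x.
Proof.
rewrite Rintegral_mkcond; congr Rintegral; apply/funext => x.
by rewrite patchE /ind indicE; case: ifPn => _; rewrite ?mul1r ?mul0r.
Qed.

Lemma loc_itv a b f : loc f -> mu.-integrable `[a, b] (EFin \o f).
Proof.
move=> [mf fi]; apply/integrable_mkcond => //.
have := fi a b; apply: eq_integrable => // x _.
by rewrite patchE /= /ind indicE; case: ifPn => _; rewrite ?mul1r ?mul0r.
Qed.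

Lemma itv_loc f : measurable_fun setT f ->
  (forall a b, mu.-integrable `[a, b] (EFin \o f)) -> loc f.
Proof.
move=> mf fi; split => // a b.
have [+ _] := @integrable_mkcond _ (measurableTypeR R) _ mu `[a, b]%classic (EFin \o f) (measurable_itv _).
move=> /(_ (fi a b)).
apply: eq_integrable => // x _.
by rewrite patchE /= /ind indicE; case: ifPn => _; rewrite ?mul1r ?mul0r.
Qed.

Lemma cont_measurable f : continuous f -> measurable_fun setT f.
Proof. exact: continuous_measurable_fun. Qed.

Lemma loc_cont f : continuous f -> loc f.
Proof.
move=> cf; apply: itv_loc; first exact: cont_measurable.
move=> a b; apply: continuous_compact_integrable; first exact: segment_compact.
exact: continuous_subspaceT.
Qed.

Lemma locP f : locally_integrable setT f <-> loc f.
Proof.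
split=> [[mf _ fK]|lf]; last first.
  split; [by case: lf|exact: openT|move=> K _ cK].
  have [M [Mr MK]] := compact_bounded cK.
  have KM : K `<=` `[- (M + 1), M + 1].
    by move=> x Kx /=; have := MK (M + 1); rewrite ltrDl ltr01 => /(_ isT _ Kx)/ler_normlP[? ?];
      rewrite in_itv/=; apply/andP; split => //; lra.
  have /integrableP[_] : mu.-integrable K (EFin \o f).
    apply: (@integrableS _ (measurableTypeR R) _ mu _ _ _ _ _ KM (loc_itv _ _ lf)) => //; exact: compact_measurable.
  by [].
apply: itv_loc => // a b; apply/integrableP; split.
  by apply/measurable_EFinP; exact: measurable_funS mf.
exact: fK (@segment_compact _ _ _).
Qed.

(** Exhaustion by [-n, n] and Fatou's lemma. This is how bounds on bounded windows, in space for
    averages and in time for the Morawetz estimate, become integrability on the whole line. *)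
Lemma trunc_bound f C : measurable_fun setT f -> (forall x, 0 <= f x) ->
  (forall n : nat, int1 (fun x => ind (- n%:R) n%:R x * f x) /\ II (- n%:R) n%:R f <= C) ->
  int1 f /\ I1 f <= C.
Proof.
move=> mf f0 fC.
apply: (@fatou_bound (fun n x => ind (- n%:R) n%:R x * f x)) => //.
- by move=> n; case: (fC n).
- by move=> n x; rewrite mulr_ge0//; case/andP: (ind01 (- n%:R) n%:R x).
- by move=> n; case: (fC n).
apply: aeW => x; apply: cvg_near_cst; near=> n.
rewrite indE (_ : _ <= _ <= _) ?mul1r//.
rewrite -ler_norml; near: n; exact: nbhs_infty_ger.
Unshelve. all: by end_near. Qed.

Lemma II_cvg f : int1 f -> II (- n%:R) n%:R f @[n --> \oo] --> I1 f.
Proof.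
move=> fi; have [] // := @dominated_cvg _ (fun n x => ind (- n%:R) n%:R x * f x) f (fun x => `|f x|).
- by move=> n; apply: measurable_funM; [exact: measurable_ind|exact: int1_measurable].
- exact: int1_measurable.
- apply: aeW => x; apply: cvg_near_cst; near=> n.
  rewrite indE (_ : _ <= _ <= _) ?mul1r//.
  rewrite -ler_norml; near: n; exact: nbhs_infty_ger.
- exact: int1_norm.
- move=> n x; rewrite normrM -[leRHS]mul1r ler_wpM2r//; exact: norm_ind.
Unshelve. all: by end_near. Qed.

End intervals.

(** * Absolutely continuous functions and their averages *)

Section absolute_continuity.
Context {R : realType}.
Notation mu := (@lebesgue_measure R).
Implicit Types (f df g dg : R -> R) (a b c h : R).

(** Local absolute continuity in integral form, with a representative of the derivative carried
    along. This is the form in which Du Bois-Reymond's lemma delivers its conclusion. *)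
Definition AC f df := loc df /\ forall a b, a <= b -> f b - f a = II a b df.

Lemma AC_cont f df : AC f df -> continuous f.
Proof.
move=> [ldf fE] x.
have xx : x - 1 <= x + 1 by lra.
have oo : `]x - 1, x + 1[%classic `<=` `[x - 1, x + 1]%classic by exact: subset_itv_oo_cc.
have := continuous_subspaceW oo (parameterized_integral_continuous xx (loc_itv _ _ ldf)).
rewrite continuous_open_subspace//.
move=> /(_ x); rewrite inE/= in_itv/= => H.
have : {for x, continuous (fun y => f (x - 1) + parameterized_integral mu (x - 1) y df)}.
  apply: cvgD; first exact: cvg_cst.
  by apply: H; apply/andP; split; lra.
rewrite /prop_for/continuous_at.
have E y : x - 1 < y -> f (x - 1) + parameterized_integral mu (x - 1) y df = f y.
  move=> xy; rewrite /parameterized_integral -II_Rintegral -fE ?(ltW xy)//; ring.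
rewrite E; last lra.
apply: cvg_trans; apply: near_eq_cvg; near=> y; rewrite E//.
near: y; apply: lt_nbhsr; lra.
Unshelve. all: by end_near. Qed.

Definition prim f x := if 0 <= x then II 0 x f else - II x 0 f.

Lemma AC_prim f : loc f -> AC (prim f) f.
Proof.
move=> lf; split => // a b ab; rewrite /prim.
have [b0|b0] := leP 0 b; have [a0|a0] := leP 0 a.
- by rewrite (@II_split _ 0 a b) ?a0//; ring.
- by rewrite (@II_split _ a 0 b) ?(ltW a0)//; ring.
- by exfalso; lra.
- by rewrite (@II_split _ a b 0) ?ab ?(ltW b0)//; ring.
Qed.

(** For absolutely continuous f the quotient [dq h f] is the average of the derivative ([dq_av]),
    and averaging does not increase the L2 norm ([nr_av]). Bounds and limits of difference quotients
    thus reduce to those of averages. *)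
Definition dq h f x := h^-1 * (f (x + h) - f x).
Definition av h f x := h^-1 * II x (x + h) f.

Lemma dq_av h f df : 0 <= h -> AC f df -> dq h f = av h df.
Proof.
by move=> h0 [_ fE]; apply/funext => x; rewrite /dq /av fE// lerDl.
Qed.

Lemma ACshift h f df : AC f df -> AC (fun x => f (x + h)) (fun x => df (x + h)).
Proof.
move=> [ldf fE]; split; first exact: loc_shift.
by move=> a b ab; rewrite fE ?lerD2r// II_shift.
Qed.

Lemma ACD f df g dg : AC f df -> AC g dg -> AC (fun x => f x + g x) (fun x => df x + dg x).
Proof.
move=> [lf fE] [lg gE]; split; first exact: locD.
by move=> a b ab; rewrite IID// -fE// -gE//; ring.
Qed.

Lemma ACZ c f df : AC f df -> AC (fun x => c * f x) (fun x => c * df x).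
Proof.
move=> [lf fE]; split; first exact: locZ.
by move=> a b ab; rewrite IIZ// -fE//; ring.
Qed.

Lemma ACN f df : AC f df -> AC (fun x => - f x) (fun x => - df x).
Proof.
move=> [lf fE]; split; first exact: locN.
by move=> a b ab; rewrite IIN// -fE//; ring.
Qed.

Lemma ACB f df g dg : AC f df -> AC g dg -> AC (fun x => f x - g x) (fun x => df x - dg x).
Proof. by move=> ? ?; exact/ACD/ACN. Qed.

Lemma AC_cst c : AC (fun=> c) (fun=> 0).
Proof.
have l0 : loc (fun=> 0 : R) by apply: loc_int1; exact: int10.
by split=> // a b ab; rewrite subrr II_cst// mul0r.
Qed.

Lemma AC_eq f df dg : AC f df -> df = dg -> AC f dg.
Proof. by move=> ? <-. Qed.

Lemma av_cont h f : 0 <= h -> loc f -> continuous (av h f).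
Proof.
move=> h0 lf; rewrite -(dq_av h0 (AC_prim lf)) => x.
apply: cvgM; first exact: cvg_cst.
by apply: cvgB; [exact: (AC_cont (ACshift h (AC_prim lf)))|exact: (AC_cont (AC_prim lf))].
Qed.

Lemma av_measurable h f : 0 <= h -> loc f -> measurable_fun setT (av h f).
Proof. by move=> h0 lf; apply: cont_measurable; exact: av_cont. Qed.

(* Averaging the primitive over [a, b] reduces the average of [f] over long
   intervals to the primitive near the two end points. *)
Lemma II_av h f a b : 0 < h -> loc f -> a <= b ->
  II a b (av h f) = h^-1 * (II b (b + h) (prim f) - II a (a + h) (prim f)).
Proof.
move=> h0 lf ab; rewrite -(dq_av (ltW h0) (AC_prim lf)).
have lp : loc (prim f) by exact: loc_cont (AC_cont (AC_prim lf)).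
have ls := loc_shift h lp.
rewrite IIZ; last exact: locB.
rewrite IIB// II_shift//; congr (_ * _).
have e1 : II a (b + h) (prim f) = II a (a + h) (prim f) + II (a + h) (b + h) (prim f).
  by apply: II_split => //; lra.
have e2 : II a (b + h) (prim f) = II a b (prim f) + II b (b + h) (prim f).
  by apply: II_split => //; lra.
lra.
Qed.

Lemma prim_le a b f : loc f -> (forall x, 0 <= f x) -> a <= b -> prim f a <= prim f b.
Proof.
by move=> lf f0 ab; rewrite -subr_ge0 (AC_prim lf).2// II_ge0.
Qed.

(** By [II_av] the integral over [-n, n] is a difference of two means of the primitive. The
    primitive is monotone, so this is at most prim f (n + h) - prim f (-n), an integral of f over an
    interval. *)
Lemma ge0_av h f : 0 < h -> int1 f -> (forall x, 0 <= f x) ->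
  int1 (av h f) /\ I1 (av h f) <= I1 f.
Proof.
move=> h0 fi f0; have lf := loc_int1 fi; have h0' := ltW h0.
have ma := av_measurable h0' lf.
have lav : loc (av h f) by apply: loc_cont; exact: av_cont.
have av0 x : 0 <= av h f x by rewrite mulr_ge0 ?invr_ge0// II_ge0.
apply: trunc_bound => // n; split; first exact: (lav.2).
have nn : - n%:R <= n%:R :> R by rewrite lerNl (@le_trans _ _ 0) ?oppr_le0.
rewrite II_av//; have lp : loc (prim f) by exact: loc_cont (AC_cont (AC_prim lf)).
have lc c : loc (fun=> c : R) by apply: loc_cont; exact: cst_continuous.
rewrite mulrC ler_pdivrMr// [leRHS]mulrC.
have : II n%:R (n%:R + h) (prim f) <= II n%:R (n%:R + h) (fun=> prim f (n%:R + h)).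
  by apply: le_II => // x /andP[_ xh]; exact: prim_le.
have : II (- n%:R) (- n%:R + h) (fun=> prim f (- n%:R)) <= II (- n%:R) (- n%:R + h) (prim f).
  by apply: le_II => // x /andP[xh _]; exact: prim_le.
rewrite !II_cst ?lerDl// !(addrC _ h) !addrK => p1 p2.
have : h * (prim f (h + n%:R) - prim f (- n%:R)) <= h * I1 f.
  rewrite ler_pM2l// (AC_prim lf).2; last by rewrite (le_trans nn)// lerDr.
  exact: II_le_I1.
lra.
Qed.

(** Cauchy-Schwarz against the indicator of [x, x + h], whose squared norm is h. *)
Lemma av_sqr_le h f x : 0 < h -> sq f -> av h f x ^+ 2 <= av h (fun y => f y ^+ 2) x.
Proof.
move=> h0 sf; have h0' := ltW h0.
have xh : x <= x + h by lra.
have sif : sq (fun y => ind x (x + h) y * f y).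
  by apply: (sq_bd (C := 1)) sf; [exact: measurable_ind|exact: norm_ind].
have := ipCS (sq_ind x (x + h)) sif.
have -> : ip (ind x (x + h)) (fun y => ind x (x + h) y * f y) = II x (x + h) f.
  by congr I1; apply/funext => y; rewrite mulrA ind_id.
move=> cs.
have : II x (x + h) f ^+ 2 <= h * II x (x + h) (fun y => f y ^+ 2).
  rewrite -(real_normK (num_real (II _ _ _))).
  apply: (@le_trans _ _ ((nr (ind x (x + h)) * nr (fun y => ind x (x + h) y * f y)) ^+ 2)).
    by rewrite ler_sqr// nnegrE mulr_ge0 ?nr_ge0.
  rewrite exprMn !nrE.
  have -> : ip (ind x (x + h)) (ind x (x + h)) = h.
    rewrite -[RHS](addrK x) (addrC h) -(I1_ind xh).
    by congr I1; apply/funext => y; rewrite ind_id.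
  rewrite ler_pM2l//; apply: le_of_eq; congr I1; apply/funext => y.
  by rewrite -[in RHS]ind_id; ring.
rewrite /av exprMn => H.
apply: (@le_trans _ _ (h^-1 ^+ 2 * (h * II x (x + h) (fun y => f y ^+ 2)))).
  by rewrite ler_wpM2l// sqr_ge0.
by rewrite expr2 -mulrA mulKf ?gt_eqF.
Qed.

Lemma sq_av h f : 0 < h -> sq f -> sq (av h f).
Proof.
move=> h0 sf; have h0' := ltW h0; have lf := loc_sq sf.
have ma := av_measurable h0' lf; split => //.
have [ai _] := ge0_av h0 sf.2 (fun x => sqr_ge0 (f x)).
apply: le_int1 ai; first exact: measurable_funX.
by move=> x; rewrite ger0_norm ?sqr_ge0// av_sqr_le.
Qed.

Lemma nr_av h f : 0 < h -> sq f -> nr (av h f) <= nr f.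
Proof.
move=> h0 sf; rewrite ler_sqrt ?ip_ge0//.
have [ai] := ge0_av h0 sf.2 (fun x => sqr_ge0 (f x)).
have -> : I1 (fun x => f x ^+ 2) = ip f f by congr I1; apply/funext => x; rewrite expr2.
apply: le_trans; apply: le_I1 => //.
  by apply: sq_int; exact: sq_av.
by move=> x; rewrite -expr2 av_sqr_le.
Qed.

(** Steps tend to zero along this one sequence, so that dominated convergence and Fatou's lemma for
    sequences apply. *)
Definition hn n : R := n.+1%:R^-1.

Lemma av_lebesgue_pt f x : loc f -> lebesgue_pt f x -> av (hn n) f x @[n --> \oo] --> f x.
Proof.
move=> lf fx; have lif := (locP f).2 lf.
pose E (x : R) (n : nat) : set R := `[x, x + n.+1%:R^-1]%classic.
have n0 (n : nat) : 0 < n.+1%:R^-1 :> R by rewrite invr_gt0.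
have muE y n : mu (E y n) = n.+1%:R^-1%:E.
  rewrite /E lebesgue_measure_itv/= lte_fin ltrDl n0 -EFinB.
  by congr EFin; rewrite addrC addKr.
have hE y : nicely_shrinking y (E y).
  split; first by move=> n; exact: measurable_itv.
  have n20 (n : nat) : 0 < 2 * n.+1%:R^-1 :> R by rewrite mulr_gt0.
  (* An interval of length d starting at x lies in the ball of radius 2 d about x, whose measure is
     4 d. *)
  exists (4, fun n => PosNum (n20 n)); split => //=.
  - rewrite -[X in _ --> X](mulr0 2); apply: cvgM; first exact: cvg_cst.
    exact: cvg_harmonic.
  - move=> n z; rewrite /E/= in_itv/= /ball/= => /andP[yz zy].
    have := n0 n; move: yz zy; set d := _^-1 => ? ? ?; rewrite ltr_norml; apply/andP; split; lra.
  - move=> n; rewrite lebesgue_measure_ball ?muE; last exact: ltW.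
    by rewrite -EFinM lee_fin; have := n0 n; set d := _^-1; lra.
have := @nice_lebesgue_differentiation _ _ hE _ lif _ fx.
move=> /fine_cvg/=; apply: cvg_trans; apply: near_eq_cvg; apply: nearW => n /=.
rewrite muE fineM//=; last first.
- by have := loc_itv x (x + n.+1%:R^-1) lf; exact: integrable_fin_num.
- by rewrite inver gt_eqF.
by rewrite inver gt_eqF//= /av II_Rintegral.
Qed.

Lemma av_ae f : loc f -> {ae mu, forall x, av (hn n) f x @[n --> \oo] --> f x}.
Proof.
move=> lf; have := lebesgue_differentiation ((locP f).2 lf).
by apply: ae_imply => x; exact: av_lebesgue_pt.
Qed.

(** If f_n stayed at distance e from f along a subsequence, the parallelogram law would bound the
    squared norm of f_n + f by 4 |f|^2 - e^2, while Fatou's lemma bounds that of the limit 2 f by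
    the same number. *)
Lemma norm_cvg_strong (f_ : nat -> R -> R) f : (forall n, sq (f_ n)) -> sq f ->
  (forall n, nr (f_ n) <= nr f) -> {ae mu, forall x, f_ ^~ x @ \oo --> f x} ->
  nr (fun x => f_ n x - f x) @[n --> \oo] --> 0.
Proof.
move=> sf_ sf ff fcv; apply/cvgrPdist_le => e e0.
have [//|H] := pselect (\forall n \near \oo, `|0 - nr (fun x => f_ n x - f x)| <= e).
have {}H N : exists2 n, (N <= n)%N & e < nr (fun x => f_ n x - f x).
  apply: contrapT => H1; apply: H; exists N => // n /= Nn.
  rewrite sub0r normrN ger0_norm ?nr_ge0// leNgt; apply/negP => en.
  by apply: H1; exists n.
pose k N := sval (cid2 (H N)).
have kN N : (N <= k N)%N by rewrite /k; case: cid2.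
have ke N : e < nr (fun x => f_ (k N) x - f x) by rewrite /k; case: cid2.
have s2 n : sq (fun x => f_ n x + f x) by exact: sqD.
have [] := @fatou_bound _ (fun N x => (f_ (k N) x + f x) ^+ 2) (fun x => (2 * f x) ^+ 2)
  (4 * nr f ^+ 2 - e ^+ 2).
- by move=> n; exact: (s2 _).2.
- by move=> n x; exact: sqr_ge0.
- move=> n; have -> : I1 (fun x => (f_ (k n) x + f x) ^+ 2) = nr (fun x => f_ (k n) x + f x) ^+ 2.
    by rewrite nrE; congr I1; apply/funext => x; rewrite expr2.
  have : nr (fun x => f_ (k n) x + f x) ^+ 2 + nr (fun x => f_ (k n) x - f x) ^+ 2 =
     2 * nr (f_ (k n)) ^+ 2 + 2 * nr f ^+ 2.
    have sm : sq (fun x => f_ (k n) x - f x) by exact: sqB.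
    by rewrite !nrE ipBl// !ipBr// ipDl// !ipDr//; ring.
  have : nr (f_ (k n)) ^+ 2 <= nr f ^+ 2 by rewrite ler_sqr ?nnegrE ?nr_ge0.
  have : e ^+ 2 <= nr (fun x => f_ (k n) x - f x) ^+ 2.
    by rewrite ler_sqr ?nnegrE ?nr_ge0 ?(ltW e0)// ltW.
  lra.
- by apply: measurable_funX; apply: measurable_funM => //; case: sf.
- by move=> x; exact: sqr_ge0.
- apply: ae_imply fcv => x fx.
  have -> : (2 * f x) ^+ 2 = (f x + f x) ^+ 2 by ring.
  have fkx : f_ (k N) x @[N --> \oo] --> f x.
    apply: (cvg_comp k (f_ ^~ x)) fx => A [N _ NA]; exists N => // m /= Nm.
    by apply: NA => /=; exact: leq_trans (kN m).
  have : f_ (k N) x + f x @[N --> \oo] --> f x + f x by apply: cvgD => //; exact: cvg_cst.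
  by move=> hc; under eq_fun do rewrite expr2; rewrite expr2; exact: cvgM.
move=> _; have -> : I1 (fun x => (2 * f x) ^+ 2) = 4 * nr f ^+ 2.
  rewrite nrE /ip -I1Z; last exact: sq_int.
  by congr I1; apply/funext => x; ring.
have : 0 < e ^+ 2 by rewrite exprn_gt0.
lra.
Qed.

Lemma av_strong f : sq f -> nr (fun x => av (hn n) f x - f x) @[n --> \oo] --> 0.
Proof.
move=> sf; have n0 (n : nat) : 0 < hn n by rewrite invr_gt0.
apply: (@norm_cvg_strong (fun n => av (hn n) f)) => //.
- by move=> n; exact: sq_av.
- by move=> n; exact: nr_av.
- exact/av_ae/loc_sq.
Qed.

Definition H1r f df := [/\ sq f, sq df & AC f df].

Lemma AC_av h f : 0 < h -> loc f -> AC (av h f) (dq h f).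
Proof.
move=> h0 lf; split; first by apply: locZ; apply: locB => //; exact: loc_shift.
move=> a b ab; rewrite IIZ; last by apply: locB => //; exact: loc_shift.
rewrite IIB//; last exact: loc_shift.
rewrite II_shift// /av -mulrBr; congr (_ * _).
have e1 : II a (b + h) f = II a (a + h) f + II (a + h) (b + h) f.
  by apply: II_split => //; lra.
have e2 : II a (b + h) f = II a b f + II b (b + h) f.
  by apply: II_split => //; lra.
lra.
Qed.

Lemma sq_dq h f : sq f -> sq (dq h f).
Proof. by move=> sf; apply: sqZ; apply: sqB => //; exact: sq_shift. Qed.

Lemma H1_av h f : 0 < h -> sq f -> H1r (av h f) (dq h f).
Proof.
move=> h0 sf; split; [exact: sq_av|exact: sq_dq|exact/AC_av/loc_sq].
Qed.

End absolute_continuity.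

(** * Integration by parts, chain rule and Sobolev bound *)

Section calculus.
Context {R : realType}.
Implicit Types (f df g dg k dk : R -> R) (a b c h : R).

Local Notation hn := (@hn R).

Lemma ipE f : ip f f = I1 (fun x => f x ^+ 2).
Proof. by congr I1; apply/funext => x; rewrite expr2. Qed.

Lemma hn_gt0 n : 0 < hn n. Proof. by rewrite invr_gt0. Qed.

Lemma hn_le1 n : hn n <= 1. Proof. by rewrite invf_le1// ler1n. Qed.

Lemma hn_inv n : (hn n)^-1 = n.+1%:R. Proof. exact: invrK. Qed.

Lemma near_hn e : 0 < e -> \forall n \near \oo, hn n < e.
Proof.
move=> e0; have /cvgr0Pnorm_lt/(_ _ e0) := @cvg_harmonic R.
by apply: filterS => n; rewrite ger0_norm// ltW// hn_gt0.
Qed.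

Lemma nr_cvgP (f_ : nat -> R -> R) f : nr (fun x => f_ n x - f x) @[n --> \oo] --> 0 <->
  forall e, 0 < e -> \forall n \near \oo, nr (fun x => f_ n x - f x) <= e.
Proof.
split=> [/cvgrPdist_le H e e0|H].
  by apply: filterS (H e e0) => n; rewrite sub0r normrN ger0_norm ?nr_ge0.
by apply/cvgrPdist_le => e e0; apply: filterS (H e e0) => n nE;
  rewrite sub0r normrN ger0_norm ?nr_ge0.
Qed.

Lemma nr_tri f g k : sq f -> sq g -> sq k ->
  nr (fun x => f x - k x) <= nr (fun x => f x - g x) + nr (fun x => g x - k x).
Proof.
move=> sf sg sk.
rewrite (_ : (fun x => f x - k x) = fun x => (f x - g x) + (g x - k x)).
  by apply: nrD; exact: sqB.
by apply/funext => x; ring.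
Qed.

Lemma ip_cvg (f_ g_ : nat -> R -> R) f g : (forall n, sq (f_ n)) -> sq f ->
  (forall n, sq (g_ n)) -> sq g ->
  nr (fun x => f_ n x - f x) @[n --> \oo] --> 0 ->
  nr (fun x => g_ n x - g x) @[n --> \oo] --> 0 ->
  ip (f_ n) (g_ n) @[n --> \oo] --> ip f g.
Proof.
move=> sf_ sf sg_ sg fc gc.
apply/cvgrPdist_le => e e0.
have H : nr (fun x => f_ n x - f x) * nr (fun x => g_ n x - g x) +
   nr (fun x => f_ n x - f x) * nr g + nr f * nr (fun x => g_ n x - g x) @[n --> \oo] --> 0.
  rewrite [X in _ --> X](_ : _ = 0 * 0 + 0 * nr g + nr f * 0); last by ring.
  apply: cvgD; [apply: cvgD|]; apply: cvgM => //; exact: cvg_cst.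
move/cvgrPdist_le : H => /(_ _ e0); apply: filterS => n.
rewrite sub0r normrN => /(le_trans (ler_norm _)) nE; apply: le_trans nE.
have s1 : sq (fun x => f_ n x - f x) by exact: sqB.
have s2 : sq (fun x => g_ n x - g x) by exact: sqB.
have -> : ip f g - ip (f_ n) (g_ n) = - (ip (fun x => f_ n x - f x) (fun x => g_ n x - g x) +
   ip (fun x => f_ n x - f x) g + ip f (fun x => g_ n x - g x)).
  by rewrite !(ipBl (sf_ n) sf)// !(ipBr (sg_ n) sg)//; ring.
rewrite normrN; apply: le_trans (ler_normD _ _) _; apply: lerD; last exact: ipCS.
by apply: le_trans (ler_normD _ _) _; apply: lerD; exact: ipCS.
Qed.

Lemma cst_nr_cvg f : sq f -> nr (fun x => f x - f x) @[n --> \oo] --> 0.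
Proof.
move=> sf; have -> : (fun x => f x - f x) = fun x => 0 * f x.
  by apply/funext => x; ring.
by rewrite nrZ// normr0 mul0r; exact: cvg_cst.
Qed.

Lemma nr_dq h f df : 0 < h -> H1r f df -> nr (dq h f) <= nr df.
Proof.
by move=> h0 [sf sdf fdf]; rewrite (dq_av (ltW h0) fdf) nr_av.
Qed.

Lemma dq_strong f df : H1r f df ->
  nr (fun x => dq (hn n) f x - df x) @[n --> \oo] --> 0.
Proof.
move=> [sf sdf fdf]; under eq_fun do rewrite (dq_av (ltW (hn_gt0 _)) fdf).
exact: av_strong.
Qed.

(** An average of f moves Lipschitz-continuously under translation, its derivative [dq k f] being
    square integrable. Replacing f by such an average costs the same before and after the
    translation. *)
Lemma tau_strong f : sq f -> nr (fun x => f (x + hn n) - f x) @[n --> \oo] --> 0.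
Proof.
move=> sf; apply/(@nr_cvgP (fun n x => f (x + hn n))) => e e0.
have e3 : 0 < e / 3 by rewrite divr_gt0.
have [N _ /(_ N (leqnn N)) kE] := (nr_cvgP (fun n => av (hn n) f) f).1 (av_strong sf) _ e3.
set k := hn N in kE; have k0 : 0 < k := hn_gt0 N.
have [sa sda ada] := H1_av k0 sf.
set a := av k f in kE sa ada.
set C := nr (dq k f).
have C0 : 0 <= C := nr_ge0 _.
have C3 : 0 < e / 3 / (C + 1) by rewrite divr_gt0// ltr_wpDl.
apply: filterS (near_hn C3) => n nE.
have h0 := hn_gt0 n.
have s1 : sq (fun x => f (x + hn n)) := sq_shift _ sf.
have s2 : sq (fun x => a (x + hn n)) := sq_shift _ sa.
apply: (le_trans (nr_tri s1 s2 sf)).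
have -> : nr (fun x => f (x + hn n) - a (x + hn n)) = nr (fun x => a x - f x).
  by rewrite nrBC; exact: (nr_shift (hn n) (sqB sa sf)).
apply: le_trans (lerD kE (nr_tri s2 sa sf)) _.
have : nr (fun x => a (x + hn n) - a x) <= e / 3.
  have -> : (fun x => a (x + hn n) - a x) = fun x => hn n * dq (hn n) a x.
    by apply/funext => x; rewrite /dq mulVKf ?gt_eqF.
  rewrite nrZ; last exact: sq_dq.
  rewrite (gtr0_norm h0); apply: (@le_trans _ _ (hn n * C)).
    by rewrite ler_wpM2l ?(ltW h0)// (nr_dq h0 (H1_av k0 sf)).
  move: nE; rewrite ltr_pdivlMr ?ltr_wpDl// => nE.
  apply: le_trans (ltW nE); rewrite ler_wpM2l ?(ltW h0)//; lra.
lra.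
Qed.

(* The adjoint of the difference quotient, in a form that avoids negative steps. *)
Lemma ip_dq h f g : sq f -> sq g ->
  ip f (dq h g) = - ip (dq h f) (fun x => g (x + h)).
Proof.
move=> sf sg; have s1 := sq_shift h sf; have s2 := sq_shift h sg.
rewrite /dq ipZr//; last exact: sqB.
rewrite ipZl//; last exact: sqB.
rewrite (ipBr s2 sg sf) (ipBl s1 sf s2) (ip_shift h sf sg); ring.
Qed.

(** The limit of the discrete formula [ip_dq] along the steps [hn]: [dq_strong] handles the
    quotients and [tau_strong] the translate. *)
Lemma ibp f df g dg : H1r f df -> H1r g dg -> ip f dg = - ip df g.
Proof.
move=> hf hg; have [sf sdf _] := hf; have [sg sdg _] := hg.
have c1 : ip f (dq (hn n) g) @[n --> \oo] --> ip f dg.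
  apply: (@ip_cvg (fun=> f) (fun n => dq (hn n) g)) => //.
  - by move=> n; exact: sq_dq.
  - exact: cst_nr_cvg.
  - exact: dq_strong.
have c2 : ip f (dq (hn n) g) @[n --> \oo] --> - ip df g.
  under eq_fun do rewrite ip_dq//.
  apply: cvgN; apply: (@ip_cvg (fun n => dq (hn n) f) (fun n x => g (x + hn n))) => //.
  - by move=> n; exact: sq_dq.
  - by move=> n; exact: sq_shift.
  - exact: dq_strong.
  - exact: tau_strong.
by apply: cvg_unique c1 c2; exact: Rhausdorff.
Qed.

(** The function al is replaced by an average of itself, which lies in H1, so that [ibp] moves the
    derivative onto it. The resulting d depends on al, C and e only; this uniformity is what later
    lets the test function move in time. *)
Lemma weak_derivative_uniform al C e : sq al -> 0 <= C -> 0 < e ->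
  exists2 d : R, 0 < d & forall f df g dg, H1r f df -> H1r g dg -> nr df <= C -> nr dg <= C ->
    nr (fun x => f x - g x) <= d -> `|ip al df - ip al dg| <= e.
Proof.
move=> sal C0 e0.
set D := 2 * C + 1.
have D0 : 0 < D by rewrite ltr_wpDl// mulr_ge0.
have d2 : 0 < e / 2 / D by rewrite !divr_gt0.
have [N _ /(_ N (leqnn N)) kE] := (nr_cvgP (fun n => av (hn n) al) al).1 (av_strong sal) _ d2.
have Ha := H1_av (hn_gt0 N) sal; have [sa sda _] := Ha.
set a := av _ al in kE Ha sa; set da := dq _ al in Ha sda.
set E := nr da + 1.
have E0 : 0 < E by rewrite ltr_wpDl// nr_ge0.
exists (e / 2 / E); first by rewrite !divr_gt0.
move=> f df g dg hf hg fC gC nE; have [sf sdf _] := hf; have [sg sdg _] := hg.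
have -> : ip al df - ip al dg = - ip (fun x => a x - al x) (fun x => df x - dg x) -
   ip da (fun x => f x - g x).
  rewrite ipBl ?ipBr//; last exact: sqB.
  by rewrite (ibp Ha hf) (ibp Ha hg); ring.
apply: le_trans (ler_normB _ _) _; rewrite normrN.
rewrite (_ : e = e / 2 + e / 2); last by field.
apply: lerD.
  apply: le_trans (ipCS _ _) _; [exact: sqB|exact: sqB|].
  have : nr (fun x => df x - dg x) <= D.
    by apply: le_trans (nrB _ _) _ => //; rewrite /D; lra.
  move=> DD; rewrite -[leRHS](divfK (lt0r_neq0 D0)).
  by apply: ler_pM => //; exact: nr_ge0.
apply: le_trans (ipCS _ _) _ => //; first exact: sqB.
rewrite -[leRHS](divfK (lt0r_neq0 E0)) mulrC.
apply: ler_pM => //; [exact: nr_ge0|exact: nr_ge0|rewrite /E; lra].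
Qed.

Lemma weak_derivative_cvg (e_ de_ : nat -> R -> R) e de al C :
  (forall n, H1r (e_ n) (de_ n)) -> H1r e de -> (forall n, nr (de_ n) <= C) ->
  nr (fun x => e_ n x - e x) @[n --> \oo] --> 0 -> sq al ->
  ip al (de_ n) @[n --> \oo] --> ip al de.
Proof.
move=> he_ he deC ec sal.
set D := `|C| + nr de.
have D0 : 0 <= D by rewrite addr_ge0 ?nr_ge0.
apply/cvgrPdist_le => d d0.
have [r r0 rE] := weak_derivative_uniform sal D0 d0.
apply: filterS ((nr_cvgP _ _).1 ec _ r0) => n nE; rewrite distrC.
apply: rE (he_ n) he _ _ nE.
  by apply: le_trans (deC n) _; have := ler_norm C; have := nr_ge0 de; rewrite /D; lra.
by rewrite /D lerDr.
Qed.

Lemma AC_is_derive f df (x : R) : AC f df -> continuous df -> is_derive x 1 f (df x).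
Proof.
move=> [ldf fE] cdf.
have x1 : x < x + 1 by lra.
have x0 : x - 1 < x by lra.
have [dF dE] := continuous_FTC1_closed x1 (loc_itv (x - 1) (x + 1) ldf) x0 (cdf x).
set F := fun _ => _ in dF dE.
have FE : \forall y \near x, f (x - 1) + F y = f y.
  near=> y; rewrite /F -II_Rintegral -fE; first by ring.
  by apply: ltW; near: y; apply: lt_nbhsr; lra.
have : is_derive x 1 (fun y => f (x - 1) + F y) (df x).
  rewrite -[df x]add0r; apply: is_deriveD.
  by rewrite -dE derive1E; exact: DeriveDef.
by apply: near_eq_is_derive => //; rewrite oner_eq0.
Unshelve. all: by end_near. Qed.

Lemma AC_C1 f df : (forall x : R, is_derive x 1 f (df x)) -> continuous df -> AC f df.
Proof.
move=> fd cdf; split; first exact: loc_cont.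
move=> a b; rewrite le_eqVlt => /predU1P[->|ab].
  by rewrite subrr II_refl//; exact: loc_cont.
have cf : continuous f.
  by move=> x; apply/differentiable_continuous/derivable1_diffP.
rewrite II_Rintegral /Rintegral (@continuous_FTC2 _ df f)//=.
- exact: continuous_subspaceT.
- by split => //; [apply: cvg_at_right_filter; exact: cf|apply: cvg_at_left_filter; exact: cf].
- by move=> x _; rewrite derive1E derive_val.
Qed.

Lemma av_cvg f x : continuous f -> av (hn n) f x @[n --> \oo] --> f x.
Proof.
move=> cf; have lf := loc_cont cf; apply/cvgrPdist_le => e e0.
move/cvgrPdist_le : (cf x) => /(_ e e0)[d d0 /= dE].
apply: filterS (near_hn d0) => n nd; have h0 := hn_gt0 n.
have xh : x <= x + hn n by lra.
have lc : loc (fun=> f x) by apply: loc_cont; exact: cst_continuous.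
have -> : f x - av (hn n) f x = (hn n)^-1 * II x (x + hn n) (fun y => f x - f y).
  rewrite IIB// II_cst// [x + _ - x]addrAC subrr add0r mulrBr /av; congr (_ - _).
  by rewrite mulrCA mulVf ?mulr1// gt_eqF.
rewrite normrM gtr0_norm ?invr_gt0// mulrC ler_pdivrMr//.
apply: (le_trans (norm_II _ _ (locB lc lf))).
rewrite [leRHS](_ : _ = II x (x + hn n) (fun=> e)); last first.
  by rewrite II_cst// addrC addKr.
apply: le_II => //; first exact/loc_norm/locB.
  by apply: loc_cont; exact: cst_continuous.
move=> y /andP[xy yx]; apply: dE; rewrite /ball/= ltr_distlC; apply/andP; split; lra.
Qed.

Definition loc2 f := measurable_fun setT f /\ forall a b, sq (fun x => ind a b x * f x).

Lemma loc2_loc f : loc2 f -> loc f.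
Proof.
move=> [mf sf]; split => // a b.
have := sq_int (sq_ind a b) (sf a b).
by under eq_fun do rewrite mulrA ind_id.
Qed.

Lemma loc2_sq f : sq f -> loc2 f.
Proof.
move=> sf; split; first by case: sf.
move=> a b; apply: sq_bd sf; [exact: measurable_ind|exact: norm_ind].
Qed.

Lemma loc2_bd (m : R -> R) f : measurable_fun setT m ->
  (forall a b, exists C : R, forall x, a <= x <= b -> `|m x| <= C) -> loc2 f ->
  loc2 (fun x => m x * f x).
Proof.
move=> mm mC [mf sf]; split; first exact: measurable_funM.
move=> a b; have [C mE] := mC a b.
rewrite (_ : (fun x => _) = fun x => (ind a b x * m x) * (ind a b x * f x)); last first.
  by apply/funext => x; rewrite -[in LHS]ind_id; ring.
apply: (@sq_bd _ `|C|) (sf a b).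
  by apply: measurable_funM => //; exact: measurable_ind.
move=> x; rewrite indE; move: (mE x); case: (_ && _) => [/(_ isT) H|_].
  by rewrite mul1r (le_trans H)// ler_norm.
by rewrite mul0r normr0.
Qed.

Lemma cont_bd f a b : continuous f -> exists C : R, forall x, a <= x <= b -> `|f x| <= C.
Proof.
move=> cf.
have := continuous_compact (continuous_subspaceT cf) (@segment_compact R a b).
move=> /compact_bounded[M [Mr MK]]; exists (M + 1) => x xab.
by apply: (MK (M + 1)); [rewrite ltrDl|exists x => //=; rewrite in_itv].
Qed.

Lemma loc2_cont f : continuous f -> loc2 f.
Proof.
move=> cf; split; first exact: cont_measurable.
move=> a b.
have [C mE] := cont_bd a b cf.
under eq_fun => x do rewrite -ind_id -mulrA mulrC.
apply: (@sq_bd _ `|C|); last exact: sq_ind.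
  by apply: measurable_funM; [exact: measurable_ind|exact: cont_measurable].
move=> x; rewrite indE; move: (mE x); case: (_ && _) => [/(_ isT) H|_].
  by rewrite mul1r (le_trans H)// ler_norm.
by rewrite mul0r normr0.
Qed.

Lemma loc2D f g : loc2 f -> loc2 g -> loc2 (fun x => f x + g x).
Proof.
move=> [mf sf] [mg sg]; split; first exact: measurable_funD.
by move=> a b; under eq_fun do rewrite mulrDr; exact: sqD.
Qed.

Lemma loc2Z c f : loc2 f -> loc2 (fun x => c * f x).
Proof.
move=> [mf sf]; split; first exact: measurable_funM.
by move=> a b; under eq_fun do rewrite mulrCA; exact: sqZ.
Qed.

(** With a locally square-integrable derivative, the products in the chain rule pass to the limit
    through the L2 pairing ([ip_cvg]). *)
Definition AC2 f df := AC f df /\ loc2 df.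

Lemma AC2_cont f df : AC2 f df -> continuous f.
Proof. by case => /AC_cont. Qed.

Lemma AC2_H1 f df : H1r f df -> AC2 f df.
Proof. by move=> [_ sdf ?]; split => //; exact: loc2_sq. Qed.

Lemma AC2_C1 f df : (forall x : R, is_derive x 1 f (df x)) -> continuous df -> AC2 f df.
Proof. by move=> fd cdf; split; [exact: AC_C1|exact: loc2_cont]. Qed.

Lemma AC2D f df g dg : AC2 f df -> AC2 g dg ->
  AC2 (fun x => f x + g x) (fun x => df x + dg x).
Proof. by move=> [? ?] [? ?]; split; [exact: ACD|exact: loc2D]. Qed.

Lemma AC2Z c f df : AC2 f df -> AC2 (fun x => c * f x) (fun x => c * df x).
Proof. by move=> [? ?]; split; [exact: ACZ|exact: loc2Z]. Qed.

Lemma AC2_cst c : AC2 (fun=> c) (fun=> 0).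
Proof. by split; [exact: AC_cst|exact/loc2_sq/sq0]. Qed.

Lemma AC2_eq f df g dg : AC2 f df -> f = g -> df = dg -> AC2 g dg.
Proof. by move=> ? <- <-. Qed.

Lemma AC2B f df g dg : AC2 f df -> AC2 g dg ->
  AC2 (fun x => f x - g x) (fun x => df x - dg x).
Proof.
move=> hf /(AC2Z (-1)) hg; apply: AC2_eq (AC2D hf hg) _ _; apply/funext => x; ring.
Qed.

(* The averages of [f] are C1 and stay in the convex set where [k] is C1; the
   flag [s] says whether that set is the half-line or the whole line. *)
Lemma AC2_chain (s : bool) k dk f df : AC2 f df -> (forall x, s -> 0 <= f x) ->
  (forall y : R, (s -> 0 <= y) -> is_derive y 1 k (dk y)) ->
  (forall y, (s -> 0 <= y) -> {for y, continuous dk}) ->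
  AC2 (fun x => k (f x)) (fun x => dk (f x) * df x).
Proof.
move=> [fdf ldf] f0 kd cdk.
have cf := AC_cont fdf; have lf := loc_cont cf.
have cdkf : continuous (fun x => dk (f x)).
  by move=> x; apply: continuous_comp; [exact: cf|apply: cdk; exact: f0].
have l2 : loc2 (fun x => dk (f x) * df x).
  apply: loc2_bd => //; first exact: cont_measurable.
  by move=> a b; exact: cont_bd.
split => //; split; first exact: loc2_loc.
move=> a b ab.
pose fn n := av (hn n) f.
have h0 n := hn_gt0 n; have h0' n := ltW (hn_gt0 n).
have cfn n : continuous (fn n) := av_cont (h0' n) lf.
have fn0 n x : s -> 0 <= fn n x.
  move=> ss; rewrite mulr_ge0 ?invr_ge0// II_ge0// => y _; exact: f0.
have dfn n : AC (fn n) (dq (hn n) f) := AC_av (h0 n) lf.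
have cdq n : continuous (dq (hn n) f).
  move=> x; apply: cvgM; first exact: cvg_cst.
  by apply: cvgB; [exact: (AC_cont (ACshift _ fdf))|exact: cf].
have cdkfn n : continuous (fun x => dk (fn n x)).
  by move=> x; apply: continuous_comp; [exact: cfn|apply: cdk; exact: fn0].
have main n : k (fn n b) - k (fn n a) = II a b (fun x => dk (fn n x) * dq (hn n) f x).
  have [_ ->//] : AC (fun x => k (fn n x)) (fun x => dk (fn n x) * dq (hn n) f x).
  apply: AC_C1 => [x|x]; last by apply: cvgM; [exact: cdkfn|exact: cdq].
  have d1 := AC_is_derive x (dfn n) (cdq n).
  have d2 : is_derive (fn n x) 1 k (dk (fn n x)) by apply: kd; exact: fn0.
  exact: (@is_derive1_comp _ k (fn n) x _ _ d2 d1).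
have L : k (fn n b) - k (fn n a) @[n --> \oo] --> k (f b) - k (f a).
  have H x : k (fn n x) @[n --> \oo] --> k (f x).
    have ck : {for f x, continuous k}.
      by apply/differentiable_continuous/derivable1_diffP; have [] := kd _ (f0 x).
    exact: (cvg_comp _ _ (av_cvg cf) ck).
  exact: cvgB.
(* The steps are at most 1, so for x in [a, b] the averaging windows stay in [a, b + 1]: the
   averages of df and of its truncation g agree there, and g is square integrable on the line. *)
pose g x := ind a (b + 1) x * df x.
have sg : sq g by exact: ldf.2.
have [C CE] := cont_bd a (b + 1) cf.
have fnC n x : a <= x <= b -> `|fn n x| <= C.
  move=> /andP[ax xb]; rewrite /fn /av normrM gtr0_norm ?invr_gt0// mulrC ler_pdivrMr//.
  apply: (le_trans (norm_II _ _ lf)).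
  have -> : C * hn n = II x (x + hn n) (fun=> C).
    by rewrite II_cst ?lerDl// addrC addKr.
  apply: le_II; first exact: loc_norm.
    by apply: loc_cont; exact: cst_continuous.
  by move=> y /andP[xy yx]; apply: CE; have := hn_le1 n; have := h0 n; move=> ? ?; apply/andP; split; lra.
have [K KE] : exists K : R, forall y, (s -> 0 <= y) -> `|y| <= C -> `|dk y| <= K.
  pose J : set R := if s then `[0, C]%classic else `[- C, C]%classic.
  have JE y : (s -> 0 <= y) -> `|y| <= C -> J y.
    rewrite ler_norml /J => + /andP[y1 y2]; case: (s) => [/(_ isT) y0|_] /=;
      by rewrite in_itv/= ?y0 ?y1 y2.
  have cJ : compact J by rewrite /J; case: (s); exact: segment_compact.
  have wJ : {within J, continuous dk}.
    apply: continuous_in_subspaceT => y; rewrite inE => Jy; apply: cdk => ss.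
    by move: Jy; rewrite /J ss/= in_itv/= => /andP[].
  have /compact_bounded[M [Mr MK]] := continuous_compact wJ cJ.
  exists (M + 1) => y y0 yC; apply: (MK (M + 1)); first by rewrite ltrDl.
  by exists y => //; exact: JE.
pose A n x := ind a b x * dk (fn n x).
pose A0 x := ind a b x * dk (f x).
have mA n : measurable_fun setT (A n).
  by apply: measurable_funM; [exact: measurable_ind|exact: cont_measurable].
have mA0 : measurable_fun setT A0.
  by apply: measurable_funM; [exact: measurable_ind|exact: cont_measurable].
have sA n : sq (A n) by exact: (loc2_cont (cdkfn n)).2.
have sA0 : sq A0 by exact: (loc2_cont cdkf).2.
have dA n x : `|A n x - A0 x| <= 2 * K * ind a b x.
  rewrite /A /A0 -mulrBr indE; case: (boolP (_ && _)) => xab; last by rewrite !(mul0r,mulr0) normr0.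
  rewrite mul1r mulr1; apply: le_trans (ler_normB _ _) _.
  have e1 : `|dk (fn n x)| <= K by apply: KE; [exact: fn0|exact: fnC].
  have e2 : `|dk (f x)| <= K.
    apply: KE; first exact: f0.
    by apply: CE; move/andP: xab => [? ?]; apply/andP; split; lra.
  lra.
have cA : nr (fun x => A n x - A0 x) @[n --> \oo] --> 0.
  have [] := @dominated_cvg _ (fun n x => (A n x - A0 x) ^+ 2) (fun=> 0)
    (fun x => (2 * K) ^+ 2 * ind a b x).
  - by move=> n; apply: measurable_funX; exact: measurable_funB.
  - exact: measurable_cst.
  - apply: aeW => x; rewrite [X in _ --> X](_ : _ = (A0 x - A0 x) ^+ 2); last by rewrite subrr expr0n.
    have hh : A n x - A0 x @[n --> \oo] --> A0 x - A0 x.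
      apply: cvgB; last exact: cvg_cst.
      apply: cvgM; first exact: cvg_cst.
      exact: (cvg_comp _ _ (av_cvg cf) (cdk _ (f0 x))).
    by under eq_fun do rewrite expr2; rewrite expr2; exact: cvgM.
  - by apply: int1Z; exact: int1_ind.
  - move=> n x; rewrite ger0_norm ?sqr_ge0// -(ind_id a b x) -expr2 -exprMn.
    rewrite -(real_normK (num_real (A n x - A0 x))) ler_sqr ?nnegrE//.
    exact: le_trans (dA n x).
  move=> _ H; have -> : 0 = Num.sqrt (I1 (fun=> 0 : R)).
    by rewrite /I1 Rintegral_cst// mul0r sqrtr0.
  by under eq_fun do rewrite /nr ipE; exact: cvg_comp H (@sqrt_continuous R _).
have M : ip (A n) (av (hn n) g) @[n --> \oo] --> ip A0 g.
  by apply: ip_cvg => //; [move=> n; exact: sq_av|exact: av_strong].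
have E0 : ip A0 g = II a b (fun x => dk (f x) * df x).
  congr I1; apply/funext => x; rewrite /A0 /g.
  have -> : ind a b x * dk (f x) * (ind a (b + 1) x * df x) =
    (ind a b x * ind a (b + 1) x) * (dk (f x) * df x) by ring.
  congr (_ * _); rewrite !indE; case: (boolP (a <= x <= b)) => [/andP[ax xb]|_]; last by rewrite mul0r.
  by rewrite mul1r ax/= (_ : _ <= _)//; lra.
have En n : ip (A n) (av (hn n) g) = k (fn n b) - k (fn n a).
  rewrite main (dq_av (h0' n) fdf); congr I1; apply/funext => x.
  rewrite /A -mulrA indE; case: (boolP (_ && _)) => [/andP[ax xb]|_]; last by rewrite !mul0r.
  rewrite !mul1r; congr (_ * _); rewrite /av; congr (_ * _).
  apply: eq_II => y /andP[xy yx]; rewrite /g indE (_ : _ && _) ?mul1r//.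
  by have := hn_le1 n; move=> ?; apply/andP; split; lra.
have M' : ip (A n) (av (hn n) g) @[n --> \oo] --> k (f b) - k (f a).
  by under eq_fun do rewrite En.
by rewrite -E0; apply: cvg_unique M' M; exact: Rhausdorff.
Qed.

Lemma AC2_sqr f df : AC2 f df -> AC2 (fun x => f x ^+ 2) (fun x => 2 * f x * df x).
Proof.
move=> hf; apply: (@AC2_chain false (fun y => y ^+ 2) (fun y => 2 * y)) => //.
- move=> y _; have := is_deriveX 2 (is_derive_id y (1 : R)).
  rewrite scaler1 expr1; congr (is_derive _ _ _ _); exact/funext.
- by move=> y _; apply: cvgM; [exact: cvg_cst|exact: cvg_id].
Qed.

(** Polarisation of the chain rule for squares. *)
Lemma AC2M f df g dg : AC2 f df -> AC2 g dg ->
  AC2 (fun x => f x * g x) (fun x => df x * g x + f x * dg x).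
Proof.
move=> hf hg.
have := AC2Z (2^-1) (AC2B (AC2B (AC2_sqr (AC2D hf hg)) (AC2_sqr hf)) (AC2_sqr hg)).
by move=> h; apply: AC2_eq h _ _; apply/funext => x; field.
Qed.

Lemma H1M f df g dg C D : H1r f df -> AC2 g dg -> measurable_fun setT dg ->
  (forall x, `|g x| <= C) -> (forall x, `|dg x| <= D) ->
  H1r (fun x => g x * f x) (fun x => dg x * f x + g x * df x).
Proof.
move=> hf hg mdg gC gD; have [sf sdf _] := hf.
have mg : measurable_fun setT g := cont_measurable (AC2_cont hg).
split; last by case: (AC2M hg (AC2_H1 hf)).
- exact: sq_bd gC sf.
- by apply: sqD; [exact: sq_bd gD sf|exact: sq_bd gC sdf].
Qed.

(** Since 2 |f f'| <= f^2 + f'^2, the square of f changes by at most the integral of f^2 + f'^2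
    between any y and x; averaging over y in [x - 1, x] replaces the value at y by an integral. *)
Lemma H1_sup f df x : H1r f df -> f x ^+ 2 <= 2 * (nr f ^+ 2 + nr df ^+ 2).
Proof.
move=> hf; have [sf sdf _] := hf.
have [[lfd fE] _] := AC2_sqr (AC2_H1 hf).
have i2 : int1 (fun x => f x ^+ 2 + df x ^+ 2) by apply: int1D; [case: sf|case: sdf].
set E := nr f ^+ 2 + nr df ^+ 2.
have EE : I1 (fun x => f x ^+ 2 + df x ^+ 2) = E.
  rewrite I1D ?/E ?nrE; [|by case: sf|by case: sdf].
  by congr (_ + _); congr I1; apply/funext => y; rewrite expr2.
have H y : y <= x -> f x ^+ 2 - E <= f y ^+ 2.
  move=> yx; have := fE _ _ yx.
  have : II y x (fun x => 2 * f x * df x) <= E.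
    rewrite -EE; apply: (@le_trans _ _ (II y x (fun x => f x ^+ 2 + df x ^+ 2))).
      apply: le_II => //; [exact: loc_int1|move=> z _; rewrite -subr_ge0].
      by rewrite (_ : _ - _ = (f z - df z) ^+ 2) ?sqr_ge0//; ring.
    by apply: II_le_I1 => // z; rewrite addr_ge0 ?sqr_ge0.
  lra.
have lc c : loc (fun=> c : R) by apply: loc_cont; exact: cst_continuous.
have l2 : loc (fun x => f x ^+ 2) by apply: loc_int1; case: sf.
have x1 : x - 1 <= x by lra.
have : II (x - 1) x (fun=> f x ^+ 2 - E) <= II (x - 1) x (fun y => f y ^+ 2).
  by apply: le_II => // y /andP[_ ?]; exact: H.
rewrite II_cst// (_ : x - (x - 1) = 1) ?mulr1; last by ring.
have : II (x - 1) x (fun y => f y ^+ 2) <= I1 (fun y => f y ^+ 2).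
  by apply: II_le_I1 => [|y]; [case: sf|exact: sqr_ge0].
have -> : I1 (fun y => f y ^+ 2) = nr f ^+ 2.
  by rewrite nrE; congr I1; apply/funext => y; rewrite expr2.
have : 0 <= nr df ^+ 2 := sqr_ge0 _.
rewrite /E; lra.
Qed.

Lemma II_tail f (u : nat -> R) : int1 f -> (forall n, n%:R <= `|u n|) ->
  II (u n) (u n + 1) f @[n --> \oo] --> 0.
Proof.
move=> fi un; have [] := @dominated_cvg _ (fun n x => ind (u n) (u n + 1) x * f x) (fun=> 0) (fun x => `|f x|).
- by move=> n; apply: measurable_funM; [exact: measurable_ind|exact: int1_measurable].
- exact: measurable_cst.
- apply: aeW => x; apply: cvg_near_cst; near=> n.
  rewrite indE; case: (boolP (_ && _)) => [/andP[ux xu]|_]; last by rewrite mul0r.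
  have : `|x| + 2 < n%:R by near: n; exact: nbhs_infty_gtr.
  have e : `|(x : R) - u n| <= 1 by rewrite ger0_norm; lra.
  have := ler_normB (x : R) (x - u n); have := un n.
  rewrite (_ : (x : R) - (x - u n) = u n); last by ring.
  lra.
- exact: int1_norm.
- by move=> n x; rewrite normrM -[leRHS]mul1r ler_wpM2r//; exact: norm_ind.
by move=> _; rewrite /I1 Rintegral_cst// mul0r.
Unshelve. all: by end_near. Qed.

(** On the unit window to the right of a point, f at that point is the mean of f up to the integral
    of |df|. Both tend to 0 far out, so the boundary values at n and -n vanish in the limit. *)
Lemma I1_deriv f df : AC f df -> int1 f -> int1 df -> I1 df = 0.
Proof.
move=> [ldf fE] fi dfi; have lf := loc_int1 fi.
have end0 (u : nat -> R) : (forall n, n%:R <= `|u n|) -> f (u n) @[n --> \oo] --> 0.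
  move=> un; have t1 := II_tail fi un; have t2 := II_tail (int1_norm dfi) un.
  apply/cvgrPdist_le => e e0; have e2 : 0 < e / 2 by rewrite divr_gt0.
  move/cvgrPdist_le : t1 => /(_ _ e2); move/cvgrPdist_le : t2 => /(_ _ e2).
  apply: filterS2 => n; rewrite !sub0r !normrN => h1 h2.
  have u1 : u n <= u n + 1 by lra.
  have lc : loc (fun=> f (u n)) by apply: loc_cont; exact: cst_continuous.
  have E : f (u n) = II (u n) (u n + 1) f + II (u n) (u n + 1) (fun y => f (u n) - f y).
    by rewrite IIB// II_cst//; ring.
  rewrite E; apply: le_trans (ler_normD _ _) _.
  rewrite [leRHS](_ : _ = e / 2 + e / 2); last by field.
  apply: lerD => //; apply: le_trans h1; apply: le_trans (ler_norm _).
  apply: (le_trans (norm_II _ _ (locB lc lf))).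
  set J := II _ _ (fun x => `|df x|).
  rewrite -[leRHS]mulr1 [X in _ * X](_ : _ = (u n + 1) - u n); last by ring.
  rewrite -II_cst//; apply: le_II; first exact/loc_norm/locB.
    by apply: loc_cont; exact: cst_continuous.
  move=> y /andP[uy yu]; rewrite distrC fE//.
  apply: (le_trans (norm_II _ _ ldf)); rewrite /J (@II_split _ _ y (u n + 1)) ?uy//; last exact: loc_norm.
  by rewrite lerDl II_ge0.
have L := II_cvg dfi.
have M : II (- n%:R) n%:R df @[n --> \oo] --> (0 - 0 : R).
  rewrite (_ : (fun n : nat => _) = (fun n : nat => f n%:R - f (- n%:R))); last first.
    by apply/funext => n; rewrite fE// (@le_trans _ _ 0)// oppr_le0.
  by apply: cvgB; apply: end0 => n; rewrite ?normrN ger0_norm.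
by rewrite (cvg_unique _ L M) ?subrr//; exact: Rhausdorff.
Qed.

End calculus.

(** * Smooth functions and test functions *)

Section smooth_functions.
Context {R : realType}.
Implicit Types (f df g dg k dk : R -> R) (a b c h x y : R).

Lemma derD f g x (a b : R) : is_derive x (1 : R) f a -> is_derive x (1 : R) g b ->
  is_derive x (1 : R) (fun y => f y + g y) (a + b).
Proof. exact: is_deriveD. Qed.

Lemma derB f g x (a b : R) : is_derive x (1 : R) f a -> is_derive x (1 : R) g b ->
  is_derive x (1 : R) (fun y => f y - g y) (a - b).
Proof. exact: is_deriveB. Qed.

Lemma derN f x (a : R) : is_derive x (1 : R) f a ->
  is_derive x (1 : R) (fun y => - f y) (- a).
Proof. exact: is_deriveN. Qed.

Lemma derZ c f x (a : R) : is_derive x (1 : R) f a ->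
  is_derive x (1 : R) (fun y => c * f y) (c * a).
Proof. exact: is_deriveZ. Qed.

Lemma derM f g x (a b : R) : is_derive x (1 : R) f a -> is_derive x (1 : R) g b ->
  is_derive x (1 : R) (fun y => f y * g y) (a * g x + f x * b).
Proof.
move=> hf hg; have := is_deriveM hf hg; congr (is_derive _ _ _ _).
by rewrite addrC; congr (_ + _); exact: mulrC.
Qed.

Lemma der_cst c x : is_derive x (1 : R) (fun=> c) 0.
Proof. exact: is_derive_cst. Qed.

Lemma der_id x : is_derive x (1 : R) (fun y => y) 1.
Proof. exact: is_derive_id. Qed.

Lemma der_comp k f x (a b : R) : is_derive (f x) (1 : R) k b -> is_derive x (1 : R) f a ->
  is_derive x (1 : R) (fun y => k (f y)) (b * a).
Proof. by move=> hk hf; exact: (@is_derive1_comp _ k f x _ _ hk hf). Qed.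

Lemma der_affine c d x : is_derive x (1 : R) (fun y => c * y + d) c.
Proof.
have := derD (derZ c (der_id x)) (der_cst d x).
by rewrite mulr1 addr0.
Qed.

Lemma derV f x (a : R) : f x != 0 -> is_derive x (1 : R) f a ->
  is_derive x (1 : R) (fun y => (f y)^-1) (- a / f x ^+ 2).
Proof.
move=> fx hf; have := is_deriveV fx hf; congr (is_derive _ _ _ _).
by rewrite mulNr mulrC -mulNr.
Qed.

Lemma der_eq f x (a b : R) : is_derive x (1 : R) f a -> a = b -> is_derive x (1 : R) f b.
Proof. by move=> ? <-. Qed.

Lemma derX f x (a : R) n : is_derive x (1 : R) f a ->
  is_derive x (1 : R) (fun y => f y ^+ n) (n%:R * f x ^+ n.-1 * a).
Proof.
move=> hf; elim: n => [|n ih].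
  by rewrite !mul0r; under eq_fun do rewrite expr0; exact: der_cst.
under eq_fun do rewrite exprS; apply: der_eq (derM hf ih) _.
rewrite -natr1; case: n {ih} => [|n] /=; first by rewrite expr0; ring.
by rewrite exprS; ring.
Qed.

Lemma der_near f g x (a : R) : (\forall y \near x, f y = g y) ->
  is_derive x (1 : R) f a -> is_derive x (1 : R) g a.
Proof. by move=> fg; apply: near_eq_is_derive => //; exact: oner_neq0. Qed.

Lemma der_cont f df : (forall x, is_derive x (1 : R) f (df x)) -> continuous f.
Proof. by move=> fd x; apply/differentiable_continuous/derivable1_diffP. Qed.

Lemma der_derive1 f df : (forall x, is_derive x (1 : R) f (df x)) -> derive1 f = df.
Proof. by move=> fd; apply/funext => x; rewrite derive1E derive_val. Qed.

(* Coinductive smoothness: [f] lies in some class of functions stable under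
   differentiation. *)
Definition Cinf f := exists2 K : (R -> R) -> Prop, K f &
  forall g, K g -> exists2 dg, K dg & forall x, is_derive x (1 : R) g (dg x).

Lemma Cinf_der f : Cinf f -> exists2 df, Cinf df & forall x, is_derive x (1 : R) f (df x).
Proof.
by move=> [K Kf KE]; have [df Kdf fd] := KE _ Kf; exists df => //; exists K.
Qed.

Lemma Cinf_int f df : Cinf df -> (forall x, is_derive x (1 : R) f (df x)) -> Cinf f.
Proof.
move=> [K Kf KE] fd; exists (fun g => K g \/ g = f); first by right.
move=> g [/KE[dg Kdg gd]|->]; [exists dg => //|exists df => //]; by left.
Qed.

Lemma Cinf_comp f c d : Cinf f -> Cinf (fun x => f (c * x + d)).
Proof.
move=> [K Kf KE].
exists (fun g => exists e k, K k /\ g = fun x => e * k (c * x + d)).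
  by exists 1, f; split => //; apply/funext => x; rewrite mul1r.
move=> _ [e [k [Kk ->]]]; have [dk Kdk kd] := KE _ Kk.
exists (fun x => (e * c) * dk (c * x + d)); first by exists (e * c), dk.
move=> x; apply: der_eq (derZ e (der_comp (kd _) (der_affine c d x))) _; ring.
Qed.

Lemma CinfZ c f : Cinf f -> Cinf (fun x => c * f x).
Proof.
move=> [K Kf KE]; exists (fun g => exists2 k, K k & g = fun x => c * k x); first by exists f.
move=> _ [k Kk ->]; have [dk Kdk kd] := KE _ Kk.
by exists (fun x => c * dk x); [exists dk|move=> x; exact: derZ].
Qed.

Lemma CinfD f g : Cinf f -> Cinf g -> Cinf (fun x => f x + g x).
Proof.
move=> [K Kf KE] [L Lg LE].
exists (fun u : R -> R => exists k l, [/\ K k, L l & u = fun x => k x + l x]); first by exists f, g.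
move=> _ [k [l [Kk Ll ->]]]; have [dk Kdk kd] := KE _ Kk; have [dl Ldl ld] := LE _ Ll.
by exists (fun x => dk x + dl x); [exists dk, dl|move=> x; exact: derD].
Qed.

Lemma Cinf_cst c : Cinf (fun=> c).
Proof.
exists (fun g => exists d, g = fun=> d); first by exists c.
by move=> _ [d ->]; exists (fun=> 0); [exists 0|move=> x; exact: der_cst].
Qed.

(** Sums of products are closed under differentiation by Leibniz's rule, as a class witnessing
    [Cinf] must be. *)
Inductive prod_span (K L : (R -> R) -> Prop) : (R -> R) -> Prop :=
| prod_span1 k l : K k -> L l -> prod_span K L (fun x => k x * l x)
| prod_spanD f g : prod_span K L f -> prod_span K L g -> prod_span K L (fun x => f x + g x).

Lemma CinfM f g : Cinf f -> Cinf g -> Cinf (fun x => f x * g x).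
Proof.
move=> [K Kf KE] [L Lg LE]; exists (prod_span K L); first exact: prod_span1.
move=> u; elim=> [k l Kk Ll|k l _ [dk Kdk kd] _ [dl Ldl ld]].
  have [dk Kdk kd] := KE _ Kk; have [dl Ldl ld] := LE _ Ll.
  exists (fun x => dk x * l x + k x * dl x); last by move=> x; exact: derM.
  by apply: prod_spanD; exact: prod_span1.
by exists (fun x => dk x + dl x); [exact: prod_spanD|move=> x; exact: derD].
Qed.

Lemma Cinf_sum n (F : nat -> R -> R) : (forall i, Cinf (F i)) ->
  Cinf (fun x => \sum_(i < n) F i x).
Proof.
move=> FE; elim: n => [|n ih].
  by under eq_fun do rewrite big_ord0; exact: Cinf_cst.
by under eq_fun do rewrite big_ord_recr/=; exact: CinfD.
Qed.

Lemma Cinf_smooth f : Cinf f -> smooth f.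
Proof.
move=> [K Kf KE].
pose F (v : R) (g : R -> R) : R -> R := 'D_v g.
(* On the line, the derivative in direction v is v times the ordinary derivative, so every iterated
   directional derivative is a multiple of a member of K. *)
have H s : exists c g, K g /\ foldr F f s = fun x => c * g x.
  elim: s => [|v s [c [g [Kg E]]]].
    by exists 1, f; split => //; apply/funext => x; rewrite mul1r.
  rewrite [foldr _ _ _]/(F v (foldr F f s)) E /F.
  have [dg Kdg gd] := KE _ Kg; exists (v * c), dg; split => //; apply/funext => x.
  have gx := derZ c (gd x).
  have dx : differentiable (fun x => c * g x) x by apply/derivable1_diffP.
  rewrite deriveE// -[v in 'd _ _ v]mulr1 linearZ/= -mulrA; congr (_ * _).
  by rewrite -deriveE// derive_val.
move=> s x; have [c [g [Kg E]]] := H s; have [dg _ gd] := KE _ Kg.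
rewrite -/F E; by apply/derivable1_diffP; have [] := derZ c (gd x).
Qed.

(** The flat function exp(-1/x), extended by 0, times x^-n. Differentiation raises n by one and by
    two, so the span over all n is closed under it. *)
Definition bump_mon (n : nat) x := if 0 < x then x^-1 ^+ n * expR (- x^-1) else 0.

(** One term of the exponential series at 1/x beats the power of 1/x. The linear bound settles the
    derivative at 0: from the right, the difference quotient of [bump_mon n] there is
    [bump_mon n.+1], which tends to 0. *)
Lemma bump_mon_le n x : 0 <= bump_mon n x /\ (0 < x -> bump_mon n x <= n.+1`!%:R * x).
Proof.
rewrite /bump_mon; case: ifP => x0; last by [].
have xi : 0 <= x^-1 by rewrite invr_ge0 ltW.
split; first by rewrite mulr_ge0 ?exprn_ge0// expR_ge0.
move=> _; rewrite expRN ler_pdivrMr ?expR_gt0//.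
have := expR_ge1Dxn n xi.
set e := expR _ => H; have fp : 0 < n.+1`!%:R :> R by rewrite ltr0n fact_gt0.
have {}H : x^-1 ^+ n.+1 <= n.+1`!%:R * e.
  by rewrite mulrC -ler_pdivrMr//; apply: le_trans H; rewrite lerDr.
have -> : x^-1 ^+ n = x * x^-1 ^+ n.+1 by rewrite exprS mulrA mulfV ?mul1r// gt_eqF.
by rewrite mulrAC [leRHS]mulrC ler_pM2l.
Qed.

Lemma bump_mon_der n x : is_derive x (1 : R) (bump_mon n)
  (bump_mon n.+2 x - n%:R * bump_mon n.+1 x).
Proof.
have [x0|x0|x0] := ltgtP 0 x.
- have xn0 : x != 0 by rewrite gt_eqF.
  have h1 : is_derive x (1 : R) (fun y => y^-1) (- 1 / x ^+ 2) := derV xn0 (der_id x).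
  have h2 : is_derive x (1 : R) (fun y => y^-1 ^+ n) (n%:R * x^-1 ^+ n.-1 * (- 1 / x ^+ 2)).
    exact: derX.
  have h3 : is_derive x (1 : R) (fun y => expR (- y^-1)) (expR (- x^-1) * - (- 1 / x ^+ 2)).
    by apply: der_comp; exact: derN.
  have h4 := derM h2 h3.
  apply: (@der_near (fun y => y^-1 ^+ n * expR (- y^-1))).
    near=> y; rewrite /bump_mon ifT//; near: y; exact: lt_nbhsr.
  apply: der_eq h4 _; rewrite /bump_mon x0.
  have e2 : (x ^+ 2)^-1 = x^-1 ^+ 2 by rewrite exprVn.
  rewrite !mulNr mul1r opprK e2; case: n {h2} => [|n] /=; first by rewrite expr0; ring.
  by rewrite !exprS; ring.
- apply: (@der_near (fun=> 0)).
    near=> y; rewrite /bump_mon ifF//; apply/negbTE; rewrite -leNgt.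
    by apply: ltW; near: y; exact: lt_nbhsl.
  apply: der_eq (der_cst _ _) _.
  by rewrite /bump_mon ltNge (ltW x0)/= mulr0 subrr.
rewrite -x0 [X in is_derive _ _ _ X](_ : _ = 0); last first.
  by rewrite /bump_mon ltxx mulr0 subrr.
have H : (fun h => h^-1 *: (bump_mon n (h *: (1 : R) + 0) - bump_mon n 0)) @ 0^' --> (0 : R).
  apply/cvgr0Pnorm_le => e e0; near=> h.
  have h0 : h != 0 by near: h; exact: nbhs_dnbhs_neq.
  have be : bump_mon n 0 = 0 by rewrite /bump_mon ltxx.
  rewrite be subr0 addr0 -[_ *: 1]/(h * 1) mulr1 -[_ *: _]/(h^-1 * _).
  have [hp|hn] := ltP 0 h; last first.
    by rewrite /bump_mon ltNge hn/= mulr0 normr0 ltW.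
  have [_ /(_ hp)] := bump_mon_le n.+1 h; have [b0 _] := bump_mon_le n.+1 h.
  have -> : h^-1 * bump_mon n h = bump_mon n.+1 h by rewrite /bump_mon hp exprS mulrA.
  rewrite ger0_norm// => /le_trans; apply.
  have fp : 0 < n.+2`!%:R :> R by rewrite ltr0n fact_gt0.
  rewrite mulrC -ler_pdivlMr//.
  apply: le_trans (ler_norm _) _; near: h.
  by apply: dnbhs0_le; exact: divr_gt0.
by apply: DeriveDef; [apply/cvg_ex; exists 0|exact/cvg_lim].
Unshelve. all: by end_near. Qed.

Inductive bump_span : (R -> R) -> Prop :=
| bump_span1 n : bump_span (bump_mon n)
| bump_spanD c f g : bump_span f -> bump_span g -> bump_span (fun x => f x + c * g x).

Lemma Cinf_bump n : Cinf (bump_mon n).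
Proof.
exists bump_span; first exact: bump_span1.
move=> u; elim=> [m|c f g _ [df Kdf fd] _ [dg Kdg gd]].
  exists (fun x => bump_mon m.+2 x + (- m%:R) * bump_mon m.+1 x).
    by apply: bump_spanD; exact: bump_span1.
  by move=> x; apply: der_eq (bump_mon_der m x) _; rewrite mulNr.
exists (fun x => df x + c * dg x); first exact: bump_spanD.
by move=> x; apply: derD => //; exact: derZ.
Qed.

(* The normalised primitive of exp(-1/x) exp(-1/(1-x)). *)
Lemma smooth_step : exists (th dth : R -> R) (K : R),
  [/\ Cinf th, forall x, is_derive x (1 : R) th (dth x),
     forall x, x <= 0 -> th x = 0, forall x, 1 <= x -> th x = 1 &
     [/\ forall x, 0 <= th x <= 1, forall x, 0 <= dth x <= K,
      Cinf dth, forall x, x <= 0 -> dth x = 0 & forall x, 1 <= x -> dth x = 0]].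
Proof.
pose rho x := bump_mon 0 x * bump_mon 0 (1 - x).
have rC : Cinf rho.
  apply: CinfM (Cinf_bump 0) _.
  have := Cinf_comp (-1) 1 (Cinf_bump 0).
  by congr Cinf; apply/funext => x; congr bump_mon; ring.
have [drho _ rd] := Cinf_der rC.
have crho := der_cont rd; have lr := loc_cont crho.
have b1 x : 0 <= bump_mon 0 x <= 1.
  rewrite (proj1 (bump_mon_le 0 x))/= /bump_mon; case: ifP => // x0.
  by rewrite expr0 mul1r -expR0 ler_expR oppr_le0 invr_ge0 ltW.
have r0 x : 0 <= rho x by rewrite mulr_ge0//; case/andP: (b1 x); case/andP: (b1 (1 - x)).
have r1 x : rho x <= 1.
  have /andP[? ?] := b1 x; have /andP[? ?] := b1 (1 - x).
  by rewrite -[leRHS]mulr1 ler_pM.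
have rl x : x <= 0 -> rho x = 0.
  by move=> x0; rewrite /rho {1}/bump_mon ltNge x0 mul0r.
have rr x : 1 <= x -> rho x = 0.
  by move=> x1; rewrite /rho {2}/bump_mon ltNge subr_le0 x1 mulr0.
pose P := prim rho; have aP : AC P rho := AC_prim lr.
have Pd x : is_derive x (1 : R) P (rho x) := AC_is_derive x aP crho.
have P0 : P 0 = 0 by rewrite /P /prim lexx II_refl.
have Pl x : x <= 0 -> P x = 0.
  move=> x0; have := aP.2 _ _ x0; rewrite P0 (@eq_II _ _ _ _ (fun=> 0)) ?II_cst// ?mul0r; first lra.
  by move=> y /andP[_ y0]; exact: rl.
have Pr x : 1 <= x -> P x = P 1.
  move=> x1; have := aP.2 _ _ x1; rewrite (@eq_II _ _ _ _ (fun=> 0)) ?II_cst// ?mul0r; first lra.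
  by move=> y /andP[y1 _]; exact: rr.
have Pm x y : x <= y -> P x <= P y by exact: prim_le.
(* On [1/4, 3/4] both 1/x and 1/(1-x) are at most 4, so the integrand is at least exp(-4)^2. *)
have Z0 : 0 < P 1.
  have q1 : (4^-1 : R) <= 3 / 4 by lra.
  have : P (3 / 4) - P 4^-1 <= P 1.
    have : P (3 / 4) <= P 1 by apply: Pm; lra.
    have : P 0 <= P 4^-1 by apply: Pm; lra.
    lra.
  apply: lt_le_trans; rewrite aP.2//.
  apply: (@lt_le_trans _ _ (II 4^-1 (3 / 4) (fun=> expR (-4) * expR (-4)))).
    by rewrite II_cst// !mulr_gt0 ?expR_gt0//; lra.
  apply: le_II => //; first by apply: loc_cont; exact: cst_continuous.
  move=> y /andP[y1 y2].
  have yp : 0 < y by lra.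
  have zp : 0 < 1 - y by lra.
  rewrite /rho /bump_mon yp zp !expr0 !mul1r.
  have i1 : y^-1 <= 4 by rewrite -[leRHS]invrK lef_pV2 ?posrE//; lra.
  have i2 : (1 - y)^-1 <= 4 by rewrite -[leRHS]invrK lef_pV2 ?posrE//; lra.
  by apply: ler_pM; rewrite ?expR_ge0// ler_expR lerN2.
exists (fun x => (P 1)^-1 * P x), (fun x => (P 1)^-1 * rho x), (P 1)^-1.
have iZ : 0 <= (P 1)^-1 by rewrite invr_ge0 ltW.
split.
- by apply: CinfZ; exact: Cinf_int Pd.
- by move=> x; exact: derZ.
- by move=> x /Pl ->; rewrite mulr0.
- by move=> x /Pr ->; rewrite mulVf// gt_eqF.
split.
- move=> x; have p0 : 0 <= P x.
    by have [/Pl ->//|/ltW/Pm] := leP x 0; rewrite P0.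
  rewrite mulr_ge0//= mulrC ler_pdivrMr// mul1r.
  by have [/Pr ->//|/ltW/Pm] := leP 1 x.
- by move=> x; rewrite mulr_ge0//= -[leRHS]mulr1 ler_wpM2l.
- exact: CinfZ.
- by move=> x /rl ->; rewrite mulr0.
- by move=> x /rr ->; rewrite mulr0.
Qed.

Lemma Cinf_test f A : Cinf f -> (forall x, A < `|x| -> f x = 0) -> test_function f.
Proof.
move=> cf fA; split; first exact: Cinf_smooth.
apply: (@subclosed_compact _ _ `[- A, A]%classic); [exact: closed_closure|exact: segment_compact|].
rewrite closureE => x /(_ `[- A, A]%classic); apply; split; first exact: interval_closed.
move=> y /= /eqP fy; rewrite in_itv/= -ler_norml leNgt.
by apply/negP => /fA.
Qed.

End smooth_functions.

(** * Tensor products as spacetime test functions *)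

Section test_functions.
Context {R : realType}.
Implicit Types (f df g dg k dk l dl : R -> R) (a b c h x y : R).

Lemma is_diff_fst (z : R * R) : is_diff z (fst : R * R -> R) fst.
Proof.
have cf : continuous (fst : R * R -> R) by move=> w; exact: cvg_fst.
by apply: DiffDef; [exact: linear_differentiable|rewrite diff_lin].
Qed.

Lemma is_diff_snd (z : R * R) : is_diff z (snd : R * R -> R) snd.
Proof.
have cf : continuous (snd : R * R -> R) by move=> w; exact: cvg_snd.
by apply: DiffDef; [exact: linear_differentiable|rewrite diff_lin].
Qed.

Lemma is_diff_der k x (a : R) : is_derive x (1 : R) k a -> is_diff x k (fun v => v * a).
Proof.
move=> kd; have dk : differentiable k x by apply/derivable1_diffP.
apply: DiffDef => //; apply/funext => v.
rewrite -[v in LHS]mulr1 linearZ/=; congr (_ * _).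
by rewrite -deriveE// derive_val.
Qed.

Lemma tensor_diff k l (z : R * R) (a b : R) :
  is_derive z.1 (1 : R) k a -> is_derive z.2 (1 : R) l b ->
  is_diff z (fun w : R * R => k w.1 * l w.2)
    (fun v : R * R => v.1 * (a * l z.2) + v.2 * (k z.1 * b)).
Proof.
move=> /is_diff_der kd /is_diff_der ld.
have h1 := is_diff_comp (is_diff_fst z) kd.
have h2 := is_diff_comp (is_diff_snd z) ld.
apply: is_diff_eq (is_diffM h1 h2) _; apply/funext => v.
rewrite -[LHS]/(k z.1 * (v.2 * b) + l z.2 * (v.1 * a)); ring.
Qed.

(** A directional derivative of k(t) l(x) is a combination of k' l and k l'; linear combinations are
    included so that the class is closed under all directions of the plane. *)
Inductive tensor_span (K L : (R -> R) -> Prop) : (R * R -> R) -> Prop :=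
| tensor_span1 k l : K k -> L l -> tensor_span K L (fun z => k z.1 * l z.2)
| tensor_spanD (c d : R) (f g : R * R -> R) : tensor_span K L f -> tensor_span K L g ->
    tensor_span K L (fun z => c * f z + d * g z).

Lemma tensor_smooth k l : Cinf k -> Cinf l -> smooth (fun z : R * R => k z.1 * l z.2).
Proof.
move=> [K Kk KE] [L Ll LE].
have D (f : R * R -> R) : tensor_span K L f -> (forall z, differentiable f z) /\
    forall v : R * R, tensor_span K L ('D_v f).
  elim=> [k1 l1 Kk1 Ll1|c d f1 g1 _ [fd1 fs] _ [gd1 gs]].
    have [dk Kdk kd] := KE _ Kk1; have [dl Ldl ld] := LE _ Ll1.
    have H z := tensor_diff (kd z.1) (ld z.2).
    split=> [z|v]; first by case: (H z).
    have -> : 'D_v (fun z : R * R => k1 z.1 * l1 z.2) =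
       fun z => v.1 * (dk z.1 * l1 z.2) + v.2 * (k1 z.1 * dl z.2).
      apply/funext => z; rewrite deriveE; last by case: (H z).
      by rewrite diff_val.
    apply: (tensor_spanD _ _ (f := fun z => dk z.1 * l1 z.2) (g := fun z => k1 z.1 * dl z.2)).
      by apply: tensor_span1.
    by apply: tensor_span1.
  have dd z : is_diff z (fun w => c * f1 w + d * g1 w) (fun v => c * 'd f1 z v + d * 'd g1 z v).
    have h1 : is_diff z f1 ('d f1 z) by apply: DiffDef.
    have h2 : is_diff z g1 ('d g1 z) by apply: DiffDef.
    exact: is_diffD (is_diffZ c h1) (is_diffZ d h2).
  split=> [z|v]; first by case: (dd z).
  have -> : 'D_v (fun z => c * f1 z + d * g1 z) = fun z => c * 'D_v f1 z + d * 'D_v g1 z.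
    apply/funext => z; rewrite deriveE; last by case: (dd z).
    by rewrite diff_val !deriveE.
  exact: tensor_spanD.
pose F (v : R * R) (g : R * R -> R) : R * R -> R := 'D_v g.
move=> s z.
have H : tensor_span K L (foldr F (fun z : R * R => k z.1 * l z.2) s).
  elim: s => [|v s ih]; first exact: tensor_span1.
  exact: (D _ ih).2.
exact: (D _ H).1.
Qed.

Lemma tensor_test k l (A B : R) : Cinf k -> Cinf l ->
  (forall x, A < `|x| -> k x = 0) -> (forall x, B < `|x| -> l x = 0) ->
  test_function (fun z : R * R => k z.1 * l z.2).
Proof.
move=> ck cl kA lB; split; first exact: tensor_smooth.
have cAB : compact (`[- A, A]%classic `*` `[- B, B]%classic : set (R * R)).
  by apply: compact_setX; exact: segment_compact.
apply: (subclosed_compact _ cAB); first exact: closed_closure.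
rewrite closureE => z /(_ (`[- A, A]%classic `*` `[- B, B]%classic)); apply; split.
  exact: compact_closed.
move=> w /=; rewrite mulf_eq0 => /norP[/eqP kw /eqP lw].
by split; rewrite /= in_itv/= -ler_norml leNgt; apply/negP; [move=> /kA|move=> /lB].
Qed.

Lemma tensor_partial_t k dk l : Cinf k -> Cinf l -> (forall x, is_derive x (1 : R) k (dk x)) ->
  partial_t (fun z : R * R => k z.1 * l z.2) = fun z => dk z.1 * l z.2.
Proof.
move=> ck /Cinf_der[dl _ ld] kd; apply/funext => z.
have H := tensor_diff (kd z.1) (ld z.2).
rewrite /partial_t deriveE; last by case: H.
by rewrite diff_val/= mul1r mul0r addr0.
Qed.

Lemma tensor_partial_x k l dl : Cinf k -> Cinf l -> (forall x, is_derive x (1 : R) l (dl x)) ->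
  partial_x (fun z : R * R => k z.1 * l z.2) = fun z => k z.1 * dl z.2.
Proof.
move=> /Cinf_der[dk _ kd] cl ld; apply/funext => z.
have H := tensor_diff (kd z.1) (ld z.2).
rewrite /partial_x deriveE; last by case: H.
by rewrite diff_val/= mul1r mul0r add0r.
Qed.

End test_functions.

(** * Du Bois-Reymond's lemma and density of test functions *)

Section approximation.
Context {R : realType}.
Notation mu := (@lebesgue_measure R).
Local Notation hn := (@hn R).
Implicit Types (f df g dg phi dphi : R -> R) (a b c h x y : R).

(** A real weak derivative with an explicit support bound. It serves twice: in x, for the parts of
    [weak_derivative], and in t, for the pairings of the solution with a fixed test function. *)
Definition weakder f g := forall phi dphi A, Cinf phi ->
  (forall x, A < `|x| -> phi x = 0) -> (forall x, is_derive x (1 : R) phi (dphi x)) ->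
  I1 (fun x => f x * dphi x) = - I1 (fun x => g x * phi x).

Lemma II_mono a a' b' b f : loc f -> (forall x, 0 <= f x) -> a <= a' -> a' <= b' -> b' <= b ->
  II a' b' f <= II a b f.
Proof.
move=> lf f0 aa ab bb.
rewrite (@II_split _ a a' b) ?aa ?(le_trans ab)// (@II_split _ a' b' b) ?ab//.
have := @II_ge0 _ a a' _ (fun x _ => f0 x); have := @II_ge0 _ b' b _ (fun x _ => f0 x).
lra.
Qed.

Lemma II_inside a b f g : (forall x, ~~ (a <= x <= b) -> f x = 0) ->
  I1 (fun x => g x * f x) = II a b (fun x => g x * f x).
Proof.
move=> fab; congr I1; apply/funext => x; rewrite indE.
by case: (boolP (_ && _)) => [_|/fab ->]; rewrite ?mul1r ?mul0r ?mulr0.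
Qed.

Lemma lebesgue_pt_dist f a : lebesgue_pt f a -> lebesgue_pt (fun y => `|f y - f a|) a.
Proof.
rewrite /lebesgue_pt.
have -> : davg (fun y => `|f y - f a|) a = davg f a; last by [].
apply/funext => r; rewrite /davg /iavg; congr (_ * _)%E; apply: eq_integral => y _.
by rewrite /= subrr normr0 subr0 normr_id.
Qed.

(** The kernel has integral 1, lives on [a, a + hn n] and is at most K / hn n. The error is
    therefore at most K times the one-sided average of |f - f a|, which vanishes in the limit at a
    Lebesgue point. *)
Lemma approx_identity (dth : R -> R) K f a : loc f -> lebesgue_pt f a ->
  continuous dth -> (forall x, 0 <= dth x <= K) -> (forall x, x <= 0 -> dth x = 0) ->
  (forall x, 1 <= x -> dth x = 0) -> II 0 1 dth = 1 ->
  I1 (fun x => f x * ((hn n)^-1 * dth ((hn n)^-1 * x + (- ((hn n)^-1 * a))))) @[n --> \oo] --> f a.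
Proof.
move=> lf fa cd dK d0 d1 dI.
have K0 : 0 <= K by have /andP[? ?] := dK 0; lra.
pose k n x := (hn n)^-1 * dth ((hn n)^-1 * x + (- ((hn n)^-1 * a))).
have h0 n := @hn_gt0 R n.
have ck n : continuous (k n).
  move=> x; apply: cvgM; first exact: cvg_cst.
  apply: (continuous_comp (f := fun x => (hn n)^-1 * x + (- ((hn n)^-1 * a)))); last exact: cd.
  by apply: cvgD; [apply: cvgM; [exact: cvg_cst|exact: cvg_id]|exact: cvg_cst].
have kout n x : ~~ (a <= x <= a + hn n) -> k n x = 0.
  move=> H; rewrite /k.
  have -> : (hn n)^-1 * x + - ((hn n)^-1 * a) = (hn n)^-1 * (x - a) by ring.
  move: H; rewrite negb_and -!ltNge => /orP[xa|xa].
    by rewrite d0 ?mulr0// pmulr_rle0 ?invr_gt0// subr_le0 ltW.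
  rewrite d1 ?mulr0//; rewrite mulrC ler_pdivlMr// mul1r; lra.
have lc c : loc (fun=> c : R) by apply: loc_cont; exact: cst_continuous.
have kbd n x : `|k n x| <= (hn n)^-1 * K.
  rewrite normrM gtr0_norm ?invr_gt0// ler_pM2l ?invr_gt0//.
  by case/andP: (dK ((hn n)^-1 * x + - ((hn n)^-1 * a))) => ? ?; rewrite ger0_norm.
have mk n : measurable_fun setT (k n) by apply: cont_measurable.
have lk n : loc (k n) by exact: loc_cont.
pose P x := prim dth x.
have dP x : is_derive x (1 : R) P (dth x) := AC_is_derive x (AC_prim (loc_cont cd)) cd.
have k1 n : II a (a + hn n) (k n) = 1.
  have aP : AC (fun x => P ((hn n)^-1 * x + - ((hn n)^-1 * a))) (k n).
    apply: AC_C1 => // x; apply: der_eq (der_comp (dP _) (der_affine _ _ x)) _.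
    by rewrite mulrC.
  rewrite -aP.2; last by rewrite lerDl ltW.
  have -> : (hn n)^-1 * (a + hn n) + - ((hn n)^-1 * a) = 1.
    by rewrite mulrDr mulVf ?gt_eqF//; ring.
  have -> : (hn n)^-1 * a + - ((hn n)^-1 * a) = 0 by ring.
  by rewrite (AC_prim (loc_cont cd)).2// dI.
have lfa : loc (fun y => `|f y - f a|) by exact/loc_norm/locB.
have := av_lebesgue_pt lfa (lebesgue_pt_dist fa).
rewrite subrr normr0 => H.
have {}H : K * av (hn n) (fun y => `|f y - f a|) a @[n --> \oo] --> 0.
  by rewrite -[X in _ --> X](mulr0 K); apply: cvgM => //; exact: cvg_cst.
apply/cvgrPdist_le => e e0; move/cvgrPdist_le : H => /(_ e e0); apply: filterS => n.
rewrite sub0r normrN => /(le_trans (ler_norm _)); apply: le_trans.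
have E : f a - I1 (fun x => f x * k n x) = II a (a + hn n) (fun x => k n x * (f a - f x)).
  rewrite (@II_inside a (a + hn n))//; last exact: kout.
  rewrite -[X in X - _]mulr1 -(k1 n) -IIZ// -IIB//.
  - by apply: eq_II => x _; ring.
  - exact: locZ.
  - rewrite (_ : (fun x => _) = fun x => k n x * f x); last by apply/funext => x; rewrite mulrC.
    exact: loc_bdM (kbd n) lf.
rewrite [X in `|X|]E.
have lkf : loc (fun x => k n x * (f a - f x)).
  by apply: loc_bdM (kbd n) _ => //; exact: locB.
apply: (le_trans (norm_II _ _ lkf)).
rewrite /av mulrA [K * _]mulrC -IIZ//; apply: le_II; [exact: loc_norm|exact: locZ|].
move=> x _; rewrite normrM distrC ler_wpM2r//.
Qed.

Lemma weakder_pt f g a b : loc f -> loc g -> weakder f g ->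
  lebesgue_pt f a -> lebesgue_pt f b -> a <= b -> f b - f a = II a b g.
Proof.
move=> lf lg w fa fb; rewrite le_eqVlt => /predU1P[->|ab].
  by rewrite subrr II_refl.
have [th [dth [K [cth thd th0 th1 [th01 dK cdth d0 d1]]]]] := @smooth_step R.
have [ddth _ dthd] := Cinf_der cdth; have cd := der_cont dthd.
have K0 : 0 <= K by have /andP[? ?] := dK 0; lra.
have dI : II 0 1 dth = 1.
  by rewrite -(AC_C1 thd cd).2// th1// th0// subr0.
have Ca := approx_identity lf fa cd dK d0 d1 dI.
have Cb := approx_identity lf fb cd dK d0 d1 dI.
have h0 n := @hn_gt0 R n.
pose u n c x := (hn n)^-1 * x + (- ((hn n)^-1 * c)).
(* A smooth plateau: it rises within one step to the right of a and falls within one step to the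
   right of b, so that its derivative is a difference of two approximate identities. *)
pose phi n x := th (u n a x) - th (u n b x).
pose dphi n x := (hn n)^-1 * dth (u n a x) - (hn n)^-1 * dth (u n b x).
have uE n c x : u n c x = (hn n)^-1 * (x - c) by rewrite /u; ring.
have cu n c : Cinf (fun x => th (u n c x)) by exact: Cinf_comp.
have cphi n : Cinf (phi n).
  rewrite /phi (_ : (fun x => _) = fun x => th (u n a x) + (-1) * th (u n b x)).
    by apply: CinfD => //; exact: CinfZ.
  by apply/funext => x; ring.
have ud n c x : is_derive x (1 : R) (fun x => th (u n c x)) ((hn n)^-1 * dth (u n c x)).
  by apply: der_eq (der_comp (thd _) (der_affine _ _ x)) _; rewrite mulrC.
have phid n x : is_derive x (1 : R) (phi n) (dphi n x) by exact: derB.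
have u0 n c x : x <= c -> u n c x <= 0.
  by move=> xc; rewrite uE pmulr_rle0 ?invr_gt0// subr_le0.
have u1 n c x : c + hn n <= x -> 1 <= u n c x.
  by move=> xc; rewrite uE mulrC ler_pdivlMr// mul1r; lra.
have phiout n x : ~~ (a <= x <= b + 1) -> phi n x = 0.
  rewrite negb_and -!ltNge /phi => /orP[xa|xb].
    by rewrite !th0 ?subrr//; apply: u0; rewrite ?ltW// (lt_trans xa).
  by rewrite !th1 ?subrr//; apply: u1; have := @hn_le1 R n; lra.
have phi1 n x : `|phi n x| <= 1.
  by rewrite ler_norml /phi; have /andP[? ?] := th01 (u n a x);
    have /andP[? ?] := th01 (u n b x); apply/andP; split; lra.
have phiA n x : `|a| + `|b + 1| < `|x| -> phi n x = 0.
  move=> xA; apply: phiout; apply/negP => /andP[ax xb].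
  move: xA; rewrite ltNge => /negP; apply; rewrite ler_norml.
  have := ler_norm (b + 1); have := ler_norm (- a); rewrite normrN.
  have := normr_ge0 a; have := normr_ge0 (b + 1).
  by move=> *; apply/andP; split; lra.
have W n : I1 (fun x => f x * dphi n x) = - I1 (fun x => g x * phi n x).
  exact: w (cphi n) (phiA n) (phid n).
have L1 : I1 (fun x => f x * dphi n x) @[n --> \oo] --> f a - f b.
  rewrite (_ : (fun n => _) = fun n => I1 (fun x => f x * ((hn n)^-1 * dth (u n a x)))
     - I1 (fun x => f x * ((hn n)^-1 * dth (u n b x)))); first exact: cvgB.
  apply/funext => n.
  have Hi c : int1 (fun x => f x * ((hn n)^-1 * dth (u n c x))).
    have mk : measurable_fun setT (fun x => (hn n)^-1 * dth (u n c x)).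
      apply: cont_measurable => x; apply: cvgM; first exact: cvg_cst.
      apply: (continuous_comp (f := u n c)); last exact: cd.
      by apply: cvgD; [apply: cvgM; [exact: cvg_cst|exact: cvg_id]|exact: cvg_cst].
    have kK x : `|(hn n)^-1 * dth (u n c x)| <= (hn n)^-1 * K.
      rewrite normrM gtr0_norm ?invr_gt0// ler_pM2l ?invr_gt0//.
      by case/andP: (dK (u n c x)) => ? ?; rewrite ger0_norm.
    have := int1_bd mk kK (lf.2 c (c + 1)); congr int1; apply/funext => x.
    rewrite indE; case: (boolP (_ && _)) => [_|]; first by rewrite mul1r; ring.
    rewrite negb_and -!ltNge => /orP[xc|xc].
      by rewrite d0 ?u0// ?ltW//; ring.
    rewrite d1; first by ring.
    by apply: u1; have := @hn_le1 R n; lra.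
  by rewrite -I1B//; congr I1; apply/funext => x; rewrite /dphi; ring.
have L2 : I1 (fun x => g x * phi n x) @[n --> \oo] --> II a b g.
  have [] // := @dominated_cvg _ (fun n x => g x * phi n x) (fun x => ind a b x * g x)
    (fun x => `|ind a (b + 1) x * g x|).
  - by move=> n; apply: measurable_funM; [case: lg|apply: cont_measurable; exact: der_cont (phid n)].
  - by apply: measurable_funM; [exact: measurable_ind|case: lg].
  - apply: ae_imply (ae_neq a) => x xa; apply: cvg_near_cst; rewrite indE.
    have [xlt|ax] := ltP (x : R) a.
      by apply: nearW => n; rewrite mul0r phiout ?mulr0// negb_and -ltNge xlt.
    have ax' : 0 < (x : R) - a by rewrite subr_gt0 lt_neqAle eq_sym xa.
    have [xb|bx] := leP (x : R) b.
      apply: filterS (near_hn ax') => n nE.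
      by rewrite mul1r /phi th1 ?th0 ?subr0 ?mulr1 ?u0//; apply: u1; lra.
    have bx' : 0 < (x : R) - b by rewrite subr_gt0.
    apply: filterS (near_hn bx') => n nE.
    by rewrite mul0r /phi !th1 ?subrr ?mulr0//; apply: u1; lra.
  - exact: int1_norm (lg.2 _ _).
  - move=> n x; rewrite !normrM; case: (boolP (a <= x <= b + 1)) => xab.
      by rewrite indE xab normr1 mul1r -[leRHS]mulr1 ler_wpM2l.
    by rewrite phiout// normr0 mulr0 mulr_ge0.
have L3 : I1 (fun x => f x * dphi n x) @[n --> \oo] --> - II a b g.
  by under eq_fun do rewrite W; exact: cvgN.
have E : f a - f b = - II a b g by exact: (cvg_unique (@Rhausdorff R) L1 L3).
lra.
Qed.

Lemma ae_exists (P : R -> Prop) : {ae mu, forall x, P x} -> exists x, P x.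
Proof.
move=> [N [mN N0 sub]]; apply: contrapT => H.
have : `[0, 1]%classic `<=` N by move=> x _; apply: sub => /= Px; apply: H; exists x.
move=> /(le_measure mu); rewrite !inE => /(_ (measurable_itv _) mN).
move=> /le_trans/(_ (le_of_eq N0)).
have E : mu (`[0, 1]%classic : set R) = 1%:E.
  by rewrite lebesgue_measure_itv/= lte_fin ltr01 oppr0 adde0.
move=> h; have : (1%:E <= 0%:E :> \bar R)%E by rewrite -E; exact: h.
by rewrite lee_fin ler10.
Qed.

Lemma weakder_AC f g : loc f -> loc g -> weakder f g ->
  exists2 F, AC F g & {ae mu, forall x, f x = F x}.
Proof.
move=> lf lg w; have fL := lebesgue_differentiation ((locP f).2 lf).
(* A Lebesgue point of f fixes the additive constant of the primitive. *)
have [c fc] := ae_exists fL.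
have ap := AC_prim lg.
exists (fun x => prim g x + (f c - prim g c)).
  by have := ACD ap (AC_cst (f c - prim g c)); under [X in AC _ X]eq_fun do rewrite addr0.
apply: ae_imply fL => x fx; have [cx|xc] := leP c x.
  have := weakder_pt lf lg w fc fx cx; rewrite -ap.2//; lra.
have := weakder_pt lf lg w fx fc (ltW xc); rewrite -ap.2 ?(ltW xc)//; lra.
Qed.

(** Every point of a continuous function is a Lebesgue point, so f itself is absolutely continuous
    and not only almost everywhere equal to such a function. This is the version used in time. *)
Lemma weakder_cont f g : continuous f -> loc g -> weakder f g -> AC f g.
Proof.
move=> cf lg w; split => // a b ab.
have fL x : lebesgue_pt f x.
  apply: (@continuous_lebesgue_pt _ f x setT) => //; last exact: cf.
  - by split => //; exact: openT.
  - exact: cont_measurable.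
by apply: weakder_pt => //; exact: loc_cont.
Qed.

Lemma compact_support_sq f A : continuous f -> (forall x, A < `|x| -> f x = 0) -> sq f.
Proof.
move=> cf fA; have [_ /(_ (- A) A)] := loc2_cont cf; congr sq; apply/funext => x.
rewrite indE -ler_norml leNgt; case: (boolP (A < `|x|)) => [/fA ->|_]; first by rewrite mulr0.
by rewrite mul1r.
Qed.

Lemma der_compact_support f df A : (forall x, is_derive x (1 : R) f (df x)) ->
  (forall x, A < `|x| -> f x = 0) -> forall x, A < `|x| -> df x = 0.
Proof.
move=> fd fA x Ax.
have H : is_derive x (1 : R) f 0.
  apply: der_near (der_cst 0 x); near=> y; rewrite fA//.
  by near: y; apply: (cvgr_gt (`|x|)) => //; exact: norm_continuous.
by have [_ <-] := fd x; have [_ ->] := H.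
Unshelve. all: by end_near. Qed.

Lemma compact_support_H1 f df A : (forall x, is_derive x (1 : R) f (df x)) -> continuous df ->
  (forall x, A < `|x| -> f x = 0) -> H1r f df.
Proof.
move=> fd cdf fA; split; [exact: compact_support_sq (der_cont fd) fA| |exact: AC_C1].
exact: compact_support_sq cdf (der_compact_support fd fA).
Qed.

Lemma sum_step (F w : nat -> R) k J : (k < J)%N -> (forall j, (j < k)%N -> w j = 1) ->
  (forall j, (k < j)%N -> w j = 0) ->
  \sum_(j < J) (F j.+1 - F j) * w j = F k - F 0%N + (F k.+1 - F k) * w k.
Proof.
move=> kJ w1 w0; rewrite -(big_mkord xpredT (fun j => (F j.+1 - F j) * w j)).
rewrite (@big_cat_nat _ _ _ k.+1)//= big_nat_recr//= [X in _ + X]big1_seq ?addr0; last first.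
  by move=> j /=; rewrite mem_index_iota => /andP[kj _]; rewrite (w0 _ kj) mulr0.
congr (_ + _); rewrite (eq_big_nat _ _ (F2 := fun j => F j.+1 - F j)); last first.
  by move=> j /andP[_ jk]; rewrite w1// mulr1.
by rewrite telescope_sumr.
Qed.

Lemma sum_single (D w : nat -> R) k J : (k < J)%N -> (forall j, j != k -> w j = 0) ->
  \sum_(j < J) D j * w j = D k * w k.
Proof.
move=> kJ w0; rewrite (bigD1 (Ordinal kJ))//= big1 ?addr0// => j jk.
by rewrite w0 ?mulr0//; apply: contra jk => /eqP jk; apply/eqP/val_inj.
Qed.

Lemma der_sum n (F dF : nat -> R -> R) x :
  (forall i, is_derive x (1 : R) (F i) (dF i x)) ->
  is_derive x (1 : R) (fun y => \sum_(i < n) F i y) (\sum_(i < n) dF i x).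
Proof.
move=> Fd; elim: n => [|n ih].
  by under eq_fun do rewrite big_ord0; rewrite big_ord0; exact: der_cst.
under eq_fun do rewrite big_ord_recr/=; rewrite big_ord_recr/=; exact: derD.
Qed.

(* Quasi-interpolation of [f] on the grid of mesh 1/m between -m and m, each
   increment being spread over its cell by the smooth step. *)
Lemma quasi_interpolation (th dth : R -> R) K n f df :
  Cinf th -> (forall x, is_derive x (1 : R) th (dth x)) ->
  (forall x, x <= 0 -> th x = 0) -> (forall x, 1 <= x -> th x = 1) ->
  (forall x, 0 <= th x <= 1) -> (forall x, 0 <= dth x <= K) ->
  (forall x, x <= 0 -> dth x = 0) -> (forall x, 1 <= x -> dth x = 0) ->
  AC f df -> (forall x, n.+1%:R <= `|x| -> f x = 0) ->
  exists e de : R -> R, [/\ Cinf e, forall x, n.+1%:R < `|x| -> e x = 0,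
    forall x, is_derive x (1 : R) e (de x),
    forall x, `|e x - f x| <= 2 * II (x - hn n) (x + hn n) (fun y => `|df y|) &
    forall x, `|de x| <= K * (hn n)^-1 * II (x - hn n) (x + hn n) (fun y => `|df y|)].
Proof.
move=> cth thd th0 th1 th01 dK d0 d1 [ldf fE] fout.
set m := n.+1%:R : R; set h := hn n.
have h0 : 0 < h := hn_gt0 n.
have mE : m = h^-1 by rewrite /h hn_inv.
have m0 : 0 < m by rewrite ltr0n.
have mh : m * h = 1 by rewrite mE mulVf// gt_eqF.
(* The number of cells of length 1 / m in [-m, m], where m = n + 1, is 2 m^2. *)
pose J := (2 * n.+1 * n.+1)%N.
pose X (j : nat) := - m + j%:R * h.
have XJ : X J = m.
  rewrite /X /J !natrM -/m -mulrA mh; ring.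
have X0 : X 0%N = - m by rewrite /X mul0r addr0.
have XS j : X j.+1 = X j + h by rewrite /X -natr1; ring.
have Xm i j : (i <= j)%N -> X i <= X j.
  by move=> ij; rewrite /X lerD2l ler_pM2r// ler_nat.
pose F j := f (X j).
have F0 : F 0%N = 0 by rewrite /F X0; apply: fout; rewrite normrN (ger0_norm (ltW m0)).
have FJ : F J = 0 by rewrite /F XJ; apply: fout; rewrite (ger0_norm (ltW m0)).
pose u j x := m * x + - (m * X j).
have uE j x : u j x = m * (x - X j) by rewrite /u; ring.
have u0 j x : x <= X j -> u j x <= 0.
  by move=> xc; rewrite uE pmulr_rle0// subr_le0.
have u1 j x : X j.+1 <= x -> 1 <= u j x.
  by move=> xc; rewrite uE -mh ler_pM2l//; rewrite XS in xc; lra.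
pose e x := \sum_(j < J) (F j.+1 - F j) * th (u j x).
pose de x := \sum_(j < J) (F j.+1 - F j) * (m * dth (u j x)).
have ndf0 x : 0 <= `|df x| by [].
have lnd := loc_norm ldf.
have fdist x y : x <= y -> `|f y - f x| <= II x y (fun y => `|df y|).
  by move=> xy; rewrite fE// norm_II.
have eleft x : x <= - m -> e x = 0 /\ de x = 0.
  move=> xm; split; rewrite /e /de big1// => j _; rewrite ?th0 ?d0 ?mulr0//;
    by apply: u0; rewrite (le_trans xm)// -X0 Xm.
have eright x : m <= x -> e x = 0 /\ de x = 0.
  move=> xm; split; rewrite /e /de.
    rewrite (eq_bigr (fun j : 'I_J => F j.+1 - F j)); last first.
      by move=> j _; rewrite th1 ?mulr1//; apply: u1; rewrite (le_trans _ xm)// -XJ Xm.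
    rewrite -(big_mkord xpredT (fun j => F j.+1 - F j)) telescope_sumr//.
    by rewrite F0 FJ subrr.
  rewrite big1// => j _; rewrite d1 ?mulr0//.
  by apply: u1; rewrite (le_trans _ xm)// -XJ Xm.
(* At a point of cell k the cells to the left contribute their full increments, which telescope, and
   the cells to the right contribute nothing. *)
have mid x : - m < x -> x < m -> exists k, [/\ X k <= x, x <= X k.+1,
    e x = F k + (F k.+1 - F k) * th (u k x) & de x = (F k.+1 - F k) * (m * dth (u k x))].
  move=> x1 x2.
  have y0 : 0 <= m * (x + m) by rewrite mulr_ge0 ?(ltW m0)//; lra.
  pose k := Num.truncn (m * (x + m)).
  have /andP[k1 k2] := truncn_itv y0; rewrite -/k in k1 k2.
  have Xk : X k <= x.
    have : k%:R * h <= (m * (x + m)) * h by rewrite ler_pM2r.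
    have -> : m * (x + m) * h = (m * h) * (x + m) by ring.
    rewrite mh /X; lra.
  have Xk1 : x < X k.+1.
    have : (m * (x + m)) * h < k.+1%:R * h by rewrite ltr_pM2r.
    have -> : m * (x + m) * h = (m * h) * (x + m) by ring.
    rewrite mh /X; lra.
  have kJ : (k < J)%N.
    rewrite ltnNge; apply/negP => /Xm; rewrite XJ => mk.
    lra.
  exists k; split => //; first exact: ltW.
    rewrite /e (@sum_step F (fun j => th (u j x)) k)//.
    - by rewrite F0 subr0.
    - by move=> j jk; apply/th1/u1; rewrite (le_trans (Xm _ _ jk)).
    - by move=> j kj; apply/th0/u0; rewrite (le_trans (ltW Xk1))// Xm.
  rewrite /de (@sum_single (fun j => F j.+1 - F j) (fun j => m * dth (u j x)) k)// => j.
  rewrite neq_ltn => /orP[jk|kj].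
    by rewrite d1 ?mulr0//; apply/u1; rewrite (le_trans (Xm _ _ jk)).
  by rewrite d0 ?mulr0//; apply/u0; rewrite (le_trans (ltW Xk1))// Xm.
have out x : ~~ ((- m < x) && (x < m)) -> [/\ e x = 0, de x = 0 & f x = 0].
  rewrite negb_and -!leNgt => /orP[xm|xm].
    have [? ?] := eleft _ xm; split => //; apply: fout.
    by rewrite -normrN (le_trans _ (ler_norm _))//; rewrite /m in xm; lra.
  by have [? ?] := eright _ xm; split => //; apply: fout; rewrite (le_trans _ (ler_norm _)).
exists e, de; split.
- apply: (@Cinf_sum _ J (fun j x => (F j.+1 - F j) * th (u j x))) => j.
  by apply: CinfZ; exact: Cinf_comp.
- by move=> x mx; have [|-> //] := out x _; rewrite -ltr_norml -leNgt ltW.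
- move=> x; apply: (@der_sum J (fun j x => (F j.+1 - F j) * th (u j x))
    (fun j x => (F j.+1 - F j) * (m * dth (u j x)))) => j.
  apply: derZ; apply: der_eq (der_comp (thd _) (der_affine _ _ x)) _.
  by rewrite mulrC.
- move=> x; have II0 : 0 <= II (x - h) (x + h) (fun y => `|df y|) by apply: II_ge0.
  case: (boolP ((- m < x) && (x < m))) => [/andP[x1 x2]|/out[-> _ ->]]; last first.
    by rewrite subrr normr0 mulr_ge0.
  have [k [k1 k2 -> _]] := mid x x1 x2; rewrite XS in k2.
  have b1 : `|f x - F k| <= II (x - h) (x + h) (fun y => `|df y|).
    apply: le_trans (fdist _ _ k1) _; apply: II_mono => //; lra.
  have b2 : `|F k.+1 - F k| <= II (x - h) (x + h) (fun y => `|df y|).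
    have XX : X k <= X k.+1 by rewrite XS; lra.
    by apply: le_trans (fdist _ _ XX) _; apply: II_mono => //; rewrite ?XS; lra.
  have -> : F k + (F k.+1 - F k) * th (u k x) - f x =
    - (f x - F k) + (F k.+1 - F k) * th (u k x) by ring.
  apply: le_trans (ler_normD _ _) _; rewrite normrN.
  have : `|(F k.+1 - F k) * th (u k x)| <= `|F k.+1 - F k|.
    have /andP[t0 t1] := th01 (u k x).
    by rewrite normrM -[leRHS]mulr1 ler_wpM2l// ger0_norm.
  lra.
- move=> x; have II0 : 0 <= II (x - h) (x + h) (fun y => `|df y|) by apply: II_ge0.
  have K0 : 0 <= K by have /andP[? ?] := dK 0; lra.
  case: (boolP ((- m < x) && (x < m))) => [/andP[x1 x2]|/out[_ -> _]]; last first.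
    by rewrite normr0 !mulr_ge0// invr_ge0 ltW.
  have [k [k1 k2 _ ->]] := mid x x1 x2; rewrite XS in k2.
  have b2 : `|F k.+1 - F k| <= II (x - h) (x + h) (fun y => `|df y|).
    have XX : X k <= X k.+1 by rewrite XS; lra.
    by apply: le_trans (fdist _ _ XX) _; apply: II_mono => //; rewrite ?XS; lra.
  have /andP[t0 t1] := dK (u k x).
  rewrite normrM mulrC -mE; apply: ler_pM => //.
  by rewrite normrM !ger0_norm ?(ltW m0)// mulrC ler_wpM2r ?(ltW m0).
Qed.

(** The approximation is in L2 with bounded derivatives, since the derivative of a quasi-interpolant
    oscillates within each cell. [weak_derivative_cvg] upgrades this to weak convergence of the
    derivatives, which suffices for pairings. *)
Lemma H1_test_dense : exists2 K : R, 0 <= K & forall f df, H1r f df ->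
  exists e de : nat -> R -> R, [/\ forall n, Cinf (e n),
    forall n, exists A : R, forall x, A < `|x| -> e n x = 0,
    forall n x, is_derive x (1 : R) (e n) (de n x),
    forall n, nr (de n) <= K * (nr f + nr df) &
    nr (fun x => e n x - f x) @[n --> \oo] --> 0].
Proof.
have [th [dth [K [cth thd th0 th1 [th01 dK cdth d0 d1]]]]] := @smooth_step R.
have K0 : 0 <= K by have /andP[? ?] := dK 0; lra.
have [ddth _ dthd] := Cinf_der cdth; have cd := der_cont dthd.
(* The cutoff, whose derivative is at most 2 K, contributes 2 K + 1; the quasi-interpolation
   contributes K, twice because its window [x - h, x + h] has length 2 h. *)
exists (2 * K * (2 * K + 1)); first by rewrite !mulr_ge0// addr_ge0// mulr_ge0.
move=> f df hf; have [sf sdf fdf] := hf.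
(* A cutoff equal to 1 on [-n, n] and to 0 outside [-(n + 1), n + 1]. *)
pose p n x := th (1 * x + n.+1%:R) * th ((-1) * x + n.+1%:R).
pose dp n x := dth (1 * x + n.+1%:R) * th ((-1) * x + n.+1%:R)
  - th (1 * x + n.+1%:R) * dth ((-1) * x + n.+1%:R).
have pd n x : is_derive x (1 : R) (p n) (dp n x).
  have h1 := der_comp (thd _) (der_affine 1 (n.+1%:R) x).
  have h2 := der_comp (thd _) (der_affine (-1) (n.+1%:R) x).
  by apply: der_eq (derM h1 h2) _; rewrite /dp; ring.
have cp n : continuous (p n) := der_cont (pd n).
have cc (k : R -> R) c d : continuous k -> continuous (fun x => k (c * x + d)).
  move=> ck x; apply: (continuous_comp (f := fun x => c * x + d)); last exact: ck.
  by apply: cvgD; [apply: cvgM; [exact: cvg_cst|exact: cvg_id]|exact: cvg_cst].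
have cth' := der_cont thd.
have cdp n : continuous (dp n).
  move=> x; apply: cvgB; apply: cvgM; exact: (cc _ _ _ _ x).
have p01 n x : 0 <= p n x <= 1.
  rewrite /p; have /andP[? ?] := th01 (1 * x + n.+1%:R).
  have /andP[? ?] := th01 ((-1) * x + n.+1%:R).
  by rewrite mulr_ge0//= -[leRHS]mulr1 ler_pM.
have p1 n x : `|p n x| <= 1 by have /andP[? ?] := p01 n x; rewrite ger0_norm.
have dpK n x : `|dp n x| <= 2 * K.
  rewrite /dp; apply: le_trans (ler_normB _ _) _.
  have H y z : `|dth y * th z| <= K.
    have /andP[? ?] := dK y; have /andP[? ?] := th01 z.
    by rewrite ger0_norm ?mulr_ge0// -[leRHS]mulr1 ler_pM.
  have := H (1 * x + n.+1%:R) ((-1) * x + n.+1%:R).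
  have := H ((-1) * x + n.+1%:R) (1 * x + n.+1%:R).
  rewrite [X in `|X| <= _ -> _]mulrC; lra.
pose fn n x := p n x * f x.
pose dfn n x := dp n x * f x + p n x * df x.
have hfn n : H1r (fn n) (dfn n).
  apply: (@H1M _ _ _ _ _ 1 (2 * K)) => //; first exact: AC2_C1.
  exact: cont_measurable.
have fout n x : n.+1%:R <= `|x| -> fn n x = 0.
  move=> nx; rewrite /fn /p; have [x0|x0] := leP 0 x.
    by rewrite (th0 ((-1) * x + n.+1%:R)) ?mulr0 ?mul0r//; rewrite ger0_norm// in nx; lra.
  by rewrite (th0 (1 * x + n.+1%:R)) ?mul0r//; rewrite ltr0_norm// in nx; lra.
have Q n := quasi_interpolation cth thd th0 th1 th01 dK d0 d1
  (let: And3 _ _ h := hfn n in h) (fout n).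
pose e n := sval (cid (Q n)).
have Qe n : exists de : R -> R, [/\ Cinf (e n), forall x, n.+1%:R < `|x| -> e n x = 0,
    forall x, is_derive x (1 : R) (e n) (de x),
    forall x, `|e n x - fn n x| <= 2 * II (x - hn n) (x + hn n) (fun y => `|dfn n y|) &
    forall x, `|de x| <= K * (hn n)^-1 * II (x - hn n) (x + hn n) (fun y => `|dfn n y|)].
  by rewrite /e; case: cid.
pose de n := sval (cid (Qe n)).
have Qde n : [/\ Cinf (e n), forall x, n.+1%:R < `|x| -> e n x = 0,
    forall x, is_derive x (1 : R) (e n) (de n x),
    forall x, `|e n x - fn n x| <= 2 * II (x - hn n) (x + hn n) (fun y => `|dfn n y|) &
    forall x, `|de n x| <= K * (hn n)^-1 * II (x - hn n) (x + hn n) (fun y => `|dfn n y|)].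
  by rewrite /de; case: cid.
have h0 n := @hn_gt0 R n.
have sab n : sq (fun y => `|dfn n y|).
  have [_ sdfn _] := hfn n; apply: sq_le (sdfn); first by case: sdfn => ? _; exact: measurableT_comp.
  by move=> x; rewrite normr_id.
have nab n : nr (fun y => `|dfn n y|) = nr (dfn n).
  by rewrite /nr /ip; congr (Num.sqrt (I1 _)); apply/funext => x; rewrite -normrM ger0_norm// -expr2 sqr_ge0.
have dfnK n : nr (dfn n) <= (2 * K + 1) * (nr f + nr df).
  have s1 : sq (fun x => dp n x * f x).
    by apply: (sq_bd (C := 2 * K)) sf => //; exact: cont_measurable.
  have s2 : sq (fun x => p n x * df x).
    by apply: (sq_bd (C := 1)) sdf => //; exact: cont_measurable.
  apply: le_trans (nrD s1 s2) _.
  have : nr (fun x => dp n x * f x) <= 2 * K * nr f.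
    by apply: nr_bd => //; exact: cont_measurable.
  have : nr (fun x => p n x * df x) <= 1 * nr df.
    by apply: nr_bd => //; exact: cont_measurable.
  have := nr_ge0 f; have := nr_ge0 df; move=> a1 a2 a3 a4.
  have : 0 <= 2 * K * nr df by rewrite !mulr_ge0.
  rewrite mulrDl mulrDr; lra.
(* The centred window is the union of two one-sided ones, so that [nr_av] applies to each. *)
pose B n x := av (hn n) (fun y => `|dfn n y|) (x - hn n) + av (hn n) (fun y => `|dfn n y|) x.
have sB n : sq (B n).
  by apply: sqD; [apply: sq_shift|]; exact: sq_av.
have BE n x : II (x - hn n) (x + hn n) (fun y => `|dfn n y|) = hn n * B n x.
  rewrite (@II_split _ _ x); first last.
  - by have := h0 n => ?; apply/andP; split; lra.
  - by have := loc_sq (sab n).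
  rewrite /B /av mulrDr !mulVKf ?gt_eqF// subrK.
  by [].
have nB n : nr (B n) <= 2 * nr (dfn n).
  have sa : sq (av (hn n) (fun y => `|dfn n y|)) by exact: sq_av.
  apply: le_trans (nrD (sq_shift (- hn n) sa) sa) _.
  rewrite nr_shift//; have := nr_av (h0 n) (sab n); rewrite nab; lra.
have se n : sq (e n).
  have [_ es ed _ _] := Qde n.
  by apply: (compact_support_sq _ es); exact: der_cont ed.
have sde n : sq (de n).
  have [ce es ed _ _] := Qde n.
  have [dde cdde dded] := Cinf_der ce.
  have -> : de n = dde by rewrite -(der_derive1 ed) (der_derive1 dded).
  have [ddde _ ddded] := Cinf_der cdde.
  by apply: compact_support_sq (der_compact_support dded es); exact: der_cont ddded.
exists e, de; split.
- by move=> n; have [] := Qde n.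
- by move=> n; exists n.+1%:R; have [] := Qde n.
- by move=> n; have [] := Qde n.
- move=> n; have [_ _ _ _ bde] := Qde n.
  have : nr (de n) <= nr (fun x => K * B n x).
    apply: nr_le => //; first exact: sqZ.
    move=> x; apply: le_trans (bde x) _; rewrite BE mulrA -(mulrA K) mulVf ?gt_eqF// mulr1.
    exact: ler_norm.
  rewrite nrZ// ger0_norm// => /le_trans; apply.
  apply: (@le_trans _ _ (K * (2 * nr (dfn n)))); first by rewrite ler_wpM2l.
  apply: (@le_trans _ _ (K * (2 * ((2 * K + 1) * (nr f + nr df))))).
    by rewrite ler_wpM2l// ler_wpM2l.
  apply: le_of_eq; ring.
- have C1 : nr (fun x => fn n x - f x) @[n --> \oo] --> 0.
    apply: (@norm_cvg_strong _ fn f) => //; first by move=> n; have [] := hfn n.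
      move=> n; apply: le_trans (nr_bd _ (p1 n) sf) _; last by rewrite mul1r.
      exact: cont_measurable.
    apply: aeW => x; apply: cvg_near_cst.
    have := @nbhs_infty_gtr R `|x|; apply: filterS => n xn.
    have := xn; rewrite ltr_norml => /andP[y1 y2].
    have nn : n.+1%:R = n%:R + 1 :> R by rewrite -natr1.
    by rewrite /fn /p !th1 ?mul1r// nn; lra.
  set D := (2 * K + 1) * (nr f + nr df).
  have C2 : 4 * D * hn n + nr (fun x => fn n x - f x) @[n --> \oo] --> 0.
    rewrite [X in _ --> X](_ : _ = 4 * D * 0 + 0); last by ring.
    apply: cvgD => //; apply: cvgM; [exact: cvg_cst|exact: cvg_harmonic].
  apply: (squeeze_cvgr _ (cvg_cst 0) C2); apply: nearW => n.
  rewrite nr_ge0/=; have [_ _ _ be _] := Qde n; have [sfn _ _] := hfn n.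
  apply: le_trans (nr_tri (se n) sfn sf) _; rewrite lerD2r.
  have : nr (fun x => e n x - fn n x) <= nr (fun x => (2 * hn n) * B n x).
    apply: nr_le; [exact: sqB|exact: sqZ|move=> x].
    by apply: le_trans (be x) _; rewrite BE mulrA; exact: ler_norm.
  rewrite nrZ// ger0_norm ?mulr_ge0// ?(ltW (h0 n))// => /le_trans; apply.
  apply: (@le_trans _ _ (2 * hn n * (2 * D))).
    rewrite ler_wpM2l ?mulr_ge0 ?(ltW (h0 n))//; apply: le_trans (nB n) _.
    by rewrite ler_wpM2l.
  by apply: le_of_eq; ring.
Qed.

End approximation.

(** * The power nonlinearity *)

Section power_nonlinearity.
Context {R : realType}.
Local Notation hn := (@hn R).
Variable q : R.
Hypothesis q0 : 0 < q.
Implicit Types (f df g dg u du v dv : R -> R) (a b c h x y z w : R).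

(* With [q = (p - 1) / 2], [nl y z] is |y + i z|^(p-1). *)
Definition nl y z := (y ^+ 2 + z ^+ 2) `^ q.

(** The derivative of |y + i z|^(p-1) y in the direction (dy, dz). If q < 1 the power q - 1 is
    singular at the origin, but its cofactor is quadratic in (y, z) and vanishes there. *)
Definition dnl y z dy dz := nl y z * dy +
  2 * q * ((y ^+ 2 + z ^+ 2) `^ (q - 1) * (y * dy + z * dz) * y).

Lemma ssq_ge0 y z : 0 <= y ^+ 2 + z ^+ 2.
Proof. by rewrite addr_ge0 ?sqr_ge0. Qed.

Lemma nl_ge0 y z : 0 <= nl y z. Proof. exact: powR_ge0. Qed.

Lemma powR_hn_cvg (r s : R) : 0 <= s -> 0 < s \/ 0 < r ->
  (s + hn n) `^ r @[n --> \oo] --> s `^ r.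
Proof.
move=> s0 rs; have hc : hn n @[n --> \oo] --> (0 : R) by exact: cvg_harmonic.
have [sp|] := ltP 0 s.
  have c1 : s + hn n @[n --> \oo] --> s.
    by rewrite -[X in _ --> X]addr0; apply: cvgD => //; exact: cvg_cst.
  have [dr _] := is_derive1_powR r sp.
  have c2 : {for s, continuous (fun x : R => x `^ r)}.
    by apply/differentiable_continuous/derivable1_diffP.
  exact: cvg_comp c1 c2.
move=> sl; have -> : s = 0 by apply/eqP; rewrite eq_le sl s0.
have r0 : 0 < r by case: rs => // ?; lra.
under eq_fun do rewrite add0r; rewrite powR0 ?gt_eqF//.
have := powR_cvg0 r0 => /cvg_at_rightP; apply; split => //.
by move=> n; exact: hn_gt0.
Qed.

(** The shift c keeps the power q - 1 away from its singularity. The bound has the same constant for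
    all c, because |y^2| and |z y| are at most s and s^(q-1) s = s^q. *)
Lemma dnl_bound c y z dy dz : 0 <= c -> `|(y ^+ 2 + z ^+ 2 + c) `^ q * dy +
  2 * q * ((y ^+ 2 + z ^+ 2 + c) `^ (q - 1) * (y * dy + z * dz) * y)| <=
  (1 + 2 * q) * (y ^+ 2 + z ^+ 2 + c) `^ q * (`|dy| + `|dz|).
Proof.
move=> c0; set s := y ^+ 2 + z ^+ 2 + c; have s0 : 0 <= s by rewrite addr_ge0 ?ssq_ge0.
have y0 : `|y * y| <= s.
  by rewrite -expr2 ger0_norm ?sqr_ge0// /s -addrA lerDl addr_ge0// sqr_ge0.
have z0 : `|z * y| <= s.
  rewrite ler_norml /s; have := sqr_ge0 (y - z); have := sqr_ge0 (y + z).
  have := sqr_ge0 y; have := sqr_ge0 z; rewrite !expr2 => *; apply/andP; split; lra.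
have H : `|(y * dy + z * dz) * y| <= s * (`|dy| + `|dz|).
  have -> : (y * dy + z * dz) * y = (y * y) * dy + (z * y) * dz by ring.
  apply: le_trans (ler_normD _ _) _; rewrite mulrDr; apply: lerD;
    by rewrite normrM ler_wpM2r.
have pq := powR_ge0 s q; have pq1 := powR_ge0 s (q - 1).
have e : s `^ (q - 1) * s = s `^ q by rewrite mulrC mulr_powRB1.
apply: le_trans (ler_normD _ _) _.
have n1 : `|s `^ q * dy| <= s `^ q * (`|dy| + `|dz|).
  by rewrite normrM ger0_norm// ler_wpM2l// lerDl.
have n2 : `|2 * q * (s `^ (q - 1) * (y * dy + z * dz) * y)| <= 2 * q * (s `^ q * (`|dy| + `|dz|)).
  rewrite normrM ger0_norm ?mulr_ge0 ?(ltW q0)//; apply: ler_wpM2l; first by rewrite mulr_ge0 ?(ltW q0).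
  by rewrite -mulrA normrM ger0_norm// -e -mulrA ler_wpM2l.
lra.
Qed.

Lemma dnl_le y z dy dz : `|dnl y z dy dz| <= (1 + 2 * q) * nl y z * (`|dy| + `|dz|).
Proof. by have := @dnl_bound 0 y z dy dz (lexx 0); rewrite !addr0. Qed.

Lemma loc2_le f g : measurable_fun setT f ->
  (forall a b, exists C : R, forall x, a <= x <= b -> `|f x| <= C * `|g x|) -> loc2 g -> loc2 f.
Proof.
move=> mf fg [mg sg]; split => // a b; have [C CE] := fg a b.
apply: (@sq_le _ _ (fun x => C * (ind a b x * g x))); last exact: sqZ.
  by apply: measurable_funM => //; exact: measurable_ind.
move=> x; rewrite indE; case: (boolP (_ && _)) => [/CE H|_]; last by rewrite !mul0r !mulr0.
by rewrite !mul1r normrM; apply: le_trans H _; rewrite ler_wpM2r// ler_norm.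
Qed.

Lemma loc2_norm f : loc2 f -> loc2 (fun x => `|f x|).
Proof.
move=> lf; apply: loc2_le (lf); first by case: lf => ? _; exact: measurableT_comp.
by move=> a b; exists 1 => x _; rewrite normr_id mul1r.
Qed.

Lemma measurable_nl u v : measurable_fun setT u -> measurable_fun setT v ->
  measurable_fun setT (fun x => nl (u x) (v x)).
Proof.
move=> mu' mv; apply: (measurableT_comp (measurable_powR q)).
by apply: measurable_funD; exact: measurable_funX.
Qed.

Lemma measurable_dnl u du v dv : measurable_fun setT u -> measurable_fun setT v ->
  measurable_fun setT du -> measurable_fun setT dv ->
  measurable_fun setT (fun x => dnl (u x) (v x) (du x) (dv x)).
Proof.
move=> mu' mv mdu mdv; apply: measurable_funD.
  by apply: measurable_funM => //; exact: measurable_nl.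
apply: measurable_funM => //; apply: measurable_funM => //; apply: measurable_funM.
  apply: (measurableT_comp (measurable_powR (q - 1))).
  by apply: measurable_funD; exact: measurable_funX.
by apply: measurable_funD; exact: measurable_funM.
Qed.

(** For q < 1 the power s^q is not differentiable at s = 0, so the chain rule is applied to (s + hn
    n)^q; [dnl_bound] dominates the derivatives while the shift tends to zero. *)
Lemma AC2_nl u du v dv : AC2 u du -> AC2 v dv ->
  AC2 (fun x => nl (u x) (v x) * u x) (fun x => dnl (u x) (v x) (du x) (dv x)).
Proof.
move=> hu hv; have cu := AC2_cont hu; have cv := AC2_cont hv.
have [mdu mdv] : measurable_fun setT du /\ measurable_fun setT dv.
  by case: hu => _ [? _]; case: hv => _ [? _].
have mu' := cont_measurable cu; have mv := cont_measurable cv.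
pose s x := u x ^+ 2 + v x ^+ 2.
have hs : AC2 s (fun x => 2 * u x * du x + 2 * v x * dv x).
  by apply: AC2D; exact: AC2_sqr.
have s0 x : 0 <= s x := ssq_ge0 _ _.
pose G x : R := `|du x| + `|dv x|.
have lG : loc2 G by apply: loc2D; apply: loc2_norm; [case: hu|case: hv].
have G0 x : 0 <= G x by rewrite addr_ge0.
have nlb a b : exists2 C : R, 0 <= C & forall c x, 0 <= c -> c <= 1 -> a <= x <= b -> (s x + c) `^ q <= C.
  have [C CE] := cont_bd a b (AC2_cont hs).
  exists ((`|C| + 1) `^ q) => [|c x c0 c1 /CE H]; first exact: powR_ge0.
  apply: ge0_ler_powR; rewrite ?nnegrE; [exact: ltW|exact: addr_ge0 (s0 x) c0|by rewrite addr_ge0|].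
  by have := ler_norm C; have := ler_norm (s x); lra.
have lD : loc2 (fun x => dnl (u x) (v x) (du x) (dv x)).
  apply: (@loc2_le _ G) => //; first exact: measurable_dnl.
  move=> a b; have [C C0 CE] := nlb a b; exists ((1 + 2 * q) * C) => x xab.
  apply: le_trans (dnl_le _ _ _ _) _; rewrite (ger0_norm (G0 x)) ler_wpM2r//.
  rewrite ler_wpM2l ?addr_ge0 ?mulr_ge0 ?(ltW q0)//.
  by have := CE 0 x (lexx _) ler01 xab; rewrite addr0.
split => //; split; first exact: loc2_loc.
move=> a b ab.
pose D n x := (s x + hn n) `^ q * du x +
  2 * q * ((s x + hn n) `^ (q - 1) * (u x * du x + v x * dv x) * u x).
have hD n : AC2 (fun x => (s x + hn n) `^ q * u x) (D n).
  have h0 := @hn_gt0 R n.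
  have kd y : (true -> 0 <= y) -> is_derive y (1 : R) (fun y => (y + hn n) `^ q) (q * (y + hn n) `^ (q - 1)).
    move=> /(_ isT) y0; have yh : 0 < y + hn n by rewrite ltr_wpDl.
    have h1 : is_derive y (1 : R) (fun y => y + hn n) 1.
      by have := derD (der_id y) (der_cst (hn n) y); rewrite addr0.
    by have := @der_comp _ (fun z => z `^ q) (fun y => y + hn n) y _ _ (is_derive1_powR q yh) h1; rewrite mulr1.
  have ck y : (true -> 0 <= y) -> {for y, continuous (fun y => q * (y + hn n) `^ (q - 1))}.
    move=> /(_ isT) y0; have yh : 0 < y + hn n by rewrite ltr_wpDl.
    have h1 : is_derive y (1 : R) (fun y => y + hn n) 1.
      by have := derD (der_id y) (der_cst (hn n) y); rewrite addr0.
    have [] := derZ q (@der_comp _ (fun z => z `^ (q - 1)) (fun y => y + hn n) y _ _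
      (is_derive1_powR (q - 1) yh) h1).
    by move=> /derivable1_diffP/differentiable_continuous.
  have := AC2M (AC2_chain hs (fun x (_ : true) => s0 x) kd ck) hu.
  move=> h; apply: AC2_eq h _ _ => //; apply/funext => x; rewrite /D; ring.
have c1 x : (s x + hn n) `^ q * u x @[n --> \oo] --> nl (u x) (v x) * u x.
  by apply: cvgM; [apply: powR_hn_cvg => //; right|exact: cvg_cst].
have [C C0 CE] := nlb a b.
have c2 : II a b (D n) @[n --> \oo] --> II a b (fun x => dnl (u x) (v x) (du x) (dv x)).
  have [] // := @dominated_cvg _ (fun n x => ind a b x * D n x)
    (fun x => ind a b x * dnl (u x) (v x) (du x) (dv x))
    (fun x => (1 + 2 * q) * C * (ind a b x * G x)).
  - move=> n; apply: measurable_funM; first exact: measurable_ind.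
    by case: (hD n) => _ [].
  - by apply: measurable_funM; [exact: measurable_ind|case: lD].
  - apply: aeW => x; apply: cvgM; first exact: cvg_cst.
    rewrite /D /dnl; have [sx|sx] := ltP 0 (s x).
      apply: cvgD; first by apply: cvgM; [apply: powR_hn_cvg => //; right|exact: cvg_cst].
      apply: cvgM; first exact: cvg_cst.
      apply: cvgM; last exact: cvg_cst.
      by apply: cvgM; [apply: powR_hn_cvg => //; left|exact: cvg_cst].
    (* Where psi vanishes the regularised power q - 1 may blow up as the shift tends to zero; the
       factor u x = 0 removes it beforehand. *)
    have u0 : u x = 0.
      apply/eqP; rewrite -sqrf_eq0 eq_le sqr_ge0 andbT; apply: le_trans sx.
      by rewrite lerDl sqr_ge0.
    under eq_fun do rewrite u0 !mulr0 addr0.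
    rewrite u0 !mulr0 addr0; apply: cvgM; last exact: cvg_cst.
    by rewrite -u0; apply: powR_hn_cvg => //; right.
  - by apply: int1Z; case: (loc2_loc lG).
  - move=> n x; rewrite normrM (ger0_norm (proj1 (andP (ind01 a b x)))).
    rewrite mulrCA; rewrite indE; case: (boolP (_ && _)) => [xab|_]; last by rewrite !mul0r.
    rewrite !mul1r; have h0 := ltW (@hn_gt0 R n).
    apply: le_trans (dnl_bound _ _ _ _ h0) _; rewrite -/(s x) -/(G x) ler_wpM2r//.
    rewrite ler_wpM2l ?addr_ge0 ?mulr_ge0 ?(ltW q0)//.
    by apply: CE => //; exact: hn_le1.
have L : (s b + hn n) `^ q * u b - (s a + hn n) `^ q * u a @[n --> \oo] -->
    nl (u b) (v b) * u b - nl (u a) (v a) * u a by exact: cvgB.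
have {}c2 : (s b + hn n) `^ q * u b - (s a + hn n) `^ q * u a @[n --> \oo] -->
    II a b (fun x => dnl (u x) (v x) (du x) (dv x)).
  by move: c2; under eq_fun => n do rewrite -((hD n).1.2 _ _ ab).
exact: (cvg_unique (@Rhausdorff R) L c2).
Qed.

Lemma nl_le K y z : 0 <= K -> y ^+ 2 + z ^+ 2 <= K -> nl y z <= K `^ q.
Proof. by move=> K0 H; apply: ge0_ler_powR; rewrite ?nnegrE ?ssq_ge0 ?(ltW q0). Qed.

Lemma nlC y z : nl y z = nl z y. Proof. by rewrite /nl addrC. Qed.

(** The derivative [dnl] is integrated along the segment joining the two points, where the bound K
    on the squared modulus persists by convexity of the square. *)
Lemma nl_lip (K : R) y z y' z' : y ^+ 2 + z ^+ 2 <= K -> y' ^+ 2 + z' ^+ 2 <= K ->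
  `|nl y z * y - nl y' z' * y'| <= (1 + 2 * q) * K `^ q * (`|y - y'| + `|z - z'|).
Proof.
move=> H H'; have K0 : 0 <= K := le_trans (ssq_ge0 y z) H.
have aff c d : AC2 (fun t => c * t + d) (fun=> c).
  by apply: AC2_C1 => [x|]; [exact: der_affine|exact: cst_continuous].
have [[lD E] _] := AC2_nl (aff (y - y') y') (aff (z - z') z').
have /= := E 0 1 ler01.
rewrite !mulr0 !add0r !mulr1 !subrK => ->.
apply: le_trans (norm_II _ _ lD) _.
have lc c : loc (fun=> c : R) by apply: loc_cont; exact: cst_continuous.
rewrite -[leRHS]mulr1 -[X in _ * X]subr0 -II_cst//; apply: le_II => //; first exact: loc_norm.
move=> t /andP[t0 t1]; apply: le_trans (dnl_le _ _ _ _) _.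
rewrite ler_wpM2r ?addr_ge0// ler_wpM2l ?addr_ge0 ?mulr_ge0 ?(ltW q0)//.
apply: nl_le => //.
have Hc c c' : ((c - c') * t + c') ^+ 2 <= t * c ^+ 2 + (1 - t) * c' ^+ 2.
  rewrite -subr_ge0 (_ : _ - _ = t * (1 - t) * (c - c') ^+ 2); last by ring.
  by rewrite mulr_ge0 ?sqr_ge0// mulr_ge0// subr_ge0.
apply: le_trans (lerD (Hc y y') (Hc z z')) _.
have : t * (y ^+ 2 + z ^+ 2) <= t * K by rewrite ler_wpM2l.
have : (1 - t) * (y' ^+ 2 + z' ^+ 2) <= (1 - t) * K by rewrite ler_wpM2l// subr_ge0.
lra.
Qed.

(* |y + i z|^(p+1) *)
Definition sl y z := nl y z * (y ^+ 2 + z ^+ 2).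

Lemma sl_ge0 y z : 0 <= sl y z.
Proof. by rewrite mulr_ge0 ?nl_ge0// ssq_ge0. Qed.

Lemma AC2_sl u du v dv : AC2 u du -> AC2 v dv ->
  AC2 (fun x => sl (u x) (v x))
    (fun x => 2 * (q + 1) * (nl (u x) (v x) * (u x * du x + v x * dv x))).
Proof.
move=> hu hv; have h1 := AC2M (AC2_nl hu hv) hu; have h2 := AC2M (AC2_nl hv hu) hv.
apply: AC2_eq (AC2D h1 h2) _ _; apply/funext => x.
  by rewrite /sl (nlC (v x)); ring.
rewrite /dnl (nlC (v x)) (addrC (v x ^+ 2)).
set s := u x ^+ 2 + v x ^+ 2.
have e : s `^ (q - 1) * s = nl (u x) (v x) by rewrite mulrC mulr_powRB1 ?ssq_ge0.
rewrite -e; move: (s `^ (q - 1)) => A; rewrite /s; ring.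
Qed.

(* Young's inequality with exponents (p+1)/p and p+1 gives the convexity of |.|^(p+1). *)
Lemma sl_convex y z y' z' :
  2 * (q + 1) * (nl y z * (y * (y' - y) + z * (z' - z))) <= sl y' z' - sl y z.
Proof.
set s := y ^+ 2 + z ^+ 2; set s' := y' ^+ 2 + z' ^+ 2.
have s0 : 0 <= s := ssq_ge0 y z; have s'0 : 0 <= s' := ssq_ge0 y' z'.
pose a : R := Num.sqrt s; pose b : R := Num.sqrt s'.
have a0 : 0 <= a := sqrtr_ge0 _; have b0 : 0 <= b := sqrtr_ge0 _.
have cs : y * y' + z * z' <= a * b.
  have : (y * y' + z * z') ^+ 2 <= (a * b) ^+ 2.
    rewrite exprMn !sqr_sqrtr// -subr_ge0 /s /s'.
    by rewrite (_ : _ - _ = (y * z' - z * y') ^+ 2) ?sqr_ge0//; ring.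
  move=> H; apply: le_trans (ler_norm _) _.
  by rewrite -(@ler_pXn2r _ 2)// ?nnegrE ?mulr_ge0// real_normK ?num_real.
pose P : R := 2 * q + 1; have P0 : 0 < P by rewrite addr_gt0 ?mulr_gt0 ?q0.
have P10 : 0 < P + 1 by rewrite addr_gt0.
have sE : nl y z = a `^ (2 * q) by rewrite powRrM powR_mulrn// sqr_sqrtr.
have slE c d : sl c d = Num.sqrt (c ^+ 2 + d ^+ 2) `^ (P + 1).
  rewrite /sl /nl mulrC -[X in _ `^ X](addrK 1) mulr_powRB1 ?ssq_ge0//; last by rewrite addr_gt0.
  rewrite -[in LHS](sqr_sqrtr (ssq_ge0 c d)); set r := Num.sqrt _.
  rewrite -(@powR_mulrn _ r 2) ?sqrtr_ge0// -powRrM.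
  by congr (_ `^ _); rewrite /P; ring.
have X1 : nl y z * a = a `^ P.
  by rewrite sE mulrC -(mulr_powRB1 a0 P0) /P addrK.
have := @conjugate_powR R (a `^ P) b ((P + 1) / P) (P + 1) (powR_ge0 _ _) b0
  (divr_gt0 P10 P0) P10.
have -> : ((P + 1) / P)^-1 + (P + 1)^-1 = 1.
  by field; apply/andP; split; rewrite gt_eqF.
move=> /(_ erefl); rewrite -powRrM mulrCA mulfV ?gt_eqF// mulr1 -/(sl y z).
rewrite -[a `^ (P + 1)]/(Num.sqrt (y ^+ 2 + z ^+ 2) `^ (P + 1)) -slE.
rewrite -[b `^ (P + 1)]/(Num.sqrt (y' ^+ 2 + z' ^+ 2) `^ (P + 1)) -slE -X1.
have -> : sl y z / ((P + 1) / P) + sl y' z' / (P + 1) = (P * sl y z + sl y' z') / (P + 1).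
  by field; apply/andP; split; rewrite gt_eqF.
rewrite ler_pdivlMr// => Y.
have : nl y z * (y * y' + z * z') <= nl y z * (a * b) by rewrite ler_wpM2l ?nl_ge0.
move=> /(ler_wpM2r (ltW P10)).
have -> : 2 * (q + 1) * (nl y z * (y * (y' - y) + z * (z' - z))) =
  nl y z * (y * y' + z * z') * (P + 1) - (P + 1) * sl y z.
  by rewrite /P /sl; ring.
lra.
Qed.

End power_nonlinearity.

(** * Weak derivatives in time *)

Section weak_time_derivative.
Context {R : realType}.
Implicit Types (f df g dg al be : R -> R) (X Y dX dY F dF : R -> R -> R) (a b c h x s t e : R).

Definition n1 f df := nr f + nr df.

Lemma n1_ge0 f df : 0 <= n1 f df. Proof. by rewrite addr_ge0 ?nr_ge0. Qed.

Definition ctL2 X := (forall t, sq (X t)) /\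
  forall t e, 0 < e -> \forall s \near t, nr (fun x => X s x - X t x) <= e.

Lemma ctL2D X Y : ctL2 X -> ctL2 Y -> ctL2 (fun t x => X t x + Y t x).
Proof.
move=> [sX cX] [sY cY]; split=> [t|t e e0]; first exact: sqD.
have e2 : 0 < e / 2 by rewrite divr_gt0.
apply: filterS2 (cX t _ e2) (cY t _ e2) => s h1 h2.
rewrite (_ : (fun x => _) = fun x => (X s x - X t x) + (Y s x - Y t x)); last first.
  by apply/funext => x; ring.
apply: le_trans (nrD (sqB (sX s) (sX t)) (sqB (sY s) (sY t))) _; lra.
Qed.

Lemma ctL2_bd C (m : R -> R) X : measurable_fun setT m -> (forall x, `|m x| <= C) ->
  ctL2 X -> ctL2 (fun t x => m x * X t x).
Proof.
move=> mm mC [sX cX]; split=> [t|t e e0]; first exact: sq_bd mC (sX t).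
have C0 : 0 <= C := le_trans (normr_ge0 _) (mC 0).
have e2 : 0 < e / (C + 1) by rewrite divr_gt0// ltr_wpDl.
apply: filterS (cX t _ e2) => s h1.
rewrite (_ : (fun x => _) = fun x => m x * (X s x - X t x)); last first.
  by apply/funext => x; ring.
apply: le_trans (nr_bd mm mC (sqB (sX s) (sX t))) _.
apply: le_trans (ler_wpM2l C0 h1) _.
rewrite mulrA ler_pdivrMr ?ltr_wpDl// mulrC ler_wpM2l ?(ltW e0)//; lra.
Qed.

Lemma ctL2Z c X : ctL2 X -> ctL2 (fun t x => c * X t x).
Proof. by apply: (@ctL2_bd `|c| (fun=> c)) => //. Qed.

Lemma ctL2_shift h X : ctL2 X -> ctL2 (fun t x => X t (x + h)).
Proof.
move=> [sX cX]; split=> [t|t e e0]; first exact: sq_shift.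
apply: filterS (cX t _ e0) => s; rewrite -(nr_shift h)//; exact: sqB.
Qed.

Lemma ctL2B X Y : ctL2 X -> ctL2 Y -> ctL2 (fun t x => X t x - Y t x).
Proof.
move=> cX cY; have := ctL2D cX (ctL2Z (-1) cY); congr ctL2.
by apply/funext => t; apply/funext => x; ring.
Qed.

Lemma ctL2N X : ctL2 X -> ctL2 (fun t x => - X t x).
Proof.
move=> cX; have := ctL2Z (-1) cX; congr ctL2.
by apply/funext => t; apply/funext => x; ring.
Qed.

Lemma ctL2_dq h X : ctL2 X -> ctL2 (fun t => dq h (X t)).
Proof. by move=> cX; apply: ctL2Z; apply: ctL2B => //; exact: ctL2_shift. Qed.

Lemma ctL2_cst f : sq f -> ctL2 (fun=> f).
Proof.
move=> sf; split=> [//|t e e0]; near=> s.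
rewrite (_ : (fun x => _) = fun x => 0 * f x); last by apply/funext => x; ring.
by rewrite nrZ// normr0 mul0r ltW.
Unshelve. all: by end_near. Qed.

Lemma ctL2_nr X t : ctL2 X -> \forall s \near t, nr (X s) <= nr (X t) + 1.
Proof.
move=> [sX cX]; apply: filterS (cX t 1 ltr01) => s h.
have -> : X s = fun x => X t x + (X s x - X t x) by apply/funext => x; ring.
by apply: le_trans (nrD (sX t) (sqB (sX s) (sX t))) _; rewrite lerD2l.
Qed.

Lemma ctL2_ip X Y : ctL2 X -> ctL2 Y -> continuous (fun t => ip (X t) (Y t)).
Proof.
move=> cX cY t; have [sX hX] := cX; have [sY hY] := cY.
apply/cvgrPdist_le => e e0.
set A := nr (X t) + 1 + nr (Y t).
have A0 : 0 < A + 1 by rewrite ltr_wpDl// !addr_ge0 ?nr_ge0.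
have e2 : 0 < e / (A + 1) by rewrite divr_gt0.
apply: filterS3 (ctL2_nr t cX) (hX t _ e2) (hY t _ e2) => s h1 h2 h3.
have -> : ip (X t) (Y t) - ip (X s) (Y s) =
  - (ip (fun x => X s x - X t x) (Y t) + ip (X s) (fun x => Y s x - Y t x)).
  by rewrite ipBl// ipBr//; ring.
rewrite normrN; apply: le_trans (ler_normD _ _) _.
have k1 := ipCS (sqB (sX s) (sX t)) (sY t).
have k2 := ipCS (sX s) (sqB (sY s) (sY t)).
have k3 : nr (fun x => X s x - X t x) * nr (Y t) <= e / (A + 1) * nr (Y t).
  by rewrite ler_wpM2r ?nr_ge0.
have k4 : nr (X s) * nr (fun x => Y s x - Y t x) <= (nr (X t) + 1) * (e / (A + 1)).
  by apply: ler_pM => //; exact: nr_ge0.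
have k5 : e / (A + 1) * A <= e.
  by rewrite mulrAC ler_pdivrMr// ler_wpM2l ?(ltW e0)// lerDl.
have : e / (A + 1) * nr (Y t) + (nr (X t) + 1) * (e / (A + 1)) = e / (A + 1) * A.
  by rewrite /A; ring.
lra.
Qed.

(* [X] is differentiable at [t] as a functional on H1, with derivative
   [f => <al, f'> + <be, f>]. *)
Definition WD X al be t := forall e, 0 < e -> \forall s \near t, forall f df, H1r f df ->
  `|ip (X s) f - ip (X t) f - (s - t) * (ip al df + ip be f)| <= e * `|s - t| * n1 f df.

(** The gain is uniformity over f. For a test function l the remainder is the time integral of <al r
    - al t, l'> + <be r - be t, l>, hence small relative to the H1 norm of l; [H1_test_dense]
    carries the estimate to all of H1. *)
Lemma WD_of_tests X (al be : R -> R -> R) t : ctL2 X -> ctL2 al -> ctL2 be ->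
  (forall l dl, Cinf l -> H1r l dl -> (forall x, is_derive x (1 : R) l (dl x)) ->
    (exists A : R, forall x, A < `|x| -> l x = 0) ->
    AC (fun s => ip (X s) l) (fun s => ip (al s) dl + ip (be s) l)) ->
  WD X (al t) (be t) t.
Proof.
move=> cX cal cbe HX e e0; have [sX _] := cX.
have [sal hal] := cal; have [sbe hbe] := cbe.
have [K K0 dense] := @H1_test_dense R.
(* The approximants of f have H1 norm at most K + 1 times that of f in the limit; the divisor K + 2
   covers this loss. *)
have e2 : 0 < e / (K + 2) by rewrite divr_gt0// ltr_wpDl.
set e' := e / (K + 2) in e2.
have /nbhs_ballP[d /= d0 dE] := hal t _ e2; have /nbhs_ballP[d' /= d'0 dE'] := hbe t _ e2.
have test s l dl : `|s - t| < d -> `|s - t| < d' -> Cinf l -> H1r l dl ->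
   (forall x, is_derive x (1 : R) l (dl x)) ->
   (exists A : R, forall x, A < `|x| -> l x = 0) ->
  `|ip (X s) l - ip (X t) l - (s - t) * (ip (al t) dl + ip (be t) l)| <= e' * `|s - t| * n1 l dl.
  move=> sd sd' cl hl ld lA; have [sl sdl _] := hl.
  have [lc HE] := HX l dl cl hl ld lA.
  have cst0 c : loc (fun=> c : R) by apply: loc_cont; exact: cst_continuous.
  have key r : `|r - t| <= `|s - t| -> `|ip (al r) dl + ip (be r) l - (ip (al t) dl + ip (be t) l)| <= e' * n1 l dl.
    move=> rs.
    have -> : ip (al r) dl + ip (be r) l - (ip (al t) dl + ip (be t) l) =
      ip (fun x => al r x - al t x) dl + ip (fun x => be r x - be t x) l.
      by rewrite !ipBl//; ring.
    apply: le_trans (ler_normD _ _) _; rewrite /n1 mulrDr addrC; apply: lerD.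
      apply: le_trans (ipCS (sqB (sbe r) (sbe t)) sl) _; rewrite ler_wpM2r ?nr_ge0//.
      by apply: dE'; rewrite /ball/= distrC (le_lt_trans rs).
    apply: le_trans (ipCS (sqB (sal r) (sal t)) sdl) _; rewrite ler_wpM2r ?nr_ge0//.
    by apply: dE; rewrite /ball/= distrC (le_lt_trans rs).
  have fin r1 r2 : r1 <= r2 -> (forall r, r1 <= r <= r2 -> `|r - t| <= `|s - t|) ->
      `|ip (X r2) l - ip (X r1) l - (r2 - r1) * (ip (al t) dl + ip (be t) l)| <=
      e' * n1 l dl * (r2 - r1).
    move=> r12 rr; rewrite HE// [(r2 - r1) * _]mulrC -II_cst// -IIB//.
    apply: le_trans (norm_II _ _ (locB lc (cst0 _))) _.
    rewrite -II_cst//; apply: le_II => //; first by apply: loc_norm; exact: locB.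
    by move=> r /rr; exact: key.
  have [ts|st] := leP t s.
    have := fin _ _ ts; rewrite (ger0_norm (_ : 0 <= s - t)) ?subr_ge0// => H.
    rewrite mulrAC; apply: H => r /andP[tr rs].
    by rewrite ger0_norm ?subr_ge0// lerD2r.
  have := fin _ _ (ltW st); rewrite (ltr0_norm (_ : s - t < 0)) ?subr_lt0// opprB => H.
  rewrite mulrAC -normrN.
  have -> : - (ip (X s) l - ip (X t) l - (s - t) * (ip (al t) dl + ip (be t) l)) =
    ip (X t) l - ip (X s) l - (t - s) * (ip (al t) dl + ip (be t) l) by ring.
  apply: H => r /andP[tr rs].
  by rewrite distrC ger0_norm ?subr_ge0// lerD2l lerN2.
have h1 : \forall s \near t, `|s - t| < d.
  by apply/nbhs_ballP; exists d => //= s; rewrite /ball/= distrC.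
have h2 : \forall s \near t, `|s - t| < d'.
  by apply/nbhs_ballP; exists d' => //= s; rewrite /ball/= distrC.
apply: filterS2 h1 h2 => s sd sd' f df hf; have [sf sdf _] := hf.
have [en [den [ce esup ed deK ecv]]] := dense f df hf.
have hen n : H1r (en n) (den n).
  have [A eA] := esup n; have [dde cdde dded] := Cinf_der (ce n).
  have -> : den n = dde by rewrite -(der_derive1 (ed n)) (der_derive1 dded).
  have [ddde _ ddded] := Cinf_der cdde.
  exact: compact_support_H1 dded (der_cont ddded) eA.
have sen n : sq (en n) by have [] := hen n.
have c1 : ip (X s) (en n) - ip (X t) (en n) -
    (s - t) * (ip (al t) (den n) + ip (be t) (en n)) @[n --> \oo] -->
    ip (X s) f - ip (X t) f - (s - t) * (ip (al t) df + ip (be t) f).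
  have H g : sq g -> ip g (en n) @[n --> \oo] --> ip g f.
    by move=> sg; apply: (@ip_cvg _ (fun=> g)) => //; exact: cst_nr_cvg.
  apply: cvgB; first by apply: cvgB; exact: H.
  apply: cvgM; first exact: cvg_cst.
  apply: cvgD; last exact: H.
  exact: weak_derivative_cvg hen hf deK ecv (sal t).
have c2 : e' * `|s - t| * (nr (fun x => en n x - f x) + nr f + K * n1 f df) @[n --> \oo] -->
    e' * `|s - t| * (0 + nr f + K * n1 f df).
  apply: cvgM; first exact: cvg_cst.
  by apply: cvgD; [apply: cvgD => //|]; exact: cvg_cst.
have le : forall n, `|ip (X s) (en n) - ip (X t) (en n) -
    (s - t) * (ip (al t) (den n) + ip (be t) (en n))| <=
    e' * `|s - t| * (nr (fun x => en n x - f x) + nr f + K * n1 f df).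
  move=> n; apply: le_trans (test s (en n) (den n) sd sd' (ce n) (hen n) (ed n) (esup n)) _.
  apply: ler_wpM2l; first by rewrite mulr_ge0 ?(ltW e2).
  apply: lerD; last exact: deK.
  have -> : en n = fun x => (en n x - f x) + f x by apply/funext => x; ring.
  apply: le_trans (nrD (sqB (sen n) sf) sf) _.
  by apply: le_of_eq; congr (nr _ + _); apply/funext => x; ring.
have /le_trans -> // : `|ip (X s) f - ip (X t) f - (s - t) * (ip (al t) df + ip (be t) f)| <=
    e' * `|s - t| * (0 + nr f + K * n1 f df).
  by apply: ler_cvg_to (cvg_norm c1) c2 _; exact: nearW.
rewrite add0r [leRHS](_ : _ = e' * `|s - t| * ((K + 2) * n1 f df)).
  apply: ler_wpM2l; first by rewrite mulr_ge0 ?(ltW e2).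
  rewrite mulrDl /n1.
  by have := nr_ge0 f; have := nr_ge0 df; lra.
by rewrite /e'; field; rewrite gt_eqF// ltr_wpDl.
Unshelve. all: by end_near. Qed.

Lemma WD_shift h X al be t : (forall s, sq (X s)) -> sq al -> sq be -> WD X al be t ->
  WD (fun s x => X s (x + h)) (fun x => al (x + h)) (fun x => be (x + h)) t.
Proof.
move=> sX sal sbe W e e0; apply: filterS (W e e0) => s H f df hf.
have [sf sdf fdf] := hf.
have sh g k : sq g -> sq k -> ip (fun x => g (x + h)) k = ip g (fun x => k (x + - h)).
  move=> sg sk; rewrite -(ip_shift (- h) (sq_shift h sg) sk); congr ip.
  by apply/funext => x; rewrite subrK.
rewrite !sh//.
have hs : H1r (fun x => f (x + - h)) (fun x => df (x + - h)).
  by split; [exact: sq_shift|exact: sq_shift|exact: ACshift].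
by apply: le_trans (H _ _ hs) _; rewrite /n1 !nr_shift.
Qed.

Lemma WD_lin c X Y alX beX alY beY t : (forall s, sq (X s)) -> (forall s, sq (Y s)) ->
  sq alX -> sq beX -> sq alY -> sq beY -> WD X alX beX t -> WD Y alY beY t ->
  WD (fun s x => c * (X s x - Y s x)) (fun x => c * (alX x - alY x))
    (fun x => c * (beX x - beY x)) t.
Proof.
move=> sX sY s1 s2 s3 s4 WX WY e e0.
have e2 : 0 < e / (2 * `|c| + 1) by rewrite divr_gt0// ltr_wpDl// mulr_ge0.
apply: filterS2 (WX _ e2) (WY _ e2) => s HX HY f df hf; have [sf sdf _] := hf.
rewrite !ipZl//; try exact: sqB.
rewrite !ipBl//.
have -> : c * (ip (X s) f - ip (Y s) f) - c * (ip (X t) f - ip (Y t) f) - (s - t) *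
    (c * (ip alX df - ip alY df) + c * (ip beX f - ip beY f)) =
  c * (ip (X s) f - ip (X t) f - (s - t) * (ip alX df + ip beX f)) -
  c * (ip (Y s) f - ip (Y t) f - (s - t) * (ip alY df + ip beY f)) by ring.
apply: le_trans (ler_normB _ _) _; rewrite !normrM.
have h1 := ler_wpM2l (normr_ge0 c) (HX f df hf).
have h2 := ler_wpM2l (normr_ge0 c) (HY f df hf).
apply: le_trans (lerD h1 h2) _.
rewrite [leLHS](_ : _ = (2 * `|c|) * (e / (2 * `|c| + 1)) * (`|s - t| * n1 f df)); last by ring.
rewrite -[leRHS]mulrA ler_wpM2r ?mulr_ge0 ?n1_ge0//.
rewrite mulrA ler_pdivrMr ?ltr_wpDl ?mulr_ge0// mulrC ler_wpM2l ?(ltW e0)//; lra.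
Qed.

Lemma WD_dq h X al be t : (forall s, sq (X s)) -> sq al -> sq be -> WD X al be t ->
  WD (fun s => dq h (X s)) (dq h al) (dq h be) t.
Proof.
move=> sX sal sbe W; apply: WD_lin => //; try by move=> *; exact: sq_shift.
exact: WD_shift.
Qed.

(** The remainder in [WD] is uniform on bounded sets of H1, and by [weak_derivative_uniform] <al, dF
    s> is close to <al, dF t> once F s is close to F t in L2. So an H1 bound and L2-continuity of F
    control the moving test function. *)
Lemma WD_moving X al be t F dF C : WD X al be t -> sq al -> sq be -> (forall s, sq (X s)) ->
  (forall s, H1r (F s) (dF s)) -> (\forall s \near t, n1 (F s) (dF s) <= C) ->
  (forall e, 0 < e -> \forall s \near t, nr (fun x => F s x - F t x) <= e) ->
  forall e, 0 < e -> \forall s \near t,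
    `|ip (X s) (F s) - ip (X t) (F s) - (s - t) * (ip al (dF t) + ip be (F t))| <= e * `|s - t|.
Proof.
move=> W sal sbe sX hF FC Fc e e0.
have C0 : 0 <= C by have := nbhs_singleton FC; apply: le_trans; exact: n1_ge0.
have e1 : 0 < e / 3 / (C + 1) by rewrite !divr_gt0// ltr_wpDl.
have e3 : 0 < e / 3 by rewrite divr_gt0.
have [d d0 dE] := weak_derivative_uniform sal C0 e3.
have e4 : 0 < e / 3 / (nr be + 1) by rewrite !divr_gt0// ltr_wpDl ?nr_ge0.
have [sFt sdFt _] := hF t.
have Ct := nbhs_singleton FC.
near=> s.
have Cs : n1 (F s) (dF s) <= C by near: s.
have [sFs sdFs _] := hF s.
have b1 : `|ip (X s) (F s) - ip (X t) (F s) - (s - t) * (ip al (dF s) + ip be (F s))| <=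
    e / 3 / (C + 1) * `|s - t| * n1 (F s) (dF s).
  by near: s; apply: filterS (W _ e1) => s; apply.
have b2 : `|ip al (dF s) - ip al (dF t)| <= e / 3.
  apply: dE (hF s) (hF t) _ _ _.
  - by apply: le_trans Cs; rewrite lerDr nr_ge0.
  - by apply: le_trans Ct; rewrite lerDr nr_ge0.
  - by near: s; exact: Fc.
have b3 : `|ip be (F s) - ip be (F t)| <= e / 3.
  rewrite -ipBr//; apply: le_trans (ipCS sbe (sqB sFs sFt)) _.
  have : nr (fun x => F s x - F t x) <= e / 3 / (nr be + 1) by near: s; exact: Fc.
  move=> /(ler_wpM2l (nr_ge0 be))/le_trans; apply.
  rewrite mulrA ler_pdivrMr ?ltr_wpDl ?nr_ge0// mulrC ler_wpM2l ?(ltW e3)//; lra.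
have -> : ip (X s) (F s) - ip (X t) (F s) - (s - t) * (ip al (dF t) + ip be (F t)) =
  (ip (X s) (F s) - ip (X t) (F s) - (s - t) * (ip al (dF s) + ip be (F s))) +
  (s - t) * ((ip al (dF s) - ip al (dF t)) + (ip be (F s) - ip be (F t))) by ring.
apply: le_trans (ler_normD _ _) _.
have b4 : e / 3 / (C + 1) * `|s - t| * n1 (F s) (dF s) <= e / 3 * `|s - t|.
  rewrite mulrAC ler_wpM2r//; apply: (@le_trans _ _ (e / 3 / (C + 1) * C)).
    by rewrite ler_wpM2l ?(ltW e1).
  rewrite mulrAC ler_pdivrMr ?ltr_wpDl// ler_wpM2l ?(ltW e3)//; lra.
have b5 : `|(s - t) * ((ip al (dF s) - ip al (dF t)) + (ip be (F s) - ip be (F t)))| <=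
  `|s - t| * (e / 3 + e / 3).
  by rewrite normrM ler_wpM2l// (le_trans (ler_normD _ _))// lerD.
have : `|s - t| * (e / 3 + e / 3) + e / 3 * `|s - t| = e * `|s - t| by field.
lra.
Unshelve. all: by end_near. Qed.

Lemma der_of_estimate (m : R -> R) t (D : R) :
  (forall e, 0 < e -> \forall s \near t, `|m s - m t - (s - t) * D| <= e * `|s - t|) ->
  is_derive t (1 : R) m D.
Proof.
move=> H.
have L : (fun h => h^-1 *: (m (h *: (1 : R) + t) - m t)) @ 0^' --> D.
  apply/cvgrPdist_le => e e0.
  have /nbhs_ballP[d /= d0 dE] := H e e0.
  near=> h.
  have h0 : h != 0 by near: h; exact: nbhs_dnbhs_neq.
  have hd : `|h| < d by near: h; apply: dnbhs0_lt.
  have := dE (h + t); rewrite /ball/= opprD addrCA subrr addr0 normrN addrK => /(_ hd).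
  rewrite -[h *: 1]/(h * 1) mulr1 -[_ *: _]/(h^-1 * _).
  have -> : D - h^-1 * (m (h + t) - m t) = - (h^-1 * (m (h + t) - m t - h * D)) by field.
  rewrite normrN normrM normfV [`|h|^-1 * _]mulrC ler_pdivrMr// normr_gt0//.
by apply: DeriveDef; [apply/cvg_ex; exists D|exact/cvg_lim].
Unshelve. all: by end_near. Qed.

Lemma WD_bilinear X dX Y dY alX beX alY beY g dg C D t :
  WD X alX beX t -> WD Y alY beY t -> sq alX -> sq beX -> sq alY -> sq beY ->
  (forall s, H1r (X s) (dX s)) -> (forall s, H1r (Y s) (dY s)) ->
  ctL2 X -> ctL2 Y -> ctL2 dY ->
  AC2 g dg -> measurable_fun setT dg -> (forall x, `|g x| <= C) -> (forall x, `|dg x| <= D) ->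
  is_derive t (1 : R) (fun s => ip (X s) (fun x => g x * Y s x))
    (ip alX (fun x => dg x * Y t x + g x * dY t x) + ip beX (fun x => g x * Y t x) +
     (ip alY (fun x => dg x * X t x + g x * dX t x) + ip beY (fun x => g x * X t x))).
Proof.
move=> WX WY s1 s2 s3 s4 hX hY cX cY cdY hg mdg gC gD.
have mg : measurable_fun setT g := cont_measurable (AC2_cont hg).
have C0 : 0 <= C := le_trans (normr_ge0 _) (gC 0).
have D0 : 0 <= D := le_trans (normr_ge0 _) (gD 0).
have sX s : sq (X s) by case: (hX s).
have sY s : sq (Y s) by case: (hY s).
have sdY s : sq (dY s) by case: (hY s).
have sgY s : sq (fun x => g x * Y s x) by exact: sq_bd gC (sY s).
have sgX s : sq (fun x => g x * X s x) by exact: sq_bd gC (sX s).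
have hgY s := H1M (hY s) hg mdg gC gD.
have hgX s := H1M (hX s) hg mdg gC gD.
have bnd : \forall s \near t, n1 (fun x => g x * Y s x) (fun x => dg x * Y s x + g x * dY s x) <=
    C * (nr (Y t) + 1) + (D * (nr (Y t) + 1) + C * (nr (dY t) + 1)).
  apply: filterS2 (ctL2_nr t cY) (ctL2_nr t cdY) => s k1 k2.
  apply: lerD; first by apply: le_trans (nr_bd mg gC (sY s)) _; rewrite ler_wpM2l.
  apply: le_trans (nrD (sq_bd mdg gD (sY s)) (sq_bd mg gC (sdY s))) _; apply: lerD.
    by apply: le_trans (nr_bd mdg gD (sY s)) _; rewrite ler_wpM2l.
  by apply: le_trans (nr_bd mg gC (sdY s)) _; rewrite ler_wpM2l.
have [_ cgY] := ctL2_bd mg gC cY.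
have E1 := WD_moving WX s1 s2 sX hgY bnd (cgY t).
have bnd2 : \forall s \near t, n1 (fun x => g x * X t x) (fun x => dg x * X t x + g x * dX t x) <=
  n1 (fun x => g x * X t x) (fun x => dg x * X t x + g x * dX t x) by near=> s.
have [_ cc] := ctL2_cst (sgX t).
have E2 := WD_moving WY s3 s4 sY (fun=> hgX t) bnd2 (cc t).
have sym f k : ip f (fun x => g x * k x) = ip k (fun x => g x * f x).
  by congr I1; apply/funext => x; ring.
apply: der_of_estimate => e e0; have e2 : 0 < e / 2 by rewrite divr_gt0.
apply: filterS2 (E1 _ e2) (E2 _ e2) => s k1 k2.
rewrite (sym (Y s)) (sym (Y t)) in k2.
set c1 := ip alX _ + ip beX _ in k1 *; set c2 := ip alY _ + ip beY _ in k2 *.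
have -> : ip (X s) (fun x => g x * Y s x) - ip (X t) (fun x => g x * Y t x) - (s - t) * (c1 + c2) =
  (ip (X s) (fun x => g x * Y s x) - ip (X t) (fun x => g x * Y s x) - (s - t) * c1) +
  (ip (X t) (fun x => g x * Y s x) - ip (X t) (fun x => g x * Y t x) - (s - t) * c2) by ring.
apply: le_trans (ler_normD _ _) _.
have : e / 2 * `|s - t| + e / 2 * `|s - t| = e * `|s - t| by field.
lra.
Unshelve. all: by end_near. Qed.

Lemma bounded_limit (f_ : nat -> R -> R) f C a b : (forall n, continuous (f_ n)) ->
  continuous f -> (forall n t, a <= t <= b -> `|f_ n t| <= C) ->
  (forall t, f_ ^~ t @ \oo --> f t) -> II a b (f_ n) @[n --> \oo] --> II a b f.
Proof.
move=> cf_ cf fC ff; have [] // := @dominated_cvg _ (fun n x => ind a b x * f_ n x)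
  (fun x => ind a b x * f x) (fun x => C * ind a b x).
- by move=> n; apply: measurable_funM; [exact: measurable_ind|exact: cont_measurable].
- by apply: measurable_funM; [exact: measurable_ind|exact: cont_measurable].
- by apply: aeW => x; apply: cvgM; [exact: cvg_cst|exact: ff].
- by apply: int1Z; exact: int1_ind.
- move=> n x; rewrite normrM indE; case: (boolP (_ && _)) => [/(fC n)|_].
    by rewrite normr1 mul1r mulr1.
  by rewrite normr0 mul0r mulr0.
Qed.

Lemma ctL2_bounded X a b : ctL2 X -> exists2 C : R, 0 <= C & forall t, a <= t <= b -> nr (X t) <= C.
Proof.
move=> cX; have cip := ctL2_ip cX cX.
have [C CE] := cont_bd a b cip.
exists (Num.sqrt `|C|) => [|t /CE H]; first exact: sqrtr_ge0.
by rewrite ler_sqrt//; apply: le_trans (ler_norm _) (le_trans H (ler_norm _)).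
Qed.

End weak_time_derivative.

(** * Bounds and time continuity of the nonlinear term *)

Section nonlinear_potential.
Context {R : realType}.
Variable q : R.
Hypothesis q0 : 0 < q.
Implicit Types (f df g dg u du v dv : R -> R) (a b c h x s t e K : R).
Local Notation nl := (nl q).
Local Notation dnl := (dnl q).

Lemma sq_norm f : sq f -> sq (fun x => `|f x|).
Proof.
move=> sf; have [mf _] := sf; apply: sq_le sf; last by move=> x; rewrite normr_id.
exact: measurableT_comp.
Qed.

Lemma nr_norm f : nr (fun x => `|f x|) = nr f.
Proof.
congr Num.sqrt; congr I1; apply/funext => x.
by rewrite -normrM ger0_norm// -expr2 sqr_ge0.
Qed.

Lemma H1_nl u du v dv K : 0 <= K -> H1r u du -> H1r v dv ->
  (forall x, u x ^+ 2 + v x ^+ 2 <= K) ->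
  [/\ H1r (fun x => nl (u x) (v x) * u x) (fun x => dnl (u x) (v x) (du x) (dv x)),
    nr (fun x => nl (u x) (v x) * u x) <= K `^ q * nr u &
    nr (fun x => dnl (u x) (v x) (du x) (dv x)) <= (1 + 2 * q) * K `^ q * (nr du + nr dv)].
Proof.
move=> K0 hu hv uvK; have [su sdu _] := hu; have [sv sdv _] := hv.
have nK x : nl (u x) (v x) <= K `^ q by apply: nl_le.
have mnl : measurable_fun setT (fun x => nl (u x) (v x)).
  by apply: measurable_nl; [case: su|case: sv].
have bnl x : `|nl (u x) (v x)| <= K `^ q by rewrite ger0_norm ?nl_ge0.
have q1 : 0 <= 1 + 2 * q by have := q0; lra.
have sab : sq (fun x => `|du x| + `|dv x|).
  by apply: sqD; exact: sq_norm.
have sd : sq (fun x => (1 + 2 * q) * K `^ q * (`|du x| + `|dv x|)) by exact: sqZ.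
have le x : `|dnl (u x) (v x) (du x) (dv x)| <= `|(1 + 2 * q) * K `^ q * (`|du x| + `|dv x|)|.
  apply: le_trans (dnl_le q0 _ _ _ _) _.
  have dd0 : 0 <= `|du x| + `|dv x| by rewrite addr_ge0.
  rewrite [leRHS]ger0_norm; last by rewrite !mulr_ge0 ?powR_ge0.
  by rewrite ler_wpM2r// ler_wpM2l.
have sdn : sq (fun x => dnl (u x) (v x) (du x) (dv x)).
  by apply: sq_le le sd; apply: measurable_dnl; [case: su|case: sv|case: sdu|case: sdv].
split.
- split => //; first exact: sq_bd bnl su.
  by have [] := AC2_nl q0 (AC2_H1 hu) (AC2_H1 hv).
- exact: nr_bd.
- apply: le_trans (nr_le sdn sd le) _.
  rewrite nrZ// ger0_norm ?mulr_ge0 ?powR_ge0// ler_wpM2l ?mulr_ge0 ?powR_ge0//.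
  by apply: le_trans (nrD (sq_norm sdu) (sq_norm sdv)) _; rewrite !nr_norm.
Qed.

Lemma local_sup (u du v dv : R -> R -> R) a b : (forall t, H1r (u t) (du t)) -> (forall t, H1r (v t) (dv t)) ->
  ctL2 u -> ctL2 du -> ctL2 v -> ctL2 dv ->
  exists2 K : R, 0 <= K & forall t, a <= t <= b -> [/\ forall x, u t x ^+ 2 + v t x ^+ 2 <= K,
    nr (u t) <= K, nr (du t) <= K, nr (v t) <= K & nr (dv t) <= K].
Proof.
move=> hu hv cu cdu cv cdv.
have [A A0 HA] := ctL2_bounded a b cu; have [B B0 HB] := ctL2_bounded a b cdu.
have [C C0 HC] := ctL2_bounded a b cv; have [D D0 HD] := ctL2_bounded a b cdv.
have sqle (x y : R) : 0 <= x -> x <= y -> x ^+ 2 <= y ^+ 2.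
  by move=> x0 xy; rewrite ler_sqr ?nnegrE// (le_trans x0).
exists (2 * (A ^+ 2 + B ^+ 2 + C ^+ 2 + D ^+ 2) + A + B + C + D).
  by rewrite !addr_ge0// mulr_ge0// !addr_ge0// sqr_ge0.
move=> t tab; have h1 := HA t tab; have h2 := HB t tab; have h3 := HC t tab; have h4 := HD t tab.
have k1 := sqr_ge0 A; have k2 := sqr_ge0 B; have k3 := sqr_ge0 C; have k4 := sqr_ge0 D.
split; [move=> x|lra..].
have e1 := H1_sup x (hu t); have e2 := H1_sup x (hv t).
have := sqle _ _ (nr_ge0 _) h1; have := sqle _ _ (nr_ge0 _) h2.
have := sqle _ _ (nr_ge0 _) h3; have := sqle _ _ (nr_ge0 _) h4.
lra.
Qed.

Lemma ctL2_nl (u du v dv : R -> R -> R) : (forall t, H1r (u t) (du t)) -> (forall t, H1r (v t) (dv t)) ->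
  ctL2 u -> ctL2 du -> ctL2 v -> ctL2 dv ->
  ctL2 (fun t x => nl (u t x) (v t x) * u t x).
Proof.
move=> hu hv cu cdu cv cdv; have [su ku] := cu; have [sv kv] := cv.
have sN t : sq (fun x => nl (u t x) (v t x) * u t x).
  have [K K0 HK] := local_sup t t hu hv cu cdu cv cdv.
  have [|bK _ _ _ _] := HK t; first by rewrite lexx.
  by have [[]] := H1_nl K0 (hu t) (hv t) bK.
split => // t e e0.
have [K K0 HK] := local_sup (t - 1) (t + 1) hu hv cu cdu cv cdv.
set L := (1 + 2 * q) * K `^ q.
have L0 : 0 <= L by rewrite mulr_ge0 ?powR_ge0//; have := q0; lra.
have e2 : 0 < e / (2 * L + 1) by rewrite divr_gt0// ltr_wpDl// mulr_ge0.
have tt : t - 1 <= t <= t + 1 by apply/andP; split; lra.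
have Ht : \forall s \near t, t - 1 <= s <= t + 1.
  apply/nbhs_ballP; exists 1 => //= s; rewrite /ball/= ltr_distlC => /andP[? ?].
  by apply/andP; split; lra.
apply: filterS3 Ht (ku t _ e2) (kv t _ e2) => s sI us vs.
have [b1 _ _ _ _] := HK s sI; have [b2 _ _ _ _] := HK t tt.
have sab : sq (fun x => L * (`|u s x - u t x| + `|v s x - v t x|)).
  by apply: sqZ; apply: sqD; apply: sq_norm; exact: sqB.
apply: (@le_trans _ _ (nr (fun x => L * (`|u s x - u t x| + `|v s x - v t x|)))).
  apply: nr_le => //; first exact: sqB.
  move=> x; rewrite [leRHS]ger0_norm; last by rewrite mulr_ge0// addr_ge0.
  exact: nl_lip.
have s1 := sq_norm (sqB (su s) (su t)); have s2 := sq_norm (sqB (sv s) (sv t)).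
rewrite nrZ ?ger0_norm//; last exact: sqD.
have := nrD s1 s2; rewrite !nr_norm => /(ler_wpM2l L0)/le_trans; apply.
apply: (@le_trans _ _ (L * (e / (2 * L + 1) + e / (2 * L + 1)))).
  by rewrite ler_wpM2l// lerD.
rewrite [leLHS](_ : _ = (2 * L) * e / (2 * L + 1)); last by ring.
have LL : 0 < 2 * L + 1 by lra.
by rewrite ler_pdivrMr// mulrC ler_wpM2l ?(ltW e0)//; lra.
Qed.

(* [ip (X t) (dF t)] is continuous although [dF] need not be: the derivative is
   controlled weakly by the L2-continuity of [F]. *)
Lemma ip_der_cont (X F dF : R -> R -> R) : ctL2 X -> ctL2 F -> (forall t, H1r (F t) (dF t)) ->
  (forall a b, exists2 C : R, 0 <= C & forall t, a <= t <= b -> nr (dF t) <= C) ->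
  continuous (fun t => ip (X t) (dF t)).
Proof.
move=> cX cF hF bF t; have [sX kX] := cX; have [sF kF] := cF.
have [C C0 HC] := bF (t - 1) (t + 1).
have tt : t - 1 <= t <= t + 1 by apply/andP; split; lra.
have Ht : \forall s \near t, t - 1 <= s <= t + 1.
  apply/nbhs_ballP; exists 1 => //= s; rewrite /ball/= ltr_distlC => /andP[? ?].
  by apply/andP; split; lra.
apply/cvgrPdist_le => e e0; have e2 : 0 < e / 2 by rewrite divr_gt0.
have e3 : 0 < e / 2 / (C + 1) by rewrite divr_gt0// ltr_wpDl.
have [d d0 Hd] := weak_derivative_uniform (sX t) C0 e2.
apply: filterS3 Ht (kX t _ e3) (kF t _ d0) => s sI Xs Fs.
have sdF r : sq (dF r) by case: (hF r).
have k1 := Hd _ _ _ _ (hF s) (hF t) (HC _ sI) (HC _ tt) Fs.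
have k2 := ipCS (sqB (sX s) (sX t)) (sdF s).
have k3 : nr (fun x => X s x - X t x) * nr (dF s) <= e / 2 / (C + 1) * C.
  by apply: ler_pM => //; rewrite ?nr_ge0//; exact: HC.
have k4 : e / 2 / (C + 1) * C <= e / 2.
  rewrite mulrAC ler_pdivrMr ?ltr_wpDl// ler_wpM2l ?(ltW e2)//; lra.
have -> : ip (X t) (dF t) - ip (X s) (dF s) =
   - (ip (fun x => X s x - X t x) (dF s) + (ip (X t) (dF s) - ip (X t) (dF t))).
  by rewrite ipBl//; ring.
rewrite normrN; apply: le_trans (ler_normD _ _) _; lra.
Qed.

End nonlinear_potential.

(** * Conservation laws and the Morawetz identity *)

(** The arithmetic behind differentiating a convex functional: d lies between its linearisations at
    the two end points, and both of these are within k (z + z) of the same multiple of r. *)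
Lemma sandwich (R : realType) (k z A1 A2 A3 A4 B1 B2 B3 B4 c1 c2 d r : R) : 0 <= k ->
  k * (A1 - A2 + (A3 - A4)) <= d -> k * (B2 - B1 + (B4 - B3)) <= - d ->
  `|A1 - A2 - r * c1| <= z -> `|A3 - A4 - r * c2| <= z ->
  `|B1 - B2 - r * c1| <= z -> `|B3 - B4 - r * c2| <= z ->
  `|d - r * (k * (c1 + c2))| <= k * (z + z).
Proof.
move=> k0 lo hi; rewrite !ler_norml => /andP[l1 u1] /andP[l2 u2] /andP[l3 u3] /andP[l4 u4].
have Glo := ler_wpM2l k0 (lerD l1 l2); have Ghi := ler_wpM2l k0 (lerD u3 u4).
by apply/andP; split; lra.
Qed.

Lemma norm_combination4 (R : realType) (x1 x2 x3 x4 K : R) :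
  `|x1| <= K -> `|x2| <= K -> `|x3| <= K -> `|x4| <= K ->
  `|2 * (x1 - x3) - 2 * (x2 - x4)| <= 8 * K.
Proof.
rewrite !ler_norml => /andP[? ?] /andP[? ?] /andP[? ?] /andP[? ?].
by apply/andP; split; lra.
Qed.

Lemma integrated_limit (R : realType) (E_ dE_ : nat -> R -> R) (E dE : R -> R) :
  (forall n t, is_derive t (1 : R) (E_ n) (dE_ n t)) -> (forall n, continuous (dE_ n)) ->
  (forall b c : R, exists K : R, forall n t, b <= t <= c -> `|dE_ n t| <= K) ->
  continuous dE ->
  (forall t, dE_ ^~ t @ \oo --> dE t) -> (forall t, E_ ^~ t @ \oo --> E t) ->
  forall s t : R, s <= t -> E t - E s = II s t dE.
Proof.
move=> der cdE bdE cd limdE limE s t st.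
have [K HK] := bdE s t.
have L1 := bounded_limit cdE cd HK limdE.
have L2 : (E_ n t - E_ n s) @[n --> \oo] --> E t - E s by apply: cvgB.
apply: (cvg_unique (@Rhausdorff R) L2).
rewrite (_ : (fun n => _) = fun n => II s t (dE_ n))//.
by apply/funext => n; have [_ ->] := AC_C1 (der n) (cdE n).
Qed.

(** The quotients of w, which is only in L2, need not be bounded as h tends to 0; moved onto f they
    cost no more than the norm of f'. *)
Lemma dq_adjoint_bd (R : realType) h (f df w : R -> R) K L : 0 < h -> H1r f df -> sq w ->
  nr df <= K -> nr w <= L -> `|ip (dq h w) f| <= K * L.
Proof.
move=> h0 hf sw dfK wL; have [sf sdf _] := hf.
rewrite ipC ip_dq// normrN.
apply: le_trans (ipCS (sq_dq h sf) (sq_shift h sw)) _; rewrite nr_shift//.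
apply: ler_pM => //; try exact: nr_ge0.
by apply: le_trans dfK; exact: nr_dq hf.
Qed.

Lemma dq_adjoint_cvg (R : realType) (f df w : R -> R) : H1r f df -> sq w ->
  ip (dq (hn n) w) f @[n --> \oo] --> - ip w df.
Proof.
move=> hf sw; have [sf sdf _] := hf.
under eq_fun do rewrite ipC ip_dq//.
apply: cvgN; rewrite ipC; apply: ip_cvg => //.
- by move=> n; exact: sq_dq.
- by move=> n; exact: sq_shift.
- exact: dq_strong.
- exact: tau_strong.
Qed.

Lemma norm_combination8 (R : realType) (x1 x2 x3 x4 x5 x6 x7 x8 K : R) :
  `|x1| <= K -> `|x2| <= K -> `|x3| <= K -> `|x4| <= K ->
  `|x5| <= K -> `|x6| <= K -> `|x7| <= K -> `|x8| <= K ->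
  `|x1 - x2 + (x3 - x4) + (x5 - x6 + (x7 - x8))| <= 8 * K.
Proof.
rewrite !ler_norml => /andP[? ?] /andP[? ?] /andP[? ?] /andP[? ?].
move=> /andP[? ?] /andP[? ?] /andP[? ?] /andP[? ?].
by apply/andP; split; lra.
Qed.

Section evolution.
Context {R : realType}.
Local Notation hn := (@hn R).
Variables (q : R) (V dV a da : R -> R) (u du v dv : R -> R -> R) (C : R).
Hypothesis q0 : 0 < q.
Hypotheses (hV : AC2 V dV) (ha : AC2 a da).
Hypotheses (mdV : measurable_fun setT dV) (mda : measurable_fun setT da).
Hypotheses (VC : forall x, `|V x| <= C) (dVC : forall x, `|dV x| <= C).
Hypotheses (aC : forall x, `|a x| <= C) (daC : forall x, `|da x| <= C).
Hypotheses (a0 : forall x, 0 <= a x).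
Hypotheses (hu : forall t, H1r (u t) (du t)) (hv : forall t, H1r (v t) (dv t)).
Hypotheses (cu : ctL2 u) (cdu : ctL2 du) (cv : ctL2 v) (cdv : ctL2 dv).
Local Notation nl := (nl q).
Local Notation dnl := (dnl q).
Local Notation sl := (sl q).

(** With q = (p - 1) / 2, N + i L is |psi|^(p-1) psi and P + i Q is (V + a |psi|^(p-1)) psi. L is N
    with the roles of u and v exchanged, so that the same lemmas cover both. *)
Let N t x := nl (u t x) (v t x) * u t x.
Let dN t x := dnl (u t x) (v t x) (du t x) (dv t x).
Let L t x := nl (v t x) (u t x) * v t x.
Let dL t x := dnl (v t x) (u t x) (dv t x) (du t x).
Definition force_u t x := V x * u t x + a x * N t x.
Definition force_v t x := V x * v t x + a x * L t x.
Let P := force_u.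
Let Q := force_v.
Let dP t x := (dV x * u t x + V x * du t x) + (da x * N t x + a x * dN t x).
Let dQ t x := (dV x * v t x + V x * dv t x) + (da x * L t x + a x * dL t x).

Let C0 : 0 <= C. Proof. exact: le_trans (VC 0). Qed.
Let mV : measurable_fun setT V. Proof. exact: cont_measurable (AC2_cont hV). Qed.
Let ma : measurable_fun setT a. Proof. exact: cont_measurable (AC2_cont ha). Qed.
Let su t : sq (u t). Proof. by case: (hu t). Qed.
Let sv t : sq (v t). Proof. by case: (hv t). Qed.
Let sdu t : sq (du t). Proof. by case: (hu t). Qed.
Let sdv t : sq (dv t). Proof. by case: (hv t). Qed.

Lemma nonlinearity_bounds b c : exists2 K : R, 0 <= K & forall t, b <= t <= c ->
  [/\ H1r (N t) (dN t), H1r (L t) (dL t) &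
    [/\ nr (u t) <= K, nr (du t) <= K, nr (v t) <= K, nr (dv t) <= K &
    [/\ nr (N t) <= K, nr (L t) <= K, nr (dN t) <= K & nr (dL t) <= K]]].
Proof.
have [K K0 HK] := local_sup b c hu hv cu cdu cv cdv.
have pK := powR_ge0 K q.
have A0 : 0 <= (1 + 2 * q) * K `^ q by rewrite mulr_ge0//; have := q0; lra.
exists (K + K `^ q * K + (1 + 2 * q) * K `^ q * (K + K)).
  by rewrite !addr_ge0// mulr_ge0// addr_ge0.
move=> t /HK[s1 s2 s3 s4 s5].
have s1' x : v t x ^+ 2 + u t x ^+ 2 <= K by rewrite addrC.
have [h1 n1 d1] := H1_nl q0 K0 (hu t) (hv t) s1.
have [h2 n2 d2] := H1_nl q0 K0 (hv t) (hu t) s1'.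
have e1 : K `^ q * nr (u t) <= K `^ q * K by rewrite ler_wpM2l.
have e2 : K `^ q * nr (v t) <= K `^ q * K by rewrite ler_wpM2l.
have e3 : (1 + 2 * q) * K `^ q * (nr (du t) + nr (dv t)) <= (1 + 2 * q) * K `^ q * (K + K).
  by rewrite ler_wpM2l// lerD.
have e4 := mulr_ge0 pK K0.
have e5 : 0 <= (1 + 2 * q) * K `^ q * (K + K) by rewrite mulr_ge0// addr_ge0.
have KK : K <= K + K `^ q * K + (1 + 2 * q) * K `^ q * (K + K) by lra.
split=> //; split; [exact: le_trans KK..|split].
- by apply: le_trans n1 _; lra.
- by apply: le_trans n2 _; lra.
- by apply: le_trans d1 _; lra.
- by apply: le_trans d2 _; rewrite [nr _ + _]addrC; lra.
Qed.

Let hN t : H1r (N t) (dN t).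
Proof. by have [K _ HK] := nonlinearity_bounds t t; have [] := HK t; rewrite ?lexx. Qed.
Let hL t : H1r (L t) (dL t).
Proof. by have [K _ HK] := nonlinearity_bounds t t; have [] := HK t; rewrite ?lexx. Qed.
Let sN t : sq (N t). Proof. by case: (hN t). Qed.
Let sL t : sq (L t). Proof. by case: (hL t). Qed.
Let sdN t : sq (dN t). Proof. by case: (hN t). Qed.
Let sdL t : sq (dL t). Proof. by case: (hL t). Qed.
Let cN : ctL2 N. Proof. exact: (@ctL2_nl _ _ q0 u du v dv). Qed.
Let cL : ctL2 L. Proof. exact: (@ctL2_nl _ _ q0 v dv u du). Qed.

Lemma H1D f df g dg : @H1r R f df -> H1r g dg -> H1r (fun x => f x + g x) (fun x => df x + dg x).
Proof. by move=> [? ? ?] [? ? ?]; split; [exact: sqD|exact: sqD|exact: ACD]. Qed.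

Let hP t : H1r (P t) (dP t).
Proof. by apply: H1D; [exact: H1M (hu t) hV mdV VC dVC|exact: H1M (hN t) ha mda aC daC]. Qed.
Let hQ t : H1r (Q t) (dQ t).
Proof. by apply: H1D; [exact: H1M (hv t) hV mdV VC dVC|exact: H1M (hL t) ha mda aC daC]. Qed.
Let sP t : sq (P t). Proof. by case: (hP t). Qed.
Let sQ t : sq (Q t). Proof. by case: (hQ t). Qed.
Let sdP t : sq (dP t). Proof. by case: (hP t). Qed.
Let sdQ t : sq (dQ t). Proof. by case: (hQ t). Qed.
Let cP : ctL2 P.
Proof. by apply: ctL2D; [exact: ctL2_bd VC cu|exact: ctL2_bd aC cN]. Qed.
Let cQ : ctL2 Q.
Proof. by apply: ctL2D; [exact: ctL2_bd VC cv|exact: ctL2_bd aC cL]. Qed.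

Lemma force_ctL2 : ctL2 force_u /\ ctL2 force_v.
Proof. by split; [exact: cP|exact: cQ]. Qed.

Lemma force_bounds b c : exists2 K : R, 0 <= K & forall t, b <= t <= c ->
  [/\ nr (u t) <= K, nr (du t) <= K, nr (v t) <= K, nr (dv t) <= K &
    [/\ nr (P t) <= K, nr (Q t) <= K, nr (dP t) <= K & nr (dQ t) <= K]].
Proof.
have [K K0 HK] := nonlinearity_bounds b c.
exists (K + C * K + C * K + C * K + C * K); first by rewrite !addr_ge0// mulr_ge0.
have CK : 0 <= C * K by rewrite mulr_ge0.
have KK : K <= K + C * K + C * K + C * K + C * K by rewrite -!addrA lerDl !addr_ge0.
have K4 : C * K + C * K + (C * K + C * K) <= K + C * K + C * K + C * K + C * K.
  by rewrite -!addrA lerDr.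
have K2 : C * K + C * K <= K + C * K + C * K + C * K + C * K.
  by apply: le_trans K4; rewrite lerDl addr_ge0.
move=> t /HK[_ _ [k1 k2 k3 k4 [k5 k6 k7 k8]]].
have B (m f : R -> R) : measurable_fun setT m -> (forall x, `|m x| <= C) -> sq f -> nr f <= K ->
    nr (fun x => m x * f x) <= C * K.
  by move=> mm mC sf fK; apply: le_trans (nr_bd mm mC sf) _; rewrite ler_wpM2l.
have S2 (f g : R -> R) (c1 c2 : R) : sq f -> sq g -> nr f <= c1 -> nr g <= c2 ->
    nr (fun x => f x + g x) <= c1 + c2.
  by move=> sf sg h1 h2; apply: le_trans (nrD sf sg) _; rewrite lerD.
have sb (m f : R -> R) : measurable_fun setT m -> (forall x, `|m x| <= C) -> sq f -> sq (fun x => m x * f x).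
  by move=> mm mC sf; exact: sq_bd mC sf.
have two (f g df dg : R -> R) : sq f -> sq g -> sq df -> sq dg -> nr f <= K -> nr df <= K -> nr g <= K -> nr dg <= K ->
   nr (fun x => V x * f x + a x * g x) <= C * K + C * K /\
   nr (fun x => (dV x * f x + V x * df x) + (da x * g x + a x * dg x)) <= (C * K + C * K) + (C * K + C * K).
  move=> s1 s2 s3 s4 n1 n2 n3 n4; split; first by apply: S2; (exact: sb || exact: B).
  have z1 := sb _ _ mdV dVC s1; have z2 := sb _ _ mV VC s3.
  have z3 := sb _ _ mda daC s2; have z4 := sb _ _ ma aC s4.
  have y1 := S2 _ _ _ _ z1 z2 (B _ _ mdV dVC s1 n1) (B _ _ mV VC s3 n2).
  have y2 := S2 _ _ _ _ z3 z4 (B _ _ mda daC s2 n3) (B _ _ ma aC s4 n4).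
  exact: S2 (sqD z1 z2) (sqD z3 z4) y1 y2.
have [e1 e2] := two _ _ _ _ (su t) (sN t) (sdu t) (sdN t) k1 k2 k5 k7.
have [e3 e4] := two _ _ _ _ (sv t) (sL t) (sdv t) (sdL t) k3 k4 k6 k8.
split; [exact: le_trans KK..|split].
- exact: le_trans e1 K2.
- exact: le_trans e3 K2.
- exact: le_trans e2 K4.
- exact: le_trans e4 K4.
Qed.

Hypothesis evol_u : forall l dl, Cinf l -> H1r l dl -> (forall x, is_derive x (1 : R) l (dl x)) ->
  (exists A : R, forall x, A < `|x| -> l x = 0) ->
  AC (fun t => ip (u t) l) (fun t => ip (dv t) dl + ip (Q t) l).
Hypothesis evol_v : forall l dl, Cinf l -> H1r l dl -> (forall x, is_derive x (1 : R) l (dl x)) ->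
  (exists A : R, forall x, A < `|x| -> l x = 0) ->
  AC (fun t => ip (v t) l) (fun t => - ip (du t) dl - ip (P t) l).

Let Wu t : WD u (dv t) (Q t) t.
Proof. exact: (@WD_of_tests _ u dv Q t cu cdv cQ evol_u). Qed.
Let Wv t : WD v (fun x => - du t x) (fun x => - P t x) t.
Proof.
apply: (@WD_of_tests _ v (fun t x => - du t x) (fun t x => - P t x) t cv (ctL2N cdu) (ctL2N cP)).
move=> l dl cl hl ld lA; have [sl sdl _] := hl.
apply: AC_eq (evol_v cl hl ld lA) _; apply/funext => s.
by rewrite (ipNl (sdu s) sdl) (ipNl (sP s) sl).
Qed.

Lemma conserved (E_ : nat -> R -> R) (dE_ : nat -> R -> R) (E : R -> R) :
  (forall n t, is_derive t (1 : R) (E_ n) (dE_ n t)) -> (forall n, continuous (dE_ n)) ->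
  (forall b c, exists K : R, forall n t, b <= t <= c -> `|dE_ n t| <= K) ->
  (forall t, dE_ ^~ t @ \oo --> 0) -> (forall t, E_ ^~ t @ \oo --> E t) ->
  forall s t, E s = E t.
Proof.
move=> der cdE bdE limdE limE.
suff H s t : s <= t -> E s = E t.
  by move=> s t; case: (leP s t) => [/H//|/ltW/H].
move=> st; have := integrated_limit der cdE bdE (@cst_continuous _ _ 0) limdE limE st.
by rewrite II_cst// mul0r => /eqP; rewrite subr_eq0 => /eqP.
Qed.

Let ac1 : AC2 (fun=> 1 : R) (fun=> 0). Proof. exact: AC2_cst. Qed.

Lemma mass_conserved s t : ip (u s) (u s) + ip (v s) (v s) = ip (u t) (u t) + ip (v t) (v t).
Proof.
(* The functions u and v are themselves admissible moving test functions, being in H1, so the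
   approximating sequence is constant. *)
apply: (@conserved (fun _ t => ip (u t) (u t) + ip (v t) (v t)) (fun _ _ => 0)
  (fun t => ip (u t) (u t) + ip (v t) (v t))) => {s t}.
- move=> _ t.
  have H1 := WD_bilinear (Wu t) (Wu t) (sdv t) (sQ t) (sdv t) (sQ t) hu hu cu cu cdu ac1
    (@measurable_cst _ _ _ _ _ _) (fun=> lexx _) (fun=> lexx _).
  have H2 := WD_bilinear (Wv t) (Wv t) (sqN (sdu t)) (sqN (sP t)) (sqN (sdu t)) (sqN (sP t)) hv hv cv cv cdv ac1
    (@measurable_cst _ _ _ _ _ _) (fun=> lexx _) (fun=> lexx _).
  have one (f : R -> R) : (fun x => 1 * f x) = f by apply/funext => x; rewrite mul1r.
  have zo (f g : R -> R) : (fun x => 0 * f x + 1 * g x) = g by apply/funext => x; rewrite mul1r mul0r add0r.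
  have := derD H1 H2; rewrite !one !zo.
  under eq_fun do rewrite !one.
  move/der_eq; apply; rewrite !ipNl// (ipC (du t)).
  have -> : ip (Q t) (u t) = ip (P t) (v t).
    by congr I1; apply/funext => x; rewrite /Q/P/force_u/force_v/N/L (nlC _ (v t x)); ring.
  ring.
- by move=> _; exact: cst_continuous.
- by move=> b c; exists 0 => n t _; rewrite normr0.
- by move=> t; exact: cvg_cst.
- by move=> t; exact: cvg_cst.
Qed.

Let haN t : H1r (fun x => a x * N t x) (fun x => da x * N t x + a x * dN t x).
Proof. exact: H1M (hN t) ha mda aC daC. Qed.
Let haL t : H1r (fun x => a x * L t x) (fun x => da x * L t x + a x * dL t x).
Proof. exact: H1M (hL t) ha mda aC daC. Qed.

Lemma int1_sl t : int1 (fun x => a x * sl (u t x) (v t x)).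
Proof.
have [s1 _ _] := haN t; have [s2 _ _] := haL t.
have := int1D (sq_int s1 (su t)) (sq_int s2 (sv t)); congr int1; apply/funext => x.
by rewrite /N /L /sl (nlC _ (v t x)); ring.
Qed.

Let near1 (t : R) : \forall s \near t, t - 1 <= s <= t + 1.
Proof.
apply/nbhs_ballP; exists 1 => //= s; rewrite /ball/= ltr_distlC => /andP[? ?].
by apply/andP; split; lra.
Qed.

(* Convexity of |.|^(p+1) squeezes the increment between the linearisations at
   the two ends, both controlled by [WD_moving]. *)
Lemma nonlinear_energy_derivative (t : R) :
  is_derive t (1 : R) (fun s => I1 (fun x => a x * sl (u s x) (v s x)))
    (2 * (q + 1) * ((ip (dv t) (fun x => da x * N t x + a x * dN t x) + ip (Q t) (fun x => a x * N t x)) +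
      (ip (fun x => - du t x) (fun x => da x * L t x + a x * dL t x) +
       ip (fun x => - P t x) (fun x => a x * L t x)))).
Proof.
set c1 := ip (dv t) _ + _; set c2 := ip (fun x => - du t x) _ + _.
have [K K0 HK] := nonlinearity_bounds (t - 1) (t + 1).
have saN s : sq (fun x => a x * N s x) by case: (haN s).
have saL s : sq (fun x => a x * L s x) by case: (haL s).
have nb (f df : R -> R) : sq f -> sq df -> nr f <= K -> nr df <= K ->
    n1 (fun x => a x * f x) (fun x => da x * f x + a x * df x) <= 3 * (C * K).
  move=> sf sdf fK dfK.
  have k1 := nr_bd ma aC sf; have k2 := nr_bd ma aC sdf; have k3 := nr_bd mda daC sf.
  have k4 := nrD (sq_bd mda daC sf) (sq_bd ma aC sdf).
  have k5 := ler_wpM2l C0 fK; have k6 := ler_wpM2l C0 dfK.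
  by rewrite /n1; lra.
have b1 : \forall s \near t, n1 (fun x => a x * N s x) (fun x => da x * N s x + a x * dN s x) <= 3 * (C * K).
  by apply: filterS (near1 t) => s /HK[_ _ [_ _ _ _ [h1 _ h2 _]]]; exact: nb.
have b2 : \forall s \near t, n1 (fun x => a x * L s x) (fun x => da x * L s x + a x * dL s x) <= 3 * (C * K).
  by apply: filterS (near1 t) => s /HK[_ _ [_ _ _ _ [_ h1 _ h2]]]; exact: nb.
have [_ caN] := ctL2_bd ma aC cN; have [_ caL] := ctL2_bd ma aC cL.
have [_ ccN] := ctL2_cst (saN t); have [_ ccL] := ctL2_cst (saL t).
have s1 := sqN (sdu t); have s2 := sqN (sP t).
have bb (f df : R -> R) : \forall s \near t, n1 f df <= n1 f df by near=> s.
have M1 := WD_moving (Wu t) (sdv t) (sQ t) su haN b1 (caN t).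
have M2 := WD_moving (Wv t) s1 s2 sv haL b2 (caL t).
have M3 := WD_moving (Wu t) (sdv t) (sQ t) su (fun=> haN t) (bb _ _) (ccN t).
have M4 := WD_moving (Wv t) s1 s2 sv (fun=> haL t) (bb _ _) (ccL t).
have q1 : 0 < 2 * (q + 1) by have := q0; lra.
apply: der_of_estimate => e e0.
have e2 : 0 < e / (2 * (2 * (q + 1))) by rewrite divr_gt0// mulr_gt0.
apply: filterS2 (filterI (M1 _ e2) (M2 _ e2)) (filterI (M3 _ e2) (M4 _ e2)) => s [k1 k2] [k3 k4].
pose F r := I1 (fun x => a x * sl (u r x) (v r x)); rewrite -/(F s) -/(F t).
have conv r r' : 2 * (q + 1) * ((ip (u r') (fun x => a x * N r x) - ip (u r) (fun x => a x * N r x)) +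
    (ip (v r') (fun x => a x * L r x) - ip (v r) (fun x => a x * L r x))) <= F r' - F r.
  have [h1 h2] : sq (fun x => u r' x - u r x) /\ sq (fun x => v r' x - v r x) by split; exact: sqB.
  rewrite -ipBl// -ipBl// -I1D; [|exact: sq_int..].
  rewrite -I1Z; last by apply: int1D; exact: sq_int.
  rewrite -I1B; [|exact: int1_sl..].
  apply: le_I1.
  - by apply: int1Z; apply: int1D; exact: sq_int.
  - by apply: int1B; exact: int1_sl.
  - move=> x; have := ler_wpM2l (a0 x) (sl_convex q0 (u r x) (v r x) (u r' x) (v r' x)).
    rewrite -mulrBr => /(le_trans _); apply; apply: le_of_eq.
    by rewrite /N /L (nlC _ (v r x)); ring.
have lo := conv t s; have hi := conv s t.
set z := e / _ * _ in k1 k2 k3 k4.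
have -> : e * `|s - t| = 2 * (q + 1) * (z + z).
  by rewrite /z; field; rewrite gt_eqF//; have := q0; lra.
have hi' : 2 * (q + 1) * (ip (u t) (fun x => a x * N s x) - ip (u s) (fun x => a x * N s x) +
    (ip (v t) (fun x => a x * L s x) - ip (v s) (fun x => a x * L s x))) <= - (F s - F t).
  by rewrite opprB.
exact: sandwich (ltW q1) lo hi' k3 k4 k1 k2.
Unshelve. all: by end_near. Qed.

(** Twice the Hamiltonian. The coefficient (q + 1)^-1, which is 2 / (p + 1), compensates the factor
    2 (q + 1) that differentiating |psi|^(p+1) produces. *)
Definition energy t := ip (du t) (du t) + ip (dv t) (dv t) +
  (ip (u t) (fun x => V x * u t x) + ip (v t) (fun x => V x * v t x) +
   (q + 1)^-1 * I1 (fun x => a x * sl (u t x) (v t x))).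

Let dqN h f : dq h (fun x => - f x) = fun x => - dq h f x :> R.
Proof. by apply/funext => x; rewrite /dq; ring. Qed.

Let cdq_du h : ctL2 (fun t => dq h (du t)). Proof. exact: ctL2_dq. Qed.
Let cdq_dv h : ctL2 (fun t => dq h (dv t)). Proof. exact: ctL2_dq. Qed.
Let cdq_u h : ctL2 (fun t => dq h (u t)). Proof. exact: ctL2_dq. Qed.
Let cdq_v h : ctL2 (fun t => dq h (v t)). Proof. exact: ctL2_dq. Qed.
Let cdq_P h : ctL2 (fun t => dq h (P t)). Proof. exact: ctL2_dq. Qed.
Let cdq_Q h : ctL2 (fun t => dq h (Q t)). Proof. exact: ctL2_dq. Qed.

Lemma H1_dq h f df : @H1r R f df -> H1r (dq h f) (dq h df).
Proof.
move=> [sf sdf fdf]; split; [exact: sq_dq|exact: sq_dq|].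
by apply: ACZ; apply: ACB => //; exact: ACshift.
Qed.

Let bdP b c : exists2 K : R, 0 <= K & forall t, b <= t <= c -> nr (dP t) <= K.
Proof. by have [K K0 HK] := force_bounds b c; exists K => // t /HK[_ _ _ _ []]. Qed.
Let bdQ b c : exists2 K : R, 0 <= K & forall t, b <= t <= c -> nr (dQ t) <= K.
Proof. by have [K K0 HK] := force_bounds b c; exists K => // t /HK[_ _ _ _ []]. Qed.

Let ip_bd f g (K : R) : sq f -> sq g -> 0 <= K -> nr f <= K -> nr g <= K -> `|ip f g| <= K * K.
Proof.
move=> sf sg K0 h1 h2; apply: le_trans (ipCS sf sg) _.
by apply: ler_pM => //; exact: nr_ge0.
Qed.

Lemma energy_conserved s t : energy s = energy t.
Proof.
pose E_ n t := ip (dq (hn n) (u t)) (dq (hn n) (u t)) + ip (dq (hn n) (v t)) (dq (hn n) (v t)) +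
  (ip (u t) (fun x => V x * u t x) + ip (v t) (fun x => V x * v t x) +
   (q + 1)^-1 * I1 (fun x => a x * sl (u t x) (v t x))).
(* Only the kinetic part is regularised. Its derivative pairs quotients of the force with quotients
   of psi, whereas the other terms pair true derivatives; [dE_] is this mismatch and vanishes with
   the step. *)
pose dE_ n t := 2 * (ip (dq (hn n) (Q t)) (dq (hn n) (u t)) - ip (du t) (dQ t)) -
  2 * (ip (dq (hn n) (P t)) (dq (hn n) (v t)) - ip (dv t) (dP t)).
have one (f : R -> R) : (fun x => 1 * f x) = f by apply/funext => x; rewrite mul1r.
have zo (f g : R -> R) : (fun x => 0 * f x + 1 * g x) = g by apply/funext => x; rewrite mul1r mul0r add0r.
apply: (@conserved E_ dE_ energy) => {s t}.
- move=> n t; set h := hn n.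
  have hdu s := H1_dq h (hu s); have hdv s := H1_dq h (hv s).
  have sh f : sq f -> sq (dq h f) by exact: sq_dq.
  have s1 := sqN (sdu t); have s2 := sqN (sP t).
  have W1 := WD_dq h su (sdv t) (sQ t) (Wu t).
  have W2 := WD_dq h sv s1 s2 (Wv t).
  have H1 := WD_bilinear W1 W1 (sh _ (sdv t)) (sh _ (sQ t)) (sh _ (sdv t)) (sh _ (sQ t))
    hdu hdu (cdq_u h) (cdq_u h) (cdq_du h) ac1
    (@measurable_cst _ _ _ _ _ _) (fun=> lexx _) (fun=> lexx _).
  have H2 := WD_bilinear W2 W2 (sh _ s1) (sh _ s2) (sh _ s1) (sh _ s2)
    hdv hdv (cdq_v h) (cdq_v h) (cdq_dv h) ac1
    (@measurable_cst _ _ _ _ _ _) (fun=> lexx _) (fun=> lexx _).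
  have H3 := WD_bilinear (Wu t) (Wu t) (sdv t) (sQ t) (sdv t) (sQ t) hu hu cu cu cdu hV mdV VC dVC.
  have H4 := WD_bilinear (Wv t) (Wv t) s1 s2 s1 s2 hv hv cv cv cdv hV mdV VC dVC.
  have H5 := derZ (q + 1)^-1 (nonlinear_energy_derivative t).
  have := derD (derD H1 H2) (derD (derD H3 H4) H5); rewrite !one !zo.
  under eq_fun do rewrite !one.
  move/der_eq; apply.
  have sVu : sq (fun x => dV x * u t x + V x * du t x).
    by apply: sqD; [exact: sq_bd dVC (su t)|exact: sq_bd VC (sdu t)].
  have sVv : sq (fun x => dV x * v t x + V x * dv t x).
    by apply: sqD; [exact: sq_bd dVC (sv t)|exact: sq_bd VC (sdv t)].
  have sVu' : sq (fun x => V x * u t x) by exact: sq_bd VC (su t).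
  have sVv' : sq (fun x => V x * v t x) by exact: sq_bd VC (sv t).
  have [saN sdaN _] := haN t; have [saL sdaL _] := haL t.
  rewrite /dE_ -/h.
  have -> : ip (du t) (dQ t) = _ := ipDr sVv sdaL (sdu t).
  have -> : ip (dv t) (dP t) = _ := ipDr sVu sdaN (sdv t).
  rewrite !dqN !ipNl//; try exact: sh.
  have e1 : ip (Q t) (fun x => V x * u t x) = ip (P t) (fun x => V x * v t x) +
     (ip (P t) (fun x => a x * L t x) - ip (Q t) (fun x => a x * N t x)).
    have ePQ : ip (P t) (Q t) = ip (Q t) (P t) by rewrite ipC.
    rewrite {2}/Q /force_v {2}/P /force_u in ePQ.
    rewrite (ipDr sVv' saL (sP t)) (ipDr sVu' saN (sQ t)) in ePQ; lra.
  rewrite e1 (ipC (dq h (dv t))); field.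
  by rewrite gt_eqF//; have := q0; lra.
- move=> n t; set h := hn n.
  have k1 := ctL2_ip (cdq_Q h) (cdq_u h); have k2 := ctL2_ip (cdq_P h) (cdq_v h).
  have k3 := ip_der_cont cdu cQ hQ bdQ; have k4 := ip_der_cont cdv cP hP bdP.
  apply: cvgB; (apply: cvgM; [exact: cvg_cst|]); apply: cvgB;
    [exact: k1|exact: k3|exact: k2|exact: k4].
- move=> b c; have [K K0 HK] := force_bounds b c.
  exists (8 * (K * K)) => n t /HK[b1 b2 b3 b4 [b5 b6 b7 b8]].
  have dqK (f df : R -> R) : H1r f df -> nr df <= K -> nr (dq (hn n) f) <= K.
    by move=> hf; have := nr_dq (@hn_gt0 R n) hf; exact: le_trans.
  have i1 := ip_bd (sq_dq (hn n) (sQ t)) (sq_dq (hn n) (su t)) K0 (dqK _ _ (hQ t) b8) (dqK _ _ (hu t) b2).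
  have i2 := ip_bd (sq_dq (hn n) (sP t)) (sq_dq (hn n) (sv t)) K0 (dqK _ _ (hP t) b7) (dqK _ _ (hv t) b4).
  have i3 := ip_bd (sdu t) (sdQ t) K0 b2 b8; have i4 := ip_bd (sdv t) (sdP t) K0 b4 b7.
  exact: norm_combination4.
- move=> t.
  have sh n f : sq f -> sq (dq (hn n) f) by exact: sq_dq.
  have -> : 0 = 2 * (ip (dQ t) (du t) - ip (du t) (dQ t)) - 2 * (ip (dP t) (dv t) - ip (dv t) (dP t)) :> R.
    by rewrite (ipC (dQ t)) (ipC (dP t)); ring.
  have c1 := ip_cvg (fun n => sh n _ (sQ t)) (sdQ t) (fun n => sh n _ (su t)) (sdu t)
    (dq_strong (hQ t)) (dq_strong (hu t)).
  have c2 := ip_cvg (fun n => sh n _ (sP t)) (sdP t) (fun n => sh n _ (sv t)) (sdv t)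
    (dq_strong (hP t)) (dq_strong (hv t)).
  by apply: cvgB; (apply: cvgM; [exact: cvg_cst|]); apply: cvgB;
    [exact: c1|exact: cvg_cst|exact: c2|exact: cvg_cst].
- move=> t; have sh n f : sq f -> sq (dq (hn n) f) by exact: sq_dq.
  apply: cvgD; last exact: cvg_cst.
  have c1 := ip_cvg (fun n => sh n _ (su t)) (sdu t) (fun n => sh n _ (su t)) (sdu t)
    (dq_strong (hu t)) (dq_strong (hu t)).
  have c2 := ip_cvg (fun n => sh n _ (sv t)) (sdv t) (fun n => sh n _ (sv t)) (sdv t)
    (dq_strong (hv t)) (dq_strong (hv t)).
  by apply: cvgD; [exact: c1|exact: c2].
Qed.

(** * The Morawetz functional and its flux *)

Section multiplier.
Variables (g dg ddg kap dkap : R -> R) (G : R).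
Hypotheses (hg : AC2 g dg) (hdg : AC2 dg ddg) (mddg : measurable_fun setT ddg).
Hypotheses (gG : forall x, `|g x| <= G) (dgG : forall x, `|dg x| <= G) (ddgG : forall x, `|ddg x| <= G).
Hypotheses (hkap : AC2 kap dkap) (mdkap : measurable_fun setT dkap).
Hypotheses (kapG : forall x, `|kap x| <= G) (dkapG : forall x, `|dkap x| <= G).

Let G0 : 0 <= G. Proof. exact: le_trans (gG 0). Qed.
Let mg : measurable_fun setT g. Proof. exact: cont_measurable (AC2_cont hg). Qed.
Let mdg : measurable_fun setT dg. Proof. exact: cont_measurable (AC2_cont hdg). Qed.

Definition morawetz t := ip (u t) (fun x => g x * dv t x) - ip (v t) (fun x => g x * du t x).

(** The form in which the limit of difference quotients delivers the flux. The second derivative of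
    g enters only as a bounded multiplier, so it may jump at the peak. *)
Definition morawetz_flux t :=
  ip (dv t) (fun x => dg x * dv t x) + ip (du t) (fun x => ddg x * u t x + dg x * du t x) +
  (ip (du t) (fun x => dg x * du t x) + ip (dv t) (fun x => ddg x * v t x + dg x * dv t x)) +
  (ip (Q t) (fun x => g x * dv t x) + ip (P t) (fun x => dg x * u t x + g x * du t x) +
   (ip (P t) (fun x => g x * du t x) + ip (Q t) (fun x => dg x * v t x + g x * dv t x))).

Let cmulg X : ctL2 X -> ctL2 (fun t x => g x * X t x). Proof. exact: ctL2_bd. Qed.
Let cmuldg X : ctL2 X -> ctL2 (fun t x => dg x * X t x). Proof. exact: ctL2_bd. Qed.
Let cmulddg X : ctL2 X -> ctL2 (fun t x => ddg x * X t x). Proof. exact: ctL2_bd. Qed.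

Lemma morawetz_flux_cont : continuous morawetz_flux.
Proof.
move=> t.
have c1 := ctL2_ip cdv (cmuldg cdv); have c2 := ctL2_ip cdu (ctL2D (cmulddg cu) (cmuldg cdu)).
have c3 := ctL2_ip cdu (cmuldg cdu); have c4 := ctL2_ip cdv (ctL2D (cmulddg cv) (cmuldg cdv)).
have c5 := ctL2_ip cQ (cmulg cdv); have c6 := ctL2_ip cP (ctL2D (cmuldg cu) (cmulg cdu)).
have c7 := ctL2_ip cP (cmulg cdu); have c8 := ctL2_ip cQ (ctL2D (cmuldg cv) (cmulg cdv)).
exact: cvgD (cvgD (cvgD (c1 t) (c2 t)) (cvgD (c3 t) (c4 t)))
  (cvgD (cvgD (c5 t) (c6 t)) (cvgD (c7 t) (c8 t))).
Qed.

Lemma morawetz_identity s t : s <= t -> morawetz t - morawetz s = II s t morawetz_flux.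
Proof.
pose M_ n t := ip (u t) (fun x => g x * dq (hn n) (v t) x) - ip (v t) (fun x => g x * dq (hn n) (u t) x).
pose dM_ n t :=
  ip (dv t) (fun x => dg x * dq (hn n) (v t) x) - ip (dq (hn n) (du t)) (fun x => dg x * u t x) +
  (ip (du t) (fun x => dg x * dq (hn n) (u t) x) - ip (dq (hn n) (dv t)) (fun x => dg x * v t x)) +
  (ip (Q t) (fun x => g x * dq (hn n) (v t) x) - ip (dq (hn n) (P t)) (fun x => g x * u t x) +
   (ip (P t) (fun x => g x * dq (hn n) (u t) x) - ip (dq (hn n) (Q t)) (fun x => g x * v t x))).
apply: (@integrated_limit _ M_ dM_) => {s t}.
- move=> n t; set h := hn n.
  have hdu s := H1_dq h (hu s); have hdv s := H1_dq h (hv s).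
  have sh f : sq f -> sq (dq h f) by exact: sq_dq.
  have s1 := sqN (sdu t); have s2 := sqN (sP t).
  have W1 := WD_dq h su (sdv t) (sQ t) (Wu t).
  have W2 := WD_dq h sv s1 s2 (Wv t).
  have H1 := WD_bilinear (Wu t) W2 (sdv t) (sQ t) (sh _ s1) (sh _ s2) hu hdv cu (cdq_v h) (cdq_dv h)
    hg mdg gG dgG.
  have H2 := WD_bilinear (Wv t) W1 s1 s2 (sh _ (sdv t)) (sh _ (sQ t)) hv hdu cv (cdq_u h) (cdq_du h)
    hg mdg gG dgG.
  have := derB H1 H2; move/der_eq; apply.
  have bg f : sq f -> sq (fun x => g x * f x) by move=> sf; exact: sq_bd gG sf.
  have bdg f : sq f -> sq (fun x => dg x * f x) by move=> sf; exact: sq_bd dgG sf.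
  have k1 := ipDr (bdg _ (sh _ (sv t))) (bg _ (sh _ (sdv t))) (sdv t).
  have k2 := ipDr (bdg _ (sh _ (su t))) (bg _ (sh _ (sdu t))) s1.
  have k3 := ipDr (bdg _ (su t)) (bg _ (sdu t)) (sh _ s1).
  have k4 := ipDr (bdg _ (sv t)) (bg _ (sdv t)) (sh _ (sdv t)).
  rewrite k1 k2 k3 k4 !dqN.
  rewrite (ipNl (sdu t) (bdg _ (sh _ (su t)))) (ipNl (sdu t) (bg _ (sh _ (sdu t)))).
  rewrite (ipNl (sh _ (sdu t)) (bdg _ (su t))) (ipNl (sh _ (sdu t)) (bg _ (sdu t))).
  rewrite (ipNl (sP t) (bg _ (sh _ (su t)))) (ipNl (sh _ (sP t)) (bg _ (su t))).
  (* The weighted pairing is symmetric, so the terms pairing v_x with quotients of v_x cancel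
     exactly, and likewise for u_x. These are the terms with no limit at H1 regularity, and they are
     gone before the step tends to zero. *)
  have sw (f k : R -> R) : ip f (fun x => g x * k x) = ip k (fun x => g x * f x).
    by congr I1; apply/funext => x; ring.
  rewrite (sw (dq h (dv t)) (dv t)) (sw (dq h (du t)) (du t)) /dM_ -/h; ring.
- move=> n t; set h := hn n.
  have c1 := ctL2_ip cdv (cmuldg (cdq_v h)); have c2 := ctL2_ip (cdq_du h) (cmuldg cu).
  have c3 := ctL2_ip cdu (cmuldg (cdq_u h)); have c4 := ctL2_ip (cdq_dv h) (cmuldg cv).
  have c5 := ctL2_ip cQ (cmulg (cdq_v h)); have c6 := ctL2_ip (cdq_P h) (cmulg cu).
  have c7 := ctL2_ip cP (cmulg (cdq_u h)); have c8 := ctL2_ip (cdq_Q h) (cmulg cv).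
  apply: cvgD; apply: cvgD; apply: cvgB;
    [exact: c1|exact: c2|exact: c3|exact: c4|exact: c5|exact: c6|exact: c7|exact: c8].
- move=> b c; have [K K0 HK] := force_bounds b c.
  exists (8 * (2 * (G * K) * K)) => n t /HK[b1 b2 b3 b4 [b5 b6 _ _]].
  have h0 : 0 < hn n := @hn_gt0 R n.
  have dqK (m f df : R -> R) : measurable_fun setT m -> (forall x, `|m x| <= G) -> H1r f df -> nr df <= K ->
      nr (fun x => m x * dq (hn n) f x) <= 2 * (G * K).
    move=> mm mG hf fK; have [sf _ _] := hf.
    apply: le_trans (nr_bd mm mG (sq_dq _ sf)) _.
    have := le_trans (nr_dq h0 hf) fK => /(ler_wpM2l G0); have := mulr_ge0 G0 K0; lra.
  have mK (m dm f df : R -> R) : measurable_fun setT m -> (forall x, `|m x| <= G) ->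
      measurable_fun setT dm -> (forall x, `|dm x| <= G) -> H1r f df -> nr f <= K -> nr df <= K ->
      nr (fun x => dm x * f x + m x * df x) <= 2 * (G * K).
    move=> mm mG mdm dmG [sf sdf _] fK dfK.
    apply: le_trans (nrD (sq_bd mdm dmG sf) (sq_bd mm mG sdf)) _.
    have h1 := le_trans (nr_bd mdm dmG sf) (ler_wpM2l G0 fK).
    have h2 := le_trans (nr_bd mm mG sdf) (ler_wpM2l G0 dfK); lra.
  have T1 (w m f df : R -> R) : measurable_fun setT m -> (forall x, `|m x| <= G) -> sq w -> nr w <= K ->
      H1r f df -> nr df <= K -> `|ip w (fun x => m x * dq (hn n) f x)| <= 2 * (G * K) * K.
    move=> mm mG sw wK hf fK; have [sf _ _] := hf.
    apply: le_trans (ipCS sw (sq_bd mm mG (sq_dq _ sf))) _; rewrite mulrC.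
    by apply: ler_pM; rewrite ?nr_ge0//; exact: dqK hf fK.
  have T2 (w m dm f df : R -> R) : AC2 m dm -> measurable_fun setT dm -> (forall x, `|m x| <= G) ->
      (forall x, `|dm x| <= G) -> sq w -> nr w <= K ->
      H1r f df -> nr f <= K -> nr df <= K -> `|ip (dq (hn n) w) (fun x => m x * f x)| <= 2 * (G * K) * K.
    move=> hm mdm mG dmG sw wK hf fK dfK.
    apply: dq_adjoint_bd h0 (H1M hf hm mdm mG dmG) sw _ wK.
    by apply: mK hf fK dfK => //; exact: cont_measurable (AC2_cont hm).
  exact: norm_combination8 (T1 _ _ _ _ mdg dgG (sdv t) b4 (hv t) b4) (T2 _ _ _ _ _ hdg mddg dgG ddgG (sdu t) b2 (hu t) b1 b2)
    (T1 _ _ _ _ mdg dgG (sdu t) b2 (hu t) b2) (T2 _ _ _ _ _ hdg mddg dgG ddgG (sdv t) b4 (hv t) b3 b4)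
    (T1 _ _ _ _ mg gG (sQ t) b6 (hv t) b4) (T2 _ _ _ _ _ hg mdg gG dgG (sP t) b5 (hu t) b1 b2)
    (T1 _ _ _ _ mg gG (sP t) b5 (hu t) b2) (T2 _ _ _ _ _ hg mdg gG dgG (sQ t) b6 (hv t) b3 b4).
- exact: morawetz_flux_cont.
- move=> t.
  have T1 (w m f df : R -> R) : measurable_fun setT m -> (forall x, `|m x| <= G) -> sq w -> H1r f df ->
      ip w (fun x => m x * dq (hn n) f x) @[n --> \oo] --> ip w (fun x => m x * df x).
    move=> mm mG sw hf; have [sf sdf _] := hf.
    have e (k : R -> R) : ip w (fun x => m x * k x) = ip (fun x => m x * w x) k.
      by congr I1; apply/funext => x; ring.
    rewrite e; under eq_fun do rewrite e.
    have smw := sq_bd mm mG sw.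
    apply: (@ip_cvg _ (fun=> fun x => m x * w x)) => //; [by move=> n; exact: sq_dq|exact: cst_nr_cvg|exact: dq_strong].
  have T2 (w m dm f df : R -> R) : AC2 m dm -> measurable_fun setT dm -> (forall x, `|m x| <= G) ->
      (forall x, `|dm x| <= G) -> sq w -> H1r f df ->
      ip (dq (hn n) w) (fun x => m x * f x) @[n --> \oo] --> - ip w (fun x => dm x * f x + m x * df x).
    by move=> hm mdm mG dmG sw hf; exact: dq_adjoint_cvg (H1M hf hm mdm mG dmG) sw.
  have oppK (x y : R) : x + y = x - (- y) by rewrite opprK.
  rewrite /morawetz_flux (oppK (ip (dv t) _)) (oppK (ip (du t) (fun x => dg x * du t x))).
  rewrite (oppK (ip (Q t) (fun x => g x * dv t x))) (oppK (ip (P t) (fun x => g x * du t x))).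
  apply: cvgD; apply: cvgD; apply: cvgB.
  + exact: T1 mdg dgG (sdv t) (hv t).
  + exact: T2 hdg mddg dgG ddgG (sdu t) (hu t).
  + exact: T1 mdg dgG (sdu t) (hu t).
  + exact: T2 hdg mddg dgG ddgG (sdv t) (hv t).
  + exact: T1 mg gG (sQ t) (hv t).
  + exact: T2 hg mdg gG dgG (sP t) (hu t).
  + exact: T1 mg gG (sP t) (hu t).
  + exact: T2 hg mdg gG dgG (sQ t) (hv t).
- move=> t; have T1 (w f df : R -> R) : sq w -> H1r f df ->
      ip w (fun x => g x * dq (hn n) f x) @[n --> \oo] --> ip w (fun x => g x * df x).
    move=> sw hf; have [sf sdf _] := hf.
    have e (k : R -> R) : ip w (fun x => g x * k x) = ip (fun x => g x * w x) k.
      by congr I1; apply/funext => x; ring.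
    rewrite e; under eq_fun do rewrite e.
    have smw := sq_bd mg gG sw.
    apply: (@ip_cvg _ (fun=> fun x => g x * w x)) => //; [by move=> n; exact: sq_dq|exact: cst_nr_cvg|exact: dq_strong].
  by apply: cvgB; [exact: T1 (su t) (hv t)|exact: T1 (sv t) (hu t)].
Qed.

Lemma int1_products t : [/\ int1 (fun x => u t x ^+ 2 + v t x ^+ 2), int1 (fun x => sl (u t x) (v t x)),
  int1 (fun x => u t x * du t x + v t x * dv t x) &
  int1 (fun x => nl (u t x) (v t x) * (u t x * du t x + v t x * dv t x))].
Proof.
split.
- by apply: int1D; [case: (su t)|case: (sv t)].
- have := int1D (sq_int (sN t) (su t)) (sq_int (sL t) (sv t)); congr int1; apply/funext => x.
  by rewrite /N /L /sl (nlC _ (v t x)); ring.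
- by apply: int1D; exact: sq_int.
- have := int1D (sq_int (sN t) (sdu t)) (sq_int (sL t) (sdv t)); congr int1; apply/funext => x.
  by rewrite /N /L (nlC _ (v t x)); ring.
Qed.

(* The total derivatives of [kap |psi|^2] and [g a |psi|^(p+1)] integrate to
   zero and are added to the flux to make its integrand nonnegative. *)
Lemma morawetz_flux_ge (w1 w2 : R -> R) (W t : R) :
  measurable_fun setT w1 -> (forall x, `|w1 x| <= W) ->
  measurable_fun setT w2 -> (forall x, `|w2 x| <= W) ->
  (forall x X Y, w1 x * Y ^+ 2 <= 2 * dg x * X ^+ 2 + (ddg x + 2 * (kap x + g x * V x)) * (X * Y) +
     (dkap x + dg x * V x) * Y ^+ 2) ->
  (forall x, (q + 1) * w2 x <= q * dg x * a x - g x * da x) ->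
  I1 (fun x => w1 x * (u t x ^+ 2 + v t x ^+ 2) + w2 x * sl (u t x) (v t x)) <= morawetz_flux t.
Proof.
move=> mw1 w1W mw2 w2W H1 H2.
have [i1 i2 i3 i4] := int1_products t.
have q1 : 0 < q + 1 by have := q0; lra.
have mga : measurable_fun setT (fun x => g x * a x) by exact: measurable_funM.
have mdga : measurable_fun setT (fun x => dg x * a x + g x * da x).
  by apply: measurable_funD; exact: measurable_funM.
have gaC x : `|g x * a x| <= G * C by rewrite normrM ler_pM.
have dgaC x : `|dg x * a x + g x * da x| <= 2 * (G * C).
  have := ler_normD (dg x * a x) (g x * da x); rewrite !normrM.
  have := ler_pM (normr_ge0 _) (normr_ge0 _) (dgG x) (aC x).
  have := ler_pM (normr_ge0 _) (normr_ge0 _) (gG x) (daC x); lra.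
have mkap : measurable_fun setT kap by exact: cont_measurable (AC2_cont hkap).
pose J2 x := dkap x * (u t x ^+ 2 + v t x ^+ 2) + kap x * (2 * (u t x * du t x + v t x * dv t x)).
have iJ2 : int1 J2.
  by apply: int1D; [exact: int1_bd mdkap dkapG i1|exact: int1_bd mkap kapG (int1Z 2 i3)].
have z2 : I1 J2 = 0.
  have [A _] := AC2M hkap (AC2D (AC2_sqr (AC2_H1 (hu t))) (AC2_sqr (AC2_H1 (hv t)))).
  apply: (@I1_deriv _ _ _ (AC_eq A _)) iJ2; last exact: int1_bd mkap kapG i1.
  by apply/funext => x; rewrite /J2; ring.
pose J3 x := (dg x * a x + g x * da x) * sl (u t x) (v t x) +
  (g x * a x) * (2 * (q + 1) * (nl (u t x) (v t x) * (u t x * du t x + v t x * dv t x))).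
have iJ3 : int1 J3.
  by apply: int1D; [exact: int1_bd mdga dgaC i2|exact: int1_bd mga gaC (int1Z _ i4)].
have z3 : I1 J3 = 0.
  have [A _] := AC2M (AC2M hg ha) (AC2_sl q0 (AC2_H1 (hu t)) (AC2_H1 (hv t))).
  by apply: I1_deriv A _ iJ3; exact: int1_bd mga gaC i2.
have bg f : sq f -> sq (fun x => g x * f x) by move=> sf; exact: sq_bd gG sf.
have bdg f : sq f -> sq (fun x => dg x * f x) by move=> sf; exact: sq_bd dgG sf.
have bddg f : sq f -> sq (fun x => ddg x * f x) by move=> sf; exact: sq_bd ddgG sf.
have k1 := sq_int (sdv t) (bdg _ (sdv t)).
have k2 := sq_int (sdu t) (sqD (bddg _ (su t)) (bdg _ (sdu t))).
have k3 := sq_int (sdu t) (bdg _ (sdu t)).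
have k4 := sq_int (sdv t) (sqD (bddg _ (sv t)) (bdg _ (sdv t))).
have k5 := sq_int (sQ t) (bg _ (sdv t)).
have k6 := sq_int (sP t) (sqD (bdg _ (su t)) (bg _ (sdu t))).
have k7 := sq_int (sP t) (bg _ (sdu t)).
have k8 := sq_int (sQ t) (sqD (bdg _ (sv t)) (bg _ (sdv t))).
have l1 := int1D (int1D k1 k2) (int1D k3 k4); have l2 := int1D (int1D k5 k6) (int1D k7 k8).
(* The factor -(q + 1)^-1 cancels the term 2 g a |psi|^(p-1) (u u_x + v v_x) of the flux and leaves
   (q + 1)^-1 (q g' a - g a') |psi|^(p+1). *)
have -> : morawetz_flux t = morawetz_flux t + (I1 J2 - (q + 1)^-1 * I1 J3).
  by rewrite z2 z3; ring.
rewrite /morawetz_flux /ip.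
rewrite -(I1D k1 k2) -(I1D k3 k4) -(I1D k5 k6) -(I1D k7 k8).
rewrite -(I1D (int1D k1 k2) (int1D k3 k4)) -(I1D (int1D k5 k6) (int1D k7 k8)) -(I1D l1 l2).
rewrite -I1Z// -I1B//; last exact: int1Z.
have l3 := int1B iJ2 (int1Z (q + 1)^-1 iJ3).
rewrite -(I1D (int1D l1 l2) l3).
apply: le_I1; [|exact: int1D (int1D l1 l2) l3|].
  by apply: int1D; [exact: int1_bd mw1 w1W i1|exact: int1_bd mw2 w2W i2].
move=> x; rewrite /J2 /J3 /P /Q /force_u /force_v /N /L (nlC _ (v t x) (u t x)).
have h1 := H1 x (du t x) (u t x); have h2 := H1 x (dv t x) (v t x).
have h3 := ler_wpM2r (sl_ge0 q (u t x) (v t x)) (H2 x).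
have h4 : w2 x * sl (u t x) (v t x) <= (q + 1)^-1 * ((q * dg x * a x - g x * da x) * sl (u t x) (v t x)).
  rewrite [leRHS]mulrC ler_pdivlMr//; apply: le_trans h3; apply: le_of_eq; ring.
rewrite mulrDr; apply: le_trans (lerD (lerD h1 h2) h4) _; apply: le_of_eq.
rewrite /sl; field; by rewrite gt_eqF.
Qed.

Hypothesis V0 : forall x, 0 <= V x.

Lemma energy_ge t : ip (du t) (du t) + ip (dv t) (dv t) <= energy t.
Proof.
rewrite lerDl !addr_ge0//.
- by apply: I1_ge0 => x; rewrite mulrCA mulr_ge0// -expr2 sqr_ge0.
- by apply: I1_ge0 => x; rewrite mulrCA mulr_ge0// -expr2 sqr_ge0.
- rewrite mulr_ge0 ?invr_ge0 ?addr_ge0 ?(ltW q0)//.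
  by apply: I1_ge0 => x; rewrite mulr_ge0// sl_ge0.
Qed.

Lemma morawetz_bounded t :
  `|morawetz t| <= 2 * G * (Num.sqrt (ip (u 0) (u 0) + ip (v 0) (v 0)) * Num.sqrt (energy 0)).
Proof.
rewrite (mass_conserved 0 t) (energy_conserved 0 t).
set m := Num.sqrt _; set E := Num.sqrt _.
have um : nr (u t) <= m by rewrite ler_wsqrtr// lerDl ip_ge0.
have vm : nr (v t) <= m by rewrite ler_wsqrtr// lerDr ip_ge0.
have duE : nr (du t) <= E.
  by rewrite ler_wsqrtr//; apply: le_trans (energy_ge t); rewrite lerDl ip_ge0.
have dvE : nr (dv t) <= E.
  by rewrite ler_wsqrtr//; apply: le_trans (energy_ge t); rewrite lerDr ip_ge0.
have k (f w : R -> R) : sq f -> sq w -> nr f <= m -> nr w <= E -> `|ip f (fun x => g x * w x)| <= G * (m * E).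
  move=> sf sw fm wE; apply: le_trans (ipCS sf (sq_bd mg gG sw)) _.
  rewrite mulrCA; apply: ler_pM; rewrite ?nr_ge0//.
  by apply: le_trans (nr_bd mg gG sw) _; rewrite ler_wpM2l.
apply: le_trans (ler_normB _ _) _.
have := k _ _ (su t) (sdv t) um dvE; have := k _ _ (sv t) (sdu t) vm duE; lra.
Qed.

Lemma morawetz_estimate (w1 w2 : R -> R) (W : R) :
  measurable_fun setT w1 -> (forall x, 0 <= w1 x <= W) ->
  measurable_fun setT w2 -> (forall x, 0 <= w2 x <= W) ->
  (forall x X Y, w1 x * Y ^+ 2 <= 2 * dg x * X ^+ 2 + (ddg x + 2 * (kap x + g x * V x)) * (X * Y) +
     (dkap x + dg x * V x) * Y ^+ 2) ->
  (forall x, (q + 1) * w2 x <= q * dg x * a x - g x * da x) ->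
  let F t := I1 (fun x => w1 x * (u t x ^+ 2 + v t x ^+ 2) + w2 x * sl (u t x) (v t x)) in
  int1 F /\ I1 F <= 4 * G * (Num.sqrt (ip (u 0) (u 0) + ip (v 0) (v 0)) * Num.sqrt (energy 0)).
Proof.
move=> mw1 w1W mw2 w2W H1 H2 F.
have b1 x : `|w1 x| <= W by have /andP[? ?] := w1W x; rewrite ger0_norm.
have b2 x : `|w2 x| <= W by have /andP[? ?] := w2W x; rewrite ger0_norm.
have cF : continuous F.
  have -> : F = fun t => (ip (u t) (fun x => w1 x * u t x) + ip (v t) (fun x => w1 x * v t x)) +
    (ip (u t) (fun x => w2 x * N t x) + ip (v t) (fun x => w2 x * L t x)).
    apply/funext => t; rewrite /ip.
    have i1 := sq_int (su t) (sq_bd mw1 b1 (su t)); have i2 := sq_int (sv t) (sq_bd mw1 b1 (sv t)).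
    have i3 := sq_int (su t) (sq_bd mw2 b2 (sN t)); have i4 := sq_int (sv t) (sq_bd mw2 b2 (sL t)).
    rewrite -(I1D i1 i2) -(I1D i3 i4) -(I1D (int1D i1 i2) (int1D i3 i4)); congr I1; apply/funext => x.
    by rewrite /N /L /sl (nlC _ (v t x)); ring.
  move=> t.
  have c1 := ctL2_ip cu (ctL2_bd mw1 b1 cu); have c2 := ctL2_ip cv (ctL2_bd mw1 b1 cv).
  have c3 := ctL2_ip cu (ctL2_bd mw2 b2 cN); have c4 := ctL2_ip cv (ctL2_bd mw2 b2 cL).
  exact: cvgD (cvgD (c1 t) (c2 t)) (cvgD (c3 t) (c4 t)).
have F0 t : 0 <= F t.
  apply: I1_ge0 => x; have /andP[? _] := w1W x; have /andP[? _] := w2W x.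
  by apply: addr_ge0; apply: mulr_ge0 => //; [exact: ssq_ge0|exact: sl_ge0].
apply: trunc_bound => //; first exact: cont_measurable.
move=> n; split; first by have [_] := loc_cont cF.
apply: le_trans (le_II (loc_cont cF) (loc_cont morawetz_flux_cont) _) _.
  by move=> t _; exact: morawetz_flux_ge b1 mw2 b2 H1 H2.
have nn : - n%:R <= n%:R :> R by have := ler0n R n; lra.
rewrite -(morawetz_identity nn); apply: le_trans (ler_norm _) (le_trans (ler_normB _ _) _).
have := morawetz_bounded n%:R; have := morawetz_bounded (- n%:R); lra.
Qed.

End multiplier.

End evolution.

(** * The tortoise coordinate and the potential *)

Section areal_geometry.
Context {R : realType}.
Variable M : R.
Hypothesis M0 : 0 < M.
Implicit Types x y : R.
Local Notation r := (areal_radius M).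

Lemma areal_gt x : 2 * M < r x. Proof. by have [] := areal_radiusP x M0. Qed.

Lemma areal_gt0 x : 0 < r x. Proof. by apply: le_lt_trans (areal_gt x); rewrite mulr_ge0// ltW. Qed.

Lemma tortoise_mono (y z : R) : 2 * M < y -> y < z ->
  y + 2 * M * ln (y - 2 * M) < z + 2 * M * ln (z - 2 * M).
Proof.
move=> My yz; apply: ltrD => //; rewrite ltr_pM2l ?mulr_gt0// ltr_ln ?posrE; lra.
Qed.

Lemma arealK (y : R) : 2 * M < y -> r (y + 2 * M * ln (y - 2 * M)) = y.
Proof.
move=> My; set x := y + _; have [h1 h2] := areal_radiusP x M0.
case: (ltgtP (r x) y) => // c.
- by have := tortoise_mono h1 c; rewrite h2 ltxx.
- by have := tortoise_mono My c; rewrite h2 ltxx.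
Qed.

Lemma der_areal x : is_derive x (1 : R) r (1 - 2 * M / r x).
Proof.
pose T (y : R) := y + 2 * M * ln (y - 2 * M).
have [h1 h2] := areal_radiusP x M0; have rx := areal_gt0 x.
have dT (y : R) : 2 * M < y -> is_derive y (1 : R) T (1 + 2 * M * (y - 2 * M)^-1).
  move=> My; have y2 : 0 < y - 2 * M by rewrite subr_gt0.
  have d1 : is_derive y (1 : R) (fun z => z - 2 * M) 1.
    by apply: der_eq (derB (der_id y) (der_cst (2 * M) y)) _; ring.
  have d2 := @der_comp _ (@ln R) (fun z => z - 2 * M) y _ _ (is_derive1_ln y2) d1.
  by apply: der_eq (derD (der_id y) (derZ (2 * M) d2)) _; ring.
have e : 1 - 2 * M / r x = (1 + 2 * M * (r x - 2 * M)^-1)^-1.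
  by field; rewrite !gt_eqF//; lra.
rewrite e -{1}h2; apply: (@is_derive_inverse R T).
- by near=> y; apply: arealK; near: y; exact: lt_nbhsr.
- near=> y; have My : 2 * M < y by near: y; exact: lt_nbhsr.
  by have [d _] := dT y My; apply: differentiable_continuous; rewrite -derivable1_diffP.
- exact: dT.
- have : 0 < (r x - 2 * M)^-1 by rewrite invr_gt0 subr_gt0.
  have M2 : 0 < 2 * M by rewrite mulr_gt0.
  by move=> /(mulr_gt0 M2) ?; rewrite gt_eqF//; lra.
Unshelve. all: by end_near. Qed.

(** In this variable V is a polynomial on ]0, 1[ with its maximum at 3/4; the horizon corresponds to
    1 and infinity to 0. *)
Definition srad x := 2 * M / r x.
Local Notation s := srad.

Lemma srad_itv x : 0 < s x /\ s x < 1.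
Proof.
have rx := areal_gt0 x; rewrite /srad; split; first by rewrite divr_gt0// mulr_gt0.
by rewrite ltr_pdivrMr// mul1r areal_gt.
Qed.

Lemma der_srad x : is_derive x (1 : R) s (- (s x ^+ 2 * (1 - s x)) / (2 * M)).
Proof.
have rx := areal_gt0 x; have rn : r x != 0 by rewrite gt_eqF.
apply: der_eq (derZ (2 * M) (derV rn (der_areal x))) _.
by rewrite /srad; field; rewrite rn gt_eqF.
Qed.

Lemma srad_cont : continuous s. Proof. exact: der_cont der_srad. Qed.

Lemma potentialE x : potential M x = s x ^+ 3 * (1 - s x) / (4 * M ^+ 2).
Proof.
have rx := areal_gt0 x; rewrite /potential /srad; field.
by rewrite !gt_eqF.
Qed.

Definition dpotential x := - (s x ^+ 4 * (3 - 4 * s x) * (1 - s x)) / (8 * M ^+ 3).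

Lemma der_potential x : is_derive x (1 : R) (potential M) (dpotential x).
Proof.
have -> : potential M = fun x => s x ^+ 3 * (1 - s x) / (4 * M ^+ 2).
  by apply/funext => z; exact: potentialE.
have d1 := der_srad x.
have d2 := derM (derX 3 d1) (derB (der_cst 1 x) d1).
apply: der_eq (derM d2 (der_cst ((4 * M ^+ 2)^-1) x)) _.
rewrite /dpotential /=; field; by rewrite gt_eqF.
Qed.

Lemma cont_comp_srad (k : R -> R) : continuous k -> continuous (fun x => k (s x)).
Proof. by move=> ck x; apply: (@continuous_comp _ _ _ s k); [exact: srad_cont|exact: ck]. Qed.

Let cpoly : continuous (fun y : R => - (y ^+ 4 * (3 - 4 * y) * (1 - y)) / (8 * M ^+ 3)).
Proof.
move=> y; apply: cvgM; last exact: cvg_cst.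
apply: cvgN; apply: cvgM; last by apply: cvgB; [exact: cvg_cst|exact: cvg_id].
apply: cvgM; first exact: exprn_continuous.
by apply: cvgB; [exact: cvg_cst|apply: cvgM; [exact: cvg_cst|exact: cvg_id]].
Qed.

Lemma dpotential_cont : continuous dpotential.
Proof. exact: cont_comp_srad cpoly. Qed.

Lemma AC2_potential : AC2 (potential M) dpotential.
Proof. exact: AC2_C1 der_potential dpotential_cont. Qed.

Lemma potential_bounds x : 0 <= potential M x <= (4 * M ^+ 2)^-1 /\
  `|dpotential x| <= 3 * (8 * M ^+ 3)^-1.
Proof.
have [s0 s1] := srad_itv x; set t := s x in s0 s1 *.
have t0 := ltW s0; have t1 := ltW s1; have t2 : 0 <= 1 - t by lra.
have X n : 0 <= t ^+ n <= 1 by rewrite exprn_ge0// exprn_ile1.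
have M3 : 0 <= (8 * M ^+ 3)^-1 by rewrite invr_ge0 mulr_ge0// exprn_ge0// ltW.
have M2 : 0 <= (4 * M ^+ 2)^-1 by rewrite invr_ge0 mulr_ge0// exprn_ge0// ltW.
split.
  rewrite potentialE -/t; have /andP[h1 h2] := X 3%N.
  have k1 : t ^+ 3 * (1 - t) <= 1 * 1 by apply: ler_pM => //; lra.
  apply/andP; split; first exact: mulr_ge0 (mulr_ge0 h1 t2) M2.
  by have := ler_wpM2r M2 k1; rewrite !mul1r.
rewrite /dpotential -/t normrM (ger0_norm M3) ler_wpM2r// normrN.
rewrite (normrM (t ^+ 4 * (3 - 4 * t))) (normrM (t ^+ 4)).
have /andP[h1 h2] := X 4%N; rewrite (ger0_norm h1) (ger0_norm t2).
have h3 : `|3 - 4 * t| <= 3 by rewrite ler_norml; apply/andP; split; lra.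
apply: le_trans (_ : 1 * 3 * 1 <= _); last by lra.
by apply: ler_pM => //; [rewrite mulr_ge0|apply: ler_pM|lra].
Qed.

Definition xpeak : R := 8 / 3 * M + 2 * M * ln (8 / 3 * M - 2 * M).

Lemma srad_peak : s xpeak = 3 / 4.
Proof. by rewrite /srad /xpeak arealK; [field; rewrite gt_eqF|have := M0; lra]. Qed.

Definition vpeak : R := (3 / 4) ^+ 3 / (16 * M ^+ 2).

Lemma potential_peak : potential M xpeak = vpeak.
Proof. by rewrite potentialE srad_peak /vpeak; field; rewrite gt_eqF. Qed.

Lemma vpeak_gt0 : 0 < vpeak.
Proof. by apply: divr_gt0; [apply: exprn_gt0; lra|apply: mulr_gt0 => //; apply: exprn_gt0]. Qed.

Definition theta x := 3 * (1 - s x) / s x.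

Lemma theta_gt0 x : 0 < theta x.
Proof. by have [? ?] := srad_itv x; rewrite divr_gt0// mulr_gt0// subr_gt0. Qed.

Lemma srad_theta x : s x = 3 / (3 + theta x).
Proof.
by have [s0 ?] := srad_itv x; rewrite /theta; field; rewrite gt_eqF//= gt_eqF//; lra.
Qed.

(* The substitution r = 2 M (1 + theta / 3), theta = 1 at the peak of V. *)
Lemma tortoise_theta x : x - xpeak = 2 * M * ((theta x - 1) / 3 + ln (theta x)).
Proof.
have [h1 h2] := areal_radiusP x M0; have rx := areal_gt0 x; have th := theta_gt0 x.
have e1 : r x = 2 * M * (1 + theta x / 3).
  by rewrite /theta /srad; field; rewrite gt_eqF//= gt_eqF.
have e2 : r x - 2 * M = (8 / 3 * M - 2 * M) * theta x by rewrite e1; field.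
have p : 0 < 8 / 3 * M - 2 * M by have := M0; lra.
by rewrite -{1}h2 e2 /xpeak lnM ?posrE//  e1; field.
Qed.

Lemma theta_sign x : (x < xpeak) = (theta x < 1).
Proof.
have th := theta_gt0 x; rewrite -subr_lt0 tortoise_theta.
have M2 : 0 < 2 * M by rewrite mulr_gt0.
rewrite pmulr_rlt0//; apply/idP/idP => [|t1].
  apply: contraTT; rewrite -!leNgt => t1.
  by rewrite addr_ge0 ?ln_ge0// divr_ge0// subr_ge0.
have := @ln_lt0 R (theta x); rewrite th t1 => /(_ isT); lra.
Qed.

Definition vrel x := potential M x / vpeak.
Local Notation W := vrel.

Lemma vrelE x : W x = 4 * (4 / 3) ^+ 3 * (s x ^+ 3 * (1 - s x)).
Proof. by rewrite /vrel potentialE /vpeak; field; rewrite gt_eqF. Qed.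

Lemma vrel_itv x : 0 <= W x <= 1.
Proof.
have [s0 s1] := srad_itv x; set t := s x in s0 s1 *; rewrite vrelE -/t; apply/andP; split.
  have t3 : 0 <= t ^+ 3 by rewrite exprn_ge0// ltW.
  have t4 : 0 <= 1 - t by lra.
  have := mulr_ge0 t3 t4; lra.
(* 1 - W has a double zero at the maximum t = 3/4; the remaining quadratic factor is positive. *)
have : 0 <= (4 * t - 3) ^+ 2 * (16 * t ^+ 2 + 8 * t + 3).
  have t2 := sqr_ge0 t; apply: mulr_ge0; [exact: sqr_ge0|lra].
have -> : (4 * t - 3) ^+ 2 * (16 * t ^+ 2 + 8 * t + 3) = 27 * (1 - 4 * (4 / 3) ^+ 3 * (t ^+ 3 * (1 - t))).
  by field.
lra.
Qed.

(** The derivative of V is bounded and W = 1 at the peak. This feeds the fourth condition of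
    [admissible] close to the peak. *)
Lemma vrel_lip x : 1 - W x <= 3 * (8 * M ^+ 3)^-1 / vpeak * `|x - xpeak|.
Proof.
have v0 := vpeak_gt0; have [_ HV] := AC2_potential.1.
have C0 : 0 <= 3 * (8 * M ^+ 3)^-1 by rewrite mulr_ge0// invr_ge0 mulr_ge0// exprn_ge0// ltW.
set C := 3 * _ in C0 *.
have lC : loc (fun=> C) by apply: loc_cont; exact: cst_continuous.
have ld := loc_cont dpotential_cont.
have key a b : a <= b -> `|potential M b - potential M a| <= C * `|b - a|.
  move=> ab; rewrite HV//; apply: le_trans (norm_II _ _ ld) _.
  rewrite (ger0_norm (_ : 0 <= b - a)) ?subr_ge0// -II_cst//.
  by apply: le_II => //; [exact: loc_norm|move=> z _; have [] := potential_bounds z].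
rewrite mulrAC ler_pdivlMr// mulrBl mul1r {1}/vrel divfK ?gt_eqF// -potential_peak.
apply: le_trans (ler_norm _) _.
case: (leP x xpeak) => [/key|/ltW/key]; rewrite -/C.
  by rewrite [`|x - _|]distrC.
by rewrite [leLHS]distrC.
Qed.

(** Towards infinity W is at most a multiple of theta^-3 while |x - xpeak| grows at most linearly in
    theta. Towards the horizon W is at most a multiple of theta while |x - xpeak| grows like |ln
    theta|, so the decay there is exponential. *)
Lemma vrel_decay : exists2 B : R, 0 <= B & forall x, W x * `|x - xpeak| ^+ 3 <= B.
Proof.
(* The sum of the bounds [A1] and [A2] for the regions theta >= 1 and theta < 1. *)
exists (4 * (4 / 3) ^+ 3 * 27 * ((2 * M) ^+ 3 * 64 / 27) + 4 / 3 * (4 / 3) ^+ 3 * (2 * M) ^+ 3 * 4 * 28).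
  have : 0 <= (2 * M) ^+ 3 by rewrite exprn_ge0// mulr_ge0// ltW.
  lra.
have M3 : 0 <= (2 * M) ^+ 3 by rewrite exprn_ge0// mulr_ge0// ltW.
move=> x; have th := theta_gt0 x; have [s0 s1] := srad_itv x.
have M2 : 0 < 2 * M by rewrite mulr_gt0.
set th' := theta x in th *.
have es : s x = 3 / (3 + th') := srad_theta x.
have th3 : 0 < 3 + th' by lra.
have e1s : 1 - s x = th' / (3 + th') by rewrite es; field; rewrite gt_eqF.
have /andP[W0 W1] := vrel_itv x.
set A1 := 4 * (4 / 3) ^+ 3 * 27 * _; set A2 := 4 / 3 * (4 / 3) ^+ 3 * _ * _ * _.
have A10 : 0 <= A1 by rewrite /A1; lra.
have A20 : 0 <= A2 by rewrite /A2; lra.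
rewrite tortoise_theta -/th'.
case: (ltP th' 1) => t1; last first.
  apply: (@le_trans _ _ A1); last by lra.
  have l0 : 0 <= ln th' by exact: ln_ge0.
  have l1 : ln th' <= th' - 1.
    by have := @le_ln1Dx R (th' - 1); rewrite addrCA subrr addr0; apply; lra.
  have y0 : 0 <= (th' - 1) / 3 + ln th' by rewrite addr_ge0// divr_ge0// subr_ge0.
  rewrite ger0_norm; last by rewrite mulr_ge0// ltW.
  have y1 : (2 * M * ((th' - 1) / 3 + ln th')) ^+ 3 <= (2 * M * (4 / 3 * th')) ^+ 3.
    rewrite lerXn2r ?nnegrE//; [by apply: mulr_ge0 => //; exact: ltW|by apply: mulr_ge0; [exact: ltW|lra]|].
    by rewrite ler_wpM2l ?(ltW M2)//; lra.
  have w1 : W x <= 4 * (4 / 3) ^+ 3 * (27 / th' ^+ 3).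
    rewrite vrelE; apply: ler_wpM2l; first by lra.
    apply: (@le_trans _ _ (s x ^+ 3 * 1)).
      by rewrite ler_wpM2l ?exprn_ge0 ?(ltW s0)//; lra.
    rewrite mulr1 es expr_div_n ler_pdivrMr ?exprn_gt0// mulrAC ler_pdivlMr ?exprn_gt0//.
    rewrite (_ : 3 ^+ 3 = 27 :> R); last by ring.
    by rewrite ler_wpM2l// lerXn2r ?nnegrE ?(ltW th) ?(ltW th3)//; lra.
  apply: le_trans (ler_pM W0 _ w1 y1) _.
    by rewrite exprn_ge0// mulr_ge0// ltW.
  rewrite /A1; apply: le_of_eq; field; by rewrite gt_eqF.
apply: (@le_trans _ _ A2); last by lra.
set L := - ln th'.
have L0 : 0 < L by rewrite oppr_gt0 ln_lt0// th.
have y1 : `|2 * M * ((th' - 1) / 3 + ln th')| <= 2 * M * (1 / 3 + L).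
  rewrite normrM (ger0_norm (ltW M2)) ler_wpM2l ?(ltW M2)// ler_norml /L.
  by apply/andP; split; rewrite /L in L0 *; lra.
have y3 : `|2 * M * ((th' - 1) / 3 + ln th')| ^+ 3 <= (2 * M * (1 / 3 + L)) ^+ 3.
  by rewrite lerXn2r ?nnegrE// mulr_ge0 ?(ltW M2)//; lra.
have w1 : W x <= 4 * (4 / 3) ^+ 3 * (th' / 3).
  rewrite vrelE; apply: ler_wpM2l; first by lra.
  apply: (@le_trans _ _ (1 * (1 - s x))).
    by rewrite ler_wpM2r ?exprn_ile1 ?(ltW s0) ?(ltW s1)//; lra.
  by rewrite mul1r e1s ler_wpM2l ?(ltW th)// lef_pV2 ?posrE//; lra.
apply: le_trans (ler_pM W0 _ w1 y3) _; first by rewrite exprn_ge0.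
have tL : th' * L ^+ 3 <= 27.
  have e : th' = expR (- L) by rewrite opprK lnK// posrE.
  (* The cube of exp(L / 3) >= L / 3 gives exp(L) >= L^3 / 27. *)
  have h := @expR_ge1Dx R (L / 3).
  have h3 : (L / 3) ^+ 3 <= expR (L / 3) ^+ 3.
    by rewrite lerXn2r ?nnegrE ?expR_ge0 ?divr_ge0 ?(ltW L0)//; lra.
  rewrite -expRM_natl in h3.
  have e3 : expR (3%:R * (L / 3)) = expR L by congr expR; field.
  rewrite e3 expr_div_n ler_pdivrMr ?exprn_gt0// in h3.
  rewrite e expRN mulrC ler_pdivrMr ?expR_gt0//; apply: le_trans h3 _.
  by rewrite mulrC; apply: le_of_eq; congr (_ * _); ring.
have c3 : (1 / 3 + L) ^+ 3 <= 4 * (1 / 27 + L ^+ 3).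
  rewrite -subr_ge0 (_ : _ - _ = 3 * (1 / 3 + L) * (1 / 3 - L) ^+ 2); last by field.
  by rewrite mulr_ge0 ?sqr_ge0// mulr_ge0//; lra.
have c4 : th' * (1 / 3 + L) ^+ 3 <= 4 * 28.
  apply: le_trans (ler_wpM2l (ltW th) c3) _.
  rewrite mulrCA ler_wpM2l// mulrDr; apply: le_trans (_ : 1 + 27 <= _); last by lra.
  by apply: lerD => //; lra.
have k0 : 0 <= 4 / 3 * (4 / 3) ^+ 3 * (2 * M) ^+ 3 by lra.
apply: le_trans (le_trans _ (ler_wpM2l k0 c4)) _; apply: le_of_eq; first by field.
by rewrite /A2; ring.
Qed.

End areal_geometry.

(** * The multiplier *)

Section piecewise.
Context {R : realType}.
Notation mu := (@lebesgue_measure R).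
Implicit Types (f df dg : R -> R) (x c a b : R).

(** The value of a derivative at one point is immaterial: the square of the sign function, which is
    0 at the peak, can be replaced by 1. *)
Lemma AC2_ae f df dg : AC2 f df -> loc2 dg -> {ae mu, forall x, df x = dg x} -> AC2 f dg.
Proof.
move=> [[ldf HA] l2] ldg e; split => //; have lg := loc2_loc ldg; split => // a b ab.
by rewrite HA//; exact: II_ae.
Qed.

Lemma norm_sg_le1 x : `|Num.sg x| <= 1.
Proof. by rewrite normr_sg; case: (x != 0). Qed.

Lemma measurable_sg c : measurable_fun setT (fun x : R => Num.sg (x - c)).
Proof.
apply: nondecreasing_measurable => // x y xy.
case: (ltgtP y c) => h.
- by rewrite !ltr0_sg ?subr_lt0//; apply: le_lt_trans xy h.
- rewrite [leRHS]gtr0_sg ?subr_gt0//; exact: le_trans (ler_norm _) (norm_sg_le1 _).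
- rewrite h subrr sgr0 sgr_le0; lra.
Qed.

Lemma sg_subE x c : x != c -> Num.sg (x - c) = if c <= x then 1 else -1.
Proof.
rewrite -subr_eq0 -subr_ge0 => xc.
case: (leP 0 (x - c)) => h; last by rewrite ltr0_sg.
by rewrite gtr0_sg// lt_neqAle eq_sym xc.
Qed.

(** The zero of f at c removes the jump of the sign; on either side of c the product is f or -f. *)
Lemma AC2_sg f df c : AC2 f df -> f c = 0 ->
  AC2 (fun x => Num.sg (x - c) * f x) (fun x => Num.sg (x - c) * df x).
Proof.
move=> [[lf HA] l2] fc.
have ms := measurable_sg c; have bs (x : R) := norm_sg_le1 (x - c).
have ls : loc (fun x => Num.sg (x - c) * df x) by exact: loc_bdM bs lf.
split; last by apply: loc2_bd => // a b; exists 1 => x _.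
split => // a b ab.
(* Two versions of the sign, almost everywhere equal, that differ at c: [m1] is constant on closed
   intervals starting at c, [m2] on those ending there. *)
pose m1 x : R := if c <= x then 1 else -1; pose m2 x : R := if c < x then 1 else -1.
have nd (m : R -> R) : nondecreasing_fun m -> (forall x, `|m x| <= 1) -> loc (fun x => m x * df x).
  by move=> mm m1'; apply: loc_bdM m1' lf; exact: nondecreasing_measurable.
have l1 : loc (fun x => m1 x * df x).
  apply: nd => [x y xy|x]; rewrite /m1; last by case: ifP; rewrite ?normrN normr1.
  by case: (leP c x) => cx; case: (leP c y) => cy //; try lra; rewrite lerN10.
have l2' : loc (fun x => m2 x * df x).
  apply: nd => [x y xy|x]; rewrite /m2; last by case: ifP; rewrite ?normrN normr1.
  by case: (ltP c x) => cx; case: (ltP c y) => cy //; try lra; rewrite lerN10.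
have E1 a' b' : II a' b' (fun x => Num.sg (x - c) * df x) = II a' b' (fun x => m1 x * df x).
  apply: II_ae => //; apply: ae_imply (ae_neq c) => x xc; congr (_ * _).
  exact: sg_subE.
have E2 a' b' : II a' b' (fun x => Num.sg (x - c) * df x) = II a' b' (fun x => m2 x * df x).
  apply: II_ae => //; apply: ae_imply (ae_neq c) => x xc; congr (_ * _); rewrite /m2.
  by rewrite sg_subE// lt_neqAle eq_sym xc.
have F x : Num.sg (x - c) * f x = if c <= x then f x else - f x.
  case: (eqVneq x c) => [->|xc]; first by rewrite subrr sgr0 mul0r fc oppr0 if_same.
  by rewrite sg_subE//; case: ifP; rewrite ?mul1r ?mulN1r.
have R1 a' b' : c <= a' -> a' <= b' -> II a' b' (fun x => Num.sg (x - c) * df x) = f b' - f a'.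
  move=> ca ab'; rewrite E1 HA//; apply: eq_II => x /andP[ax _].
  by rewrite /m1 (le_trans ca ax) mul1r.
have R2 a' b' : b' <= c -> a' <= b' -> II a' b' (fun x => Num.sg (x - c) * df x) = - (f b' - f a').
  move=> bc ab'; rewrite E2 HA// -IIN//; apply: eq_II => x /andP[_ xb].
  by rewrite /m2 ltNge (le_trans xb bc) /= mulN1r.
rewrite !F; case: (leP c a) => ca.
  by rewrite (le_trans ca ab) R1.
case: (leP c b) => cb.
  rewrite (II_split ls (_ : a <= c <= b)) ?(ltW ca) ?cb//.
  rewrite (R1 c b (lexx c) cb) (R2 a c (lexx c) (ltW ca)) fc; ring.
by rewrite R2 ?(ltW cb)//; ring.
Qed.

Lemma AC2_abs c : AC2 (fun x => `|x - c|) (fun x => Num.sg (x - c)).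
Proof.
have h : AC2 (fun x => x - c) (fun=> 1).
  apply: AC2_C1; last exact: cst_continuous.
  by move=> x; apply: der_eq (derB (der_id x) (der_cst c x)) _; rewrite subr0.
have := AC2_sg h (subrr c); move/AC2_eq; apply; apply/funext => x; last by rewrite mulr1.
by rewrite -normrEsg.
Qed.

End piecewise.

Section bounded_functions.
Context {R : realType}.
Implicit Types f g : R -> R.

Definition bounded_by f (C : R) := forall x : R, `|f x| <= C.
Definition bdd f := exists C : R, bounded_by f C.

Lemma bdd_cst (c : R) : bdd (fun=> c). Proof. by exists `|c|. Qed.

Lemma bddD f g : bdd f -> bdd g -> bdd (fun x => f x + g x).
Proof. by move=> [C fC] [D gD]; exists (C + D) => x; apply: le_trans (ler_normD _ _) (lerD _ _). Qed.

Lemma bddM f g : bdd f -> bdd g -> bdd (fun x => f x * g x).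
Proof. by move=> [C fC] [D gD]; exists (C * D) => x; rewrite normrM ler_pM. Qed.

Lemma bddN f : bdd f -> bdd (fun x => - f x).
Proof. by move=> [C fC]; exists C => x; rewrite normrN. Qed.

Lemma bddB f g : bdd f -> bdd g -> bdd (fun x => f x - g x).
Proof. by move=> bf bg; apply: bddD => //; exact: bddN. Qed.

Lemma bounded_by_le f C D : C <= D -> bounded_by f C -> bounded_by f D.
Proof. by move=> CD fC x; exact: le_trans CD. Qed.

Lemma common_bound (s : seq (R -> R)) : (forall f, List.In f s -> bdd f) ->
  exists2 C : R, 0 <= C & forall f, List.In f s -> bounded_by f C.
Proof.
elim: s => [_|f s IH H]; first by exists 0.
have [|C C0 sC] := IH; first by move=> g gs; apply: H; right.
have [|D fD] := H f; first by left.
exists (C + `|D|); first exact: addr_ge0.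
move=> g [<-|/sC gC]; first by apply: bounded_by_le fD; rewrite ler_wpDl ?ler_norm.
by apply: bounded_by_le gC; rewrite lerDl.
Qed.

End bounded_functions.

(** A is the geometric mean of the outer coefficients, so |k| <= 2 A is the discriminant condition
    k^2 <= 4 Z D; the proof completes the square after multiplying by Z. *)
Lemma quadratic_form_ge0 (R : realType) (Z A D k X Y : R) : 0 < Z -> A ^+ 2 = Z * D ->
  `|k| <= 2 * A -> 0 <= Z * X ^+ 2 + k * (X * Y) + D * Y ^+ 2.
Proof.
move=> Z0 AE kA; rewrite -(pmulr_rge0 _ Z0).
have A0 : 0 <= A by have := le_trans (normr_ge0 k) kA; lra.
have k2 : k ^+ 2 <= (2 * A) ^+ 2.
  by rewrite -(real_normK (num_real k)) lerXn2r ?nnegrE// mulr_ge0.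
have -> : Z * (Z * X ^+ 2 + k * (X * Y) + D * Y ^+ 2) =
  (Z * X + k / 2 * Y) ^+ 2 + (Z * D - k ^+ 2 / 4) * Y ^+ 2 by field.
rewrite -AE addr_ge0 ?sqr_ge0// mulr_ge0 ?sqr_ge0//.
have : (2 * A) ^+ 2 = 4 * A ^+ 2 by ring.
lra.
Qed.

(** * Construction of the multiplier and positivity of the quadratic form *)

Section multiplier_construction.
Context {R : realType}.
Variable M : R.
Hypothesis M0 : 0 < M.
Implicit Types (x y X Y : R).
Local Notation x0 := (xpeak M).
Local Notation W := (vrel M).
Local Notation vp := (vpeak M).
Local Notation s := (srad M).
Local Notation V := (potential M).
Local Notation dV := (dpotential M).

(* Every [eps] small enough qualifies.  The four conditions are what
   [mass_weight_le] and [mult_abs_decay] use: the third says that V / vpeak decays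
   faster than z^(-3), the fourth that V is flat enough near its peak. *)
Definition admissible (eps : R) := [/\ 0 < eps, 2 * M * eps <= 1 / 10,
  forall x, W x * (1 + eps * `|x - x0|) ^+ 3 <= 2 &
  forall x, 2 * eps * (1 - W x) / vp <= 1 / (1 + eps * `|x - x0|) * `|x - x0| ].

Lemma admissible_exists : exists eps, admissible eps.
Proof.
have [B B0 HB] := vrel_decay M0; have v0 := vpeak_gt0 M0.
pose C := 3 * (8 * M ^+ 3)^-1 / vp.
have C0 : 0 <= C.
  apply: divr_ge0; last exact: ltW.
  by apply: mulr_ge0 => //; rewrite invr_ge0; apply: mulr_ge0 => //; apply: exprn_ge0; exact: ltW.
(* Each requirement on e = 1 / T is of the form e S <= 1 and S is dominated by T. The 7 is 3 + 3 +
   1, the coefficients of (1 + e y)^3 beyond the constant; the last two summands serve the fourth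
   condition near and far from the peak. *)
pose T := 1 + 20 * M + 7 * (1 + B) + 4 * C / vp + 4 / vp.
have T1 : 0 <= 4 * C / vp by apply: divr_ge0; [lra|exact: ltW].
have T2 : 0 <= 4 / vp by apply: divr_ge0; [lra|exact: ltW].
have T0 : 0 < T by rewrite /T; have := M0; lra.
pose e := T^-1; have e0 : 0 < e by rewrite invr_gt0.
have eT : e * T = 1 by rewrite /e mulVf// gt_eqF.
have eS (S : R) : S <= T -> e * S <= 1 by move=> ST; rewrite -eT ler_wpM2l// ltW.
have m0 := M0.
exists e; split => //.
- have : e * (20 * M) <= 1 by apply: eS; rewrite /T; lra.
  lra.
- move=> x; have /andP[W0 W1] := vrel_itv M0 x; have Wy := HB x.
  set w := W x in W0 W1 Wy *; set y := `|x - x0| in Wy *; have y0 : 0 <= y := normr_ge0 _.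
  have e1 : e <= 1 by have := eS 1; rewrite mulr1; apply; rewrite /T; lra.
  have eB : 7 * (e * (1 + B)) <= 1 by have : e * (7 * (1 + B)) <= 1 by [apply: eS; rewrite /T; lra]; lra.
  have k1 : w * y <= 1 + B.
    case: (leP y 1) => hy; first by have := ler_pM W0 y0 W1 hy; lra.
    have : w * y <= w * y ^+ 3.
      rewrite ler_wpM2l// -{1}(expr1 y) ler_weXn2l// ltW//.
    lra.
  have k2 : w * y ^+ 2 <= 1 + B.
    case: (leP y 1) => hy.
      have : w * y ^+ 2 <= 1 * 1 by apply: ler_pM => //; [exact: exprn_ge0|exact: exprn_ile1].
      lra.
    have : w * y ^+ 2 <= w * y ^+ 3.
      by rewrite ler_wpM2l// ler_weXn2l// ltW.
    lra.
  have -> : w * (1 + e * y) ^+ 3 = w + 3 * (e * (w * y)) + 3 * (e * (e * (w * y ^+ 2))) + e * (e * (e * (w * y ^+ 3))).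
    by ring.
  have ge a b : 0 <= a -> a <= b -> 0 <= e * a /\ e * a <= e * b.
    by move=> a0 ab; split; [apply: mulr_ge0 => //; exact: ltW|rewrite ler_wpM2l// ltW].
  have lee a : 0 <= a -> e * a <= a by move=> a0; rewrite -[leRHS]mul1r ler_wpM2r.
  have B1 : 0 <= 1 + B by lra.
  have [_ j1] := ge _ _ (mulr_ge0 W0 y0) k1.
  have [j2' j2] := ge _ _ (mulr_ge0 W0 (exprn_ge0 2 y0)) k2.
  have j3 := le_trans (lee _ j2') j2.
  have k3 : w * y ^+ 3 <= 1 + B by lra.
  have [j4' j4] := ge _ _ (mulr_ge0 W0 (exprn_ge0 3 y0)) k3.
  have j5' : 0 <= e * (e * (w * y ^+ 3)) by apply: mulr_ge0 => //; exact: ltW.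
  have j5 := le_trans (lee _ j5') (le_trans (lee _ j4') j4).
  lra.
- move=> x; have /andP[W0 W1] := vrel_itv M0 x; have Wl := vrel_lip M0 x; rewrite -/C in Wl.
  set w := W x in W0 W1 Wl *; set y := `|x - x0| in Wl *; have y0 : 0 <= y := normr_ge0 _.
  have ey : 0 <= e * y by apply: mulr_ge0 => //; exact: ltW.
  have z0 : 0 < 1 + e * y by lra.
  have vi : 0 <= vp^-1 by rewrite invr_ge0 ltW.
  (* Within distance 1 / e of the peak the Lipschitz bound decides. Beyond it the left side is at
     most 1/2, and y / (1 + e y) is at least 1/2 because e <= 1. *)
  case: (leP (e * y) 1) => h.
    have h1 : 1 / 2 <= 1 / (1 + e * y) by rewrite !div1r lef_pV2 ?posrE//; lra.
    apply: (@le_trans _ _ (1 / 2 * y)); last by rewrite ler_wpM2r.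
    have h2 : e * (4 * C / vp) <= 1 by apply: eS; rewrite /T; lra.
    have h3 : 2 * e * (1 - w) / vp <= 2 * e * (C * y) / vp.
      by rewrite ler_wpM2r// ler_wpM2l//; lra.
    have h4 : e * (4 * C / vp) * y <= 1 * y by rewrite ler_wpM2r.
    have h5 : 2 * e * (C * y) / vp = 1 / 2 * (e * (4 * C / vp) * y) by field; rewrite gt_eqF.
    lra.
  have h1 : e * (4 / vp) <= 1 by apply: eS; rewrite /T; lra.
  have e1 : e <= 1 by have := eS 1; rewrite mulr1; apply; rewrite /T; lra.
  rewrite (_ : 1 / (1 + e * y) * y = y / (1 + e * y)); last by field; rewrite gt_eqF.
  rewrite ler_pdivlMr//.
  have h2 : 2 * e * (1 - w) / vp <= 1 / 2.
    have h3 : (1 - w) * (e * (4 / vp)) <= 1 * 1.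
      apply: ler_pM => //; [lra|apply: mulr_ge0 => //; exact: ltW|lra].
    have -> : 2 * e * (1 - w) / vp = 1 / 2 * ((1 - w) * (e * (4 / vp))) by field; rewrite gt_eqF.
    lra.
  apply: (@le_trans _ _ (1 / 2 * (1 + e * y))); first by rewrite ler_wpM2r// ltW.
  have : e * y <= 1 * y by rewrite ler_wpM2r.
  lra.
Qed.

Variables (sigma eps : R).
Hypotheses (sigma1 : 1 < 2 * sigma) (sigma2 : sigma <= 1) (heps : admissible eps).

Let e0 : 0 < eps. Proof. by case: heps. Qed.
Let v0 : 0 < vp. Proof. exact: vpeak_gt0. Qed.
Let sigma0 : 0 < sigma. Proof. by have := sigma1; lra. Qed.

Definition zdist x := 1 + eps * `|x - x0|.
Definition zpow a x := zdist x `^ a.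
Local Notation z := zdist.

Lemma zdist_ge1 x : 1 <= z x.
Proof. by rewrite /zdist lerDl mulr_ge0// ltW. Qed.

Lemma zdist_gt0 x : 0 < z x. Proof. exact: lt_le_trans (zdist_ge1 x). Qed.

Lemma zpow_gt0 a x : 0 < zpow a x. Proof. exact: powR_gt0 (zdist_gt0 x). Qed.

Lemma zpow_le1 a x : a <= 0 -> zpow a x <= 1.
Proof. by move=> a0; have := ler_powR (zdist_ge1 x) a0; rewrite powRr0. Qed.

Lemma zpowB1 a x : zpow (a - 1) x = zpow a x / z x.
Proof.
have z0 := zdist_gt0 x.
rewrite /zpow powRB; first by rewrite powRr1// ltW.
by apply/implyP => _; rewrite gt_eqF.
Qed.

Lemma AC2_zpow a : AC2 (zpow a) (fun x => a * eps * (Num.sg (x - x0) * zpow (a - 1) x)).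
Proof.
have h := AC2Z eps (AC2_abs x0).
have pos (y : R) : 0 <= y -> 0 < 1 + y by move=> ?; lra.
have d1 (y : R) : is_derive y (1 : R) (fun w => 1 + w) 1.
  by apply: der_eq (derD (der_cst 1 y) (der_id y)) _; rewrite add0r.
have dk b (y : R) : 0 <= y -> is_derive y (1 : R) (fun w => (1 + w) `^ b) (b * (1 + y) `^ (b - 1)).
  move=> y0; have := @der_comp _ (fun w => w `^ b) (fun w => 1 + w) y _ _ (is_derive1_powR b (pos y y0)) (d1 y).
  by rewrite mulr1.
have := @AC2_chain _ true (fun y => (1 + y) `^ a) (fun y => a * (1 + y) `^ (a - 1)) _ _ h.
move/(_ _ _ _)/AC2_eq; apply.
- by move=> x _; apply: mulr_ge0 => //; exact: ltW.
- by move=> y /(_ isT); exact: dk.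
- move=> y /(_ isT) y0; apply: cvgM; first exact: cvg_cst.
  have [d _] := dk (a - 1) y y0.
  have c : {for y, continuous (fun w : R => (1 + w) `^ (a - 1))}.
    by apply: differentiable_continuous; rewrite -derivable1_diffP.
  exact: c.
- by [].
- by apply/funext => x; rewrite /zpow /zdist; ring.
Qed.

Let tau := 2 * sigma - 1.
Let tau0 : 0 < tau. Proof. by rewrite /tau; have := sigma1; lra. Qed.
Let tau1 : tau <= 1. Proof. by rewrite /tau; have := sigma2; lra. Qed.

(** The integral of z^(-2 sigma) over the distance from the peak; it stays bounded because 2 sigma >
    1. *)
Definition mult_abs x := (1 - zpow (1 - 2 * sigma) x) / (eps * tau).
Definition mult x := Num.sg (x - x0) * mult_abs x.
Definition dmult := zpow (- (2 * sigma)).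
Definition ddmult x := - (2 * sigma * eps) * (Num.sg (x - x0) * zpow (- (2 * sigma) - 1) x).

Lemma zpow_peak a : zpow a x0 = 1.
Proof. by rewrite /zpow /zdist subrr normr0 mulr0 addr0 powR1. Qed.

Lemma AC2_dmult : AC2 dmult ddmult.
Proof.
by apply: AC2_eq (AC2_zpow _) _ _ => //; apply/funext => x; rewrite /ddmult; ring.
Qed.

Lemma AC2_mult : AC2 mult dmult.
Proof.
have h1 := AC2B (AC2_cst 1) (AC2_zpow (1 - 2 * sigma)).
have h2 := AC2Z (eps * tau)^-1 h1.
have z0 : (eps * tau)^-1 * (1 - zpow (1 - 2 * sigma) x0) = 0.
  by rewrite zpow_peak subrr mulr0.
apply: (@AC2_ae _ _ _ _ (AC2_eq (AC2_sg h2 z0) _ erefl)).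
- by apply/funext => x; rewrite /mult /mult_abs; ring.
- exact: loc2_cont (AC2_cont AC2_dmult).
- apply: ae_imply (ae_neq x0) => x xc; rewrite /dmult.
  have sg2 : Num.sg (x - x0) * Num.sg (x - x0) = 1 by rewrite sg_subE//; case: ifP => _; ring.
  have -> : zpow (- (2 * sigma)) x = zpow (1 - 2 * sigma - 1) x by congr (zpow _ x); ring.
  set A := zpow _ x.
  have -> : Num.sg (x - x0) * ((eps * tau)^-1 * (0 - (1 - 2 * sigma) * eps * (Num.sg (x - x0) * A))) =
    (Num.sg (x - x0) * Num.sg (x - x0)) * ((eps * tau)^-1 * (tau * eps) * A).
    by rewrite /tau; ring.
  rewrite sg2; field; by rewrite !gt_eqF.
Qed.

Lemma mult_abs_bounds x : [/\ `|x - x0| / z x <= mult_abs x, mult_abs x <= `|x - x0| &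
  mult_abs x <= (eps * tau)^-1].
Proof.
have z0 := zdist_gt0 x; have z1 := zdist_ge1 x.
have et : 0 < eps * tau by rewrite mulr_gt0.
set L := ln (z x).
have eL : expR L = z x by rewrite lnK.
have zE a : zpow a x = expR (a * L) by rewrite /zpow /powR gt_eqF.
have ey : eps * `|x - x0| = z x - 1 by rewrite /zdist; ring.
have t0 := tau0; have t1 := tau1.
have eT : 1 - 2 * sigma = - tau by rewrite /tau; ring.
split.
- rewrite /mult_abs eT zE mulNr ler_pdivlMr//.
  have -> : `|x - x0| / z x * (eps * tau) = tau * (1 - (z x)^-1).
    rewrite (_ : `|x - x0| / z x * (eps * tau) = eps * `|x - x0| / z x * tau); last by ring.
    rewrite ey; field; by rewrite gt_eqF.
  have -> : (z x)^-1 = expR (- L) by rewrite expRN eL.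
  set c := expR (- (tau * L)).
  have c0 : 0 < c := expR_gt0 _.
  (* The weighted mean inequality z^(-tau) <= tau z^(-1) + (1 - tau), assembled from two
     tangent-line bounds for the exponential with weights tau and 1 - tau. *)
  have h1 : c * (1 + (- L + tau * L)) <= expR (- L).
    have := @expR_ge1Dx R (- L + tau * L) => /(ler_wpM2l (ltW c0))/le_trans; apply.
    by rewrite -expRD; apply: le_of_eq; congr expR; ring.
  have h2 : c * (1 + tau * L) <= 1.
    have := @expR_ge1Dx R (tau * L) => /(ler_wpM2l (ltW c0))/le_trans; apply.
    by rewrite -expRD addNr expR0.
  have k1 := ler_wpM2l (ltW t0) h1.
  have k2 := ler_wpM2l (_ : 0 <= 1 - tau) h2; rewrite subr_ge0 t1 in k2; have := k2 isT.
  have : tau * (c * (1 + (- L + tau * L))) + (1 - tau) * (c * (1 + tau * L)) = c by ring.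
  lra.
- rewrite /mult_abs eT zE ler_pdivrMr//.
  have -> : `|x - x0| * (eps * tau) = tau * (z x - 1) by rewrite -ey; ring.
  have h1 := @expR_ge1Dx R (- tau * L).
  have h2 : L <= z x - 1 by have := @expR_ge1Dx R L; rewrite eL; lra.
  have := ler_wpM2l (ltW t0) h2; lra.
- rewrite /mult_abs -[leRHS]mul1r ler_wpM2r ?invr_ge0 ?(ltW et)//.
  by have := zpow_gt0 (1 - 2 * sigma) x; lra.
Qed.

(* Up to a factor, the primitive of the zeroth order term that compensates g''
   far from the peak, where V / vpeak <= 2 z^(-3), and that vanishes at the peak. *)
Definition corr x := eps * sigma * (Num.sg (x - x0) *
  (1 - (1 - W x) ^+ 2 - zpow (- (2 * sigma) - 1) x)).
Definition dcorr x := eps * sigma * (Num.sg (x - x0) * (2 * (1 - W x) * (dV x / vp)) +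
  (2 * sigma + 1) * eps * zpow (- (2 * sigma) - 2) x).

Lemma AC2_W : AC2 W (fun x => dV x / vp).
Proof.
apply: AC2_eq (AC2Z vp^-1 (AC2_potential M0)) _ _; apply/funext => x.
- by rewrite /vrel mulrC.
- by rewrite mulrC.
Qed.

Lemma W_peak : W x0 = 1.
Proof. by rewrite /vrel potential_peak// divff// gt_eqF. Qed.

Lemma AC2_corr : AC2 corr dcorr.
Proof.
have h1 := AC2B (AC2_cst 1) (AC2_sqr (AC2B (AC2_cst 1) AC2_W)).
have h2 := AC2B h1 (AC2_zpow (- (2 * sigma) - 1)).
have z0 : 1 - (1 - W x0) ^+ 2 - zpow (- (2 * sigma) - 1) x0 = 0.
  by rewrite zpow_peak W_peak; ring.
have h4 := AC2Z (eps * sigma) (AC2_sg h2 z0).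
have lW := loc2_cont (AC2_cont AC2_W).
have lz := loc2_cont (AC2_cont (AC2_zpow (- (2 * sigma) - 2))).
apply: (@AC2_ae _ _ _ _ (AC2_eq h4 _ erefl)).
- by apply/funext => x.
- apply: loc2Z; apply: loc2D; last exact: loc2Z.
  apply: loc2_bd; [exact: measurable_sg|by move=> a b; exists 1 => x _; exact: norm_sg_le1|].
  apply: loc2_cont => x; apply: cvgM.
    apply: cvgM; first exact: cvg_cst.
    by apply: cvgB; [exact: cvg_cst|exact: (AC2_cont AC2_W)].
  by apply: cvgM; [exact: dpotential_cont|exact: cvg_cst].
- apply: ae_imply (ae_neq x0) => x xc; rewrite /dcorr.
  have sg2 : Num.sg (x - x0) * Num.sg (x - x0) = 1 by rewrite sg_subE//; case: ifP => _; ring.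
  have -> : - (2 * sigma) - 1 - 1 = - (2 * sigma) - 2 by ring.
  set A := zpow _ x.
  congr (_ * _).
  rewrite (_ : _ * (_ - _) = Num.sg (x - x0) * (2 * (1 - W x) * (dV x / vp)) +
    (Num.sg (x - x0) * Num.sg (x - x0)) * ((2 * sigma + 1) * eps * A)); last by ring.
  by rewrite sg2; ring.
Qed.

(** Subtracting g V makes the cross coefficient g'' + 2 corr and the zeroth order coefficient corr'
    - g V'. *)
Definition kappa x := corr x - mult x * V x.
Definition dkappa x := dcorr x - (dmult x * V x + mult x * dV x).
Definition mass_weight x := sigma * eps ^+ 2 * zpow (- (2 * sigma) - 2) x.

Lemma AC2_kappa : AC2 kappa dkappa.
Proof. exact: AC2B AC2_corr (AC2M AC2_mult (AC2_potential M0)). Qed.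

Lemma sg_dpotential x : Num.sg (x - x0) * dV x <= 0.
Proof.
have [s0 s1] := srad_itv M0 x; have th := theta_gt0 M0 x.
have es := srad_theta M0 x.
have k : 0 <= s x ^+ 4 * (1 - s x) / (8 * M ^+ 3).
  apply: divr_ge0; last by apply: mulr_ge0 => //; apply: exprn_ge0; exact: ltW.
  by apply: mulr_ge0; [apply: exprn_ge0; exact: ltW|lra].
have -> : dV x = (4 * s x - 3) * (s x ^+ 4 * (1 - s x) / (8 * M ^+ 3)).
  by rewrite /dpotential; ring.
rewrite (mulrA _ (4 * s x - 3)); apply: mulr_le0_ge0; last exact: k.
have th3 : 0 < 3 + theta M x by lra.
have e4 : 4 * s x - 3 = 3 * (1 - theta M x) / (3 + theta M x) by rewrite es; field; rewrite gt_eqF.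
rewrite e4; case: (ltP x x0) => h.
  rewrite ltr0_sg ?subr_lt0// mulN1r oppr_le0; apply: divr_ge0; last exact: ltW.
  by rewrite (theta_sign M0) in h; lra.
apply: mulr_ge0_le0; first by rewrite sgr_ge0 subr_ge0.
apply: mulr_le0_ge0; last by rewrite invr_ge0 ltW.
by move: h; rewrite leNgt (theta_sign M0) -leNgt; lra.
Qed.

Lemma mass_weight_le x X Y : mass_weight x * Y ^+ 2 <=
  2 * dmult x * X ^+ 2 + (ddmult x + 2 * (kappa x + mult x * V x)) * (X * Y) +
  (dkappa x + dmult x * V x) * Y ^+ 2.
Proof.
have [_ _ c2 c1] := heps; have /andP[W0 W1] := vrel_itv M0 x.
have z0 := zdist_gt0 x; have z1 := zdist_ge1 x.
have [g1 _ _] := mult_abs_bounds x.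
set sg := Num.sg (x - x0); set G := mult_abs x in g1.
pose Z := dmult x; pose A := zpow (- (2 * sigma) - 1) x; pose D := zpow (- (2 * sigma) - 2) x.
have Z0 : 0 < Z := zpow_gt0 _ x.
have AE : A = Z / z x by exact: zpowB1.
have DE : D = Z / z x / z x.
  rewrite -AE /D (_ : - (2 * sigma) - 2 = - (2 * sigma) - 1 - 1); last by ring.
  exact: zpowB1.
have ZD : A ^+ 2 = Z * D by rewrite AE DE; field; rewrite gt_eqF.
set w := W x in W0 W1.
(* The cross coefficient g'' + 2 corr equals 2 sigma eps k. *)
pose k := sg * (1 - (1 - w) ^+ 2 - 2 * A).
have A3 : (z x ^+ 3)^-1 <= A.
  rewrite -powR_invn ?(ltW z0)//; apply: ler_powR => //.
  by have := sigma2; lra.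
(* Here the cubic decay of V meets sigma <= 1. The factor 2 is what puts k between -2 A and 2 A,
   since 1 - (1 - w)^2 lies between 0 and 2 w. *)
have wA : w <= 2 * A.
  apply: (@le_trans _ _ (2 * (z x ^+ 3)^-1)); last by rewrite ler_wpM2l.
  by rewrite ler_pdivlMr ?exprn_gt0//; exact: c2.
have kA : `|k| <= 2 * A.
  rewrite normrM -[leRHS]mul1r; apply: ler_pM => //; first exact: norm_sg_le1.
  have : 0 <= w * (2 - w) by apply: mulr_ge0 => //; lra.
  have : w * (2 - w) <= 2 * w by have := sqr_ge0 w; lra.
  by move=> h1 h2; rewrite ler_norml; apply/andP; split; lra.
have q0 := quadratic_form_ge0 X (sigma * eps * Y) Z0 ZD kA.
(* The derivative of (1 - W)^2 in corr' has the bad sign. It is a multiple of V', like the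
   favourable -g V', and the fourth condition of [admissible] with the lower bound on |g| makes the
   latter win. *)
have N0 : 0 <= eps * sigma * (sg * (2 * (1 - w) * (dV x / vp))) - sg * G * dV x.
  have -> : eps * sigma * (sg * (2 * (1 - w) * (dV x / vp))) - sg * G * dV x =
    - (sg * dV x) * (G - 2 * eps * (1 - w) / vp * sigma) by field; rewrite gt_eqF.
  apply: mulr_ge0; first by rewrite oppr_ge0 sg_dpotential.
  rewrite subr_ge0; apply: le_trans g1; have := c1 x; rewrite -/w -/(z x) => c1x.
  apply: (@le_trans _ _ (2 * eps * (1 - w) / vp)); last by apply: le_trans c1x _; rewrite div1r mulrC.
  have h0 : 0 <= 2 * eps * (1 - w) / vp.
    apply: divr_ge0; last exact: ltW.
    by apply: mulr_ge0; [apply: mulr_ge0 => //; exact: ltW|lra].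
  by rewrite -[leRHS]mulr1 ler_wpM2l.
have := mulr_ge0 N0 (sqr_ge0 Y).
rewrite /kappa /dkappa /dcorr /corr /mass_weight /ddmult /mult -/sg -/G -/w -/A -/D -[dmult x]/Z.
move=> NY; rewrite -subr_ge0.
set lhs := (X in 0 <= X).
(* The coefficient sigma (2 sigma + 1) eps^2 of corr' splits into 2 (sigma eps)^2, which completes
   the quadratic form, and sigma eps^2, which is [mass_weight]. *)
have -> : lhs = 2 * (Z * X ^+ 2 + k * (X * (sigma * eps * Y)) + D * (sigma * eps * Y) ^+ 2) +
   (eps * sigma * (sg * (2 * (1 - w) * (dV x / vp))) - sg * G * dV x) * Y ^+ 2.
  by rewrite /lhs /k; ring.
by apply: addr_ge0 => //; apply: mulr_ge0.
Qed.

(* For x below the peak [ln (theta x)] is minus the distance to the horizon in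
   units of 2 M; the inequality reduces to exp(m - 1/3) >= 4/3 m (1 + m/10)^2,
   which follows from exp y >= 1 + y at y = 8/10 m - 1, 2/3 and m/10. *)
Lemma mult_abs_decay x : x < x0 -> 4 * mult_abs x * (s x * (1 - s x) / (2 * M)) <= dmult x.
Proof.
move=> xx; have th := theta_gt0 M0 x; have t1 := xx; rewrite (theta_sign M0) in t1.
have [_ e10 _ _] := heps; have [s0 s1] := srad_itv M0 x.
have z0 := zdist_gt0 x; have z1 := zdist_ge1 x; have M2 : 0 < 2 * M by rewrite mulr_gt0.
have [_ g2 _] := mult_abs_bounds x.
set t := theta M x in th t1; set L := - ln t; pose m := 1 / 3 + L.
have L0 : 0 < L by rewrite oppr_gt0 ln_lt0// th.
have m0 : 0 < m by rewrite /m; lra.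
have y1 : `|x - x0| <= 2 * M * m.
  rewrite (tortoise_theta M0) -/t normrM (ger0_norm (ltW M2)) ler_wpM2l ?(ltW M2)// ler_norml /m /L.
  by rewrite /L in L0; apply/andP; split; lra.
have zm : z x <= 1 + m / 10.
  rewrite /zdist lerD2l; apply: le_trans (ler_wpM2l (ltW e0) y1) _.
  have := ler_wpM2r (ltW m0) e10; lra.
have ss : s x * (1 - s x) <= t / 3.
  apply: (@le_trans _ _ (1 * (1 - s x))); first by rewrite ler_wpM2r//; lra.
  rewrite mul1r (srad_theta M0) -/t.
  have t3 : 0 < 3 + t by lra.
  have -> : 1 - 3 / (3 + t) = t / (3 + t) by field; rewrite gt_eqF.
  by rewrite ler_wpM2l ?(ltW th)// lef_pV2 ?posrE//; lra.
have big : 4 / 3 * m * (1 + m / 10) ^+ 2 <= expR L.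
  have -> : L = (8 / 10 * m - 1) + (2 / 3 + (m / 10 + m / 10)) by rewrite /m; field.
  rewrite expRD (expRD (2 / 3)) (expRD (m / 10)).
  have h1 := @expR_ge1Dx R (8 / 10 * m - 1); have h2 := @expR_ge1Dx R (2 / 3).
  have h3 := @expR_ge1Dx R (m / 10).
  have h4 : (1 + m / 10) * (1 + m / 10) <= expR (m / 10) * expR (m / 10) by apply: ler_pM => //; lra.
  have h5 : 5 / 3 * ((1 + m / 10) * (1 + m / 10)) <= expR (2 / 3) * (expR (m / 10) * expR (m / 10)).
    by apply: ler_pM => //; [apply: mulr_ge0; lra|lra].
  have h6 : 8 / 10 * m * (5 / 3 * ((1 + m / 10) * (1 + m / 10))) <=
      expR (8 / 10 * m - 1) * (expR (2 / 3) * (expR (m / 10) * expR (m / 10))).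
    apply: ler_pM => //; [lra|apply: mulr_ge0; [lra|apply: mulr_ge0; lra]|lra].
  by apply: le_trans h6; apply: le_of_eq; field.
have tL : t * expR L = 1.
  by rewrite /L expRN lnK ?posrE// mulfV// gt_eqF.
have c : 4 / 3 * m * t * (1 + m / 10) ^+ 2 <= 1.
  by have := ler_wpM2l (ltW th) big; rewrite tL; apply: le_trans; apply: le_of_eq; ring.
apply: (@le_trans _ _ (4 / 3 * m * t)).
  have k1 : mult_abs x <= 2 * M * m := le_trans g2 y1.
  have s2 : 0 <= s x * (1 - s x) by apply: mulr_ge0; lra.
  have k2 : mult_abs x * (s x * (1 - s x) / (2 * M)) <= 2 * M * m * (t / 3 / (2 * M)).
    apply: (@le_trans _ _ (2 * M * m * (s x * (1 - s x) / (2 * M)))).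
      by apply: ler_wpM2r => //; apply: divr_ge0 => //; exact: ltW.
    apply: ler_wpM2l; first by apply: mulr_ge0; exact: ltW.
    by apply: ler_wpM2r => //; rewrite invr_ge0 ltW.
  have -> : 4 / 3 * m * t = 4 * (2 * M * m * (t / 3 / (2 * M))) by field; rewrite gt_eqF.
  by rewrite -mulrA ler_wpM2l.
have D1 : (z x ^+ 2)^-1 <= dmult x.
  rewrite -powR_invn ?(ltW z0)//; apply: ler_powR => //.
  by have := sigma2; lra.
apply: le_trans D1; rewrite -[leRHS]mul1r ler_pdivlMr ?exprn_gt0//.
apply: le_trans c; apply: ler_wpM2l; first by apply: mulr_ge0; [apply: mulr_ge0; lra|exact: ltW].
by rewrite lerXn2r ?nnegrE ?(ltW z0)//; lra.
Qed.

Lemma bdd_multipliers : [/\ bdd mult, bdd dmult, bdd ddmult, bdd kappa & bdd dkappa].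
Proof.
have bsg : bdd (fun x => Num.sg (x - x0)) by exists 1 => x; exact: norm_sg_le1.
have bz a : a <= 0 -> bdd (zpow a).
  by move=> a0; exists 1 => x; rewrite ger0_norm ?zpow_le1// ltW// zpow_gt0.
have bW : bdd W by exists 1 => x; have /andP[? ?] := vrel_itv M0 x; rewrite ger0_norm.
have bV : bdd V by exists (4 * M ^+ 2)^-1 => x; have [/andP[? ?] _] := potential_bounds M0 x; rewrite ger0_norm.
have bdV : bdd dV by exists (3 * (8 * M ^+ 3)^-1) => x; have [] := potential_bounds M0 x.
have s0 := sigma0.
have b1 : bdd mult.
  apply: bddM => //; exists (eps * tau)^-1 => x; have [h _ h'] := mult_abs_bounds x.
  by rewrite ger0_norm//; apply: le_trans h; apply: divr_ge0 => //; exact: ltW (zdist_gt0 x).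
have b2 : bdd dmult by apply: bz; lra.
have b3 : bdd ddmult by apply: bddM; [exact: bdd_cst|apply: bddM => //; apply: bz; lra].
have b4 : bdd corr.
  apply: bddM; first exact: bdd_cst.
  apply: bddM => //; apply: bddB; last by apply: bz; lra.
  have bw1 : bdd (fun x => 1 - W x) by apply: bddB => //; exact: bdd_cst.
  by apply: bddB; [exact: bdd_cst|exact: bddM].
have b5 : bdd dcorr.
  apply: bddM; first exact: bdd_cst.
  apply: bddD; last by apply: bddM; [exact: bdd_cst|apply: bz; lra].
  apply: bddM => //; apply: bddM; last by apply: bddM => //; exact: bdd_cst.
  by apply: bddM; [exact: bdd_cst|apply: bddB => //; exact: bdd_cst].
split => //; first by apply: bddB => //; exact: bddM.
by apply: bddB => //; apply: bddD; exact: bddM.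
Qed.

End multiplier_construction.

(** * Estimates for the real and imaginary parts *)

Section real_form.
Context {R : realType}.
Implicit Types (u du v dv : R -> R -> R) (V a : R -> R).

(* [u] and [v] are the real and imaginary parts: u_t = - v_xx + W v and
   v_t = u_xx - W u, with W = V + a |psi|^(2 q), tested in x. *)
Definition real_solution q V a u du v dv :=
  [/\ forall t, H1r (u t) (du t), forall t, H1r (v t) (dv t),
    [/\ ctL2 u, ctL2 du, ctL2 v & ctL2 dv],
    forall l dl, Cinf l -> H1r l dl -> (forall x, is_derive x (1 : R) l (dl x)) ->
      (exists A : R, forall x, A < `|x| -> l x = 0) ->
      AC (fun t => ip (u t) l) (fun t => ip (dv t) dl + ip (force_v q V a u v t) l) &
    forall l dl, Cinf l -> H1r l dl -> (forall x, is_derive x (1 : R) l (dl x)) ->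
      (exists A : R, forall x, A < `|x| -> l x = 0) ->
      AC (fun t => ip (v t) l) (fun t => - ip (du t) dl - ip (force_u q V a u v t) l)].

Variables M lambda p : R.
Hypotheses (M0 : 0 < M) (lambda0 : 0 < lambda) (p1 : 1 < p).
Local Notation x0 := (xpeak M).
Local Notation r := (areal_radius M).
Local Notation s := (srad M).
Local Notation V := (potential M).
Local Notation dV := (dpotential M).
Let q := (p - 1) / 2.
Let q0 : 0 < q. Proof. by rewrite divr_gt0// subr_gt0. Qed.

Definition acoef (x : R) := lambda * r x `^ (- p + 1).
Definition dacoef (x : R) := - (p - 1) * (acoef x * (s x * (1 - s x) / (2 * M))).

Lemma acoef_gt0 x : 0 < acoef x.
Proof. by rewrite mulr_gt0// powR_gt0// areal_gt0. Qed.

Lemma der_acoef x : is_derive x (1 : R) acoef (dacoef x).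
Proof.
have rx := areal_gt0 M0 x.
have := @der_comp _ (fun w => w `^ (- p + 1)) r x _ _ (is_derive1_powR (- p + 1) rx) (der_areal M0 x).
move/(derZ lambda)/der_eq; apply; rewrite /dacoef /acoef.
have -> : r x `^ (- p + 1 - 1) = r x `^ (- p + 1) / r x.
  by rewrite powRB ?powRr1 ?(ltW rx)//; apply/implyP => _; rewrite gt_eqF.
rewrite /srad; field; by rewrite !gt_eqF.
Qed.

Lemma dacoef_cont : continuous dacoef.
Proof.
move=> x; apply: cvgM; first exact: cvg_cst.
apply: cvgM; first exact: (der_cont der_acoef).
apply: cvgM; last exact: cvg_cst.
have c := srad_cont M0.
by apply: cvgM; [exact: c|apply: cvgB; [exact: cvg_cst|exact: c]].
Qed.

Lemma AC2_acoef : AC2 acoef dacoef.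
Proof. exact: AC2_C1 der_acoef dacoef_cont. Qed.

Lemma bdd_acoef : bdd acoef /\ bdd dacoef.
Proof.
have ba : bdd acoef.
  exists (lambda * ((2 * M) `^ (p - 1))^-1) => x.
  rewrite ger0_norm ?(ltW (acoef_gt0 x))// ler_wpM2l ?(ltW lambda0)//.
  have -> : - p + 1 = - (p - 1) by ring.
  have M2 : 0 < 2 * M by rewrite mulr_gt0.
  rewrite powRN lef_pV2 ?posrE ?powR_gt0 ?areal_gt0//.
  apply: ge0_ler_powR; rewrite ?nnegrE ?(ltW M2) ?(ltW (areal_gt0 M0 x)) ?(ltW (areal_gt M0 x))//.
  by have := p1; lra.
split => //; apply: bddM; first exact: bdd_cst.
apply: bddM => //; apply: bddM; last exact: bdd_cst.
have bs : bdd s by exists 1 => x; have [h1 h2] := srad_itv M0 x; rewrite gtr0_norm// ltW.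
by apply: bddM => //; apply: bddB => //; exact: bdd_cst.
Qed.

(** The coefficient a decreases in x. Above the peak g >= 0 makes -g a' nonnegative; below it
    [mult_abs_decay] limits the loss to half of q g' a. *)
Lemma acoef_decay sigma eps x : 1 < 2 * sigma -> sigma <= 1 -> admissible M eps ->
  q * (dmult M sigma eps x * acoef x) / 2 <=
  q * dmult M sigma eps x * acoef x - mult M sigma eps x * dacoef x.
Proof.
move=> h1 h2 he; have a0 := acoef_gt0 x; have [s0 s1] := srad_itv M0 x.
have Z0 : 0 < dmult M sigma eps x := zpow_gt0 he _ x.
have [G0 _ _] := mult_abs_bounds h1 h2 he x.
have {}G0 : 0 <= mult_abs M sigma eps x.
  by apply: le_trans G0; apply: divr_ge0 => //; exact: ltW (zdist_gt0 he x).
have k0 : 0 <= s x * (1 - s x) / (2 * M).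
  by apply: divr_ge0; apply: mulr_ge0 => //; [exact: ltW|lra|exact: ltW].
have qa : 0 < q * acoef x by rewrite mulr_gt0.
rewrite /mult /dacoef.
set G := mult_abs _ _ _ _ in G0 *; set k := s x * _ / _ in k0 *.
have -> : q * dmult M sigma eps x * acoef x -
   Num.sg (x - x0) * G * (- (p - 1) * (acoef x * k)) =
  (q * acoef x) * (dmult M sigma eps x + 2 * Num.sg (x - x0) * (G * k)) by rewrite /q; field.
have -> : q * (dmult M sigma eps x * acoef x) / 2 = (q * acoef x) * (dmult M sigma eps x / 2) by ring.
rewrite ler_wpM2l ?(ltW qa)//.
case: (ltP x x0) => xx.
  have := mult_abs_decay M0 h1 h2 he xx; rewrite -/G -/k ltr0_sg ?subr_lt0//; lra.
have sg0 : 0 <= Num.sg (x - x0) by rewrite sgr_ge0 subr_ge0.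
have := mulr_ge0 sg0 (mulr_ge0 G0 k0); lra.
Qed.

(** The constant is built from sup bounds on the multiplier, V and a alone and is produced before
    the solution, which is the uniformity that the theorem claims. *)
Lemma weighted_estimate sigma eps : 1 < 2 * sigma -> sigma <= 1 -> admissible M eps ->
  exists2 K : R, 0 <= K & forall u du v dv, real_solution q V acoef u du v dv ->
  forall (w1 w2 : R -> R) (W : R),
  measurable_fun setT w1 -> (forall x, 0 <= w1 x <= W) ->
  measurable_fun setT w2 -> (forall x, 0 <= w2 x <= W) ->
  (forall x, w1 x <= mass_weight M sigma eps x) ->
  (forall x, (q + 1) * w2 x <= q * (dmult M sigma eps x * acoef x) / 2) ->
  let F t := I1 (fun x => w1 x * (u t x ^+ 2 + v t x ^+ 2) + w2 x * sl q (u t x) (v t x)) in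
  int1 F /\ I1 F <= K * (Num.sqrt (ip (u 0) (u 0) + ip (v 0) (v 0)) *
    Num.sqrt (energy q V acoef u du v dv 0)).
Proof.
move=> h1 h2 he; have [b1 b2 b3 b4 b5] := bdd_multipliers M0 h1 h2 he.
have [b6 b7] := bdd_acoef.
have b8 : bdd V by exists (4 * M ^+ 2)^-1 => x; have [/andP[? ?] _] := potential_bounds M0 x; rewrite ger0_norm.
have b9 : bdd dV by exists (3 * (8 * M ^+ 3)^-1) => x; have [] := potential_bounds M0 x.
have [G G0 HG] := @common_bound R [:: mult M sigma eps; dmult M sigma eps; ddmult M sigma eps;
  kappa M sigma eps; dkappa M sigma eps; acoef; dacoef; V; dV]
  (fun f => ltac:(move=> /= H; repeat (case: H => [<- //|H]); by case: H)).
exists (4 * G) => [|u du v dv [hu hv [cu cdu cv cdv] eu ev] w1 w2 W mw1 w1W mw2 w2W i1 i2].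
  by rewrite mulr_ge0.
have hV := AC2_potential M0; have ha := AC2_acoef.
have hg := AC2_mult h1 he; have hdg := @AC2_dmult _ _ sigma _ he; have hk := AC2_kappa M0 h1 he.
have V0 x : 0 <= V x by have [/andP[? _] _] := potential_bounds M0 x.
have a0 x : 0 <= acoef x := ltW (acoef_gt0 x).
apply: (@morawetz_estimate R q V dV acoef dacoef u du v dv G q0 hV ha _ _ _ _ _ _ a0 hu hv cu cdu cv cdv eu ev
  (mult M sigma eps) (dmult M sigma eps) (ddmult M sigma eps) (kappa M sigma eps) (dkappa M sigma eps) G
  hg hdg _ _ _ _ hk _ _ _ V0 w1 w2 W mw1 w1W mw2 w2W);
  try (by apply: HG; rewrite /=; tauto).
- by case: hV.1.1.
- by case: ha.1.1.
- by case: hdg.1.1.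
- by case: hk.1.1.
- move=> x X Y; apply: le_trans (mass_weight_le M0 h1 h2 he x X Y).
  by rewrite ler_wpM2r ?sqr_ge0.
- by move=> x; apply: le_trans (i2 x) (acoef_decay x h1 h2 he).
Qed.

Lemma mass_weight_ge beta : 3 / 2 < beta -> exists sigma eps c : R,
  [/\ 1 < 2 * sigma, sigma <= 1, admissible M eps, 0 < c &
  forall x, c * (1 + x ^+ 2) `^ (- beta) <= mass_weight M sigma eps x].
Proof.
move=> hb; have [eps he] := admissible_exists M0; have e0 : 0 < eps by case: he.
(* The weight z^(-2 sigma - 2) must decay no faster than |x|^(-2 beta), with 2 sigma > 1: possible
   because beta > 3/2. The cap at 1 serves [mass_weight_le] and [mult_abs_decay]. *)
pose sigma := Num.min (beta - 1) 1.
have h1 : 1 < 2 * sigma by rewrite /sigma /Num.min; case: ifP => _; lra.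
have h2 : sigma <= 1 by rewrite ge_min lexx orbT.
have h3 : sigma + 1 <= beta by have : sigma <= beta - 1 by [rewrite ge_min lexx]; lra.
have s0 : 0 < sigma by lra.
(* From z <= b + eps |x| one gets z^2 <= K (1 + x^2). *)
set b := 1 + eps * `|x0|; pose K := 2 * b ^+ 2 + 2 * eps ^+ 2.
have b0 : 0 < b by rewrite ltr_pwDl// mulr_ge0// ltW.
have b2 : 0 < b ^+ 2 by rewrite exprn_gt0.
have ee : 0 < eps ^+ 2 by rewrite exprn_gt0.
have K0 : 0 < K by rewrite /K; lra.
exists sigma, eps, (sigma * eps ^+ 2 * K `^ (- (sigma + 1))); split=> // [|x].
  by rewrite mulr_gt0 ?powR_gt0// mulr_gt0.
have x2 := sqr_ge0 x; have X0 : 0 < 1 + x ^+ 2 by lra.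
have z0 := zdist_gt0 he x.
rewrite /mass_weight -(mulrA (sigma * eps ^+ 2)).
apply: ler_wpM2l; first exact: mulr_ge0 (ltW s0) (ltW ee).
have zK : zdist M eps x ^+ 2 <= K * (1 + x ^+ 2).
  have zle : zdist M eps x <= b + eps * `|x|.
    rewrite /zdist /b -addrA lerD2l -mulrDr ler_wpM2l ?(ltW e0)//.
    by apply: le_trans (ler_normB _ _) _; rewrite addrC.
  have ex : 0 <= eps * `|x| by rewrite mulr_ge0// ltW.
  have h : zdist M eps x ^+ 2 <= (b + eps * `|x|) ^+ 2.
    by rewrite lerXn2r ?nnegrE ?(ltW z0)// addr_ge0// ltW.
  apply: le_trans h _.
  have e1 : (eps * `|x|) ^+ 2 = eps ^+ 2 * x ^+ 2 by rewrite exprMn real_normK// num_real.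
  have e2 : (b + eps * `|x|) ^+ 2 <= 2 * b ^+ 2 + 2 * (eps * `|x|) ^+ 2.
    have := sqr_ge0 (b - eps * `|x|); lra.
  rewrite e1 in e2; apply: le_trans e2 _.
  have := mulr_ge0 (ltW b2) x2; rewrite /K; lra.
have -> : zpow M eps (- (2 * sigma) - 2) x = (zdist M eps x ^+ 2) `^ (- (sigma + 1)).
  rewrite -powR_mulrn ?(ltW z0)// -powRrM /zpow; congr (_ `^ _); ring.
apply: (@le_trans _ _ ((K * (1 + x ^+ 2)) `^ (- (sigma + 1)))).
  rewrite powRM ?(ltW K0) ?(ltW X0)// ler_wpM2l ?powR_ge0//.
  by apply: ler_powR; lra.
rewrite !powRN lef_pV2 ?posrE ?powR_gt0 ?exprn_gt0 ?mulr_gt0//.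
by apply: ge0_ler_powR; rewrite ?nnegrE ?(ltW K0) ?(ltW X0) ?mulr_ge0 ?exprn_ge0 ?(ltW z0)//; lra.
Qed.

Lemma real_estimate_mass beta : 3 / 2 < beta -> exists2 K : R, 0 <= K &
  forall u du v dv, real_solution q V acoef u du v dv ->
  let F t := I1 (fun x => (1 + x ^+ 2) `^ (- beta) * (u t x ^+ 2 + v t x ^+ 2)) in
  int1 F /\ I1 F <= K * (Num.sqrt (ip (u 0) (u 0) + ip (v 0) (v 0)) *
    Num.sqrt (energy q V acoef u du v dv 0)).
Proof.
move=> hb; have [sigma [eps [c [h1 h2 he c0 cw]]]] := mass_weight_ge hb.
have [K K0 HK] := weighted_estimate h1 h2 he.
exists (c^-1 * K) => [|u du v dv sol]; first by rewrite mulr_ge0// invr_ge0 ltW.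
pose w x : R := c * (1 + x ^+ 2) `^ (- beta).
have mw : measurable_fun setT w.
  apply: measurable_funM => //; apply: (measurableT_comp (measurable_powR (- beta))).
  by apply: measurable_funD => //; exact: measurable_funX.
have w1 x : 0 <= w x <= c.
  rewrite /w mulr_ge0 ?powR_ge0 ?(ltW c0)//= -[leRHS]mulr1 ler_wpM2l ?(ltW c0)//.
  have x2 := sqr_ge0 x.
  have : 1 <= 1 + x ^+ 2 by lra.
  by move=> /ler_powR /(_ (- beta) 0); rewrite powRr0; apply; lra.
have A1 (x : R) : (0 : R) <= 0 <= c by rewrite lexx ltW.
have A3 x : (q + 1) * 0 <= q * (dmult M sigma eps x * acoef x) / 2.
  rewrite mulr0; have Z0 : 0 < dmult M sigma eps x := zpow_gt0 he _ x.
  by apply: divr_ge0 => //; exact: ltW (mulr_gt0 q0 (mulr_gt0 Z0 (acoef_gt0 x))).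
have [iF bF] := HK u du v dv sol w (fun=> 0) c mw w1 (@measurable_cst _ _ _ _ _ _) A1 cw A3.
move=> F.
set F' := (fun t => I1 _) in iF bF.
have EF : F = fun t => c^-1 * F' t.
  have [_ _ _ _ _] := sol; apply/funext => t; rewrite /F /F'.
  have [hu hv _ _ _] := sol; have [su _ _] := hu t; have [sv _ _] := hv t.
  rewrite -I1Z.
    by congr I1; apply/funext => x; rewrite /w; field; rewrite gt_eqF.
  have := int1D (sq_int su (sq_bd mw (C:=c) _ su)) (sq_int sv (sq_bd mw (C:=c) _ sv)).
  have b : forall x, `|w x| <= c by move=> x; have /andP[? ?] := w1 x; rewrite ger0_norm.
  by move=> /(_ b b); congr int1; apply/funext => x; ring.
rewrite EF; split; first exact: int1Z.
by rewrite I1Z// -mulrA ler_wpM2l// invr_ge0 ltW.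
Qed.

Lemma real_estimate_local R0 : 0 <= R0 -> exists2 K : R, 0 <= K &
  forall u du v dv, real_solution q V acoef u du v dv ->
  let F t := I1 (fun x => ind (- R0) R0 x * (r x `^ (- p - 1) * sl q (u t x) (v t x))) in
  int1 F /\ I1 F <= K * (Num.sqrt (ip (u 0) (u 0) + ip (v 0) (v 0)) *
    Num.sqrt (energy q V acoef u du v dv 0)).
Proof.
move=> R00; have [eps he] := admissible_exists M0; have e0 : 0 < eps by case: he.
(* Only a positive lower bound for g' on the window [-R0, R0] matters, so the largest allowed
   exponent will do. *)
pose sigma : R := 1; have h1 : 1 < 2 * sigma by rewrite /sigma; lra.
have h2 : sigma <= 1 by [].
have [K K0 HK] := weighted_estimate h1 h2 he.
pose zm := 1 + eps * (R0 + `|x0|).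
have zm0 : 0 < zm by rewrite ltr_pwDl// mulr_ge0 ?addr_ge0// ltW.
have M2 : 0 < 2 * M by rewrite mulr_gt0.
(* On the window z <= zm, while r > 2 M and r^(1-p) = r^2 r^(-p-1); c is the resulting lower bound
   for the nonlinear coefficient relative to r^(-p-1). *)
pose c := q / 2 / (q + 1) * lambda * (2 * M) ^+ 2 * zm `^ (- (2 * sigma)).
have q1 : 0 < q + 1 by have := q0; lra.
have qq : 0 < q / 2 / (q + 1) by apply: divr_gt0 => //; exact: divr_gt0.
have c0 : 0 < c := mulr_gt0 (mulr_gt0 (mulr_gt0 qq lambda0) (exprn_gt0 2 M2)) (powR_gt0 _ zm0).
exists (c^-1 * K) => [|u du v dv sol]; first by rewrite mulr_ge0// invr_ge0 ltW.
have cr : continuous r := der_cont (der_areal M0).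
have rpow : continuous (fun x => r x `^ (- p - 1)).
  have d x : is_derive x (1 : R) (fun x => r x `^ (- p - 1)) ((- p - 1) * r x `^ (- p - 1 - 1) * (1 - 2 * M / r x)).
    exact: (@der_comp _ (fun w => w `^ (- p - 1)) r x _ _ (is_derive1_powR (- p - 1) (areal_gt0 M0 x)) (der_areal M0 x)).
  exact: der_cont d.
pose w x : R := c * (ind (- R0) R0 x * r x `^ (- p - 1)).
have mw : measurable_fun setT w.
  apply: measurable_funM => //; apply: measurable_funM; first exact: measurable_ind.
  exact: cont_measurable.
have bw x : 0 <= w x <= c * (2 * M) `^ (- p - 1).
  have /andP[i0 i1] := ind01 (- R0) R0 x.
  have P0 := powR_ge0 (r x) (- p - 1).
  apply/andP; split; first exact: mulr_ge0 (ltW c0) (mulr_ge0 i0 P0).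
  apply: ler_wpM2l; first exact: ltW.
  rewrite -[leRHS]mul1r; apply: ler_pM => //.
  have -> : - p - 1 = - (p + 1) by ring.
  rewrite !powRN lef_pV2 ?posrE ?powR_gt0 ?areal_gt0//.
  apply: ge0_ler_powR; rewrite ?nnegrE ?(ltW M2) ?(ltW (areal_gt0 M0 x)) ?(ltW (areal_gt M0 x))//.
  by have := p1; lra.
have A2 x : 0 <= mass_weight M sigma eps x.
  by apply: mulr_ge0; [apply: mulr_ge0; [lra|exact: sqr_ge0]|exact: ltW (zpow_gt0 he _ x)].
have A3 x : (q + 1) * w x <= q * (dmult M sigma eps x * acoef x) / 2.
  have a0 := acoef_gt0 x; have Z0 : 0 < dmult M sigma eps x := zpow_gt0 he _ x.
  rewrite /w indE; case: (boolP (_ && _)) => [/andP[xl xr]|_]; last first.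
    by rewrite mul0r !mulr0; apply: divr_ge0 => //; apply: mulr_ge0; [exact: ltW|apply: mulr_ge0; exact: ltW].
  rewrite mul1r.
  have rx := areal_gt0 M0 x; have rM := areal_gt M0 x.
  have er : r x `^ (- p - 1) * r x ^+ 2 = r x `^ (- p + 1).
    rewrite -powR_mulrn ?(ltW rx)// -powRD; first by congr (_ `^ _); ring.
    by apply/implyP => _; rewrite gt_eqF.
  have zz : zdist M eps x <= zm.
    rewrite /zdist /zm lerD2l ler_wpM2l ?(ltW e0)//.
    apply: le_trans (ler_normB _ _) _; rewrite lerD2r ler_norml; apply/andP; split; lra.
  have zd : zm `^ (- (2 * sigma)) <= dmult M sigma eps x.
    rewrite /dmult /zpow !powRN lef_pV2 ?posrE ?powR_gt0 ?(zdist_gt0 he)//.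
    by apply: ge0_ler_powR; rewrite ?nnegrE ?(ltW zm0) ?(ltW (zdist_gt0 he x))//; lra.
  have rr : (2 * M) ^+ 2 <= r x ^+ 2 by rewrite lerXn2r ?nnegrE ?(ltW M2) ?(ltW rx) ?(ltW rM).
  have P0 := powR_ge0 (r x) (- p - 1).
  have -> : (q + 1) * (c * r x `^ (- p - 1)) =
    q / 2 * lambda * ((2 * M) ^+ 2 * (zm `^ (- (2 * sigma)) * r x `^ (- p - 1))).
    by rewrite /c; field; rewrite gt_eqF.
  have -> : q * (dmult M sigma eps x * acoef x) / 2 =
    q / 2 * lambda * (r x ^+ 2 * (dmult M sigma eps x * r x `^ (- p - 1))).
    by rewrite /acoef -er; field.
  have ql : 0 < q / 2 * lambda by apply: mulr_gt0 => //; exact: divr_gt0.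
  apply: ler_wpM2l; first exact: ltW.
  apply: ler_pM => //; [exact: exprn_ge0 (ltW M2)|by rewrite mulr_ge0 ?powR_ge0|by rewrite ler_wpM2r].
have A1 (x : R) : (0 : R) <= 0 <= c * (2 * M) `^ (- p - 1).
  by rewrite lexx mulr_ge0 ?powR_ge0 ?(ltW c0).
have [iF bF] := HK u du v dv sol (fun=> 0) w (c * (2 * M) `^ (- p - 1)) (@measurable_cst _ _ _ _ _ _) A1 mw bw A2 A3.
move=> F.
set F' := (fun t => I1 _) in iF bF.
have EF : F = fun t => c^-1 * F' t.
  apply/funext => t; rewrite /F /F' -I1Z.
    by congr I1; apply/funext => x; rewrite /w; field; rewrite gt_eqF.
  have [hu hv [cu cdu cv cdv] eu ev] := sol.
  have is1 : int1 (fun x => sl q (u t x) (v t x)).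
    by have [] := int1_products q0 hu hv cu cdu cv cdv t.
  have b : forall x, `|w x| <= c * (2 * M) `^ (- p - 1) by move=> x; have /andP[? ?] := bw x; rewrite ger0_norm.
  by have := int1_bd mw b is1; congr int1; apply/funext => x; rewrite mul0r add0r.
rewrite EF; split; first exact: int1Z.
by rewrite I1Z// -mulrA ler_wpM2l// invr_ge0 ltW.
Qed.

End real_form.

(** * Real and imaginary parts of a solution *)

Section complex_translation.
Context {R : realType}.
Notation mu := (@lebesgue_measure R).
Local Notation hn := (@hn R).
Local Notation Re := (@complex.Re R).
Local Notation Im := (@complex.Im R).
Implicit Types (f g : R -> R[i]) (u v du dv : R -> R) (a b c x t : R).

Lemma normc_sqr (w : R[i]) : normc w ^+ 2 = Re w ^+ 2 + Im w ^+ 2.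
Proof. by case: w => a b /=; rewrite sqr_sqrtr// addr_ge0 ?sqr_ge0. Qed.

Lemma normc_ge0 (w : R[i]) : 0 <= normc w.
Proof. by case: w => a b /=; exact: sqrtr_ge0. Qed.

Lemma normc_powR (w : R[i]) (e : R) : normc w `^ e = (Re w ^+ 2 + Im w ^+ 2) `^ (e / 2).
Proof. by rewrite -normc_sqr -powR_mulrn ?normc_ge0// -powRrM mulrCA divff ?mulr1. Qed.

Lemma L2normE f : L2norm f = ((\int[mu]_x (Re (f x) ^+ 2 + Im (f x) ^+ 2)%:E) `^ 2^-1)%E.
Proof.
rewrite /L2norm unlock; congr (_ `^ _)%E; apply: eq_integral => x _.
by rewrite gee0_abs ?lee_fin ?normc_ge0// poweR_EFin powR_mulrn ?normc_ge0// normc_sqr.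
Qed.

Lemma measurable_ssq f : cmeasurable f -> measurable_fun setT (fun x => Re (f x) ^+ 2 + Im (f x) ^+ 2).
Proof. by move=> [mr mi]; apply: measurable_funD; exact: measurable_funX. Qed.

Lemma L2_sq f : L2 f -> sq (fun x => Re (f x)) /\ sq (fun x => Im (f x)).
Proof.
move=> [mf]; rewrite L2normE => fin; have [mr mi] := mf; have ms := measurable_ssq mf.
have i : int1 (fun x => Re (f x) ^+ 2 + Im (f x) ^+ 2).
  apply/integrableP; split; first exact/measurable_EFinP.
  have e : (\int[mu]_x `|(EFin \o (fun x => (Re (f x) ^+ 2 + Im (f x) ^+ 2)%R)) x| =
     \int[mu]_x (Re (f x) ^+ 2 + Im (f x) ^+ 2)%R%:E)%E.
    by apply: eq_integral => x _ /=; rewrite ger0_norm// addr_ge0 ?sqr_ge0.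
  rewrite e ltNge leye_eq; apply/negP => /eqP E; rewrite E in fin.
  by rewrite poweRyr ?invr_eq0 ?pnatr_eq0// in fin.
split; split => //; apply: le_int1 i; try exact: measurable_funX.
- by move=> x; rewrite ger0_norm ?sqr_ge0// lerDl sqr_ge0.
- by move=> x; rewrite ger0_norm ?sqr_ge0// lerDr sqr_ge0.
Qed.

(** The value of a solution at a given time is only determined up to null sets, whereas u and v will
    be the continuous representatives of its parts. *)
Definition ae_parts f u v := {ae mu, forall x, Re (f x) = u x} /\ {ae mu, forall x, Im (f x) = v x}.

Lemma ge0_integral_ae (h k : R -> R) : measurable_fun setT h -> int1 k -> {ae mu, forall x, h x = k x} ->
  (\int[mu]_x (h x)%:E = (I1 k)%:E)%E.
Proof.
move=> mh ik e; have mk := int1_measurable ik; rewrite EFin_I1//.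
apply: ae_eq_integral => //; [exact/measurable_EFinP|exact/measurable_EFinP|].
by apply: ae_imply e => x /= -> _.
Qed.

Lemma L2norm_parts f u v : cmeasurable f -> sq u -> sq v -> ae_parts f u v ->
  L2norm f = (Num.sqrt (ip u u + ip v v))%:E.
Proof.
move=> mf su sv [e1 e2]; rewrite L2normE.
have i1 : int1 (fun x => u x ^+ 2) by case: su.
have i2 : int1 (fun x => v x ^+ 2) by case: sv.
rewrite (ge0_integral_ae (measurable_ssq mf) (int1D i1 i2)); last first.
  by apply: ae_imply (ae_and e1 e2) => x [-> ->].
by rewrite I1D// -!ipE poweR_EFin powR12_sqrt// addr_ge0 ?ip_ge0.
Qed.

Lemma Re_real (w : R[i]) (a : R) : Re (w * (a%:C)%C) = Re w * a.
Proof. by case: w => b c /=; rewrite mulr0 subr0. Qed.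

Lemma Im_real (w : R[i]) (a : R) : Im (w * (a%:C)%C) = Im w * a.
Proof. by case: w => b c /=; rewrite mulr0 add0r. Qed.

Lemma weak_derivative_parts f g : weak_derivative f g ->
  [/\ [/\ loc (fun x => Re (f x)), loc (fun x => Im (f x)), loc (fun x => Re (g x)) & loc (fun x => Im (g x))],
    weakder (fun x => Re (f x)) (fun x => Re (g x)) & weakder (fun x => Im (f x)) (fun x => Im (g x))].
Proof.
move=> [[/locP l1 /locP l2] [/locP l3 /locP l4] H].
have key phi dphi A : Cinf phi -> (forall x, A < `|x| -> phi x = 0) ->
   (forall x, is_derive x (1 : R) phi (dphi x)) ->
   cintegral (fun x => f x * ((dphi x)%:C)%C) = - cintegral (fun x => g x * ((phi x)%:C)%C).
  by move=> cp sp dp; rewrite -(der_derive1 dp); apply: H; exact: Cinf_test sp.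
split => // phi dphi A cp sp dp; have [] := key _ _ _ cp sp dp => hr hi.
- have e (h : R -> R[i]) (k : R -> R) : (fun x => Re (h x) * k x) = fun x => Re (h x * ((k x)%:C)%C).
    by apply/funext => x; rewrite Re_real.
  by rewrite !e; exact: hr.
- have e (h : R -> R[i]) (k : R -> R) : (fun x => Im (h x) * k x) = fun x => Im (h x * ((k x)%:C)%C).
    by apply/funext => x; rewrite Im_real.
  by rewrite !e; exact: hi.
Qed.

Lemma continuous_ae_eq (F G : R -> R) : continuous F -> continuous G -> {ae mu, forall x, F x = G x} -> F = G.
Proof.
move=> cF cG e; apply/funext => x.
have -> // : F x = G x; apply: (cvg_unique (@Rhausdorff R) (av_cvg (x := x) cF)).
have -> : (fun n => av (hn n) F x) = fun n => av (hn n) G x; last exact: av_cvg.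
by apply/funext => n; congr (_ * _); apply: II_ae => //; exact: loc_cont.
Qed.

Lemma AC_derivative_unique (F f g : R -> R) : AC F f -> AC F g -> {ae mu, forall x, f x = g x}.
Proof.
move=> [lf Hf] [lg Hg]; apply: ae_imply (ae_and (av_ae lf) (av_ae lg)) => x [h1 h2].
apply: (cvg_unique (@Rhausdorff R) h1).
rewrite (_ : (fun n => _) = fun n => av (hn n) g x)//.
apply/funext => n; rewrite /av -Hf -?Hg// lerDl; exact: ltW (@hn_gt0 R n).
Qed.

(** Two absolutely continuous representatives of f coincide by continuity, and derivatives of one
    function agree almost everywhere. This identifies the weak derivative picked by [wderiv]. *)
Lemma weakder_AC_rep (f g F dF : R -> R) : loc f -> loc g -> weakder f g -> AC F dF ->
  {ae mu, forall x, f x = F x} -> {ae mu, forall x, g x = dF x}.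
Proof.
move=> lf lg w hF e; have [G hG eG] := weakder_AC lf lg w.
suff EFG : F = G by rewrite EFG in hF; exact: AC_derivative_unique hG hF.
apply: continuous_ae_eq; [exact: AC_cont hF|exact: AC_cont hG|].
by apply: ae_imply (ae_and e eG) => x [<- <-].
Qed.

Lemma H1_parts f : H1 f -> exists u v du dv : R -> R, [/\ H1r u du, H1r v dv & ae_parts f u v].
Proof.
move=> [lf [g wg lg]]; have [[l1 l2 l3 l4] w1 w2] := weak_derivative_parts wg.
have [s1 s2] := L2_sq lf; have [s3 s4] := L2_sq lg.
have [u hu eu] := weakder_AC l1 l3 w1; have [v hv ev] := weakder_AC l2 l4 w2.
exists u, v, (fun x => Re (g x)), (fun x => Im (g x)); split => //.
- split => //; apply: sq_ae s1 => //; exact: cont_measurable (AC_cont hu).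
- split => //; apply: sq_ae s2 => //; exact: cont_measurable (AC_cont hv).
Qed.

(** [weak_derivative] quantifies over all test functions, so subtracting two such identities
    requires integrability against each of them; this unpacks [smooth] into a C1 function of bounded
    support. *)
Lemma test_function_AC (phi : R -> R) : test_function phi ->
  exists A : R, [/\ AC phi (derive1 phi), continuous (derive1 phi), forall x, A < `|x| -> phi x = 0 &
    forall x, A < `|x| -> derive1 phi x = 0].
Proof.
move=> [sm cpt].
have d0 x : differentiable phi x := sm [::] x.
have d1 x : differentiable (derive1 phi) x.
  have -> : derive1 phi = 'D_(1 : R) phi by apply/funext => y; rewrite derive1E.
  exact: (sm [:: 1] x).
have der x : is_derive x (1 : R) phi (derive1 phi x).
  by rewrite derive1E; apply: DeriveDef => //; exact: diff_derivable.
have cd : continuous (derive1 phi) by move=> x; exact: differentiable_continuous.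
have [A [_ HA]] := compact_bounded cpt.
have out x : A + 1 < `|x| -> phi x = 0.
  move=> xA; apply/eqP; apply: contraTT xA => px; rewrite -leNgt.
  by apply: HA; [rewrite ltrDl|exact: subset_closure].
exists (A + 1); split => //; first exact: AC_C1.
exact: der_compact_support der out.
Qed.

Lemma int1_compact_support (f0 k : R -> R) A : loc f0 -> continuous k -> (forall x, A < `|x| -> k x = 0) ->
  int1 (fun x => f0 x * k x).
Proof.
move=> [mf lf] ck kA; have [C HC] := cont_bd (- A) A ck.
have kC x : `|k x| <= `|C|.
  case: (leP `|x| A) => h; last by rewrite kA// normr0.
  by apply: le_trans (ler_norm C); apply: HC; rewrite -ler_norml.
have := int1_bd (cont_measurable ck) kC (lf (- A) A); congr int1; apply/funext => x.
rewrite indE; case: (boolP (_ && _)) => h; first by rewrite mul1r mulrC.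
rewrite mul0r mulr0 kA ?mulr0// ltNge ler_norml; exact: h.
Qed.

Lemma weak_derivativeP f g : weak_derivative f g <->
  [/\ clocally_integrable f, clocally_integrable g & forall phi, test_function phi ->
    I1 (fun x => Re (f x) * derive1 phi x) = - I1 (fun x => Re (g x) * phi x) /\
    I1 (fun x => Im (f x) * derive1 phi x) = - I1 (fun x => Im (g x) * phi x)].
Proof.
have e (h : R -> R[i]) (k : R -> R) : cintegral (fun x => h x * ((k x)%:C)%C) =
    (I1 (fun x => Re (h x) * k x) +i* I1 (fun x => Im (h x) * k x))%C.
  rewrite /cintegral; congr (_ +i* _)%C; congr I1; apply/funext => x; [exact: Re_real|exact: Im_real].
split=> -[l1 l2 H]; split => // phi /H; rewrite !e.
- by move=> [-> ->].
- by move=> [-> ->].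
Qed.

Lemma weak_derivativeB f g f' g' : weak_derivative f g -> weak_derivative f' g' ->
  weak_derivative (f \- f') (g \- g').
Proof.
move=> /weak_derivativeP[[/locP a1 /locP a2] [/locP a3 /locP a4] H1].
move=> /weak_derivativeP[[/locP b1 /locP b2] [/locP b3 /locP b4] H2].
have reB (h k : R -> R[i]) : (fun x => Re ((h \- k) x)) = fun x => Re (h x) - Re (k x).
  by apply/funext => x /=; case: (h x) => ? ?; case: (k x).
have imB (h k : R -> R[i]) : (fun x => Im ((h \- k) x)) = fun x => Im (h x) - Im (k x).
  by apply/funext => x /=; case: (h x) => ? ?; case: (k x).
apply/weak_derivativeP; split; [split|split|move=> phi tp].
- by apply/locP; rewrite reB; exact: locB.
- by apply/locP; rewrite imB; exact: locB.
- by apply/locP; rewrite reB; exact: locB.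
- by apply/locP; rewrite imB; exact: locB.
have [A [hAC cd s0 s1]] := test_function_AC tp; have cp := AC_cont hAC.
have I (f1 f2 k : R -> R) : loc f1 -> loc f2 -> continuous k -> (forall x, A < `|x| -> k x = 0) ->
    I1 (fun x => (f1 x - f2 x) * k x) = I1 (fun x => f1 x * k x) - I1 (fun x => f2 x * k x).
  move=> l1 l2 ck sk; rewrite -I1B; [|exact: int1_compact_support sk|exact: int1_compact_support sk].
  by congr I1; apply/funext => x; ring.
have [r1 i1] := H1 phi tp; have [r2 i2] := H2 phi tp.
have E1 := fun x => congr1 (fun h => h x) (reB f f'); have E2 := fun x => congr1 (fun h => h x) (reB g g').
have E3 := fun x => congr1 (fun h => h x) (imB f f'); have E4 := fun x => congr1 (fun h => h x) (imB g g').
split.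
- rewrite (_ : (fun x => _) = fun x => (Re (f x) - Re (f' x)) * derive1 phi x); last first.
    by apply/funext => x; rewrite -E1.
  rewrite [in RHS](_ : (fun x => _) = fun x => (Re (g x) - Re (g' x)) * phi x); last first.
    by apply/funext => x; rewrite -E2.
  by rewrite !I// r1 r2; ring.
- rewrite (_ : (fun x => _) = fun x => (Im (f x) - Im (f' x)) * derive1 phi x); last first.
    by apply/funext => x; rewrite -E3.
  rewrite [in RHS](_ : (fun x => _) = fun x => (Im (g x) - Im (g' x)) * phi x); last first.
    by apply/funext => x; rewrite -E4.
  by rewrite !I// i1 i2; ring.
Qed.

Lemma wderiv_parts f u v du dv : (exists g, weak_derivative f g) -> H1r u du -> H1r v dv ->
  ae_parts f u v -> ae_parts (wderiv f) du dv /\ cmeasurable (wderiv f).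
Proof.
move=> wf [_ _ hu] [_ _ hv] [e1 e2].
have : weak_derivative f (wderiv f) by exact: (@xgetPex _ (cst 0) [set g | weak_derivative f g]).
move/weak_derivative_parts => [[l1 l2 l3 l4] w1 w2]; split.
  by split; [exact: weakder_AC_rep w1 hu e1|exact: weakder_AC_rep w2 hv e2].
by split; [case: l3|case: l4].
Qed.

Lemma H1norm_parts f u v du dv : cmeasurable f -> (exists g, weak_derivative f g) -> H1r u du -> H1r v dv ->
  ae_parts f u v -> H1norm f = (Num.sqrt (ip u u + ip v v + (ip du du + ip dv dv)))%:E.
Proof.
move=> mf wf hu hv e; have [ed md] := wderiv_parts wf hu hv e.
have [su sdu _] := hu; have [sv sdv _] := hv.
rewrite /H1norm (L2norm_parts mf su sv e) (L2norm_parts md sdu sdv ed).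
rewrite -!EFin_expe !sqr_sqrtr ?addr_ge0 ?ip_ge0// -EFinD poweR_EFin powR12_sqrt//.
by rewrite !addr_ge0 ?ip_ge0.
Qed.

Lemma ae_partsB f u v f' u' v' : ae_parts f u v -> ae_parts f' u' v' ->
  ae_parts (f \- f') (fun x => u x - u' x) (fun x => v x - v' x).
Proof.
move=> [a1 a2] [b1 b2]; split.
- by apply: ae_imply (ae_and a1 b1) => x [<- <-] /=; case: (f x) => ? ?; case: (f' x).
- by apply: ae_imply (ae_and a2 b2) => x [<- <-] /=; case: (f x) => ? ?; case: (f' x).
Qed.

Lemma cmeasurableB f f' : cmeasurable f -> cmeasurable f' -> cmeasurable (f \- f').
Proof.
move=> [a1 a2] [b1 b2]; split.
- rewrite (_ : (fun x => _) = fun x => Re (f x) - Re (f' x)); first exact: measurable_funB.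
  by apply/funext => x /=; case: (f x) => ? ?; case: (f' x).
- rewrite (_ : (fun x => _) = fun x => Im (f x) - Im (f' x)); first exact: measurable_funB.
  by apply/funext => x /=; case: (f x) => ? ?; case: (f' x).
Qed.

Lemma H1B (f df g dg : R -> R) : H1r f df -> H1r g dg -> H1r (fun x => f x - g x) (fun x => df x - dg x).
Proof. by move=> [? ? ?] [? ? ?]; split; [exact: sqB|exact: sqB|exact: ACB]. Qed.

Lemma continuous_H1_parts (psi : R -> R -> R[i]) : continuous_H1 psi ->
  exists u v du dv : R -> R -> R, [/\ forall t, H1r (u t) (du t), forall t, H1r (v t) (dv t),
    forall t, ae_parts (psi t) (u t) (v t) & [/\ ctL2 u, ctL2 du, ctL2 v & ctL2 dv]].
Proof.
move=> [h1 hc].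
(* Representatives are chosen separately at each time, without any joint measurability in (t, x);
   what ties the times together is the continuity of the H1 norm of differences. *)
have := choice (fun t => H1_parts (h1 t)) => -[u /= hu].
have := choice hu => -[v /= hv]; have := choice hv => -[du /= hdu]; have := choice hdu => -[dv /= hdv].
have Hu t : H1r (u t) (du t) by have [] := hdv t.
have Hv t : H1r (v t) (dv t) by have [] := hdv t.
have Hp t : ae_parts (psi t) (u t) (v t) by have [] := hdv t.
exists u, v, du, dv; split => //.
have mf t : cmeasurable (psi t) by have [[]] := h1 t.
have N s t := H1norm_parts (cmeasurableB (mf s) (mf t))
  (let: conj _ (ex_intro2 g wg _) := h1 s in let: conj _ (ex_intro2 g' wg' _) := h1 t in
     ex_intro _ _ (weak_derivativeB wg wg'))
  (H1B (Hu s) (Hu t)) (H1B (Hv s) (Hv t)) (ae_partsB (Hp s) (Hp t)).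
have near0 t e : 0 < e -> \forall s \near t, H1norm (psi s \- psi t) = 
    (Num.sqrt (ip (fun x => u s x - u t x) (fun x => u s x - u t x) + ip (fun x => v s x - v t x) (fun x => v s x - v t x) +
     (ip (fun x => du s x - du t x) (fun x => du s x - du t x) + ip (fun x => dv s x - dv t x) (fun x => dv s x - dv t x))))%:E /\
    fine (H1norm (psi s \- psi t)) <= e.
  move=> e0; have /fine_cvg/cvgrPdist_le/(_ _ e0) := hc t.
  apply: filterS => s; rewrite /= sub0r normrN => h; split; first exact: N.
  by apply: le_trans h; exact: ler_norm.
have small t e : 0 < e -> \forall s \near t, [/\ nr (fun x => u s x - u t x) <= e, nr (fun x => du s x - du t x) <= e,
   nr (fun x => v s x - v t x) <= e & nr (fun x => dv s x - dv t x) <= e].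
  move=> e0; apply: filterS (near0 t e e0) => s [-> /=] h.
  by split; apply: le_trans h; rewrite ler_wsqrtr//;
    have := ip_ge0 (fun x => u s x - u t x); have := ip_ge0 (fun x => v s x - v t x);
    have := ip_ge0 (fun x => du s x - du t x); have := ip_ge0 (fun x => dv s x - dv t x); lra.
split; split; try (by move=> t; have [] := Hu t); try (by move=> t; have [] := Hv t);
  by move=> t e /(small t); apply: filterS => s [].
Qed.

End complex_translation.

(** * The real system satisfied by the parts of a solution *)

Section main_translation.
Context {R : realType}.
Notation mu := (@lebesgue_measure R).
Local Notation Re := (@complex.Re R).
Local Notation Im := (@complex.Im R).
Variables M lambda p : R.
Hypotheses (M0 : 0 < M) (lambda0 : 0 < lambda) (p1 : 1 < p).
Local Notation V := (potential M).
Local Notation a := (acoef M lambda p).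
Local Notation q := ((p - 1) / 2).

Let q0 : 0 < q. Proof. by rewrite divr_gt0// subr_gt0. Qed.

Lemma measurable_force (u v : R -> R -> R) t : measurable_fun setT (u t) -> measurable_fun setT (v t) ->
  measurable_fun setT (force_u q V a u v t) /\ measurable_fun setT (force_v q V a u v t).
Proof.
move=> mu' mv; have mV := cont_measurable (AC2_cont (AC2_potential M0)).
have ma := cont_measurable (AC2_cont (AC2_acoef lambda p M0)).
split; (apply: measurable_funD; first exact: measurable_funM); apply: measurable_funM => //;
  (apply: measurable_funM => //; exact: measurable_nl).
Qed.

Lemma force_ae (u v u' v' : R -> R -> R) t : {ae mu, forall x, u t x = u' t x} ->
  {ae mu, forall x, v t x = v' t x} ->
  {ae mu, forall x, force_u q V a u v t x = force_u q V a u' v' t x} /\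
  {ae mu, forall x, force_v q V a u v t x = force_v q V a u' v' t x}.
Proof.
by move=> e1 e2; split; apply: ae_imply (ae_and e1 e2) => x [h1 h2]; rewrite /force_u /force_v h1 h2.
Qed.

Lemma force_regular (u v du dv : R -> R -> R) : (forall t, H1r (u t) (du t)) -> (forall t, H1r (v t) (dv t)) ->
  ctL2 u -> ctL2 du -> ctL2 v -> ctL2 dv -> ctL2 (force_u q V a u v) /\ ctL2 (force_v q V a u v).
Proof.
move=> hu hv cu cdu cv cdv; have [b6 b7] := bdd_acoef M0 lambda0 p1.
have b8 : bdd V by exists (4 * M ^+ 2)^-1 => x; have [/andP[? ?] _] := potential_bounds M0 x; rewrite ger0_norm.
have b9 : bdd (dpotential M) by exists (3 * (8 * M ^+ 3)^-1) => x; have [] := potential_bounds M0 x.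
have [C C0 HC] := @common_bound R [:: a; dacoef M lambda p; V; dpotential M]
  (fun f => ltac:(move=> /= H; repeat (case: H => [<- //|H]); by case: H)).
have hV := AC2_potential M0; have ha := AC2_acoef lambda p M0.
apply: (@force_ctL2 R q V (dpotential M) a (dacoef M lambda p) u du v dv C q0 hV ha);
  try (by apply: HC; rewrite /=; tauto); try (by case: hV.1.1); try (by case: ha.1.1); by [].
Qed.

(** Testing with chi(t) l(x) turns the inner integrals into pairings at fixed t, where the parts of
    psi may be exchanged for their representatives. Multiplication by -i makes the real part of the
    equation govern v and the imaginary part u. *)
Lemma NLS_tested (psi : R -> R -> R[i]) (u v : R -> R -> R) (chi dchi l dl ddl : R -> R) (A B : R) :
  solves_NLS M lambda p psi -> (forall t, L2 (psi t)) -> (forall t, ae_parts (psi t) (u t) (v t)) ->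
  (forall t, sq (u t)) -> (forall t, sq (v t)) ->
  (forall t, sq (force_u q V a u v t)) -> (forall t, sq (force_v q V a u v t)) ->
  Cinf chi -> (forall x, A < `|x| -> chi x = 0) -> (forall x, is_derive x (1 : R) chi (dchi x)) ->
  Cinf l -> Cinf dl -> (forall x, B < `|x| -> l x = 0) -> (forall x, is_derive x (1 : R) l (dl x)) ->
  (forall x, is_derive x (1 : R) dl (ddl x)) -> sq l -> sq ddl ->
  I1 (fun t => ip (v t) l * dchi t) = I1 (fun t => (ip (force_u q V a u v t) l - ip (u t) ddl) * chi t) /\
  I1 (fun t => - (ip (u t) l * dchi t)) = I1 (fun t => (ip (force_v q V a u v t) l - ip (v t) ddl) * chi t).
Proof.
move=> eq L2p parts su sv sP sQ cchi schi dchiE cl cdl sl' dlE ddlE sql sqddl.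
pose U t x := Re (psi t x); pose W t x := Im (psi t x).
have sU t : sq (U t) by have [] := L2_sq (L2p t).
have sW t : sq (W t) by have [] := L2_sq (L2p t).
have eU t : {ae mu, forall x, U t x = u t x} by have [] := parts t.
have eW t : {ae mu, forall x, W t x = v t x} by have [] := parts t.
have flip (f g : R -> R) : {ae mu, forall x, f x = g x} -> {ae mu, forall x, g x = f x}.
  by apply: ae_imply => x ->.
have mPQ t := measurable_force (proj1 (sU t)) (proj1 (sW t)).
have ePQ t := force_ae (eU t) (eW t).
have sP' t : sq (force_u q V a U W t).
  by have [m _] := mPQ t; have [e _] := ePQ t; exact: sq_ae m (flip _ _ e) (sP t).
have sQ' t : sq (force_v q V a U W t).
  by have [_ m] := mPQ t; have [_ e] := ePQ t; exact: sq_ae m (flip _ _ e) (sQ t).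
have refl f : {ae mu, forall x, f x = f x :> R} by apply: aeW.
have pu t f : sq f -> ip (U t) f = ip (u t) f by move=> sf; exact: ip_ae (eU t) (refl f).
have pv t f : sq f -> ip (W t) f = ip (v t) f by move=> sf; exact: ip_ae (eW t) (refl f).
have pP t f : sq f -> ip (force_u q V a U W t) f = ip (force_u q V a u v t) f.
  by move=> sf; have [e _] := ePQ t; exact: ip_ae e (refl f).
have pQ t f : sq f -> ip (force_v q V a U W t) f = ip (force_v q V a u v t) f.
  by move=> sf; have [_ e] := ePQ t; exact: ip_ae e (refl f).
have := eq _ (tensor_test cchi cl schi sl').
rewrite (tensor_partial_t cchi cl dchiE) (tensor_partial_x cchi cl dlE) (tensor_partial_x cchi cdl ddlE).
have lhs t : cintegral (fun x => - (0 +i* 1)%C * psi t x * ((dchi (t, x).1 * l (t, x).2)%:C)%C) =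
    (ip (v t) l * dchi t +i* - (ip (u t) l * dchi t))%C.
  rewrite -pu// -pv// /cintegral; congr (_ +i* _)%C.
    rewrite mulrC -I1Z; last exact: sq_int.
    congr I1; apply/funext => x; rewrite /W /=; case: (psi t x) => b c /=; ring.
  rewrite mulrC -mulNr -I1Z; last exact: sq_int.
  congr I1; apply/funext => x; rewrite /U /=; case: (psi t x) => b c /=; ring.
have rhs t : cintegral (fun x => - psi t x * ((chi (t, x).1 * ddl (t, x).2)%:C)%C +
    (((V x)%:C)%C * psi t x + ((lambda * areal_radius M x `^ (- p + 1) * normc (psi t x) `^ (p - 1))%:C)%C * psi t x) *
    ((chi (t, x).1 * l (t, x).2)%:C)%C) =
    ((ip (force_u q V a u v t) l - ip (u t) ddl) * chi t +i*
     ((ip (force_v q V a u v t) l - ip (v t) ddl) * chi t))%C.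
  rewrite -pP// -pQ// -(pu _ ddl)// -(pv _ ddl)// /cintegral; congr (_ +i* _)%C.
    rewrite mulrC -I1B; [|exact: sq_int..].
    rewrite -I1Z; last by apply: int1B; exact: sq_int.
    congr I1; apply/funext => x; rewrite /force_u normc_powR -/(nl q (Re (psi t x)) (Im (psi t x))) -/(acoef M lambda p x).
    by rewrite -/(U t x) -/(W t x) /U /W; case: (psi t x) => b c /=; ring.
  rewrite mulrC -I1B; [|exact: sq_int..].
  rewrite -I1Z; last by apply: int1B; exact: sq_int.
  congr I1; apply/funext => x; rewrite /force_v nlC normc_powR -/(nl q (Re (psi t x)) (Im (psi t x))) -/(acoef M lambda p x).
  by rewrite -/(U t x) -/(W t x) /U /W; case: (psi t x) => b c /=; ring.
under [fun t => cintegral _]funext do rewrite lhs.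
under [X in _ = cintegral X]funext do rewrite rhs.
by rewrite /cintegral => -[h1 h2]; split; [exact: h1|exact: h2].
Qed.

(** For fixed l the pairings are continuous in t, so [weakder_cont] integrates the equation tested
    in time; [ibp] first brings the second derivative of l down to a first one. *)
Lemma solution_parts (psi : R -> R -> R[i]) : solution M lambda p psi ->
  exists u v du dv : R -> R -> R, real_solution q V a u du v dv /\ forall t, ae_parts (psi t) (u t) (v t).
Proof.
move=> [cpsi nls]; have L2p t : L2 (psi t) by have [h1 _] := cpsi; have [] := h1 t.
have [u [v [du [dv [hu hv parts [cu cdu cv cdv]]]]]] := continuous_H1_parts cpsi.
exists u, v, du, dv; split => //.
have [cP cQ] := force_regular hu hv cu cdu cv cdv.
have sP := proj1 cP; have sQ := proj1 cQ.
have su t : sq (u t) by case: (hu t).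
have sv t : sq (v t) by case: (hv t).
have sdu t : sq (du t) by case: (hu t).
have sdv t : sq (dv t) by case: (hv t).
have main l dl : Cinf l -> H1r l dl -> (forall x, is_derive x (1 : R) l (dl x)) ->
    (exists A : R, forall x, A < `|x| -> l x = 0) ->
    AC (fun t => ip (u t) l) (fun t => ip (dv t) dl + ip (force_v q V a u v t) l) /\
    AC (fun t => ip (v t) l) (fun t => - ip (du t) dl - ip (force_u q V a u v t) l).
  move=> cl hl dlE [B sl']; have [sql sqdl _] := hl.
  have [dl' cdl' dlE'] := Cinf_der cl.
  have edl : dl = dl' by rewrite -(der_derive1 dlE) (der_derive1 dlE').
  rewrite -edl in cdl'; have [ddl cddl ddlE] := Cinf_der cdl'.
  have [ddd _ dddE] := Cinf_der cddl.
  have sdl := der_compact_support dlE sl'.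
  have hdl : H1r dl ddl := compact_support_H1 ddlE (der_cont dddE) sdl.
  have [_ sqddl _] := hdl.
  have cst (f : R -> R) : sq f -> ctL2 (fun=> f) by exact: ctL2_cst.
  have c1 := ctL2_ip cu (cst _ sql); have c2 := ctL2_ip cv (cst _ sql).
  have c3 := ctL2_ip cdu (cst _ sqdl); have c4 := ctL2_ip cdv (cst _ sqdl).
  have c5 := ctL2_ip cP (cst _ sql); have c6 := ctL2_ip cQ (cst _ sql).
  have cg1 : continuous (fun t => ip (dv t) dl + ip (force_v q V a u v t) l).
    by move=> t; apply: cvgD; [exact: c4|exact: c6].
  have cg2 : continuous (fun t => - ip (du t) dl - ip (force_u q V a u v t) l).
    by move=> t; apply: cvgB; [apply: cvgN; exact: c3|exact: c5].
  have tested (chi dchi : R -> R) (A : R) : Cinf chi -> (forall x, A < `|x| -> chi x = 0) ->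
      (forall x, is_derive x (1 : R) chi (dchi x)) ->
      [/\ continuous chi, continuous dchi & forall x, A < `|x| -> dchi x = 0].
    move=> cchi schi dchiE; have [d cd dE] := Cinf_der cchi; have [k _ kE] := Cinf_der cd.
    rewrite -(der_derive1 dchiE) (der_derive1 dE).
    split; [exact: der_cont dE|exact: der_cont kE|exact: der_compact_support dE schi].
  have nlsT chi dchi A cchi schi dchiE :=
    NLS_tested (psi := psi) (u := u) (v := v) (chi := chi) (dchi := dchi) (A := A) nls L2p parts su sv sP sQ cchi schi dchiE cl cdl' sl' dlE ddlE sql sqddl.
  split; (apply: weakder_cont; [by []|exact: loc_cont|]) => chi dchi A cchi schi dchiE;
    have [cchi' cdchi sdchi] := tested _ _ _ cchi schi dchiE;
    have [H1 H2] := nlsT _ _ _ cchi schi dchiE.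
  - have i1 := int1_compact_support (loc_cont c1) cdchi sdchi.
    move: H2; rewrite I1N// => /eqP; rewrite eqr_oppLR => /eqP ->; congr (- I1 _); apply/funext => t.
    by rewrite (ibp (hv t) hdl); ring.
  - have i2 := int1_compact_support (loc_cont cg2) cchi' schi.
    rewrite H1 -(I1N i2); congr I1; apply/funext => t.
    by rewrite (ibp (hu t) hdl); ring.
by split => // l dl cl hl dlE sl'; have [] := main l dl cl hl dlE sl'.
Qed.

Lemma sl_normc (w : R[i]) : normc w `^ (p + 1) = sl q (Re w) (Im w).
Proof.
rewrite normc_powR /sl /nl (_ : (p + 1) / 2 = q + 1); last by field.
rewrite powRD ?powRr1 ?ssq_ge0//; apply/implyP => /eqP e.
by have := q0; lra.
Qed.

(** The squared norm weighs |psi|^(p+1) by 1 and the conserved energy by 2 / (p + 1) < 1, hence an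
    inequality between them. *)
Lemma energy_norm_parts (f : R -> R[i]) (u du v dv : R -> R -> R) : real_solution q V a u du v dv ->
  cmeasurable f -> (exists g, weak_derivative f g) -> ae_parts f (u 0) (v 0) ->
  exists2 E : R, energy_norm M lambda p f = (Num.sqrt E)%:E & energy q V a u du v dv 0 <= E.
Proof.
move=> [hu hv [cu cdu cv cdv] _ _] mf wf pf.
have [[d1 d2] [mr mi]] := wderiv_parts wf (hu 0) (hv 0) pf.
have [su sdu _] := hu 0; have [sv sdv _] := hv 0; have [e1 e2] := pf; have [mR mI] := mf.
have [_ i2 _ _] := int1_products q0 hu hv cu cdu cv cdv 0.
have mV := cont_measurable (AC2_cont (AC2_potential M0)).
have ma := cont_measurable (AC2_cont (AC2_acoef lambda p M0)).
have [[C aC] _] := bdd_acoef M0 lambda0 p1.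
have VC x : `|V x| <= (4 * M ^+ 2)^-1.
  by have [/andP[? ?] _] := potential_bounds M0 x; rewrite ger0_norm.
have V0 x : 0 <= V x by have [/andP[? _] _] := potential_bounds M0 x.
have iS := int1_bd ma aC i2.
have iVu := sq_int su (sq_bd mV VC su); have iVv := sq_int sv (sq_bd mV VC sv).
have idu := sq_int sdu sdu; have idv := sq_int sdv sdv.
have iE := int1D (int1D (int1D idu idv) (int1D iVu iVv)) iS.
pose k x := (du 0 x * du 0 x + dv 0 x * dv 0 x) +
  (u 0 x * (V x * u 0 x) + v 0 x * (V x * v 0 x)) + a x * sl q (u 0 x) (v 0 x).
exists (I1 k).
  rewrite /energy_norm -[RHS]/((Num.sqrt (I1 k))%:E) -powR12_sqrt; last first.
    apply: I1_ge0 => x; apply: addr_ge0.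
      by apply: addr_ge0; apply: addr_ge0; rewrite -?expr2 ?sqr_ge0// mulrCA mulr_ge0// -expr2 sqr_ge0.
    by apply: mulr_ge0; [exact: ltW (acoef_gt0 p M0 lambda0 x)|exact: sl_ge0].
  rewrite -poweR_EFin -(@ge0_integral_ae _ (fun x => (Re (wderiv f x) ^+ 2 + Im (wderiv f x) ^+ 2) +
    V x * (Re (f x) ^+ 2 + Im (f x) ^+ 2) + a x * sl q (Re (f x)) (Im (f x))) k).
  - congr (_ `^ _)%E; apply: eq_integral => x _; congr (_%:E).
    by rewrite !normc_sqr sl_normc.
  - apply: measurable_funD; first apply: measurable_funD.
    + by apply: measurable_funD; exact: measurable_funX.
    + by apply: measurable_funM => //; apply: measurable_funD; exact: measurable_funX.
    + apply: measurable_funM => //; apply: measurable_funM; first exact: measurable_nl.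
      by apply: measurable_funD; exact: measurable_funX.
  - exact: iE.
  - by apply: ae_imply (ae_and (ae_and d1 d2) (ae_and e1 e2)) => x [[-> ->] [-> ->]]; rewrite /k; ring.
rewrite /k /energy (I1D (int1D (int1D idu idv) (int1D iVu iVv)) iS).
rewrite (I1D (int1D idu idv) (int1D iVu iVv)) (I1D idu idv) (I1D iVu iVv) -!/(ip _ _).
rewrite addrA lerD2l -[leRHS]mul1r; apply: ler_wpM2r.
  by apply: I1_ge0 => x; apply: mulr_ge0; [exact: ltW (acoef_gt0 p M0 lambda0 x)|exact: sl_ge0].
by rewrite invf_le1; have := q0; lra.
Qed.

End main_translation.

(** * The two left-hand sides in terms of real and imaginary parts *)

Section norms_of_parts.
Context {R : realType}.
Notation mu := (@lebesgue_measure R).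
Local Notation Re := (@complex.Re R).
Local Notation Im := (@complex.Im R).

Lemma L2norm_weighted beta (f : R -> R[i]) (u v : R -> R) : 0 < beta -> cmeasurable f -> sq u -> sq v -> ae_parts f u v ->
  (L2norm (fun x => ((((1 + x ^+ 2) `^ (- beta / 2))%:C)%C * f x)%R) ^+ 2 =
   (I1 (fun x => (1 + x ^+ 2) `^ (- beta) * (u x ^+ 2 + v x ^+ 2)))%:E)%E.
Proof.
move=> b0 [mr mi] su sv [e1 e2]; pose w (x : R) : R := (1 + x ^+ 2) `^ (- beta / 2).
have mw : measurable_fun setT w.
  apply: (measurableT_comp (measurable_powR (- beta / 2))).
  by apply: measurable_funD => //; exact: measurable_funX.
have w1 x : `|w x| <= 1.
  rewrite ger0_norm ?powR_ge0//; have x2 := sqr_ge0 x.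
  have : 1 <= 1 + x ^+ 2 by lra.
  by move=> /ler_powR /(_ (- beta / 2) 0); rewrite powRr0; apply; lra.
have reM (a : R) (z : R[i]) : Re ((a%:C)%C * z) = a * Re z by case: z => b c /=; ring.
have imM (a : R) (z : R[i]) : Im ((a%:C)%C * z) = a * Im z by case: z => b c /=; ring.
have swu := sq_bd mw w1 su; have swv := sq_bd mw w1 sv.
rewrite (@L2norm_parts _ _ (fun x => w x * u x) (fun x => w x * v x))//.
- rewrite -EFin_expe sqr_sqrtr ?addr_ge0 ?ip_ge0// /ip -I1D; [|exact: sq_int..].
  congr (_%:E); congr I1; apply/funext => x; have x2 := sqr_ge0 x.
  have -> : (1 + x ^+ 2) `^ (- beta) = w x * w x.
    rewrite /w -powRD; first by congr (_ `^ _); field.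
    by apply/implyP => _; rewrite gt_eqF//; lra.
  by ring.
- split.
  + rewrite (_ : (fun x => _) = fun x => w x * Re (f x)); first exact: measurable_funM.
    by apply/funext => x; rewrite reM.
  + rewrite (_ : (fun x => _) = fun x => w x * Im (f x)); first exact: measurable_funM.
    by apply/funext => x; rewrite imM.
- split; first by apply: ae_imply e1 => x <-; rewrite reM.
  by apply: ae_imply e2 => x <-; rewrite imM.
Qed.

Lemma local_potential_energy M p R0 (f : R -> R[i]) (u v : R -> R) : 0 < M -> 1 < p ->
  cmeasurable f -> int1 (fun x => sl ((p - 1) / 2) (u x) (v x)) -> ae_parts f u v ->
  (\int[mu]_(x in `[(- R0)%R, R0]) (areal_radius M x `^ (- p - 1) * normc (f x) `^ (p + 1))%:E =
   (I1 (fun x => ind (- R0) R0 x * (areal_radius M x `^ (- p - 1) * sl ((p - 1) / 2) (u x) (v x))))%:E)%E.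
Proof.
move=> M0 p1 [mr mi] i [e1 e2].
have cr : continuous (fun x => areal_radius M x `^ (- p - 1)).
  have d x : is_derive x (1 : R) (fun x => areal_radius M x `^ (- p - 1))
      ((- p - 1) * areal_radius M x `^ (- p - 1 - 1) * (1 - 2 * M / areal_radius M x)).
    exact: (@der_comp _ (fun w => w `^ (- p - 1)) (areal_radius M) x _ _
      (is_derive1_powR (- p - 1) (areal_gt0 M0 x)) (der_areal M0 x)).
  exact: der_cont d.
have [C HC] := cont_bd (- R0) R0 cr.
pose m x := ind (- R0) R0 x * areal_radius M x `^ (- p - 1).
have mm : measurable_fun setT m.
  by apply: measurable_funM; [exact: measurable_ind|exact: cont_measurable].
have mC x : `|m x| <= `|C|.
  rewrite /m indE; case: (boolP (_ && _)) => [/HC h|_]; last by rewrite mul0r normr0.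
  by rewrite mul1r; apply: le_trans h (ler_norm _).
have im := int1_bd mm mC i.
rewrite integral_mkcond.
rewrite (_ : (I1 _) = I1 (fun x => m x * sl ((p - 1) / 2) (u x) (v x))); last first.
  by congr I1; apply/funext => x; rewrite /m mulrA.
rewrite -(@ge0_integral_ae _ (fun x => m x * sl ((p - 1) / 2) (Re (f x)) (Im (f x))))//.
- apply: eq_integral => x _; rewrite patchE /m indE mem_setE /= in_itv /=.
  by case: ifP => _; rewrite ?mul0r// mul1r sl_normc.
- apply: measurable_funM => //; apply: measurable_funM; first exact: measurable_nl.
  by apply: measurable_funD; exact: measurable_funX.
- by apply: ae_imply (ae_and e1 e2) => x [-> ->].
Qed.

End norms_of_parts.

Local Open Scope complex_scope.

Theorem proposition5p1 (R : realType) (M lambda p : R)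
    (hM : 0 < M) (hlambda : 0 < lambda) (hp : 1 < p) :
  (forall beta : R, 3 / 2 < beta ->
     exists C : R, forall psi : R -> R -> R[i],
       solution M lambda p psi -> energy_space M lambda p (psi 0) ->
       (\int[lebesgue_measure]_t
          L2norm (fun x => ((1 + x ^+ 2) `^ (- beta / 2))%:C * psi t x)%R ^+ 2
        <= C%:E * L2norm (psi 0%R) * energy_norm M lambda p (psi 0%R))%E) /\
  (forall R0 : R, 0 <= R0 ->
     exists C : R, forall psi : R -> R -> R[i],
       solution M lambda p psi -> energy_space M lambda p (psi 0) ->
       (\int[lebesgue_measure]_t \int[lebesgue_measure]_(x in `[(- R0)%R, R0])
          (areal_radius M x `^ (- p - 1) * normc (psi t x) `^ (p + 1))%:E
        <= C%:E * L2norm (psi 0%R) * energy_norm M lambda p (psi 0%R))%E).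
Proof.
pose q := (p - 1) / 2.
(* The right-hand side is expressed through the parts at time 0: the mass is exact, and E, the
   squared energy norm, dominates the conserved energy. *)
have norms psi : solution M lambda p psi -> energy_space M lambda p (psi 0) ->
  exists u v du dv : R -> R -> R, exists E : R,
  [/\ real_solution q (potential M) (acoef M lambda p) u du v dv,
    forall t, ae_parts (psi t) (u t) (v t), forall t, cmeasurable (psi t),
    (L2norm (psi 0%R) * energy_norm M lambda p (psi 0%R) =
     (Num.sqrt (ip (u 0) (u 0) + ip (v 0) (v 0)) * Num.sqrt E)%R%:E)%E &
    energy q (potential M) (acoef M lambda p) u du v dv 0 <= E].
  move=> sol [_ wd _]; have [u [v [du [dv [rs parts]]]]] := solution_parts hM hlambda hp sol.
  have [[h1 _] _] := sol; have mf t : cmeasurable (psi t) by have [[]] := h1 t.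
  have [hu hv _ _ _] := rs; have [su _ _] := hu 0; have [sv _ _] := hv 0.
  have [E eE leE] := energy_norm_parts hM hlambda hp rs (mf 0) wd (parts 0).
  exists u, v, du, dv, E; split => //.
  by rewrite (L2norm_parts (mf 0) su sv (parts 0)) eE EFinM.
have bound (F : R -> R) (K m e E : R) : 0 <= K -> e <= E -> int1 F -> I1 F <= K * (Num.sqrt m * Num.sqrt e) ->
    (\int[lebesgue_measure]_t (F t)%:E <= K%:E * (Num.sqrt m * Num.sqrt E)%R%:E)%E.
  move=> K0 eE iF bF; rewrite -EFin_I1// -EFinM lee_fin; apply: le_trans bF _.
  by rewrite ler_wpM2l// ler_wpM2l ?sqrtr_ge0// ler_wsqrtr.
split=> [beta hb|R0 hR].
- have [K K0 HK] := real_estimate_mass hM hlambda hp hb.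
  exists K => psi sol en; have [u [v [du [dv [E [rs parts mf eN leE]]]]]] := norms psi sol en.
  have [iF bF] := HK u du v dv rs; have [hu hv _ _ _] := rs.
  rewrite -muleA eN; apply: le_trans (bound _ _ _ _ _ K0 leE iF bF).
  apply: le_of_eq; apply: eq_integral => t _.
  have [su _ _] := hu t; have [sv _ _] := hv t.
  by apply: L2norm_weighted => //; lra.
- have [K K0 HK] := real_estimate_local hM hlambda hp hR.
  exists K => psi sol en; have [u [v [du [dv [E [rs parts mf eN leE]]]]]] := norms psi sol en.
  have [iF bF] := HK u du v dv rs; have [hu hv [cu cdu cv cdv] _ _] := rs.
  rewrite -muleA eN; apply: le_trans (bound _ _ _ _ _ K0 leE iF bF).
  apply: le_of_eq; apply: eq_integral => t _.
  have q0 : 0 < q by rewrite divr_gt0// subr_gt0.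
  have [_ iS _ _] := int1_products q0 hu hv cu cdu cv cdv t.
  exact: local_potential_energy.
Qed.
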